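(* Let $M$ be a compact orientable $2$-dimensional smooth manifold endowed with a $2$-dimensional almost-Riemannian structure $(E,\mathfrak f,\langle\cdot,\cdot\rangle)$, with associated submodule $\mathcal D=\mathfrak f_*(\Gamma(E))\subseteq \mathrm{Vec}(M)$ and singular set $\mathcal Z$. Assume that (HA) the singular set $\mathcal Z$ is an embedded one-dimensional submanifold of $M$; (HB) for every $q\in M$, $\mathcal D(q)+[\mathcal D,\mathcal D](q)=T_qM$. Let $d\omega$ be the corresponding Riemannian area and $\Delta$ the corresponding Laplace-Beltrami operator, both defined on $M\setminus\mathcal Z$. Then: 1. $\Delta$ with domain $C^\infty_0(M\setminus\mathcal Z)$ is essentially self-adjoint on $L^2(M,d\omega)$. 2. The domain of its self-adjoint extension (denoted again by $\Delta$) is $$D(\Delta)=\{u\in L^2(M,d\omega)\;:\;\Delta_{D,g}u\in L^2(M,d\omega)\},$$ where $\Delta_{D,g}u$ denotes $\Delta u$ taken in the sense of distributions on $M\setminus\mathcal Z$. 3. The resolvent $(-\Delta+1)^{-1}$ is compact on $L^2(M,d\omega)$, and therefore the spectrum of $\Delta$ is discrete and consists of eigenvalues with finite multiplicity.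
   Context: Manifolds are smooth and without boundary; vector fields are smooth; $\mathrm{Vec}(M)$ is the set of smooth vector fields on $M$; $C_0^\infty$ denotes smooth compactly supported functions. A $2$-dimensional almost-Riemannian structure (2-ARS) on a smooth surface $M$ is a triple $(E,\mathfrak f,\langle\cdot,\cdot\rangle)$ where $E$ is a rank-$2$ vector bundle over $M$, $\langle\cdot,\cdot\rangle$ is a Euclidean structure on $E$ (a scalar product on $E_q$ depending smoothly on $q$), and $\mathfrak f:E\to TM$ is a morphism of vector bundles over the identity of $M$ (linear on fibers), such that the submodule $\mathcal D=\mathfrak f_*(\Gamma(E))=\{\mathfrak f\circ\sigma:\sigma\in\Gamma(E)\}$ of $\mathrm{Vec}(M)$ is bracket generating, i.e. $\mathrm{Lie}_q(\mathcal D)=T_qM$ for every $q\in M$. Here $\mathrm{Lie}_q(\mathcal D)$ is the space of evaluations at $q$ of elements of the Lie algebra generated by $\mathcal D$. Set $\mathcal D(q)=\{V(q):V\in\mathcal D\}=\mathfrak f(E_q)\subseteq T_qM$, and $[\mathcal D,\mathcal D](q)$ is the span of $\{[V,W](q):V,W\in\mathcal D\}$. The singular set is $\mathcal Z=\{q\in M:\dim\mathcal D(q)<2\}$. On $M\setminus\mathcal Z$, $\mathfrak f|_{E_q}$ is an isomorphism, and $g$ denotes the Riemannian metric on $M\setminus \mathcal Z$ obtained by transporting $\langle\cdot,\cdot\rangle$ via $\mathfrak f$. $d\omega$ is the Riemannian area of $g$ on $M\setminus\mathcal Z$, and $L^2(M,d\omega)$ means $L^2(M\setminus\mathcal Z,d\omega)$.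 The Laplace-Beltrami operator on $M\setminus\mathcal Z$ is $\Delta\phi=\mathrm{div}(\nabla\phi)$, with $\nabla$ the gradient of $g$ and $\mathrm{div}$ the divergence with respect to $d\omega$. For $u\in L^2(M,d\omega)$, $\Delta_{D,g}u\in L^2(M,d\omega)$ means that there is $f\in L^2(M,d\omega)$ with $\int u\,\Delta\varphi\,d\omega=\int f\varphi\,d\omega$ for all $\varphi\in C_0^\infty(M\setminus\mathcal Z)$. *)

(* Defs.v *)
(* Written in MathComp-Analysis, over an arbitrary [R : realType]. *)
From HB Require Import structures.
From mathcomp Require Import all_boot all_order all_algebra.
From mathcomp Require Import all_classical all_reals all_analysis.
From mathcomp Require Import measurable_realfun.

Set Implicit Arguments.
Unset Strict Implicit.
Unset Printing Implicit Defensive.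
Import Order.TTheory GRing.Theory Num.Theory.
Import numFieldNormedType.Exports.
Local Open Scope classical_set_scope.
Local Open Scope ring_scope.

Definition coord (R : realType) (i : 'I_2) (x : R * R) : R :=
  if i == ord0 then x.1 else x.2.

Definition basis_vec (R : realType) (i : 'I_2) : R * R :=
  if i == ord0 then (1, 0) else (0, 1).

Definition partial (R : realType) (i : 'I_2) (f : R * R -> R) : R * R -> R :=
  fun x => 'D_(basis_vec R i) f x.

Definition iter_partial (R : realType) (s : seq 'I_2) (f : R * R -> R) :=
  foldl (fun g i => partial i g) f s.

(* Meant for open [U]: all iterated partial derivatives exist and are continuous
   on [U], so that the derivatives at points of [U] see only [f] on [U]. *)
Definition smooth_on (R : realType) (U : set (R * R)) (f : R * R -> R) :=
  forall (s : seq 'I_2) x, U x ->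
    {for x, continuous (iter_partial s f)} /\
    forall i, derivable (iter_partial s f) x (basis_vec R i).

Section SmoothOn.
Context (R : realType) (U : set (R * R)).
Context (openU : open U).
Implicit Types f g : R * R -> R.

Let upto n f := forall (s : seq 'I_2) x, (size s <= n)%N -> U x ->
  {for x, continuous (iter_partial s f)} /\
  forall i, derivable (iter_partial s f) x (basis_vec R i).

Let near_U f g x : (forall y, U y -> f y = g y) -> U x -> \near x, f x = g x.
Proof.
move=> fg Ux; near=> y; apply: fg; near: y.
exact: open_nbhs_nbhs.
Unshelve. all: by end_near. Qed.

Let partial_eq f g i : (forall y, U y -> f y = g y) ->
  forall y, U y -> partial i f y = partial i g y.
Proof. by move=> fg y Uy; apply: near_eq_derive; exact: near_U. Qed.

Let iter_partial_eq s f g : (forall y, U y -> f y = g y) ->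
  forall y, U y -> iter_partial s f y = iter_partial s g y.
Proof.
elim: s f g => //= i s IH f g fg; apply: IH; exact: partial_eq.
Qed.

Let upto_eq n f g : (forall y, U y -> f y = g y) -> upto n f -> upto n g.
Proof.
move=> fg uf s x sn Ux; have [cf df] := uf s x sn Ux.
have e := iter_partial_eq s fg.
split.
  rewrite /prop_for /continuous_at -(e _ Ux); apply: cvg_trans cf.
  apply: near_eq_cvg; exact: near_U e Ux.
move=> i; apply: near_eq_derivable (df i); exact: near_U e Ux.
Qed.

Let uptoS n f : upto n.+1 f <-> upto 0 f /\ forall i, upto n (partial i f).
Proof.
split=> [uf|[u0 up]].
  split; first by move=> [|//] x _ Ux; exact: (uf [::]).
  by move=> i s x sn Ux; exact: (uf (i :: s)).
by move=> [|i s] x sn Ux; [exact: (u0 [::])|exact: (up i s)].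
Qed.

Let uptoW n f : upto n.+1 f -> upto n f.
Proof. by move=> uf s x sn; apply: uf; exact: leqW. Qed.

Let upto0 n f : upto n f -> upto 0 f.
Proof. by move=> uf s x sn; apply: uf; exact: leq_trans sn _. Qed.

Let uptoD n f g : upto n f -> upto n g -> upto n (f + g).
Proof.
elim: n f g => [|n IH] f g uf ug.
  move=> [|//] x s0 Ux; have [cf df] := uf [::] x s0 Ux.
  have [cg dg] := ug [::] x s0 Ux; split; first exact: continuousD.
  by move=> i; exact: derivableD.
apply/uptoS; split.
  move=> [|//] x s0 Ux; have [cf df] := uf [::] x isT Ux.
  have [cg dg] := ug [::] x isT Ux; split; first exact: continuousD.
  by move=> i; exact: derivableD.
move=> i; have /uptoS[_ uf'] := uf; have /uptoS[_ ug'] := ug.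
apply: upto_eq (IH _ _ (uf' i) (ug' i)) => y Uy.
rewrite /partial deriveD //; first by have [_] := uf [::] y isT Uy; exact.
by have [_] := ug [::] y isT Uy; exact.
Qed.

Let uptoM n f g : upto n f -> upto n g -> upto n (f * g).
Proof.
elim: n f g => [|n IH] f g uf ug.
  move=> [|//] x s0 Ux; have [cf df] := uf [::] x s0 Ux.
  have [cg dg] := ug [::] x s0 Ux; split; first exact: continuousM.
  by move=> i; exact: derivableM.
apply/uptoS; split.
  move=> [|//] x s0 Ux; have [cf df] := uf [::] x isT Ux.
  have [cg dg] := ug [::] x isT Ux; split; first exact: continuousM.
  by move=> i; exact: derivableM.
move=> i; have /uptoS[_ uf'] := uf; have /uptoS[_ ug'] := ug.
apply: (upto_eq (f := f * partial i g + g * partial i f)).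
  move=> y Uy; rewrite /partial deriveM //.
    by have [_] := uf [::] y isT Uy; exact.
  by have [_] := ug [::] y isT Uy; exact.
by apply: uptoD; apply: IH => //; exact: uptoW.
Qed.

Lemma smooth_on_cst (a : R) : smooth_on U (cst a).
Proof.
move=> s x _; have [b ->] : exists b, iter_partial s (cst a) = cst b.
  elim: s a => [|i s IH] b; first by exists b.
  rewrite /= (_ : partial i (cst b) = cst 0); first exact: IH.
  by apply/funext => y; rewrite /partial derive_cst.
by split=> [|i]; [exact: cst_continuous|exact: derivable_cst].
Qed.

Lemma smooth_onD f g : smooth_on U f -> smooth_on U g -> smooth_on U (f + g).
Proof.
move=> sf sg s x; apply: (@uptoD (size s) f g _ _ s x) => //.
  by move=> t y _; exact: sf.
by move=> t y _; exact: sg.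
Qed.

Lemma smooth_onM f g : smooth_on U f -> smooth_on U g -> smooth_on U (f * g).
Proof.
move=> sf sg s x; apply: (@uptoM (size s) f g _ _ s x) => //.
  by move=> t y _; exact: sf.
by move=> t y _; exact: sg.
Qed.

End SmoothOn.

(* [chart_map] and [chart_inv] are total functions whose values matter only on
   [chart_dom] and on its image, respectively. *)
Record chart (R : realType) (M : topologicalType) := Chart {
  chart_dom : set M;
  chart_map : M -> R * R;
  chart_inv : R * R -> M;
  chart_dom_open : open chart_dom;
  chart_img_open : open (chart_map @` chart_dom);
  chart_mapK : forall q, chart_dom q -> chart_inv (chart_map q) = q;
  chart_map_continuous :
    forall q, chart_dom q -> {for q, continuous chart_map};
  chart_inv_continuous :
    forall x, (chart_map @` chart_dom) x -> {for x, continuous chart_inv} }.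

Definition transition (R : realType) (M : topologicalType) (c d : chart R M)
    (i : 'I_2) (x : R * R) : R :=
  coord i (chart_map d (chart_inv c x)).

Definition smooth_transition (R : realType) (M : topologicalType)
    (c d : chart R M) :=
  forall i, smooth_on (chart_map c @` (chart_dom c `&` chart_dom d))
                      (transition c d i).

Record smooth_surface (R : realType) (M : topologicalType) := SmoothSurface {
  surface_hausdorff : hausdorff_space M;
  surface_second_countable : @second_countable M;
  atlas : set (chart R M);
  atlas_cover : forall q, exists2 c, atlas c & chart_dom c q;
  atlas_smooth : forall c d, atlas c -> atlas d -> smooth_transition c d }.

Section SmoothFunctions.
Context (R : realType) (M : topologicalType) (S : smooth_surface R M).
Implicit Types (c d : chart R M) (f g : M -> R) (q : M) (W : set M).

(* The charts of the maximal atlas. *)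
Definition smooth_chart : set (chart R M) :=
  [set c | forall d, atlas S d -> smooth_transition c d /\ smooth_transition d c].

Definition jacobian_det c d (x : R * R) : R :=
  \det (\matrix_(i, j) partial i (transition c d j) x).

Definition orientable := exists A : set (chart R M),
  [/\ A `<=` smooth_chart,
      forall q, exists2 c, A c & chart_dom c q &
      forall c d q, A c -> A d -> chart_dom c q -> chart_dom d q ->
        0 < jacobian_det c d (chart_map c q)].

(* Smoothness of [f] on the open set [W]. *)
Definition smooth_fun W f := forall c, atlas S c ->
  smooth_on (chart_map c @` (chart_dom c `&` W)) (f \o chart_inv c).

Definition smooth_pred : {pred (M -> R)} := mem [set f | smooth_fun setT f].

Lemma smooth_pred_subring : subring_closed smooth_pred.
Proof.
have cst_smooth a : smooth_fun setT (cst a).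
  by move=> c _; exact: smooth_on_cst.
have oc c : open (chart_map c @` (chart_dom c `&` setT)).
  by rewrite setIT; exact: chart_img_open.
have mulS f g : smooth_fun setT f -> smooth_fun setT g -> smooth_fun setT (f * g).
  by move=> sf sg c Ac; apply: smooth_onM (sf c Ac) (sg c Ac); exact: oc.
split.
- by apply/mem_set; exact: cst_smooth.
- move=> f g /set_mem/= sf /set_mem/= sg; apply/mem_set => /=.
  have -> : f - g = f + cst (-1) * g.
    by apply/funext => q; rewrite !fctE mulN1r.
  move=> c Ac; apply: smooth_onD; [exact: oc|exact: sf|].
  exact: (mulS (cst (-1)) g (cst_smooth (-1)) sg c Ac).
- by move=> f g /set_mem/= sf /set_mem/= sg; apply/mem_set; exact: mulS.
Qed.

Lemma smooth_pred_scaler : scaler_closed smooth_pred.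
Proof.
move=> a f /set_mem/= sf; apply/mem_set => /= c Ac.
rewrite (_ : (a *: f) \o _ = cst a * (f \o chart_inv c)).
  apply: smooth_onM; [|exact: smooth_on_cst|exact: sf].
  by rewrite setIT; exact: chart_img_open.
by apply/funext => x; rewrite !fctE.
Qed.

HB.instance Definition _ :=
  GRing.isSubringClosed.Build (M -> R) smooth_pred smooth_pred_subring.
HB.instance Definition _ :=
  GRing.isScaleClosed.Build R (M -> R) smooth_pred smooth_pred_scaler.

(* The algebra of smooth real functions on [M]. *)
Record Cinf := MkCinf { Cinf_val :> M -> R; _ : Cinf_val \in smooth_pred }.

HB.instance Definition _ := [isSub for Cinf_val].
HB.instance Definition _ := [Choice of Cinf by <:].
HB.instance Definition _ :=
  GRing.SubChoice_isSubComPzRing.Build (M -> R) smooth_pred Cinf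
    (subringClosedP smooth_pred).
HB.instance Definition _ := [SubZmodule_isSubLmodule of Cinf by <:].

End SmoothFunctions.

Section LinearAlgebra.
Context (R : realType) (V : lmodType R).

Definition lin_span (A : set V) : set V := [set v | exists n (a : 'I_n -> R)
  (w : 'I_n -> V), (forall i, A (w i)) /\ v = \sum_i a i *: w i].

(* [A] is a linear subspace of dimension [n]. *)
Definition lin_dim (A : set V) (n : nat) := exists e : 'I_n -> V,
  (forall a : 'I_n -> R, \sum_i a i *: e i = 0 -> forall i, a i = 0) /\
  A = [set \sum_i a i *: e i | a in [set: 'I_n -> R]].

End LinearAlgebra.

Section TangentSpaces.
Context (R : realType) (M : topologicalType) (S : smooth_surface R M).
Implicit Types (f g : Cinf S) (q : M) (X Y : Cinf S -> Cinf S).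

(* T_q M as the space of derivations at [q] of the algebra of smooth functions,
   inside the vector space of all functions [Cinf S -> R]. *)
Definition tangent q : set (Cinf S -> R) := [set v |
  (forall a f g, v (a *: f + g) = a * v f + v g) /\
  (forall f g, v (f * g) = f q * v g + g q * v f)].

(* The coordinate vector d/dx_i at [q] in the chart [c]. *)
Definition coord_vec (c : chart R M) (i : 'I_2) q : Cinf S -> R :=
  fun f => partial i (f \o chart_inv c) (chart_map c q).

Definition field_at q X : Cinf S -> R := fun f => X f q.

(* A vector field [q |-> X_q] is encoded by its action [X] on smooth functions,
   [X f q = X_q f]; that [X f] is again a smooth function is the smoothness of
   the field. *)
Definition vector_field : set (Cinf S -> Cinf S) :=
  [set X | forall q, tangent q (field_at q X)].

Definition bracket X Y : Cinf S -> Cinf S := fun f => X (Y f) - Y (X f).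

Definition lie_subalgebra (L : set (Cinf S -> Cinf S)) :=
  [/\ L 0, forall a X Y, L X -> L Y -> L (a *: X + Y) &
      forall X Y, L X -> L Y -> L (bracket X Y)].

Definition lie_hull (D : set (Cinf S -> Cinf S)) : set (Cinf S -> Cinf S) :=
  [set X | forall L, lie_subalgebra L -> D `<=` L -> L X].

(* Local slice condition: around each of its points, [Z] is the zero set of the
   second coordinate of a smooth chart. *)
Definition embedded_curve (Z : set M) := forall q, Z q ->
  exists c, [/\ smooth_chart S c, chart_dom c q &
    forall p, chart_dom c p -> (Z p <-> coord ord_max (chart_map c p) = 0)].

End TangentSpaces.

Arguments tangent {R M} S q.
Arguments coord_vec {R M} S c i q.

(* A local frame of a family of vector spaces; a rank-2 vector bundle is given by
   its fibers and a covering by local frames with smooth transition matrices. *)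
Record frame (R : realType) (M : topologicalType) (E : M -> lmodType R) :=
  Frame {
    frame_dom : set M;
    frame_vec : forall q, 'I_2 -> E q;
    frame_dom_open : open frame_dom;
    frame_basis : forall q, frame_dom q -> forall v : E q,
      exists! a : 'I_2 -> R, v = \sum_i a i *: frame_vec q i }.

Record rank2_bundle (R : realType) (M : topologicalType)
    (S : smooth_surface R M) := Rank2Bundle {
  fiber :> M -> lmodType R;
  frames : set (frame fiber);
  frames_cover : forall q, exists2 e, frames e & frame_dom e q;
  frames_smooth : forall d e, frames d -> frames e ->
    exists A : 'I_2 -> 'I_2 -> M -> R,
      (forall i j, smooth_fun S (frame_dom d `&` frame_dom e) (A i j)) /\
      forall q, frame_dom d q -> frame_dom e q ->
        forall j, frame_vec e q j = \sum_i A i j q *: frame_vec d q i }.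

Definition smooth_section (R : realType) (M : topologicalType)
    (S : smooth_surface R M) (E : rank2_bundle S) :
    set (forall q, E q) :=
  [set sigma | forall e, frames e -> exists a : 'I_2 -> M -> R,
    (forall i, smooth_fun S (frame_dom e) (a i)) /\
    forall q, frame_dom e q -> sigma q = \sum_i a i q *: frame_vec e q i].

(* [anchor q] is the restriction to the fiber at [q] of the bundle morphism to TM;
   a morphism is smooth when it maps local frames to smooth local vector fields,
   that is, to derivations taking smooth functions to smooth functions. *)
Record anchored_euclidean_bundle (R : realType) (M : topologicalType)
    (S : smooth_surface R M) := AnchoredEuclideanBundle {
  bundle : rank2_bundle S;
  anchor : forall q, bundle q -> Cinf S -> R;
  anchor_tangent : forall q (v : bundle q), tangent S q (anchor v);
  anchor_linear : forall q a (v w : bundle q),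
    anchor (a *: v + w) = a *: anchor v + anchor w;
  anchor_smooth : forall e, frames e -> forall i f,
    smooth_fun S (frame_dom e) (fun q => anchor (frame_vec e q i) f);
  scalar_product : forall q, bundle q -> bundle q -> R;
  scalar_product_linear : forall q a (u v w : bundle q),
    scalar_product (a *: u + v) w =
      a * scalar_product u w + scalar_product v w;
  scalar_product_sym : forall q (v w : bundle q),
    scalar_product v w = scalar_product w v;
  scalar_product_pos : forall q (v : bundle q),
    v != 0 -> 0 < scalar_product v v;
  scalar_product_smooth : forall e, frames e -> forall i j,
    smooth_fun S (frame_dom e)
      (fun q => scalar_product (frame_vec e q i) (frame_vec e q j)) }.

Section Distribution.
Context (R : realType) (M : topologicalType) (S : smooth_surface R M).
Context (A : anchored_euclidean_bundle S).

Definition distribution : set (Cinf S -> Cinf S) := [set X |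
  vector_field X /\
  exists2 sigma, @smooth_section _ _ _ (bundle A) sigma &
    forall q, field_at q X = anchor (sigma q)].

Definition distribution_at q : set (Cinf S -> R) :=
  field_at q @` distribution.

Definition bracket_at q : set (Cinf S -> R) :=
  lin_span [set field_at q (bracket X Y) |
            X in distribution & Y in distribution].

Definition bracket_generating :=
  forall q, field_at q @` lie_hull distribution = tangent S q.

End Distribution.

Record almost_riemannian (R : realType) (M : topologicalType)
    (S : smooth_surface R M) := AlmostRiemannian {
  ars_bundle :> anchored_euclidean_bundle S;
  ars_bracket_generating : bracket_generating ars_bundle }.

Section AlmostRiemannian.
Context (R : realType) (M : ptopologicalType) (S : smooth_surface R M).
Context (A : almost_riemannian S).
Implicit Types (c : chart R M) (q : M).

Definition singular_set : set M :=
  [set q | exists2 n, (n < 2)%N & lin_dim (distribution_at A q) n].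

(* From here to [divergence], values at points of [singular_set] are
   meaningless. *)
Definition anchor_inv q (v : Cinf S -> R) : bundle A q :=
  xget 0 [set e | anchor e = v].

Definition metric q (v w : Cinf S -> R) : R :=
  scalar_product (anchor_inv q v) (anchor_inv q w).

(* The factor sqrt(det g_ij) of the area element in the chart [c], as a function
   of the coordinates. *)
Definition area_density c (x : R * R) : R :=
  let q := chart_inv c x in
  Num.sqrt (\det (\matrix_(i, j)
    metric q (coord_vec S c i q) (coord_vec S c j q))).

Definition borel := g_sigma_algebraType (@open M).

Definition lebesgue2 :
    {measure set (measurableTypeR R * measurableTypeR R) -> \bar R} :=
  (@lebesgue_measure R \x @lebesgue_measure R)%E.

(* The Riemannian area of [M \ singular_set], extended by zero to [M]: this is the
   unique Borel measure with area element sqrt(det g_ij) dx in each chart. *)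
Definition riemannian_area (omega : {measure set borel -> \bar R}) :=
  omega singular_set = 0%E /\
  forall c (B : set M), atlas S c -> measurable (B : set borel) ->
    B `<=` chart_dom c `\` singular_set ->
    omega B = (\int[lebesgue2]_(x in chart_map c @` B) (area_density c x)%:E)%E.

Definition gradient (phi : Cinf S) q : Cinf S -> R :=
  xget 0 [set v | tangent S q v /\
                  forall w, tangent S q w -> metric q v w = w phi].

(* The components of the tangent vector [v] at [q] in the basis d/dx_i. *)
Definition components c q (v : Cinf S -> R) : 'I_2 -> R :=
  xget 0 [set a | v = \sum_i a i *: coord_vec S c i q].

Definition chart_at q : chart R M := s2val (cid2 (atlas_cover S q)).

(* div X = rho^-1 sum_i d(rho X^i)/dx_i, with rho the area density; the value does
   not depend on the chart. *)
Definition divergence (X : M -> Cinf S -> R) q : R :=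
  let c := chart_at q in
  (area_density c (chart_map c q))^-1 *
  \sum_i partial i (fun x => area_density c x *
    components c (chart_inv c x) (X (chart_inv c x)) i) (chart_map c q).

Definition laplace_beltrami (phi : Cinf S) : M -> R :=
  divergence (gradient phi).

(* A smooth function with compact support in [M \ singular_set] is identified with
   its extension by zero, which is smooth on [M]. *)
Definition test_function : set (Cinf S) := [set phi |
  let supp := closure [set q | (phi : M -> R) q != 0] in
  compact supp /\ supp `<=` ~` singular_set].

End AlmostRiemannian.

Section L2.
Context d (T : measurableType d) (R : realType).
Context (mu : {measure set T -> \bar R}).

Local Open Scope quotient_scope.
Local Notation L2fun := (LfunType mu (lee1n 2)).
Implicit Types f g : L2fun.

Definition ae_null : {pred L2fun} :=
  mem [set f : L2fun | (f : T -> R) = cst 0 %[ae mu]].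

Lemma ae_null_zmod_closed : zmod_closed ae_null.
Proof.
split=> [|f g /set_mem/= f0 /set_mem/= g0]; apply/mem_set => /=.
  exact: nearW.
by apply: filterS2 f0 g0 => x fx gx _; rewrite !fctE fx// gx// subrr.
Qed.

Lemma ae_nullZ (a : R) f : f \in ae_null -> a *: f \in ae_null.
Proof.
move=> /set_mem/= f0; apply/mem_set => /=.
by apply: filterS f0 => x fx _; rewrite fctE fx// scaler0.
Qed.

HB.instance Definition _ :=
  GRing.isZmodClosed.Build L2fun ae_null ae_null_zmod_closed.

(* The space of classes of square-integrable functions modulo equality almost
   everywhere. *)
Definition L2 : Type := Quotient.quot ae_null.
HB.instance Definition _ := GRing.Zmodule.on L2.
HB.instance Definition _ := EqQuotient.on L2.

Definition L2fun_norm f : R := fine ('N[mu]_2%:R%:E [EFin \o f])%E.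
Definition L2_scale (a : R) (u : L2) : L2 := \pi_L2 (a *: repr u).
Definition L2_norm (u : L2) : R := L2fun_norm (repr u).
Definition L2_repr (u : L2) : T -> R := repr u.
Definition inner (u v : L2) : R := (\int[mu]_x (L2_repr u x * L2_repr v x))%R.

Lemma L2fun_norm_ae f g :
  (f : T -> R) = g %[ae mu] -> L2fun_norm f = L2fun_norm g.
Proof.
move=> fg; rewrite /L2fun_norm Lnorm.unlock /=.
apply: (congr1 (fun z => fine (poweR z 2^-1))).
have mp (h : L2fun) : measurable_fun [set: T] (fun x => (`|h x| `^ 2)%:E).
  apply/measurable_EFinP.
  apply: (@measurableT_comp _ _ _ _ _ _ (@powR R ^~ 2)) => //.
  exact: measurableT_comp.
apply: ge0_ae_eq_integral => //=.
by apply: (filterS _ fg) => x fx _ /=; rewrite fx.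
Qed.

Let repr_pi f : (repr (\pi_L2 f : L2) : T -> R) = f %[ae mu].
Proof.
have /eqP : \pi_L2 (repr (\pi_L2 f)) = \pi_L2 f :> L2 by rewrite reprK.
rewrite -Quotient.idealrBE => /set_mem/= H.
by apply: filterS H => x /(_ I) /eqP; rewrite !fctE subr_eq0 => /eqP.
Qed.

Let L2_norm_pi f : L2_norm (\pi_L2 f) = L2fun_norm f.
Proof. exact/L2fun_norm_ae/repr_pi. Qed.

Let pi_scale a f : L2_scale a (\pi_L2 f) = \pi_L2 (a *: f).
Proof.
apply/eqP; rewrite /L2_scale -Quotient.idealrBE -scalerBr.
apply: ae_nullZ; rewrite Quotient.idealrBE; apply/eqP; exact: reprK.
Qed.

Let piD f g : \pi_L2 (f + g) = \pi_L2 f + \pi_L2 g :> L2.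
Proof. exact: Quotient.pi_add. Qed.

Let L2_scaleA a b u : L2_scale a (L2_scale b u) = L2_scale (a * b) u.
Proof. by rewrite -[u]reprK (pi_scale b) !pi_scale scalerA. Qed.
Let L2_scale1 : left_id 1 L2_scale.
Proof. by move=> u; rewrite -[u]reprK pi_scale scale1r. Qed.
Let L2_scaleDr : right_distributive L2_scale +%R.
Proof.
by move=> a u v; rewrite -[u]reprK -[v]reprK -piD !pi_scale -piD scalerDr.
Qed.
Let L2_scaleDl u : {morph L2_scale^~ u : a b / a + b}.
Proof. by move=> a b; rewrite -[u]reprK !pi_scale -piD scalerDl. Qed.

HB.instance Definition _ := GRing.Zmodule_isLmodule.Build R L2
  L2_scaleA L2_scale1 L2_scaleDr L2_scaleDl.

Let L2_normD u v : L2_norm (u + v) <= L2_norm u + L2_norm v.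
Proof. by rewrite -[u]reprK -[v]reprK -piD !L2_norm_pi; exact: ler_LnormD. Qed.

Let L2_normZ a u : L2_norm (a *: u) = `|a| * L2_norm u.
Proof.
rewrite -[u]reprK [_ *: _]pi_scale !L2_norm_pi /L2fun_norm.
by rewrite (LnormZ (repr u) a) -finite_norm_fine.
Qed.

Let L2_norm0_eq0 u : L2_norm u = 0 -> u = 0.
Proof.
rewrite -[u]reprK L2_norm_pi => /fine_Lnormr_eq0 H.
have <- : \pi_L2 0 = 0 :> L2.
  by apply: (@addrI _ (\pi_L2 0)); rewrite -piD !addr0.
apply/eqP; rewrite -Quotient.idealrBE subr0; apply/mem_set => /=.
exact: H.
Qed.

HB.instance Definition _ :=
  Lmodule_isNormed.Build R L2 L2_normD L2_normZ L2_norm0_eq0.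

End L2.

Arguments inner {d T R} mu u v.

Section UnboundedOperators.
Context (R : realType) (H : normedModType R) (ip : H -> H -> R).
Implicit Types (A : set (H * H)) (K : H -> H).

(* An unbounded operator is represented by its graph. *)
Definition linear_operator A :=
  [/\ A (0, 0),
      forall (a : R) p q, A p -> A q -> A (a *: p + q) &
      forall u v w, A (u, v) -> A (u, w) -> v = w].

Definition op_domain A : set H := [set u | exists v, A (u, v)].

Definition symmetric_operator A := forall u v u' v',
  A (u, v) -> A (u', v') -> ip v u' = ip u v'.

Definition adjoint A : set (H * H) :=
  [set p | forall u v, A (u, v) -> ip v p.1 = ip u p.2].

Definition self_adjoint A :=
  [/\ linear_operator A, dense (op_domain A) & adjoint A = A].

(* [closure] is the closure of the graph in the product space [H * H]. *)
Definition essentially_self_adjoint A :=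
  [/\ linear_operator A, dense (op_domain A), symmetric_operator A &
      self_adjoint (closure A)].

(* The operator [a A + b]. *)
Definition affine_operator (a b : R) A : set (H * H) :=
  [set (p.1, a *: p.2 + b *: p.1) | p in A].

Definition inverse_operator A K := forall u v, A (u, v) <-> u = K v.

Definition linear_map K :=
  forall (a : R) u v, K (a *: u + v) = a *: K u + K v.

Definition compact_operator K := linear_map K /\
  forall B : set H, bounded_set B -> compact (closure (K @` B)).

(* The complement of the set of [lambda] for which [A - lambda] is a bijection from
   its domain to [H] with bounded inverse. The scalars are real; the spectrum of a
   self-adjoint operator is real. *)
Definition spectrum A : set R := [set lambda | ~ exists K,
  [/\ linear_map K, continuous K &
      inverse_operator (affine_operator 1 (- lambda) A) K]].

Definition op_eigenspace A (lambda : R) : set H :=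
  [set u | A (u, lambda *: u)].

Definition op_eigenvalue A (lambda : R) :=
  exists2 u, u != 0 & op_eigenspace A lambda u.

End UnboundedOperators.

Section LaplaceBeltramiOperator.
Context (R : realType) (M : ptopologicalType) (S : smooth_surface R M).
Context (A : almost_riemannian S).
Context (omega : {measure set (borel M) -> \bar R}).

Definition laplace_operator : set (L2 omega * L2 omega) :=
  [set p : L2 omega * L2 omega | exists2 phi : Cinf S, test_function A phi &
    L2_repr p.1 = (phi : borel M -> R) %[ae omega] /\
    L2_repr p.2 = (laplace_beltrami A phi : borel M -> R) %[ae omega]].

(* The Laplacian of [u] in the sense of distributions on [M \ singular_set] is
   [f]. *)
Definition distributional_laplacian (u f : L2 omega) :=
  forall phi : Cinf S, test_function A phi ->
    (\int[omega]_(q in ~` singular_set A) (L2_repr u q * laplace_beltrami A phi q) =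
     \int[omega]_(q in ~` singular_set A) (L2_repr f q * (phi : M -> R) q))%R.

End LaplaceBeltramiOperator.

Arguments laplace_operator {R M S} A omega.

(* Main.v *)
(* The step-two condition gives a function T >= 0 vanishing exactly on Z, near Z a
  positive multiple of the squared determinant of a frame, with |grad T|^2 ~ T and
  (Delta T)^2 <= C T. Hardy's inequality with a potential ~ 1/T then lets an Agmon
  estimate rule out nonzero L2 solutions of Delta u = E u, whence self-adjointness,
  and bounds the mass near Z by the energy; with Rellich's theorem away from Z this
  makes the resolvent compact. *)
Require Import Defs.
From HB Require Import structures.
From mathcomp Require Import all_boot all_order all_algebra.
From mathcomp Require Import all_classical all_reals all_analysis.
From mathcomp Require Import measurable_realfun.
From mathcomp Require Import ring lra.
Import Order.TTheory GRing.Theory Num.Theory.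
Import numFieldNormedType.Exports.
Local Open Scope classical_set_scope.
Local Open Scope ring_scope.

Set Implicit Arguments.
Unset Strict Implicit.
Unset Printing Implicit Defensive.

Local Notation sqrt := Num.sqrt.
Local Notation o0 := ord0.
Local Notation o1 := ord_max.

(** The metric blows up on Z but its inverse does not: the pairing of gradients [Gam phi psi] is
    smooth on all of M, and everything near Z is phrased with it. Put r = sqrt T. The Hardy
    potential is |grad r|^2 / r^2 up to an error of order 1/r, and its constant 1 is critical: for
    the natural Agmon weight F = r, the quantity potential F^2 - |grad F|^2 vanishes to leading
    order. The corrected weight r / (1 + b r) with b large gains a term of order r, which absorbs
    the error. This is where (Delta T)^2 <= C T matters: a mere bound on Delta T would leave an
    error of order 1/r^2. A second obstacle is that a weak solution u is only square integrable, so
    Hardy's inequality cannot be applied to F u directly. Instead u is mollified in charts;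
    Friedrichs' lemma makes the commutators vanish in L2, and the limiting inequality, which
    contains derivatives of F alone, holds for u itself. The support of F then approaches Z. The
    Hardy potential is also bounded below by 1 / (2 C T) minus a constant, which keeps mass from
    concentrating at Z in the compactness proof. *)

Lemma le_of_eq (R : numDomainType) (x y : R) : x = y -> x <= y.
Proof. by move->. Qed.

Lemma near_invS (R : realType) (e : R) : 0 < e ->
 exists N, forall n, (N <= n)%N -> n.+1%:R^-1 < e.
Proof.
move=> e0; exists (Num.truncn e^-1) => n Nn.
rewrite invf_plt ?posrE//.
by apply: lt_le_trans (truncnS_gt _) _; rewrite ler_nat.
Qed.

(** In the parallelogram law for two points of a minimising sequence, S is the infimum of the
    distance, x and y are the squared distances of the points and z that of their midpoint. The
    factor 4 (2 S + 2) dominates the expansion of both squares. *)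
Lemma parallelogram_bound (R : realType) (S a b e x y z : R) : 0 <= S ->
 0 < a -> a <= 1 -> 0 < b -> b <= 1 ->
 x <= (S + a) ^+ 2 -> y <= (S + b) ^+ 2 -> S ^+ 2 <= z ->
 a * (4 * (S * 2 + 2)) < e -> b * (4 * (S * 2 + 2)) < e ->
 2 * x + 2 * y - 4 * z < e.
Proof.
move=> S0 a0 a1 b0 b1 xa yb Sz ae be.
have tm : a ^+ 2 <= a by rewrite expr2 ler_piMl// ltW.
have tn : b ^+ 2 <= b by rewrite expr2 ler_piMl// ltW.
have pa := mulr_ge0 S0 (ltW a0); have pb := mulr_ge0 S0 (ltW b0).
have ea : (S + a) ^+ 2 = S ^+ 2 + 2 * (S * a) + a ^+ 2 by ring.
have eb : (S + b) ^+ 2 = S ^+ 2 + 2 * (S * b) + b ^+ 2 by ring.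
rewrite ea in xa; rewrite eb in yb.
have fa : a * (4 * (S * 2 + 2)) = 8 * (S * a) + 8 * a by ring.
have fb : b * (4 * (S * 2 + 2)) = 8 * (S * b) + 8 * b by ring.
rewrite fa in ae; rewrite fb in be.
clear ea eb fa fb; lra.
Qed.

(** * Hilbert spaces: projection, total boundedness, closed operators *)

Section Hilbert.
Context (R : realType) (H : normedModType R).

Definition cauchy_sequence (u : nat -> H) :=
 forall e : R, 0 < e -> exists N, forall m n, (N <= m)%N -> (N <= n)%N ->
  `|u m - u n| < e.

(** A predicate on the form rather than a structure on the space, so that it can be proved of
    [inner] on the existing normed space [L2]. Completeness is asked of sequences, which is how it
    is used. *)
Definition hilbert (ip : H -> H -> R) :=
 [/\ forall u v, ip u v = ip v u,
   forall a u v w, ip (a *: u + v) w = a * ip u w + ip v w,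
   forall u, ip u u = `|u| ^+ 2 &
   forall u, cauchy_sequence u -> exists l : H, u n @[n --> \oo] --> l].

Definition subspace (V : set H) :=
 V 0 /\ forall a u v, V u -> V v -> V (a *: u + v).

Context (ip : H -> H -> R) (hip : hilbert ip).

Lemma ipC u v : ip u v = ip v u. Proof. by case: hip. Qed.
Lemma ipP a u v w : ip (a *: u + v) w = a * ip u w + ip v w.
Proof. by case: hip. Qed.
Lemma ipxx u : ip u u = `|u| ^+ 2. Proof. by case: hip. Qed.
Lemma ip0l w : ip 0 w = 0.
Proof. by have := ipP 1 0 0 w; rewrite scale1r addr0; lra. Qed.
Lemma ipDl u v w : ip (u + v) w = ip u w + ip v w.
Proof. by have := ipP 1 u v w; rewrite scale1r mul1r. Qed.
Lemma ipZl a u w : ip (a *: u) w = a * ip u w.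
Proof. by have := ipP a u 0 w; rewrite addr0 ip0l addr0. Qed.
Lemma ipNl u w : ip (- u) w = - ip u w.
Proof. by rewrite -scaleN1r ipZl mulN1r. Qed.
Lemma ipBl u v w : ip (u - v) w = ip u w - ip v w.
Proof. by rewrite ipDl ipNl. Qed.
Lemma ip0r w : ip w 0 = 0. Proof. by rewrite ipC ip0l. Qed.
Lemma ipDr u v w : ip w (u + v) = ip w u + ip w v.
Proof. by rewrite !(ipC w) ipDl. Qed.
Lemma ipZr a u w : ip w (a *: u) = a * ip w u.
Proof. by rewrite !(ipC w) ipZl. Qed.
Lemma ipBr u v w : ip w (u - v) = ip w u - ip w v.
Proof. by rewrite !(ipC w) ipBl. Qed.
Lemma ip_suml (I : finType) (F : I -> H) w :
 ip (\sum_i F i) w = \sum_i ip (F i) w.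
Proof. by apply: (big_morph (ip^~ w)) => [u v|]; rewrite ?ipDl ?ip0l. Qed.

Lemma ipNr u w : ip w (- u) = - ip w u.
Proof. by rewrite !(ipC w) ipNl. Qed.

Definition ipE := (ipDl, ipDr, ipNl, ipNr, ipZl, ipZr).

Lemma ip_eq0 u : ip u u = 0 -> u = 0.
Proof. by rewrite ipxx => /eqP; rewrite sqrf_eq0 normr_eq0 => /eqP. Qed.

Lemma sqr_normB u v : `|u - v| ^+ 2 = `|u| ^+ 2 - 2 * ip u v + `|v| ^+ 2.
Proof. by rewrite -!ipxx !ipE ipC; ring. Qed.

Lemma cauchy_schwarz u v : `|ip u v| <= `|u| * `|v|.
Proof.
have [->|v0] := eqVneq v 0; first by rewrite ip0r !normr0 mulr0.
have nv : 0 < `|v| ^+ 2 by rewrite exprn_gt0 ?normr_gt0.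
have : 0 <= `|v| ^+ 2 * (`|v| ^+ 2 * `|u| ^+ 2 - ip u v ^+ 2).
 have -> : `|v| ^+ 2 * (`|v| ^+ 2 * `|u| ^+ 2 - ip u v ^+ 2) =
   `|(`|v| ^+ 2) *: u - ip u v *: v| ^+ 2.
  by rewrite sqr_normB !ipE -!ipxx !ipE; ring.
 exact: sqr_ge0.
rewrite pmulr_rge0// subr_ge0 -exprMn mulrC -(real_normK (num_real _)).
by rewrite ler_pXn2r// nnegrE.
Qed.

Lemma closure_ballP (V : set H) f :
 (forall e, 0 < e -> exists2 v, V v & `|f - v| < e) <-> closure V f.
Proof.
split=> [h B /nbhs_ballP[e /= e0 eB]|h e e0].
- by have [v Vv fv] := h e e0; exists v; split => //; apply: eB; rewrite -ball_normE.
- have [v [Vv]] := h _ (nbhsx_ballx f e e0); rewrite -ball_normE; by exists v.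
Qed.

(** The projection theorem: a sequence in V minimising the distance to f is Cauchy, and for its
    limit p the difference f - p is orthogonal to V, so f = p. *)
Lemma orth_dense (V : set H) : subspace V ->
 (forall u, (forall v, V v -> ip u v = 0) -> u = 0) ->
 forall f e, 0 < e -> exists2 v, V v & `|f - v| < e.
Proof.
move=> [V0 VL] orth f.
set S := [set `|f - v| | v in V].
have Sinf : has_inf S by split; [exists `|f - 0|, 0|exists 0 => _ [v _ <-]].
have d0 : 0 <= inf S by apply: lb_le_inf; [case: Sinf|move=> _ [v _ <-]].
have dle v : V v -> inf S <= `|f - v| by move=> Vv; apply: ge_inf; [case: Sinf|exists v].
have /choice[v Vv] n : exists w, V w /\ `|f - w| < inf S + n.+1%:R^-1.
 have n0 : 0 < (n.+1%:R^-1 : R) by rewrite invr_gt0 ltr0n.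
 by have [_ [w Vw <-] h] := inf_adherent n0 Sinf; exists w.
have pz : inf S * 2 + 2 > 0 by lra.
have vC : cauchy_sequence v.
 move=> e e0; have c0 : 0 < 4 * (inf S * 2 + 2) by lra.
 have [|N hN'] := @near_invS _ (e ^+ 2 / (4 * (inf S * 2 + 2))).
  by rewrite divr_gt0 ?exprn_gt0.
 have hN k : (N <= k)%N -> k.+1%:R^-1 * (4 * (inf S * 2 + 2)) < e ^+ 2.
  by move=> /hN'; rewrite ltr_pdivlMr.
 exists N => m n Nm Nn.
 have Vmid : V (2^-1 *: v m + 2^-1 *: v n).
  apply: (VL); first by case: (Vv m).
  rewrite -[_ *: _]addr0; apply: (VL) => //; by case: (Vv n).
 (* The parallelogram law. The midpoint lies in V, so its distance to f is at least the infimum. *)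
 have pl : `|v m - v n| ^+ 2 = 2 * `|f - v m| ^+ 2 + 2 * `|f - v n| ^+ 2
   - 4 * `|f - (2^-1 *: v m + 2^-1 *: v n)| ^+ 2.
  by rewrite -!ipxx !ipE (ipC (v n) f) (ipC (v m) f) (ipC (v n) (v m)); field.
 have hd := dle _ Vmid; have [_ hm] := Vv m; have [_ hn] := Vv n.
 have k1 (k : nat) : 0 < (k.+1%:R^-1 : R) <= 1.
  by rewrite invr_gt0 ltr0n invf_le1 ?ltr0n// ler1n.
 have hm' := hN _ Nm; have hn' := hN _ Nn.
 have sq x y : 0 <= x -> x < y -> x ^+ 2 <= y ^+ 2 :> R by move=> *; nra.
 have sm := sq _ _ (normr_ge0 _) hm; have sn := sq _ _ (normr_ge0 _) hn.
 have sd : inf S ^+ 2 <= `|f - (2^-1 *: v m + 2^-1 *: v n)| ^+ 2 by nra.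
 have /andP[m0 m1] := k1 m; have /andP[n0 n1] := k1 n.
 move: sm sn hm' hn'; move: m0 m1 n0 n1.
 set a := _^-1 : R; set b := n.+1%:R^-1 : R => m0 m1 n0 n1 sm sn hm' hn'.
 rewrite -(@ltr_pXn2r _ 2) ?nnegrE ?(ltW e0)// pl.
 exact: (parallelogram_bound d0 m0 m1 n0 n1 sm sn sd hm' hn').
have [p vp] : exists l : H, v n @[n --> \oo] --> l by case: hip => _ _ _; apply.
have pcl (e : R) : 0 < e -> exists2 w, V w & `|p - w| < e.
 move=> e0; have /cvgrPdist_lt /(_ e e0) [N _ h] := vp.
 by exists (v N); [case: (Vv N)|exact: h (leqnn N)].
suff fp : f = p by rewrite fp.
apply/eqP; rewrite -subr_eq0; apply/eqP/orth => w Vw.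
have lep u : V u -> inf S <= `|f - p - u|.
 move=> Vu; suff h (e : R) : 0 < e -> inf S <= `|f - p - u| + e by apply/ler_addgt0Pr => e /h.
 move=> e0; have [z Vz pz'] := pcl e e0.
 have Vuz : V (1 *: u + z) by exact: (VL).
 apply: (le_trans (dle _ Vuz)); rewrite scale1r.
 have -> : f - (u + z) = f - p - u + (p - z).
  by rewrite -!addrA; congr (_ + _); rewrite opprD addrCA; congr (_ + _); rewrite addKr.
 by apply: le_trans (ler_normD _ _) _; rewrite lerD2l ltW.
have pS : `|f - p| <= inf S.
 suff h (e : R) : 0 < e -> `|f - p| <= inf S + e by apply/ler_addgt0Pr => e /h.
 move=> e0.
 have /cvgrPdist_lt /(_ _ (divr_gt0 e0 (ltr0n _ 2))) [N _ h] := vp.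
 have [K hK] := near_invS (divr_gt0 e0 (ltr0n R 2)).
 have h1 := h (maxn N K) (leq_maxl _ _).
 have [_ h2] := Vv (maxn N K).
 have h3 := hK (maxn N K) (leq_maxr _ _).
 have := ler_distD (v (maxn N K)) f p; rewrite (distrC (v _) p) => h4.
 apply: le_trans h4 _; rewrite (splitr e) addrA; apply: lerD; last exact: ltW.
 by apply: ltW; apply: lt_trans h2 _; rewrite ltrD2l.
(* Moving p along w cannot decrease the distance to f; this quadratic in t, taken at its minimum,
   forces the inner product to vanish. *)
have q t : 0 <= t ^+ 2 * `|w| ^+ 2 - 2 * t * ip (f - p) w.
 have Vtw : V (t *: w) by rewrite -[_ *: _]addr0; apply: (VL).
 have h : `|f - p| <= `|f - p - t *: w| by apply: le_trans pS (lep _ Vtw).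
 have : `|f - p| ^+ 2 <= `|f - p - t *: w| ^+ 2 by rewrite lerXn2r ?nnegrE.
 rewrite [X in _ <= X]sqr_normB normrZ exprMn real_normK ?num_real// ipZr.
 by rewrite -subr_ge0 => h'; apply: le_trans h' _; lra.
have [w0|w0] := eqVneq w 0; first by rewrite w0 ip0r.
have W : 0 < `|w| ^+ 2 by rewrite exprn_gt0 ?normr_gt0.
have := q (ip (f - p) w / `|w| ^+ 2).
have -> : (ip (f - p) w / `|w| ^+ 2) ^+ 2 * `|w| ^+ 2 - 2 * (ip (f - p) w / `|w| ^+ 2) * ip (f - p) w
 = - (ip (f - p) w ^+ 2 / `|w| ^+ 2) by field; rewrite lt0r_neq0 // normr_gt0.
rewrite oppr_ge0 pmulr_lle0 ?invr_gt0// => h.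
by apply/eqP; rewrite -sqrf_eq0 eq_le h sqr_ge0.
Qed.

Definition totally_bounded (S : set H) := forall e : R, 0 < e ->
 exists s : seq H, forall u, S u -> exists2 c, c \in s & `|u - c| < e.

Lemma ultra_ball (F : set_system H) (s : seq H) (e : R) : UltraFilter F ->
 F [set u | exists2 c, c \in s & `|u - c| < e] -> exists c, F [set u | `|u - c| < e].
Proof.
move=> FU; elim: s => [|c s IH] Fs.
 by have /filter_ex[x [c]] := Fs.
have [Fc|Fc] := in_ultra_setVsetC [set u | `|u - c| < e] FU; first by exists c.
apply: IH; apply: filterS2 Fs Fc => u [d]; rewrite in_cons => /orP[/eqP->//|ds ud _].
by exists d.
Qed.

(** An ultrafilter containing the closure of S contains a ball of radius 1/(n+1) for each n. The
    centres form a Cauchy sequence, whose limit is the limit of the ultrafilter. *)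
Lemma totally_bounded_compact S : totally_bounded S -> compact (closure S).
Proof.
move=> tbS; rewrite compact_ultra => F FU FS.
have /choice[c hc] (n : nat) : exists c, F [set u | `|u - c| < (n.+1%:R^-1 : R)].
 have n0 : 0 < (n.+1%:R^-1 : R) / 2 by [].
 have [s hs] := tbS _ n0; apply: (@ultra_ball _ s).
 apply: filterS FS => u /(closure_ballP S) /(_ _ n0)[v Sv uv].
 have [d ds vd] := hs _ Sv; exists d => //.
 by apply: le_lt_trans (ler_distD v _ _) _; rewrite (splitr n.+1%:R^-1) ltrD.
have cC : cauchy_sequence c.
 move=> e e0; have [N hN] := near_invS (divr_gt0 e0 (ltr0n R 2)).
 exists N => m n Nm Nn.
 have /filter_ex[u [/= um un]] := @filterI _ F (@filter_filter _ _ (@ultra_proper _ _ FU)) _ _ (hc m) (hc n).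
 rewrite (splitr e); apply: le_lt_trans (ler_distD u _ _) _.
 by apply: ltrD; [rewrite distrC; apply: lt_trans um (hN _ Nm)|apply: lt_trans un (hN _ Nn)].
have [l cl] : exists l : H, c n @[n --> \oo] --> l by case: hip => _ _ _; apply.
have Fl : F --> l.
 apply/cvgrPdist_lt => e e0.
 have /cvgrPdist_lt /(_ _ (divr_gt0 e0 (ltr0n _ 2))) [N _ h] := cl.
 have [K hK] := near_invS (divr_gt0 e0 (ltr0n R 2)).
 apply: filterS (hc (maxn N K)) => u /= uc.
 rewrite (splitr e); apply: le_lt_trans (ler_distD (c (maxn N K)) _ _) _.
 apply: ltrD; first exact: h (leq_maxl _ _).
 by rewrite distrC; apply: lt_trans uc (hK _ (leq_maxr _ _)).
exists l; split => //.
have : closure (closure S) l.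
 move=> B /Fl FB; have PF := @ultra_proper _ _ FU.
 by have /filter_ex[x [? ?]] := @filterI _ F (@filter_filter _ _ PF) _ _ FS FB; exists x.
by have /closure_id <- := @closed_closure _ S.
Qed.

Implicit Types (A B : set (H * H)).

Lemma ip_polar u v : ip u v = (`|u + v| ^+ 2 - `|u| ^+ 2 - `|v| ^+ 2) / 2.
Proof. by rewrite -!ipxx !ipE ipC; field. Qed.

Lemma ip_continuous (T : topologicalType) (f g : T -> H) :
 continuous f -> continuous g -> continuous (fun t => ip (f t) (g t)).
Proof.
move=> cf cg t.
rewrite (_ : (fun t => _) = (fun t =>
 (`|f t + g t| ^+ 2 - `|f t| ^+ 2 - `|g t| ^+ 2) / 2)); last first.
 by apply/funext => s; exact: ip_polar.
have sq (h : T -> H) : {for t, continuous h} -> {for t, continuous (fun s => `|h s| ^+ 2 : R)}.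
 move=> ch; apply: (@continuous_comp _ _ _ (fun s => `|h s|) (fun x => x ^+ 2)).
  by apply: (@continuous_comp _ _ _ h) => //; exact: norm_continuous.
 exact: exprn_continuous.
apply: cvgMr_tmp; apply: cvgB; [apply: cvgB|].
- by apply: sq; apply: cvgD; [exact: cf|exact: cg].
- by apply: sq; exact: cf.
- by apply: sq; exact: cg.
Qed.

Lemma closure_eq A (g h : H * H -> R) : continuous g -> continuous h ->
 (forall p, A p -> g p = h p) -> forall p, closure A p -> g p = h p.
Proof.
move=> cg ch gh p Ap; apply/eqP; rewrite -subr_eq0; apply/eqP.
have cl : closed [set q | (g q - h q) = 0].
 apply: (@closed_comp _ _ (fun q => g q - h q) [set 0]) => //.
 by move=> q _; apply: cvgB; [exact: cg|exact: ch].
suff : closure [set q | g q - h q = 0] p by have /closure_id <- := cl.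
by apply: closure_subset Ap => q /gh /= ->; rewrite subrr.
Qed.

Lemma closure_le0 A (g : H * H -> R) : continuous g ->
 (forall p, A p -> g p <= 0) -> forall p, closure A p -> g p <= 0.
Proof.
move=> cg gh p Ap.
have cl : closed [set q | g q <= 0].
 apply: (@closed_comp _ _ g [set x | x <= 0]); last exact: closed_le.
 by move=> q _; exact: cg.
suff : closure [set q | g q <= 0] p by have /closure_id <- := cl.
exact: closure_subset Ap => q /gh.
Qed.

Lemma closure_graphP A p : closure A p <-> forall e : R, 0 < e ->
 exists2 q, A q & `|p.1 - q.1| < e /\ `|p.2 - q.2| < e.
Proof.
split=> [h e e0|h B /nbhs_ballP[e /= e0 eB]].
 have [q [Aq]] := h _ (nbhsx_ballx p e e0).
 by case=> h1 h2; exists q => //; move: h1 h2; rewrite -!ball_normE.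
have [q Aq [h1 h2]] := h e e0; exists q; split => //; apply: eB.
by split; rewrite -ball_normE.
Qed.

Lemma closure_graph_seq A (u v : nat -> H) x y : (forall n, A (u n, v n)) ->
 u n @[n --> \oo] --> x -> v n @[n --> \oo] --> y -> closure A (x, y).
Proof.
move=> Auv ux vy; apply/closure_graphP => e e0.
have /cvgrPdist_lt /(_ _ e0) [N _ hN] := ux.
have /cvgrPdist_lt /(_ _ e0) [K _ hK] := vy.
exists (u (maxn N K), v (maxn N K)) => //=.
by split; [exact: hN (leq_maxl _ _)|exact: hK (leq_maxr _ _)].
Qed.

Definition graph_subspace A :=
 A (0, 0) /\ forall (a : R) p q, A p -> A q -> A (a *: p + q).

Lemma graph_subspace_closure A : graph_subspace A -> graph_subspace (closure A).
Proof.
move=> [A0 AL]; split; first exact: subset_closure.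
move=> a p q /closure_graphP hp /closure_graphP hq; apply/closure_graphP => e e0.
have a0 : 0 < `|a| + 1 by rewrite ltr_wpDl.
have e2 : 0 < e / 2 by rewrite divr_gt0.
have [p' Ap' [p1 p2]] := hp _ (divr_gt0 e2 a0).
have [q' Aq' [q1 q2]] := hq _ e2.
exists (a *: p' + q'); first exact: AL.
have key x x' y y' : `|x - x'| < e / 2 / (`|a| + 1) -> `|y - y'| < e / 2 ->
  `|a *: x + y - (a *: x' + y')| < e.
 move=> xx yy; rewrite opprD addrACA -scalerBr (splitr e).
 apply: le_lt_trans (ler_normD _ _) _; apply: ler_ltD => //.
 rewrite normrZ; move: xx; rewrite ltr_pdivlMr// => /ltW; apply: le_trans.
 by rewrite mulrC ler_wpM2l// lerDl.
by split; exact: key.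
Qed.

Lemma graph_subspaceB A p q : graph_subspace A -> A p -> A q -> A (p - q).
Proof. by move=> [_ AL] Ap Aq; rewrite addrC -scaleN1r; exact: AL. Qed.

Lemma graph_subspaceZ A a p : graph_subspace A -> A p -> A (a *: p).
Proof. by move=> [A0 AL] Ap; rewrite -[_ *: _]addr0; exact: AL. Qed.

(** An operator bounded below has closed range: preimages of a convergent sequence of values are
    Cauchy, and closedness of the graph keeps the limit in B. With zero orthogonal complement the
    range is also dense, hence everything. *)
Lemma closed_range B (lam c : R) : graph_subspace B -> closed B -> 0 < c ->
 (forall u v, B (u, v) -> c * `|u| <= `|v - lam *: u|) ->
 (forall w, (forall u v, B (u, v) -> ip w (v - lam *: u) = 0) -> w = 0) ->
 forall f, exists u v, B (u, v) /\ v - lam *: u = f.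
Proof.
move=> Bs Bc c0 bd orth f.
pose V := [set p.2 - lam *: p.1 | p in B].
have Vs : subspace V.
 split; first by exists (0, 0); [case: Bs|rewrite /= scaler0 subrr].
 move=> a _ _ [p Bp <-] [q Bq <-]; exists (a *: p + q); first exact: (Bs.2).
 rewrite scalerDr scalerBr !scalerA mulrC opprD addrACA; congr _.
have dV := orth_dense Vs _ f.
have /choice[p hp] n : exists p : H * H,
  B p /\ `|f - (p.2 - lam *: p.1)| < n.+1%:R^-1.
 have n0 : 0 < (n.+1%:R^-1 : R) by rewrite invr_gt0 ltr0n.
 have [|_ [q Bq <-] h] := dV _ _ n0; last by exists q.
 by move=> w hw; apply: orth => u v Buv; apply: hw; exists (u, v).
have vf : (p n).2 - lam *: (p n).1 @[n --> \oo] --> f.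
 apply/cvgrPdist_lt => e e0; have [N hN] := near_invS e0.
 by exists N => // n /= Nn; apply: lt_trans (hp n).2 (hN _ Nn).
have uC : cauchy_sequence (fun n => (p n).1).
 move=> e e0; have ce : 0 < c * e / 2 by rewrite divr_gt0 ?mulr_gt0.
 have [N hN] := near_invS ce.
 exists N => m n Nm Nn.
 have Bmn := graph_subspaceB Bs (hp m).1 (hp n).1.
 have := bd (p m - p n).1 (p m - p n).2; rewrite -surjective_pairing => /(_ Bmn) h.
 rewrite -(ltr_pM2l c0); apply: le_lt_trans h _.
 have -> : (p m - p n).2 - lam *: (p m - p n).1 =
  (p m).2 - lam *: (p m).1 - ((p n).2 - lam *: (p n).1).
  rewrite -[_.2]/(_.2 - _.2) -[_.1]/(_.1 - _.1).
  by rewrite scalerBr !opprB [X in _ + X = _]addrC addrACA [X in _ + X = _]addrC.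
 apply: le_lt_trans (ler_distD f _ _) _; rewrite (splitr (c * e)).
 apply: ltrD; last exact: lt_trans (hp n).2 (hN _ Nn).
 by rewrite distrC; apply: lt_trans (hp m).2 (hN _ Nm).
have [u pu] : exists l : H, (p n).1 @[n --> \oo] --> l by case: hip => _ _ _; apply.
have pv : (p n).2 @[n --> \oo] --> f + lam *: u.
 rewrite (_ : (fun n => _) = (fun n => ((p n).2 - lam *: (p n).1) + lam *: (p n).1)).
  by apply: (cvgD vf); exact: cvgZl_tmp.
 by apply/funext => n; rewrite subrK.
exists u, (f + lam *: u); split; last by rewrite addrK.
have /closure_id -> := Bc.
apply: (closure_graph_seq (u := fun n => (p n).1) (v := fun n => (p n).2)) => // n.
by rewrite -surjective_pairing; case: (hp n).
Qed.

Lemma dense_orth A : dense (op_domain A) -> forall w,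
 (forall u v, A (u, v) -> ip w u = 0) -> w = 0.
Proof.
move=> dA w hw; apply: ip_eq0; apply/eqP; rewrite -normr_eq0; apply/negPn/negP => n0.
have W0 : w != 0 by apply: contra n0 => /eqP ->; rewrite ip0l normr0.
have nw : 0 < `|w| by rewrite normr_gt0.
have [|u [/= wu [v Auv]]] := dA (ball w `|w|) _ (ball_open _ _).
 by exists w; exact: ballxx.
move: wu; rewrite -ball_normE /= => wu.
have := cauchy_schwarz w (w - u); rewrite ipBr (hw _ _ Auv) subr0 ipxx.
by rewrite normrX normr_id ler_pM2l// => /(lt_le_trans wu); rewrite ltxx.
Qed.

Lemma adjoint_closure A : adjoint ip (closure A) = adjoint ip A.
Proof.
apply/seteqP; split => p hp u v Auv; first by apply: hp; exact: subset_closure.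
apply: (@closure_eq A (fun q => ip q.2 p.1) (fun q => ip q.1 p.2) _ _ _ (u, v)) => //.
- by apply: ip_continuous => q; [exact: cvg_snd|exact: cvg_cst].
- by apply: ip_continuous => q; [exact: cvg_fst|exact: cvg_cst].
- by move=> [x y] Axy; exact: hp.
Qed.

(** * Self-adjointness and discreteness of the spectrum for dissipative operators *)

Section SelfAdjoint.
Lemma linear_graph_subspace A : linear_operator A -> graph_subspace A.
Proof. by case. Qed.

Lemma adjoint_functional A : dense (op_domain A) -> forall u v w,
 adjoint ip A (u, v) -> adjoint ip A (u, w) -> v = w.
Proof.
move=> dA u v w uv uw; apply/eqP; rewrite -subr_eq0; apply/eqP.
apply: (dense_orth dA) => a b Aab.
have := uv _ _ Aab; have := uw _ _ Aab => /= h1 h2.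
by rewrite ipBl !(ipC _ a) -h1 -h2 subrr.
Qed.

(** Two orthonormal vectors are at distance sqrt 2, so a ball of radius 1/2 holds at most one of
    them. *)
Lemma orthonormal_card (S : set H) : totally_bounded S -> exists N, forall n (e : 'I_n -> H),
 (forall i, S (e i)) -> (forall i j, ip (e i) (e j) = (i == j)%:R) -> (n <= N)%N.
Proof.
move=> /(_ 2^-1) [|s hs]; first by rewrite invr_gt0.
exists (size s) => n e Se oe.
have /choice[f hf] (i : 'I_n) : exists c, c \in s /\ `|e i - c| < 2^-1.
 by have [c cs h] := hs _ (Se i); exists c.
have bf (i : 'I_n) : (index (f i) s < size s)%N by rewrite index_mem; case: (hf i).
pose g i := Ordinal (bf i).
have ginj : injective g.
 move=> i j /(congr1 val) /= ij; apply/eqP/negPn/negP => nij.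
 have fij : f i = f j.
  by rewrite -(nth_index (f i) (hf i).1) ij nth_index//; case: (hf j).
 have : `|e i - e j| < 1.
  have := ler_distD (f i) (e i) (e j); move: (hf i).2 (hf j).2.
  rewrite fij (distrC (f j)) => h1 h2 h3.
  by apply: le_lt_trans h3 _; rewrite [ltRHS](splitr 1) ltrD// mul1r.
 have : `|e i - e j| ^+ 2 = 2.
  rewrite sqr_normB -ipxx -ipxx !oe !eqxx (negbTE nij).
  by rewrite mulr0 subr0.
 move=> h2 h1; have := normr_ge0 (e i - e j); nra.
by have := leq_card g ginj; rewrite !card_ord.
Qed.

Lemma orthonormal_extend (V : set H) n (e : 'I_n -> H) r : V r -> subspace V ->
 (forall i, V (e i)) -> (forall i j, ip (e i) (e j) = (i == j)%:R) ->
 (forall i, ip r (e i) = 0) -> r != 0 ->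
 exists e' : 'I_n.+1 -> H, (forall i, V (e' i)) /\
  forall i j, ip (e' i) (e' j) = (i == j)%:R.
Proof.
move=> Vr [V0 VL] Ve oe re r0.
exists (fun i => if unlift ord_max i is Some j then e j else `|r|^-1 *: r); split.
 move=> i; case: unliftP => [j _|_]; first exact: Ve.
 by rewrite -[_ *: _]addr0; exact: (VL).
have rr : ip (`|r|^-1 *: r) (`|r|^-1 *: r) = 1.
 by rewrite !ipE ipxx; field; rewrite normr_eq0.
move=> i j; case: unliftP => [i' ->|->]; case: unliftP => [j' ->|->].
- by rewrite oe (inj_eq (@lift_inj _ _)).
- by rewrite !ipE ipC re mulr0 (eq_sym (lift _ _)) (negbTE (neq_lift _ _)).
- by rewrite !ipE re mulr0 (negbTE (neq_lift _ _)).
- by rewrite eqxx.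
Qed.

(** An orthonormal family of maximal length is a basis: a nonzero residue after projection would
    extend it. *)
Lemma finite_orthonormal_dim (V : set H) N : subspace V ->
 (forall n (e : 'I_n -> H), (forall i, V (e i)) ->
  (forall i j, ip (e i) (e j) = (i == j)%:R) -> (n <= N)%N) ->
 exists n : nat, lin_dim V n.
Proof.
move=> sV hN; have [V0 VL] := sV.
pose P n := `[< exists e : 'I_n -> H, (forall i, V (e i)) /\
 forall i j, ip (e i) (e j) = (i == j)%:R >].
have P0 : exists n, P n.
 by exists 0%N; apply/asboolP; exists (fun=> 0); split=> [[]|[]].
have PN n : P n -> (n <= N)%N by move=> /asboolP[e [Ve oe]]; exact: hN oe.
have [n /asboolP[e [Ve oe]] nmax] := ex_maxnP P0 PN.
have Vsum (a : 'I_n -> R) : V (\sum_i a i *: e i).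
 by elim/big_rec: _ => // i x _ Vx; exact: (VL).
have coef (a : 'I_n -> R) j : ip (\sum_i a i *: e i) (e j) = a j.
 rewrite ip_suml (bigD1 j)//= big1 ?addr0 ?ipE ?oe ?eqxx ?mulr1// => i ij.
 by rewrite ipE oe (negbTE ij) mulr0.
exists n, e; split=> [a a0 j|]; first by rewrite -coef a0 ip0l.
apply/seteqP; split=> [u Vu|_ [a _ <-]//].
exists (fun i => ip u (e i)) => //; apply/esym/eqP; rewrite -subr_eq0; apply/negPn/negP => r0.
have Vr : V (u - \sum_i ip u (e i) *: e i) by rewrite addrC -scaleN1r; exact: (VL).
have [|e' [Ve' oe']] := orthonormal_extend Vr sV Ve oe _ r0.
 by move=> i; rewrite ipBl coef subrr.
have : P n.+1 by apply/asboolP; exists e'.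
by move=> /nmax; rewrite ltnn.
Qed.

(** [uA] says that the range of E - A has zero orthogonal complement for one E > 0, and [cA] that
    the unit ball of the energy |u|^2 - (u, A u) is totally bounded. These are the two analytic
    inputs; the rest of the section is abstract. *)
Context A (lA : linear_operator A) (dA : dense (op_domain A))
 (sA : symmetric_operator ip A)
 (nA : forall u v, A (u, v) -> ip u v <= 0)
 (E : R) (E0 : 0 < E)
 (uA : forall w, (forall u v, A (u, v) -> ip w (E *: u - v) = 0) -> w = 0)
 (cA : totally_bounded [set u | exists2 v, A (u, v) & `|u| ^+ 2 - ip u v <= 1]).
Local Notation B := (closure A).

Let gB : graph_subspace B.
Proof. exact/graph_subspace_closure/linear_graph_subspace. Qed.

Let nB u v : B (u, v) -> ip u v <= 0.
Proof.
move=> Buv; apply: (@closure_le0 A (fun q => ip q.1 q.2) _ _ (u, v)) => //.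
 by apply: ip_continuous => q; [exact: cvg_fst|exact: cvg_snd].
by move=> [a b]; exact: nA.
Qed.

(** By dissipativity the inner product of lam u - v with u is at least lam |u|^2. *)
Let boundB (lam : R) u v : 0 < lam -> B (u, v) -> lam * `|u| <= `|v - lam *: u|.
Proof.
move=> l0 Buv; have [->|u0] := eqVneq u 0; first by rewrite normr0 mulr0.
rewrite -(@ler_pM2r _ `|u|) ?normr_gt0//.
have := cauchy_schwarz (v - lam *: u) u; apply: le_trans.
rewrite -(normrN (ip _ _)); apply: le_trans (ler_norm _).
rewrite ipBl ipZl ipxx ipC opprB mulrA lerBrDr.
by rewrite gerDl; exact: nB.
Qed.

Let adjA p : B p -> adjoint ip A p.
Proof.
move=> Bp u v Auv; apply: (@closure_eq A (fun q => ip v q.1) (fun q => ip u q.2)) => //.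
- by apply: ip_continuous => q; [exact: cvg_cst|exact: cvg_fst].
- by apply: ip_continuous => q; [exact: cvg_cst|exact: cvg_snd].
- by move=> [x y] Axy; exact: sA.
Qed.

(** Given (u, v) in the adjoint, surjectivity of the closure minus E yields (u', v') in the closure
    with v' - E u' = v - E u. Then u - u' is orthogonal to the range of E - A, and [uA] makes it
    zero. *)
Lemma adjoint_eq_closure : adjoint ip A = B.
Proof.
apply/seteqP; split => [[u v] auv|]; last exact: adjA.
have h1 x y (Bxy : B (x, y)) := boundB E0 Bxy.
have h2 w : (forall x y, B (x, y) -> ip w (y - E *: x) = 0) -> w = 0.
 move=> hw; apply: uA => x y Axy; have := hw _ _ (subset_closure Axy).
 by rewrite -opprB ipNr => /eqP; rewrite oppr_eq0 => /eqP.
have [u' [v' [Buv' e]]] := closed_range gB (@closed_closure _ A) E0 h1 h2 (v - E *: u).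
have a' := adjA Buv'.
have uu : u - u' = 0.
 apply: uA => x y Axy; have /= k1 := auv _ _ Axy; have /= k2 := a' _ _ Axy.
 have : ip (v - E *: u) x = ip (v' - E *: u') x by rewrite e.
 move: k1 k2; rewrite !(ipBl, ipBr, ipZl, ipZr).
 by rewrite (ipC y) (ipC y) (ipC x) (ipC x) => -> ->; lra.
have ux : u = u' by apply/eqP; rewrite -subr_eq0 uu.
by move: e; rewrite ux => /addIr <-.
Qed.

Let aB : adjoint ip B = B.
Proof. by rewrite adjoint_closure adjoint_eq_closure. Qed.

Let dB : dense (op_domain B).
Proof.
move=> O On Oo; have [u [Ou [v Auv]]] := dA On Oo.
by exists u; split => //; exists v; exact: subset_closure.
Qed.

Lemma essentially_self_adjoint_closure : essentially_self_adjoint ip A.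
Proof.
suff : self_adjoint ip B by [].
split => //; split; [by case: gB|by case: gB|].
by move=> u v w; rewrite -adjoint_eq_closure; exact: adjoint_functional.
Qed.

(** Adjoints reverse inclusions: A inside Delta puts Delta inside the closure of A, and since both
    are self-adjoint a second adjoint gives the converse. *)
Lemma self_adjoint_extension_unique Delta :
 self_adjoint ip Delta -> A `<=` Delta -> Delta = B.
Proof.
move=> [_ _ aD] AD.
have DB : Delta `<=` B.
 by rewrite -aD -adjoint_eq_closure => p hp u v /AD; exact: hp.
apply/seteqP; split => //; rewrite -aB -[X in _ `<=` X]aD => p hp u v /DB; exact: hp.
Qed.

(** [cA] concerns A, this its closure: a point of the graph is moved to a nearby point of A and
    scaled by 1/L into the energy ball, its energy being at most 2 (|M| + 1)^2 <= L^2. *)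
Lemma graph_ball_totally_bounded (M : R) :
 totally_bounded [set u | exists v, [/\ B (u, v), `|u| <= M & `|v| <= M]].
Proof.
move=> e e0; pose d := Num.min 1 (e / 2).
have d0 : 0 < d by rewrite lt_min ltr01 divr_gt0.
pose L : R := 2 * (`|M| + 1).
have L0 : 0 < L by rewrite mulr_gt0// ltr_wpDl.
have [s hs] := cA (divr_gt0 (divr_gt0 e0 (ltr0n R 2)) L0).
exists [seq L *: c | c <- s] => u [v [Buv uM vM]].
have /closure_graphP /(_ _ d0)[[u' v'] Auv' /= [hu hv]] := Buv.
have d1 : d <= 1 by rewrite ge_min lexx.
have nu : `|u'| <= `|M| + 1.
 have := ler_distD u u' 0; rewrite !subr0 distrC => h; apply: le_trans h _.
 rewrite addrC; apply: lerD; first exact: le_trans uM (ler_norm _).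
 by apply: le_trans d1; exact: ltW.
have nv : `|v'| <= `|M| + 1.
 have := ler_distD v v' 0; rewrite !subr0 distrC => h; apply: le_trans h _.
 rewrite addrC; apply: lerD; first exact: le_trans vM (ler_norm _).
 by apply: le_trans d1; exact: ltW.
have [|c cs hc] := hs (L^-1 *: u').
 exists (L^-1 *: v'); first by apply: (graph_subspaceZ L^-1 (linear_graph_subspace lA) Auv').
 rewrite normrZ (ger0_norm (ltW _)) ?invr_gt0// ipZl ipZr.
 have -> : (L^-1 * `|u'|) ^+ 2 - L^-1 * (L^-1 * ip u' v') = (`|u'| ^+ 2 - ip u' v') / L ^+ 2.
  by field; rewrite gt_eqF.
 rewrite ler_pdivrMr ?exprn_gt0// mul1r.
 have h1 : `|u'| ^+ 2 <= (`|M| + 1) ^+ 2 by rewrite lerXn2r ?nnegrE ?addr_ge0.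
 have h2 : - ip u' v' <= (`|M| + 1) ^+ 2.
  apply: le_trans (ler_norm _) _; rewrite normrN; apply: le_trans (cauchy_schwarz _ _) _.
  by rewrite expr2 ler_pM.
 have h3 : L ^+ 2 = 4 * (`|M| + 1) ^+ 2 by rewrite /L; ring.
 by rewrite h3; have := sqr_ge0 (`|M| + 1); lra.
exists (L *: c); first exact: map_f.
apply: le_lt_trans (ler_distD u' _ _) _; rewrite (splitr e); apply: ltrD.
 by apply: lt_le_trans hu _; rewrite ge_min lexx orbT.
have -> : u' - L *: c = L *: (L^-1 *: u' - c).
 by rewrite scalerBr scalerA divff ?scale1r// gt_eqF.
by rewrite normrZ gtr0_norm// mulrC -ltr_pdivlMr.
Qed.

(** The pair (a, lam) covers both 1 - closure, with a = -1 and lam = 1, and closure - lam, with a =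
    1. The lower bound gives injectivity; self-adjointness turns a vector orthogonal to the range
    into an eigenvector, so there is none but zero. *)
Let resolvent (a lam c : R) : a != 0 -> 0 < c ->
 (forall u v, B (u, v) -> c * `|u| <= `|v - lam *: u|) ->
 exists K, [/\ linear_map K, inverse_operator (affine_operator a (- (a * lam)) B) K,
  forall f, B (K f, a^-1 *: f + lam *: K f) & forall f, c * `|K f| <= `|a^-1 *: f|].
Proof.
move=> a0 c0 bd.
have eig0 u : B (u, lam *: u) -> u = 0.
 by move=> /bd; rewrite subrr normr0 pmulr_rle0// normr_le0 => /eqP.
have orth w : (forall x y, B (x, y) -> ip w (y - lam *: x) = 0) -> w = 0.
 move=> hw; apply: eig0; rewrite -adjoint_eq_closure => x y Axy /=.
 have := hw _ _ (subset_closure Axy).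
 by rewrite ipBr !ipZr !(ipC w) => /eqP; rewrite subr_eq0 => /eqP.
have /choice[K hK] f : exists u, B (u, a^-1 *: f + lam *: u).
 have [u [v [Buv e]]] := closed_range gB (@closed_closure _ A) c0 bd orth (a^-1 *: f).
 by exists u; rewrite -e subrK.
have uniq u u' f : B (u, f + lam *: u) -> B (u', f + lam *: u') -> u = u'.
 move=> Bu Bu'; have := graph_subspaceB gB Bu Bu'.
 rewrite -[_ - _]/(u - u', _ - _) opprD addrACA subrr add0r -scalerBr.
 by move=> /eig0/eqP; rewrite subr_eq0 => /eqP.
have ev u : a *: (a^-1 *: u) = u by rewrite scalerA mulfV// scale1r.
exists K; split => // [b u v|u f|f]; last by apply: le_trans (bd _ _ (hK f)) _; rewrite addrK.
 apply: uniq (hK _) _; have := gB.2 b _ _ (hK u) (hK v).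
 rewrite -[_ + _]/(b *: K u + K v, b *: (a^-1 *: u + lam *: K u) + (a^-1 *: v + lam *: K v)).
 by rewrite !scalerDr addrACA !scalerA (mulrC b) (mulrC b).
split=> [[[x y]  Bxy [<- <-]]|->]; last first.
 by exists (K f, a^-1 *: f + lam *: K f) => //=; rewrite scalerDr ev scalerA scaleNr addrK.
apply: uniq (hK _); rewrite scalerDr scalerA mulVf// scale1r scalerA mulrN mulrA mulVf// mul1r.
by rewrite scaleNr subrK.
Qed.

(** Both K f and its image under the closure are bounded by multiples of |f|, so K maps bounded sets
    into balls of the graph norm. *)
Lemma compact_resolvent :
 exists K, inverse_operator (affine_operator (-1) 1 B) K /\ compact_operator K.
Proof.
have bd x y (Bxy : B (x, y)) := boundB ltr01 Bxy.
have [|K []] := @resolvent (-1) 1 1 _ ltr01 bd; first by rewrite oppr_eq0 oner_neq0.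
rewrite mulN1r opprK => Klin Kinv BK Kb; exists K; do 2!split => //.
move=> S [M [_ hM]]; apply: totally_bounded_compact => e e0.
have [s hs] := graph_ball_totally_bounded (2 * (`|M| + 1)) e0.
exists s => _ [f Sf <-]; apply: hs; exists ((-1)^-1 *: f + 1 *: K f); have := Kb f.
have fM : `|f| <= `|M| + 1.
 by apply: hM => //; apply: le_lt_trans (ler_norm _) _; rewrite ltrDl.
have := BK f; rewrite invrN1 scaleN1r scale1r mul1r normrN => hB hKf; split => //.
 by apply: le_trans hKf _; have := normr_ge0 f; lra.
by apply: le_trans (ler_normD _ _) _; rewrite normrN; lra.
Qed.

Lemma eigen_totally_bounded (M : R) : totally_bounded
 [set u | exists l, [/\ B (u, l *: u), `|u| <= M & `|l| <= M]].
Proof.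
move=> e e0; have [s hs] := graph_ball_totally_bounded (`|M| + M ^+ 2) e0.
exists s => u [l [Bu uM lM]]; apply: hs; exists (l *: u); split => //.
 apply: le_trans uM _; apply: le_trans (ler_norm _) _.
 by rewrite lerDl sqr_ge0.
rewrite normrZ; apply: (@le_trans _ _ (M ^+ 2)); first by rewrite expr2 ler_pM.
by rewrite lerDr.
Qed.

Lemma eigenspace_dim (lam : R) : exists n : nat, lin_dim (op_eigenspace B lam) n.
Proof.
have [N hN] := orthonormal_card (eigen_totally_bounded (`|lam| + 1)).
apply: (@finite_orthonormal_dim _ N).
 split; first by rewrite /op_eigenspace /= scaler0; case: gB.
 move=> a u v; rewrite /op_eigenspace /= => Bu Bv.
 by have := gB.2 a _ _ Bu Bv; rewrite -[_ + _]/(_, _) /= scalerDr !scalerA mulrC.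
move=> n e Ve oe; apply: (hN n e) => // i; exists lam; split; first exact: Ve.
 have : `|e i| ^+ 2 = 1 by rewrite -ipxx oe eqxx.
 move/eqP; rewrite sqrf_eq1 => /orP[/eqP->|/eqP h]; first by rewrite lerDr.
 by have := normr_ge0 (e i); rewrite h oppr_ge0 ler10.
by rewrite lerDl.
Qed.

(** If lam is no eigenvalue, the closure minus lam is bounded below: otherwise normalised
    approximate eigenvectors lie in a ball of the graph norm and accumulate at an eigenvector of
    norm 1. The lower bound yields a continuous resolvent, so lam is not in the spectrum. *)
Lemma spectrum_eigenvalue (lam : R) : spectrum B lam -> op_eigenvalue B lam.
Proof.
apply: contrapT => /not_implyP[sp ne]; apply: sp.
have e0 u : B (u, lam *: u) -> u = 0.
 by move=> Bu; apply/eqP/negPn/negP => u0; apply: ne; exists u.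
have [c c0 h1] : exists2 c : R, 0 < c & forall u v, B (u, v) -> c * `|u| <= `|v - lam *: u|.
 apply: contrapT => nc.
 have /choice[p hp] (n : nat) : exists p : H * H, [/\ B p, `|p.1| = 1 &
   `|p.2 - lam *: p.1| < (n.+1%:R^-1 : R)].
  have n0 : 0 < (n.+1%:R^-1 : R) by rewrite invr_gt0 ltr0n.
  apply: contrapT => np; apply: nc; exists (n.+1%:R^-1) => // u v Buv.
  rewrite leNgt; apply/negP => h; apply: np.
  have u0 : 0 < `|u|.
   rewrite normr_gt0; apply: contraTneq h => ->.
   by rewrite normr0 mulr0 -leNgt.
  exists (`|u|^-1 *: (u, v)); split; first exact: (graph_subspaceZ _ gB Buv).
   by rewrite /= normrZ gtr0_norm ?invr_gt0// mulVf// gt_eqF.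
  rewrite /= scalerA mulrC -scalerA -scalerBr normrZ gtr0_norm ?invr_gt0//.
  by rewrite mulrC ltr_pdivrMr.
 pose S := [set u | exists v, [/\ B (u, v), `|u| <= `|lam| + 2 & `|v| <= `|lam| + 2]].
 have cS := totally_bounded_compact (graph_ball_totally_bounded (`|lam| + 2)).
 have pS n : S (p n).1.
  have [Bp p1 p2] := hp n; exists (p n).2; split.
  - by rewrite -surjective_pairing.
  - by rewrite p1; have := normr_ge0 lam; lra.
  - rewrite -[_.2](subrK (lam *: (p n).1)); apply: le_trans (ler_normD _ _) _.
   rewrite normrZ p1 mulr1 addrC lerD2l; apply: le_trans (ltW p2) _.
   by apply: (@le_trans _ _ 1); rewrite ?invf_le1 ?ltr0n ?ler1n ?ler1n.
 have [|u [_ uc]] := cS ((fun n => (p n).1) @ \oo) _.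
  by exists 0%N => // n _ /=; apply: subset_closure; exact: pS.
 have near_u (d : R) N : 0 < d -> exists2 n, (N <= n)%N & `|u - (p n).1| < d.
  move=> d0; have [|_ [[n Nn <-]]] := uc [set (p n).1 | n in [set n | (N <= n)%N]] _ _ (nbhsx_ballx u d d0).
   by exists N => // n Nn; exists n.
  by rewrite -ball_normE => h; exists n.
 have u1 : `|u| = 1.
  apply/eqP; rewrite -subr_eq0 -normr_eq0; apply/negPn/negP => n0.
  have d0 : 0 < `| `|u| - 1| by rewrite lt_def n0/=.
  have [n _ h] := near_u _ 0%N d0.
  have [_ p1 _] := hp n.
  by have := ler_dist_dist u (p n).1; rewrite p1 => /le_lt_trans /(_ h); rewrite ltxx.
 have Bu : B (u, lam *: u).
  have /closure_id -> := @closed_closure _ A; apply/closure_graphP => d d0.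
  have l0 : 0 < `|lam| + 1 by rewrite ltr_wpDl.
  have d2 : 0 < d / 2 / (`|lam| + 1) by rewrite !divr_gt0.
  have d4 : 0 < d / 2 by rewrite divr_gt0.
  have [N hN] := near_invS d4.
  have [n Nn h] := near_u _ N d2; have [Bp _ p2] := hp n.
  exists (p n) => //; split.
   apply: lt_le_trans h _; rewrite ler_pdivrMr// ler_pdivrMr// -mulrA ler_peMr ?ltW//.
   by have := normr_ge0 lam; lra.
  have -> : (lam *: u, u).1 - (p n).2 = lam *: (u - (p n).1) - ((p n).2 - lam *: (p n).1).
   by rewrite scalerBr opprB addrA subrK.
  apply: le_lt_trans (ler_normB _ _) _; rewrite (splitr d); apply: ler_ltD.
   rewrite normrZ; move: h; rewrite ltr_pdivlMr// => /ltW; apply: le_trans.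
   by rewrite mulrC ler_wpM2l// lerDl.
  exact: lt_trans p2 (hN _ Nn).
 by move: u1; rewrite (e0 _ Bu) normr0 => /eqP; rewrite eq_sym oner_eq0.
have [K []] := resolvent (oner_neq0 R) c0 h1.
rewrite mul1r invr1 => Klin Kinv BK Kb; exists K; split => // f.
apply/cvgrPdist_lt => e ep; apply/nbhs_ballP; exists (c * e); first exact: mulr_gt0.
move=> g; rewrite -ball_normE /= => fg; have -> : K f - K g = K (f - g).
 by rewrite [LHS]addrC -scaleN1r -Klin scaleN1r addrC.
by rewrite -(ltr_pM2l c0); apply: le_lt_trans (Kb _) _; rewrite scale1r.
Qed.

Lemma eigenvector_orth u v (a b : R) : a != b -> B (u, a *: u) -> B (v, b *: v) -> ip u v = 0.
Proof.
move=> ab Bu Bv; have := Bv; rewrite -aB => /(_ _ _ Bu) /=.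
rewrite ipZl ipZr => /eqP; rewrite -subr_eq0 -mulrBl mulf_eq0 subr_eq0 (negbTE ab).
by move/eqP.
Qed.

(** Accumulation at lam would give arbitrarily many distinct eigenvalues within distance 1 of it,
    with orthonormal eigenvectors in one totally bounded set. *)
Lemma spectrum_discrete (lam : R) : ~ limit_point (spectrum B) lam.
Proof.
move=> lp.
have fam n : exists s : seq R, [/\ uniq s, size s = n &
  forall a, a \in s -> [/\ spectrum B a, a != lam & `|a - lam| < 1]].
 elim: n => [|n [s [us <- hs]]]; first by exists [::].
 (* The next eigenvalue is taken closer to lam than all the previous ones, which makes it distinct
    from them. *)
 have [d [d0 d1 hd]] : exists d : R, [/\ 0 < d, d <= 1 &
   forall a, a \in s -> d <= `|a - lam|].
  elim: s {us} hs => [|b s IH] hs; first by exists 1.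
  have [|d [d0 d1 hd]] := IH; first by move=> a as_; apply: hs; rewrite in_cons as_ orbT.
  have [_ bl _] := hs _ (mem_head b s).
  exists (Num.min d `|b - lam|); split.
  - by rewrite lt_min d0 normr_gt0 subr_eq0.
  - by rewrite ge_min d1.
  - move=> a; rewrite in_cons => /orP[/eqP->|/hd h]; first by rewrite ge_min lexx orbT.
   by rewrite ge_min h.
 have [a [al sa]] := lp _ (nbhsx_ballx lam d d0); rewrite -ball_normE /= distrC => la.
 exists (a :: s); split => //.
  rewrite /= us andbT; apply/negP => /hd; rewrite leNgt la//.
 move=> b; rewrite in_cons => /orP[/eqP->|/hs//]; split => //.
 exact: lt_le_trans la d1.
have [N hN] := orthonormal_card (eigen_totally_bounded (`|lam| + 1)).
have [s [us sN hs]] := fam N.+1.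
have /choice[e he] (i : 'I_N.+1) : exists u, B (u, s`_i *: u) /\ `|u| = 1.
 have [|sp _ _] := hs s`_i; first by rewrite mem_nth ?sN.
 have [u u0 Bu] := spectrum_eigenvalue sp.
 exists (`|u|^-1 *: u); split.
  have := graph_subspaceZ `|u|^-1 gB Bu.
  by rewrite -[_ *: _]/(_, _) /= !scalerA mulrC.
 by rewrite normrZ ger0_norm ?invr_ge0// mulVf// normr_eq0.
suff : (N.+1 <= N)%N by rewrite ltnn.
apply: (hN _ e) => [i|i j].
 have [Be e1] := he i; exists s`_i; split => //; first by rewrite e1 lerDr.
 have [|_ _ h] := hs s`_i; first by rewrite mem_nth ?sN.
 by rewrite -[s`_i](subrK lam) addrC; apply: le_trans (ler_normD _ _) _; rewrite lerD2l ltW.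
have [->|ij] := eqVneq i j; first by rewrite ipxx (he j).2 expr1n.
apply: (@eigenvector_orth _ _ s`_i s`_j); [|exact: (he i).1|exact: (he j).1].
by rewrite nth_uniq ?sN.
Qed.

End SelfAdjoint.

End Hilbert.

(** * Real-valued integrals and the completeness of L2 *)

Section RealIntegrals.
Context d (T : measurableType d) (R : realType) (mu : {measure set T -> \bar R}).
Implicit Types f g : T -> R.

Definition integ f := mu.-integrable [set: T] (EFin \o f).

Lemma integ_meas f : integ f -> measurable_fun setT f.
Proof. by move=> /measurable_int /measurable_EFinP. Qed.

Lemma integ_eq f g : f =1 g -> integ f -> integ g.
Proof. by move=> /funext ->. Qed.

Lemma integD f g : integ f -> integ g -> integ (fun x => f x + g x).
Proof. by move=> fi gi; exact: (integrableD _ fi gi). Qed.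

Lemma integZ a f : integ f -> integ (fun x => a * f x).
Proof. by move=> fi; exact: (integrableZl _ _ fi). Qed.

Lemma integB f g : integ f -> integ g -> integ (fun x => f x - g x).
Proof. by move=> fi gi; apply: integ_eq (integD fi (integZ (-1) gi)) => x; rewrite mulN1r. Qed.

Lemma integ_sum (I : Type) (s : seq I) (F : I -> T -> R) :
 (forall i, integ (F i)) -> integ (fun x => \sum_(i <- s) F i x).
Proof.
move=> Fi; elim: s => [|i s IH].
 by rewrite (_ : (fun x => _) = fun=> 0) ?funeqE => [|x]; [exact: integrable0|rewrite big_nil].
rewrite (_ : (fun x => _) = fun x => F i x + \sum_(j <- s) F j x).
 exact: integD.
by apply/funext => x; rewrite big_cons.
Qed.

Lemma integ_le f g : measurable_fun setT f -> (forall x, `|f x| <= g x) ->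
 integ g -> integ f.
Proof.
move=> mf fg; apply: le_integrable => //; first exact/measurable_EFinP.
move=> x _ /=; rewrite lee_fin; apply: le_trans (fg x) _; exact: ler_norm.
Qed.

Lemma integ_norm f : integ f -> integ (fun x => `|f x|).
Proof. exact: integrable_norm. Qed.

Lemma integ_ae f g : measurable_fun setT g -> f = g %[ae mu] -> integ f -> integ g.
Proof.
move=> mg fg /integrableP[mf fi]; apply/integrableP; split; first exact/measurable_EFinP.
rewrite -(@ge0_ae_eq_integral _ _ _ mu setT (fun x => `|f x|%:E)) //.
- by apply: measurableT_comp => //; exact/measurableT_comp/measurable_EFinP.
- by apply: measurableT_comp => //; exact: measurableT_comp.
- by apply: filterS fg => x /[apply] /= ->.
Qed.

Lemma int_ae f g : measurable_fun setT f -> measurable_fun setT g ->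
 f = g %[ae mu] -> (\int[mu]_x f x = \int[mu]_x g x).
Proof.
move=> mf mg fg; congr fine; apply: ae_eq_integral => //; [exact/measurable_EFinP..|].
by apply: filterS fg => x /[apply] /= ->.
Qed.

Lemma intD f g : integ f -> integ g ->
 (\int[mu]_x (f x + g x) = \int[mu]_x f x + \int[mu]_x g x).
Proof. exact: RintegralD. Qed.

Lemma intB f g : integ f -> integ g ->
 (\int[mu]_x (f x - g x) = \int[mu]_x f x - \int[mu]_x g x).
Proof. exact: RintegralB. Qed.

Lemma intZ a f : integ f -> (\int[mu]_x (a * f x) = a * \int[mu]_x f x).
Proof. exact: RintegralZl. Qed.

Lemma int_sum (I : Type) (s : seq I) (F : I -> T -> R) : (forall i, integ (F i)) ->
 (\int[mu]_x (\sum_(i <- s) F i x) = \sum_(i <- s) \int[mu]_x F i x).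
Proof.
move=> Fi; elim: s => [|i s IH].
 rewrite big_nil (_ : (fun x => _) = fun=> 0) ?/Rintegral ?integral0//.
 by apply/funext => x; rewrite big_nil.
rewrite big_cons -IH -intD//; last exact: integ_sum.
by apply: eq_Rintegral => x _; rewrite big_cons.
Qed.

Lemma int_le f g : integ f -> integ g -> (forall x, f x <= g x) ->
 (\int[mu]_x f x <= \int[mu]_x g x).
Proof. by move=> fi gi fg; apply: le_Rintegral. Qed.

Lemma int_ge0 f : (forall x, 0 <= f x) -> (0 <= \int[mu]_x f x).
Proof. by move=> f0; apply: Rintegral_ge0. Qed.

Lemma eq_int f g : f =1 g -> (\int[mu]_x f x = \int[mu]_x g x).
Proof. by move=> fg; apply: eq_Rintegral => x _; exact: fg. Qed.

Lemma int_norm_le f : integ f -> (`|\int[mu]_x f x| <= \int[mu]_x `|f x|).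
Proof. by move=> fi; apply: le_normr_Rintegral. Qed.

Lemma int_EFin f : integ f -> ((\int[mu]_x f x)%R%:E = \int[mu]_x (f x)%:E)%E.
Proof. by move=> fi; rewrite fineK//; exact: integrable_fin_num. Qed.

Lemma int_eq0_ae f : integ f -> (forall x, 0 <= f x) -> (\int[mu]_x f x = 0) ->
 f = cst 0 %[ae mu].
Proof.
move=> fi f0 i0; have mf := integ_meas fi.
have mF : measurable_fun setT (EFin \o f) by exact/measurable_EFinP.
have : ae_eq mu setT (EFin \o f) (cst 0%E).
 apply: (proj1 (ae_eq_integral_abs mu measurableT mF)); rewrite -[RHS]/(0%:E) -i0 int_EFin//; apply: eq_integral => x _ /=.
 by rewrite ger0_norm.
by apply: filterS => x /(_ I) [].
Qed.

(** Measurability of f is listed apart because that of f^2 does not imply it. *)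
Definition sq_integ f := measurable_fun setT f /\ integ (fun x => f x ^+ 2).

Lemma sq_integM f g : sq_integ f -> sq_integ g -> integ (fun x => f x * g x).
Proof.
move=> [mf fi] [mg gi]; apply: integ_le (integD fi gi); first exact: measurable_funM.
move=> x; rewrite normrM.
have := sqr_ge0 (`|f x| - `|g x|); rewrite sqrrB !real_normK ?num_real//.
have := mulr_ge0 (normr_ge0 (f x)) (normr_ge0 (g x)); rewrite -mulr_natr; lra.
Qed.

Lemma sq_integD f g : sq_integ f -> sq_integ g -> sq_integ (fun x => f x + g x).
Proof.
move=> sf sg; split; first by apply: measurable_funD; [case: sf|case: sg].
by apply: integ_eq (integD (integD sf.2 sg.2) (integZ 2 (sq_integM sf sg))) => x; ring.
Qed.

Lemma sq_integZ a f : sq_integ f -> sq_integ (fun x => a * f x).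
Proof.
move=> [mf fi]; split; first exact: measurable_funM.
have := integZ (a ^+ 2) fi.
by rewrite /integ /comp; under eq_fun do rewrite -exprMn.
Qed.

Lemma sq_integ_le f g : measurable_fun setT f -> (forall x, `|f x| <= `|g x|) ->
 sq_integ g -> sq_integ f.
Proof.
move=> mf fg [mg gi]; split => //; apply: integ_le gi; first exact: measurable_funX.
by move=> x; rewrite normrX -(real_normK (num_real (g x))) lerXn2r ?nnegrE.
Qed.

Lemma sq_integM_bounded f (h : T -> R) (C : R) : measurable_fun setT h ->
 (forall x, `|h x| <= C) -> sq_integ f -> sq_integ (fun x => h x * f x).
Proof.
move=> mh hC sf; apply: sq_integ_le (sq_integZ C sf).
 by apply: measurable_funM => //; case: sf.
move=> x; rewrite !normrM ler_wpM2r//; exact: le_trans (hC x) (ler_norm _).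
Qed.

Lemma sq_Lfun f : sq_integ f <-> f \in Lfun mu 2%:E.
Proof.
split=> [[mf /integrableP[_ fi]]|h].
 rewrite inE; apply/andP; split; rewrite inE/=//.
 rewrite /finite_norm unlock; apply: poweR_lty; apply: le_lt_trans fi.
 rewrite (_ : (\int[mu]_x _ = \int[mu]_x `|((EFin \o (fun x => (f x ^+ 2)%R)) x)|)%E)//.
 by apply: eq_integral => x _; rewrite /= powR_mulrn// normrX.
split; last exact: Lfun2_integrable_sqr.
by move: h; rewrite inE => /andP[]; rewrite inE.
Qed.

Local Notation H := (L2 mu).
Local Open Scope quotient_scope.

Lemma L2_reprP (u : H) : sq_integ (L2_repr u).
Proof. exact/sq_Lfun/LfunP. Qed.

Definition L2_class f (hf : sq_integ f) : H :=
 \pi_H (Lfun_Sub (lee1n 2) (proj1 (sq_Lfun f) hf) : LfunType mu (lee1n 2)).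

Lemma L2_repr_pi (f : LfunType mu (lee1n 2)) : L2_repr (\pi_H f) = f %[ae mu].
Proof.
have /eqP : \pi_H (repr (\pi_H f)) = \pi_H f :> H by rewrite reprK.
rewrite -Quotient.idealrBE => /set_mem/= h.
by apply: filterS h => x /(_ I) /eqP; rewrite !fctE subr_eq0 => /eqP.
Qed.

Lemma L2_repr_eqpi (w : H) (f : LfunType mu (lee1n 2)) :
 w = \pi_H f -> L2_repr w = f %[ae mu].
Proof. by move=> ->; exact: L2_repr_pi. Qed.

Lemma L2_classE f (hf : sq_integ f) : L2_repr (L2_class hf) = f %[ae mu].
Proof. exact: L2_repr_pi. Qed.

Lemma L2_reprD (u v : H) : L2_repr (u + v) = (fun x => L2_repr u x + L2_repr v x) %[ae mu].
Proof.
have h : u + v = \pi_H (repr u + repr v) by rewrite Quotient.pi_add !reprK.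
by apply: filterS (L2_repr_eqpi h) => x /(_ I) -> _.
Qed.

Lemma L2_reprZ a (u : H) : L2_repr (a *: u) = (fun x => a * L2_repr u x) %[ae mu].
Proof. exact: L2_repr_pi. Qed.

Lemma L2_reprP_lin a (u v : H) :
 L2_repr (a *: u + v) = (fun x => a * L2_repr u x + L2_repr v x) %[ae mu].
Proof.
have := L2_reprD (a *: u) v; have := L2_reprZ a u.
by apply: filterS2 => x /(_ I) h /(_ I) ->; rewrite h.
Qed.

Lemma L2_eq (u v : H) : L2_repr u = L2_repr v %[ae mu] -> u = v.
Proof.
move=> uv; rewrite -[u]reprK -[v]reprK; apply/eqP; rewrite -Quotient.idealrBE.
apply/mem_set => /=; apply: filterS uv => x /(_ I) e _.
by rewrite !fctE; apply/eqP; rewrite subr_eq0; apply/eqP.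
Qed.

Lemma L2_repr0 : L2_repr (0 : H) = cst 0 %[ae mu].
Proof.
have := L2_reprZ 0 (0 : H); rewrite scale0r.
by apply: filterS => x /(_ I) -> _; rewrite mul0r.
Qed.

Lemma inner_L2 (u v : H) f g : L2_repr u = f %[ae mu] -> L2_repr v = g %[ae mu] ->
 measurable_fun setT f -> measurable_fun setT g ->
 inner mu u v = (\int[mu]_x (f x * g x)).
Proof.
move=> uf vg mf mg; have [mu1 _] := L2_reprP u; have [mv _] := L2_reprP v.
apply: int_ae; [exact: measurable_funM..|].
by apply: filterS2 uf vg => x /(_ I) -> /(_ I) ->.
Qed.

Lemma L2_norm_sq (u : H) : `|u| ^+ 2 = inner mu u u.
Proof.
rewrite -[`|u|]/(L2fun_norm (repr u)) /L2fun_norm unlock /=.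
have [mf fi] := L2_reprP u.
have -> : (\int[mu]_x (`|(EFin \o repr u) x| `^ 2) = (inner mu u u)%:E)%E.
 transitivity ((\int[mu]_x (L2_repr u x ^+ 2))%R%:E); last first.
  by congr EFin; apply: eq_Rintegral => x _; rewrite expr2.
 rewrite int_EFin//; apply: eq_integral => x _.
 by rewrite /= powR_mulrn// real_normK// num_real.
rewrite poweR_EFin /= powR12_sqrt.
 by rewrite sqr_sqrtr//; apply: int_ge0 => x; rewrite -expr2 sqr_ge0.
by apply: int_ge0 => x; rewrite -expr2 sqr_ge0.
Qed.

(** Fatou's lemma for (F n - g)^2. With g a term of a Cauchy sequence it yields both the square
    integrability of the limit and the convergence in norm. *)
Lemma int_sqB_fatou (F : nat -> T -> R) f g (C : R) :
 (forall n, sq_integ (F n)) -> sq_integ g -> measurable_fun setT f ->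
 (forall n, (\int[mu]_x ((F n x - g x) ^+ 2) <= C)) ->
 {ae mu, forall x, F n x @[n --> \oo] --> f x} ->
 integ (fun x => (f x - g x) ^+ 2) /\ (\int[mu]_x ((f x - g x) ^+ 2) <= C).
Proof.
move=> sF sg mf FC Ff.
have C0 : 0 <= C by apply: le_trans (FC 0%N); apply: int_ge0 => x; exact: sqr_ge0.
have mg : measurable_fun setT g by case: sg.
have sFg n : sq_integ (fun x => F n x - g x).
 have := sq_integD (sF n) (sq_integZ (-1) sg).
 by rewrite (_ : (fun x => _) = fun x => F n x - g x)//; apply/funext => x; rewrite mulN1r.
have mfg : measurable_fun setT (fun x => ((f x - g x) ^+ 2)%:E).
 by apply/measurable_EFinP/measurable_funX; exact: measurable_funB.
have mFg n : measurable_fun setT (fun x => ((F n x - g x) ^+ 2)%:E).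
 by apply/measurable_EFinP; exact: integ_meas (sFg n).2.
have le : (\int[mu]_x ((f x - g x) ^+ 2)%:E <= C%:E)%E.
 rewrite (@ge0_ae_eq_integral _ _ _ mu setT _ (fun x => limn_einf (fun n => ((F n x - g x) ^+ 2)%:E))) //.
 - apply: le_trans (fatou mu measurableT mFg _) _.
   by move=> n x _; rewrite lee_fin sqr_ge0.
  apply: le_trans (limn_einf_sup _) _; rewrite limn_esup_lim.
  apply: lime_le; first exact: is_cvg_esups.
  apply: nearW => n; apply: ge_ereal_sup => _ [k _ <-].
  by rewrite -int_EFin ?lee_fin//; exact: (sFg k).2.
 - rewrite (_ : (fun x => _) = fun x => - limn_esup (fun n => - ((F n x - g x) ^+ 2)%:E))%E.
   apply: measurableT_comp => //; apply: measurable_fun_limn_esup => n.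
   exact: measurableT_comp.
  apply/funext => x; rewrite -limn_einfN; congr limn_einf; apply/funext => n /=.
  by rewrite opprK.
 - by move=> x _; rewrite lee_fin sqr_ge0.
 - move=> x _; rewrite limn_einf_lim; apply: lime_ge; first exact: is_cvg_einfs.
  apply: nearW => n; apply: le_ereal_inf_tmp => _ [k _ <-].
  by rewrite lee_fin sqr_ge0.
 - apply: filterS Ff => x Fx _.
  have : ((F n x - g x) ^+ 2)%:E @[n --> \oo] --> ((f x - g x) ^+ 2)%:E.
   apply: cvg_EFin; first exact: nearW.
   rewrite /comp /=; apply: (@cvg_comp _ _ _ (fun n => F n x - g x) (fun y => y ^+ 2)).
    by exact: (cvgB Fx (cvg_cst _)).
   exact: exprn_continuous.
  by move=> /cvg_limn_einf_sup[-> _].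
have fi : integ (fun x => (f x - g x) ^+ 2).
 apply/integrableP; split; first exact: mfg.
 under eq_integral => x _ do rewrite /= ger0_norm ?sqr_ge0//.
 exact: le_lt_trans le (ltry _).
by split => //; rewrite -lee_fin int_EFin.
Qed.

(** Completeness is the Riesz-Fischer argument: a fast subsequence converges almost everywhere, and
    Fatou's lemma turns the Cauchy property into convergence in norm to the pointwise limit. *)
Lemma hilbert_L2 : hilbert (inner mu).
Proof.
split.
- by move=> u v; rewrite /inner; apply: eq_Rintegral => x _; rewrite mulrC.
- move=> a u v w; have [su mw] := (L2_reprP u, L2_reprP w); have sv := L2_reprP v.
 rewrite (inner_L2 (L2_reprP_lin a u v) (ae_eq_refl mu _ _)); [|apply: measurable_funD|by case: mw].
 + have i1 : integ (fun x => a * (L2_repr u x * L2_repr w x)) by exact/integZ/sq_integM.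
  have i2 : integ (fun x => L2_repr v x * L2_repr w x) by exact/sq_integM.
  rewrite /inner -intZ; last exact/sq_integM.
  by rewrite -intD//; apply: eq_Rintegral => x _; rewrite mulrDl mulrA.
 + by case: (sq_integZ a su).
 + by case: sv.
- by move=> u; rewrite L2_norm_sq.
move=> u uC.
have normB (v w : H) : `|v - w| ^+ 2 = (\int[mu]_x ((L2_repr v x - L2_repr w x) ^+ 2)).
 have e : L2_repr (v - w) = (fun x => L2_repr v x - L2_repr w x) %[ae mu].
  have := L2_reprP_lin (-1) w v; rewrite scaleN1r addrC.
  by apply: filterS => x /(_ I) -> _; rewrite mulN1r addrC.
 have m : measurable_fun setT (fun x => L2_repr v x - L2_repr w x).
  by apply: measurable_funB; [case: (L2_reprP v)|case: (L2_reprP w)].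
 by rewrite L2_norm_sq (inner_L2 e e m m); apply: eq_Rintegral => x _; rewrite expr2.
(* Squared distances below 8^-k leave room for the weights 4^k of the series G: its integral is at
   most the sum of the 2^-k, and finiteness of G at x bounds the k-th increment there by a multiple
   of 2^-k. *)
have /choice[K hK] (k : nat) : exists N, forall m n, (N <= m)%N -> (N <= n)%N ->
  `|u m - u n| ^+ 2 < 8^-1 ^+ k.
 have e0 : 0 < sqrt (8^-1 ^+ k : R) by rewrite sqrtr_gt0 exprn_gt0// invr_gt0.
 have [N hN] := uC _ e0; exists N => m n Nm Nn.
 rewrite -(@sqr_sqrtr _ (8^-1 ^+ k)); last by rewrite exprn_ge0// invr_ge0.
 by rewrite ltrXn2r ?nnegrE ?sqrtr_ge0// hN.
pose L := fix L k := if k is j.+1 then maxn (K k) (L j).+1 else K 0%N.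
have LK k : (K k <= L k)%N by case: k => // k; rewrite leq_maxl.
have Lmon k : (L k < L k.+1)%N by rewrite leq_maxr.
have Lge k : (k <= L k)%N by elim: k => // k IH; exact: leq_ltn_trans IH (Lmon k).
pose F k := L2_repr (u (L k)).
have sF k : sq_integ (F k) by exact: L2_reprP.
have dF k : (\int[mu]_x ((F k.+1 x - F k x) ^+ 2) <= 8^-1 ^+ k).
 rewrite -normB; apply/ltW/hK; last exact: LK.
 by apply: leq_trans (ltnW (Lmon k)); exact: LK.
have sdF k : sq_integ (fun x => F k.+1 x - F k x).
 have := sq_integD (sF k.+1) (sq_integZ (-1) (sF k)).
 by rewrite (_ : (fun x => _) = fun x => F k.+1 x - F k x)//; apply/funext => x; rewrite mulN1r.
pose G x := (\sum_(k <oo) (4 ^+ k * (F k.+1 x - F k x) ^+ 2)%:E)%E.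
have mG k : measurable_fun setT (fun x => (4 ^+ k * (F k.+1 x - F k x) ^+ 2)%:E).
 by apply/measurable_EFinP; apply: measurable_funM => //; exact: integ_meas (sdF k).2.
have G0 x k : (0 <= (4 ^+ k * (F k.+1 x - F k x) ^+ 2)%:E)%E.
 by rewrite lee_fin; apply: mulr_ge0; [exact: exprn_ge0|exact: sqr_ge0].
have Gfin : {ae mu, forall x, (G x < +oo)%E}.
 have Gi : (\int[mu]_x G x <= 2%:E)%E.
  rewrite integral_nneseries//.
  have cg := @cvg_geometric_eseries_half R 2 0.
  rewrite (_ : 2%:E = limn (eseries (fun k => (2 / (2 ^ (k + 1))%:R)%:E)))%E; last first.
   by apply/esym/cvg_lim => //; rewrite -[X in _ --> X%:E]divr1.
  apply: lee_nneseries => [k _ _|k _]; first by apply: integral_ge0 => x _; exact: G0.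
  rewrite -int_EFin ?lee_fin; last exact: integZ (sdF k).2.
  rewrite intZ; last exact: (sdF k).2.
  apply: (@le_trans _ _ (4 ^+ k * 8^-1 ^+ k)); first by rewrite ler_wpM2l ?exprn_ge0.
  rewrite -exprMn addn1 expnS natrM invfM mulrA divff// mul1r natrX -exprVn.
  by have -> : (4 / 8 : R) = 2^-1 by field.
 have Gint : mu.-integrable setT G.
  apply/integrableP; split; first exact: ge0_emeasurable_sum.
  under eq_integral => x _ do rewrite gee0_abs ?nneseries_ge0//.
  exact: le_lt_trans Gi (ltry _).
 have := integrable_ae measurableT Gint; apply: filterS => x /(_ I).
 by rewrite fin_numE => /andP[_]; rewrite ltey.
have Fcvg : {ae mu, forall x, cvgn (F^~ x)}.
 apply: filterS Gfin => x Gx.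
 have [C [C0 hC]] : exists C : R, 0 <= C /\ forall k, `|F k.+1 x - F k x| <= C * 2^-1 ^+ k.
  have Gf : G x \is a fin_num by rewrite ge0_fin_numE// nneseries_ge0.
  exists (sqrt (fine (G x))); split; first exact: sqrtr_ge0.
  move=> k; rewrite exprVn ler_pdivlMr ?exprn_gt0//.
  rewrite -[leLHS]ger0_norm ?mulr_ge0 ?exprn_ge0// -sqrtr_sqr ler_wsqrtr//.
  rewrite exprMn real_normK ?num_real// -exprM mulnC exprM -natrX -lee_fin fineK//.
  rewrite mulrC; have := @nneseries_lim_ge R _ xpredT 0%N k.+1 (fun i _ _ => G0 x i).
  apply: le_trans; rewrite big_mkord big_ord_recr /= leeDr//.
  by apply: sume_ge0 => i _; exact: G0.
 have /normed_cvg dc : cvgn [normed series (fun k => F k.+1 x - F k x)].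
  apply: (series_le_cvg _ _ hC) => //.
   by move=> n; rewrite mulr_ge0// exprn_ge0// invr_ge0.
  by apply: is_cvg_geometric_series; rewrite ger0_norm ?invf_lt1 ?invr_ge0// ltr1n.
 rewrite (_ : F^~ x = (fun n => F 0%N x + series (fun k => F k.+1 x - F k x) n)).
  by apply: is_cvgD => //; exact: is_cvg_cst.
 by apply/funext => n; rewrite /series /= telescope_sumr// addrC subrK.
(* A limit superior is measurable and defined everywhere; it equals the limit wherever that
   exists. *)
pose f x := fine (limn_esup (fun k => (F k x)%:E)).
have mf : measurable_fun setT f.
 apply: measurableT_comp => //; apply: measurable_fun_limn_esup => k.
 by apply/measurable_EFinP; case: (sF k).
have Ff : {ae mu, forall x, F n x @[n --> \oo] --> f x}.
 apply: filterS Fcvg => x /cvg_ex[l Fl].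
 have /cvg_limn_einf_sup[_ fl] : (F n x)%:E @[n --> \oo] --> l%:E.
  by apply: cvg_EFin => //; exact: nearW.
 by rewrite /f fl.
have fatou_u m N : (N <= m)%N -> forall e : R, 0 <= e ->
  (forall n, (N <= n)%N -> `|u n - u m| <= e) ->
  integ (fun x => (f x - L2_repr (u m) x) ^+ 2) /\
  (\int[mu]_x ((f x - L2_repr (u m) x) ^+ 2) <= e ^+ 2).
 move=> Nm e e0 h; apply: (@int_sqB_fatou (fun n => F (n + N)%N)) => //.
 - exact: L2_reprP.
 - move=> n; rewrite -normB; rewrite lerXn2r ?nnegrE//; apply: h.
  exact: leq_trans (leq_addl n N) (Lge _).
 - apply: filterS Ff => x; rewrite -(@cvg_shiftn N _ (fun n => F n x)); exact.
have sf : sq_integ f.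
 have [N hN] := uC 1 ltr01.
 have [||fi _] := fatou_u N N (leqnn N) 1 => //.
  by move=> n Nn; apply/ltW/hN.
 have su := L2_reprP (u N).
 have s1 : sq_integ (fun x => f x - L2_repr (u N) x).
  by split => //; apply: measurable_funB => //; case: su.
 have := sq_integD s1 su.
 by rewrite (_ : (fun x => _) = f)//; apply/funext => x; rewrite subrK.
exists (L2_class sf); apply/cvgrPdist_le => e e0; have [N hN] := uC e e0.
exists N => // m /= Nm; have [||_ le] := fatou_u m N Nm e => //; first exact: ltW.
 by move=> n Nn; apply/ltW/hN.
rewrite -(@ler_pXn2r _ 2%N) ?nnegrE ?(ltW e0)// normB; apply: le_trans le.
apply: le_of_eq; apply: int_ae.
- apply: measurable_funX; apply: measurable_funB; first by case: (L2_reprP (L2_class sf)).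
 by case: (L2_reprP (u m)).
- by apply: measurable_funX; apply: measurable_funB => //; case: (L2_reprP (u m)).
- by apply: filterS (L2_classE sf) => x /(_ I) ->.
Qed.

End RealIntegrals.

Section RealDominated.
Context d (T : measurableType d) (R : realType) (mu : {measure set T -> \bar R}).

Lemma int_dominated (F : nat -> T -> R) (f g : T -> R) :
 (forall n, measurable_fun setT (F n)) -> measurable_fun setT f ->
 integ mu g -> (forall n x, `|F n x| <= g x) ->
 {ae mu, forall x, F n x @[n --> \oo] --> f x} ->
 integ mu f /\ (\int[mu]_x F n x) @[n --> \oo] --> (\int[mu]_x f x).
Proof.
move=> mF mf gi Fg Ff.
have mFE n : measurable_fun setT (fun x => (F n x)%:E) by exact/measurable_EFinP.
have mfE : measurable_fun setT (EFin \o f) by exact/measurable_EFinP.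
have cE : {ae mu, forall x, setT x -> (F n x)%:E @[n --> \oo] --> (EFin \o f) x}.
 by apply: filterS Ff => x Fx _; apply: cvg_EFin => //; exact: nearW.
have bE : {ae mu, forall x n, setT x -> (`|(F n x)%:E| <= (EFin \o g) x)%E}.
 by apply: aeW => x n _; rewrite /= lee_fin.
have [i1 _ c] := dominated_convergence measurableT mFE mfE cE gi bE.
split; first exact: i1.
have iF n : integ mu (F n) by exact: integ_le (mF n) (Fg n) gi.
have h : (\int[mu]_x F n x)%R%:E @[n --> \oo] --> (\int[mu]_x f x)%R%:E.
 rewrite int_EFin//; apply: cvg_trans c; apply: near_eq_cvg.
 by apply: nearW => n; rewrite /= int_EFin.
by move/fine_cvgP: h => [_].
Qed.

End RealDominated.

Lemma cvg0_eq0 (R : realType) (l : R) : (fun=> 0 : R) @ \oo --> l -> l = 0.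
Proof. by move=> h; apply/esym; exact: (cvg_unique (@norm_hausdorff _ _) (cvg_cst _) h). Qed.

Lemma sqr_mono (R : realDomainType) (a b : R) : 0 <= a -> a <= b -> a ^+ 2 <= b ^+ 2.
Proof. by move=> a0 ab; rewrite ler_sqr ?nnegrE// (le_trans a0). Qed.

Lemma sqr_lt (R : realDomainType) (a b : R) : 0 <= a -> a < b -> a ^+ 2 < b ^+ 2.
Proof. by move=> a0 ab; rewrite ltr_sqr ?nnegrE// (le_trans a0)// ltW. Qed.

(** * Integral inequalities and a criterion for total boundedness *)

Section IntCauchySchwarz.
Context d (T : measurableType d) (R : realType) (mu : {measure set T -> \bar R}).

Lemma int_cauchy_schwarz (f g : T -> R) : sq_integ mu f -> sq_integ mu g ->
 ((\int[mu]_x (f x * g x)) ^+ 2 <= (\int[mu]_x (f x ^+ 2)) * (\int[mu]_x (g x ^+ 2))).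
Proof.
move=> sf sg; have H := hilbert_L2 mu.
have e (a b : T -> R) (sa : sq_integ mu a) (sb : sq_integ mu b) :
  inner mu (L2_class sa) (L2_class sb) = (\int[mu]_x (a x * b x)).
 by apply: inner_L2; [exact: L2_classE|exact: L2_classE|case: sa|case: sb].
have := sqr_mono (normr_ge0 _) (cauchy_schwarz H (L2_class sf) (L2_class sg)).
by rewrite exprMn !L2_norm_sq !e real_normK ?num_real//; move/le_trans; apply.
Qed.

Lemma int_sqD_le (f g : T -> R) : sq_integ mu f -> sq_integ mu g ->
 ((\int[mu]_x ((f x + g x) ^+ 2)) <=
  2 * (\int[mu]_x (f x ^+ 2)) + 2 * (\int[mu]_x (g x ^+ 2))).
Proof.
move=> sf sg; have [_ f2] := sf; have [_ g2] := sg; have [_ fg2] := sq_integD sf sg.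
rewrite -intZ// -intZ// -intD; [|exact: integZ..].
apply: int_le => //; first by apply: integD; exact: integZ.
by move=> x; have := sqr_ge0 (f x - g x); rewrite sqrrB sqrrD; lra.
Qed.

End IntCauchySchwarz.

Lemma cvg0_eps (R : realType) (u : nat -> R) :
 (forall e : R, 0 < e -> \forall n \near \oo, `|u n| <= e) -> u @ \oo --> (0 : R).
Proof. by move=> h; apply/cvgr0Pnorm_le => e e0; exact: h. Qed.

Lemma integM_bounded d (T : measurableType d) (R : realType) (mu : {measure set T -> \bar R})
  (v h : T -> R) (C : R) : measurable_fun setT h ->
 (forall x, `|h x| <= C) -> integ mu v -> integ mu (fun x => v x * h x).
Proof.
move=> mh hC iv; apply: (@integ_le _ _ _ mu _ (fun x => C * `|v x|)); last exact/integZ/integ_norm.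
 by apply: measurable_funM => //; exact: integ_meas iv.
by move=> x; rewrite normrM mulrC ler_wpM2r.
Qed.

(** Here g is the indicator of a set of measure h. The first term on the right is the contribution
    of the mean of f, and the oscillation bounds the variance: (f x - f y)^2 <= D is integrated
    first in y, then in x. *)
Lemma osc_poincare d (T : measurableType d) (R : realType) (mu : {measure set T -> \bar R})
  (f g : T -> R) (h D : R) : 0 < h -> integ mu g -> (\int[mu]_x g x = h) ->
 (forall x, g x = 0 \/ g x = 1) ->
 integ mu (fun x => f x * g x) -> integ mu (fun x => f x ^+ 2 * g x) ->
 (forall x y, g x = 1 -> g y = 1 -> (f x - f y) ^+ 2 <= D) ->
 (\int[mu]_x (f x ^+ 2 * g x) <= h^-1 * (\int[mu]_x (f x * g x)) ^+ 2 + h * D).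
Proof.
move=> h0 ig eg g01 i1 i2 hD.
set A := (\int[mu]_x (f x ^+ 2 * g x)); set B := (\int[mu]_x (f x * g x)).
have D0 : 0 <= h * D.
 rewrite -eg mulrC -intZ//; apply: int_ge0 => x.
 have [->|gx] := g01 x; first by rewrite mulr0.
 by rewrite gx mulr1; apply: le_trans (hD x x gx gx); rewrite subrr expr0n.
have step x : g x = 1 -> f x ^+ 2 * h - 2 * f x * B + A <= D * h.
 move=> gx; rewrite -eg -!intZ// -intB; [|exact: integZ..].
 rewrite -intD//; last by apply: integB; exact: integZ.
 apply: int_le; [|exact: integZ|].
  by apply: integD => //; apply: integB; exact: integZ.
 move=> y; have [->|gy] := g01 y; first by rewrite !mulr0 subrr addr0.
 by rewrite gy !mulr1; apply: le_trans (hD x y gx gy); rewrite sqrrB; nra.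
have : (\int[mu]_x (h * (f x ^+ 2 * g x) - (2 * B) * (f x * g x) + A * g x)) <= (\int[mu]_x (D * h * g x)).
 apply: int_le; [|exact: integZ|].
  by apply: integD; [apply: integB|]; exact: integZ.
 move=> x; have [->|gx] := g01 x; first by rewrite !mulr0 subrr addr0.
 by rewrite gx !mulr1; have := step x gx; lra.
rewrite intD ?intB ?intZ//; try (by apply: integZ); last by apply: integB; exact: integZ.
rewrite eg => H.
have H2 : h * A <= B ^+ 2 + h * (h * D).
 have := mulr_ge0 (ltW h0) D0; move: H; rewrite -/A -/B; nra.
have -> : h^-1 * B ^+ 2 + h * D = h^-1 * (B ^+ 2 + h * (h * D)).
 by rewrite mulrDr (mulrA h^-1 h) mulVf ?gt_eqF// mul1r.
by rewrite ler_pdivlMl.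
Qed.

Lemma cell_arith (R : realFieldType) (h P M X G I : R) : 0 < h -> I <= h^-1 * P + h ^+ 2 * X ->
 P <= h^-1 * M + h * (h * (h * G)) -> I <= (h ^+ 2)^-1 * M + h ^+ 2 * (X + G).
Proof.
move=> h0 H1 H2; apply: le_trans H1 _.
have -> : (h ^+ 2)^-1 * M + h ^+ 2 * (X + G) = h^-1 * (h^-1 * M + h * (h * (h * G))) + h ^+ 2 * X.
 by field; rewrite gt_eqF.
by rewrite lerD2r ler_wpM2l// invr_ge0 ltW.
Qed.

(** The values of the N functionals on S fill at most a cube of side 2 B. Cutting it into boxes of
    side d and choosing one point of S in each box that is met gives a finite net. *)
Lemma totally_bounded_functionals (R : realType) (V : normedModType R) (S : set V) :
 (forall e : R, 0 < e -> exists (N : nat) (l : 'I_N -> V -> R) (B d : R), [/\ 0 < d,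
  forall k u, S u -> `|l k u| <= B &
  forall u v, S u -> S v -> (forall k, `|l k u - l k v| <= d) -> `|u - v| < e]) ->
 totally_bounded S.
Proof.
move=> H e e0; have [N [l [B [d [d0 lB lS]]]]] := H e e0.
have [m hm] : exists m : nat, 2 * B / d < m%:R.
 by exists (Num.truncn (2 * B / d)).+1; exact: truncnS_gt.
pose cl (k : 'I_N) (j : 'I_m.+1) u := - B + j%:R * d <= l k u <= - B + j%:R * d + d.
have clP k u : S u -> exists j : 'I_m.+1, cl k j u.
 move=> Su; have := lB k u Su; rewrite ler_norml => /andP[b1 b2].
 pose t := (l k u + B) / d.
 have t0 : 0 <= t by apply: divr_ge0; [lra|exact: ltW].
 have /andP[t1 t2] := truncn_itv t0.
 have jm : (Num.truncn t < m.+1)%N.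
  rewrite ltnS -(@ler_nat R); apply: le_trans t1 _; apply: le_trans (ltW hm).
  by rewrite ler_pM2r ?invr_gt0//; lra.
 exists (Ordinal jm); rewrite /cl /=; move: t1 t2; rewrite ler_pdivlMr// ltr_pdivrMr// -natr1.
 by rewrite mulrDl mul1r => ? ?; apply/andP; split; lra.
pose cell_of (f : {ffun 'I_N -> 'I_m.+1}) : set V := [set u | S u /\ forall k, cl k (f k) u].
exists [seq xget 0 (cell_of f) | f <- enum {ffun 'I_N -> 'I_m.+1}] => u Su.
have [f0 hf0] := choice (fun k => clP k u Su).
pose f := [ffun k => f0 k].
have fu : cell_of f u by split => // k; rewrite ffunE.
exists (xget 0 (cell_of f)); first by apply: map_f; rewrite mem_enum.
have [Sx hx] := @xgetPex _ 0 (cell_of f) (ex_intro _ u fu).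
apply: lS => // k; have := hx k; have [_ /(_ k)] := fu.
by rewrite /cl ler_norml => /andP[? ?] /andP[? ?]; apply/andP; split; lra.
Qed.

Lemma sum_ord2 (V : nmodType) (F : 'I_2 -> V) : \sum_i F i = F ord0 + F ord_max.
Proof. by rewrite big_ord_recl big_ord1; congr (_ + F _); exact: val_inj. Qed.

(** * Limits of bilinear integrals and algebra for the energy inequality *)

Section SquareLimits.
Context d (X : measurableType d) (R : realType) (mu : {measure set X -> \bar R}).
Implicit Types (f g b : X -> R) (p q : nat -> X -> R).

Lemma int_sq_ge0 f : (0 <= \int[mu]_x (f x ^+ 2)).
Proof. by apply: int_ge0 => x; exact: sqr_ge0. Qed.

Lemma int_bilinear_le f g b (B : R) : measurable_fun setT b -> (forall x, `|b x| <= B) ->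
 sq_integ mu f -> sq_integ mu g ->
 ((\int[mu]_x (b x * f x * g x)) ^+ 2 <= B ^+ 2 * (\int[mu]_x (f x ^+ 2)) * (\int[mu]_x (g x ^+ 2))).
Proof.
move=> mb hb sf sg; have sbf := sq_integM_bounded mb hb sf.
apply: le_trans (int_cauchy_schwarz sbf sg) _.
rewrite ler_wpM2r ?int_sq_ge0// -intZ; last exact: sf.2.
apply: int_le; [exact: sbf.2|exact: integZ sf.2|] => x.
rewrite exprMn ler_wpM2r ?sqr_ge0// -real_normK ?num_real//; exact: sqr_mono.
Qed.

Lemma int_bilinear_cvg0 p q b (B D : R) : measurable_fun setT b -> (forall x, `|b x| <= B) ->
 (forall n, sq_integ mu (p n)) -> (forall n, sq_integ mu (q n)) ->
 (\int[mu]_x (p n x ^+ 2)) @[n --> \oo] --> (0 : R) ->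
 (\forall n \near \oo, (\int[mu]_x (q n x ^+ 2) <= D)) ->
 (\int[mu]_x (b x * p n x * q n x)) @[n --> \oo] --> (0 : R).
Proof.
move=> mb hb sp sq cp qD; apply: cvg0_eps => e e0.
pose k := B ^+ 2 * `|D| + 1.
have k0 : 0 < k by rewrite ltr_wpDl// mulr_ge0// sqr_ge0.
have ek : 0 < e ^+ 2 / k by rewrite divr_gt0// exprn_gt0.
have /(cvgr0_norm_lt _)/(_ _ ek) := cp; move=> h; near=> n.
have h1 : `|\int[mu]_x (p n x ^+ 2)| < e ^+ 2 / k by near: n.
have h2 : (\int[mu]_x (q n x ^+ 2) <= D) by near: n.
rewrite -(ler_pXn2r (_ : 0 < 2)%N) ?nnegrE//; last exact: ltW.
rewrite real_normK ?num_real//; apply: le_trans (int_bilinear_le mb hb (sp n) (sq n)) _.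
have {}h1 : (\int[mu]_x (p n x ^+ 2)) * k <= e ^+ 2.
 by rewrite -ler_pdivlMr//; apply: le_trans (ltW h1); exact: ler_norm.
apply: le_trans h1; rewrite -mulrA mulrC -mulrA ler_wpM2l ?int_sq_ge0//.
rewrite mulrC; apply: (@le_trans _ _ (B ^+ 2 * `|D|)); last by rewrite lerDl.
rewrite ler_wpM2l ?sqr_ge0//; apply: le_trans h2 _; exact: ler_norm.
Unshelve. all: by end_near. Qed.

Lemma int_bilinear_cvg p q f g b (B : R) : measurable_fun setT b -> (forall x, `|b x| <= B) ->
 (forall n, sq_integ mu (p n)) -> (forall n, sq_integ mu (q n)) -> sq_integ mu f -> sq_integ mu g ->
 (\int[mu]_x ((p n x - f x) ^+ 2)) @[n --> \oo] --> (0 : R) ->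
 (\int[mu]_x ((q n x - g x) ^+ 2)) @[n --> \oo] --> (0 : R) ->
 (\int[mu]_x (b x * p n x * q n x)) @[n --> \oo] --> (\int[mu]_x (b x * f x * g x)).
Proof.
move=> mb hb sp sq sf sg cp cq.
have subP (u w : X -> R) : sq_integ mu u -> sq_integ mu w -> sq_integ mu (fun x => u x - w x).
 move=> su sw; have := sq_integD su (sq_integZ (-1) sw).
 by under eq_fun do rewrite mulN1r.
have dp n := subP _ _ (sp n) sf; have dq n := subP _ _ (sq n) sg.
have ii u w : sq_integ mu u -> sq_integ mu w -> integ mu (fun x => b x * u x * w x).
 by move=> su sw; exact: (sq_integM (sq_integM_bounded mb hb su) sw).
have c1 : (\int[mu]_x (b x * (p n x - f x) * g x)) @[n --> \oo] --> (0 : R).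
 apply: (@int_bilinear_cvg0 _ (fun=> g) _ B (\int[mu]_x (g x ^+ 2)) mb hb dp (fun=> sg) cp); exact: nearW.
have c2 : (\int[mu]_x (b x * (q n x - g x) * f x)) @[n --> \oo] --> (0 : R).
 apply: (@int_bilinear_cvg0 _ (fun=> f) _ B (\int[mu]_x (f x ^+ 2)) mb hb dq (fun=> sf) cq); exact: nearW.
have q1 : \forall n \near \oo, (\int[mu]_x ((q n x - g x) ^+ 2) <= 1).
 have := cvgr_le _ cq _ ltr01; exact.
have c3 := int_bilinear_cvg0 mb hb dp dq cp q1.
set I := (\int[mu]_x (b x * f x * g x)).
have -> : I = I + (0 + 0) + 0 by rewrite !addr0.
rewrite (_ : (fun n => _) = (fun n => I + ((\int[mu]_x (b x * (p n x - f x) * g x)) +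
 (\int[mu]_x (b x * (q n x - g x) * f x))) + (\int[mu]_x (b x * (p n x - f x) * (q n x - g x))))).
 by apply: cvgD => //; apply: cvgD; [exact: cvg_cst|exact: cvgD].
apply/funext => n; transitivity (\int[mu]_x (b x * f x * g x + (b x * (p n x - f x) * g x + b x * (q n x - g x) * f x) +
 b x * (p n x - f x) * (q n x - g x))); first by apply: eq_Rintegral => x _; ring.
have i1 := ii _ _ sf sg; have i2 := ii _ _ (dp n) sg; have i3 := ii _ _ (dq n) sf; have i4 := ii _ _ (dp n) (dq n).
rewrite intD//; last by apply: integD => //; exact: integD.
by rewrite (intD i1) ?(intD i2)//; exact: integD.
Qed.

End SquareLimits.

Lemma cvg_ge0 (R : realType) (s : nat -> R) (l : R) n0 : (forall n, (n0 <= n)%N -> 0 <= s n) ->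
 s @ \oo --> l -> 0 <= l.
Proof.
move=> h c; rewrite -(cvg_lim _ c)//; apply: limr_ge; first by apply/cvg_ex; exists l.
by near=> n; apply: h; near: n; exact: nbhs_infty_ge.
Unshelve. all: by end_near. Qed.

Lemma young (R : realFieldType) (x z d : R) : 0 < d -> x * z <= d * x ^+ 2 + (4 * d)^-1 * z ^+ 2.
Proof.
move=> d0; rewrite -subr_ge0.
have -> : d * x ^+ 2 + (4 * d)^-1 * z ^+ 2 - x * z = d * (x - (2 * d)^-1 * z) ^+ 2.
 by field; rewrite gt_eqF.
by rewrite mulr_ge0 ?sqr_ge0// ltW.
Qed.

Lemma cvg0_sum2 (R : realType) (s : nat -> 'I_2 -> R) : (forall i, s n i @[n --> \oo] --> (0 : R)) ->
 \sum_i s n i @[n --> \oo] --> (0 : R).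
Proof.
move=> h; rewrite (_ : (fun n => _) = (fun n => s n ord0 + s n ord_max)); last first.
 by apply/funext => n; exact: sum_ord2.
by rewrite -[X in _ --> X]addr0; exact: cvgD.
Qed.

(** The integrand obtained when an equation in divergence form is tested against F^2 w. With p the
    differential of F w, the cross terms combine by symmetry of al into |d(F w)|^2 - |dF|^2 w^2, and
    Q collects the mollification error. *)
Lemma quad_product (R : comNzRingType) (al Q : 'I_2 -> 'I_2 -> R) (dF dw p : 'I_2 -> R) (F w : R) :
 al ord_max ord0 = al ord0 ord_max -> (forall i, p i = dF i * w + F * dw i) ->
 \sum_i (F * p i + F * w * dF i) * (\sum_j (al i j * dw j - Q i j)) =
 (\sum_i \sum_j al i j * p i * p j) - (\sum_i \sum_j al i j * dF i * dF j) * w * w -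
 \sum_i \sum_j (F * p i + F * w * dF i) * Q i j.
Proof. by move=> e hp; rewrite !sum_ord2 e !hp; ring. Qed.

Lemma quad_sum (R : comNzRingType) (p : 'I_2 -> R) (Q : 'I_2 -> 'I_2 -> R) (A B K : R) :
 \sum_i \sum_j (A * p i + B + K * Q i j) = 2 * A * (\sum_i p i) + 4 * B + K * (\sum_i \sum_j Q i j).
Proof. by rewrite !sum_ord2; ring. Qed.

(** If the energy inequality failed by gap > 0, this choice of del would keep the error terms below
    gap / 2. *)
Lemma absorb_arith (R : realFieldType) (I1 I3 I4 J del gap aI1 : R) : gap = I1 + J - I3 -> 0 < gap -> 0 < del ->
 del * (gap + aI1 + I4) = gap / 2 -> I1 <= aI1 -> 0 <= I3 + del * I4 - ((1 - del) * I1 + J) -> False.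
Proof.
move=> e g0 d0; rewrite !mulrDr mulrBl mul1r => e2 le h.
have h1 : del * I1 <= del * aI1 by rewrite ler_wpM2l// ltW.
have dg : 0 < del * gap by rewrite mulr_gt0.
lra.
Qed.

Section Plane.
Context (R : realType).
Local Notation pt := (R * R)%type.
Local Notation mT := (measurableTypeR R).
Local Notation mpt := (mT * mT)%type.
Local Notation Leb := (lebesgue2 R).
Local Notation mfT := (measurable_fun [set: mT]).
Local Notation mfP := (measurable_fun [set: mpt]).
Local Notation bv := (basis_vec R).
Local Notation lam := (@lebesgue_measure R).

(** * Smooth functions on the plane *)

Section SmoothCalculus.
Implicit Types (U V : set pt) (f g h : pt -> R) (x : pt) (i : 'I_2).

Definition has_partials U f := forall x, U x ->
 {for x, continuous f} /\ forall i, derivable f x (bv i).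

Lemma near_eq_open U f g x : open U -> {in U, f =1 g} -> U x -> \near x, f x = g x.
Proof.
move=> oU fg Ux; apply: filterS (open_nbhs_nbhs (conj oU Ux)) => y Uy; apply: fg.
exact: mem_set.
Qed.

Lemma partial_eq U f g i : open U -> {in U, f =1 g} -> {in U, partial i f =1 partial i g}.
Proof. by move=> oU fg y /set_mem Uy; apply: near_eq_derive; exact: near_eq_open Uy. Qed.

Lemma iter_partial_eq U s f g : open U -> {in U, f =1 g} ->
 {in U, iter_partial s f =1 iter_partial s g}.
Proof.
move=> oU; elim: s f g => //= i s IH f g fg; apply: IH; exact: partial_eq.
Qed.

Lemma has_partials_eq U f g : open U -> {in U, f =1 g} -> has_partials U f -> has_partials U g.
Proof.
move=> oU fg hf x Ux; have [cf df] := hf x Ux; split.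
 rewrite /prop_for /continuous_at -(fg _ (mem_set Ux)); apply: cvg_trans cf.
 apply: near_eq_cvg; exact: near_eq_open Ux.
move=> i; apply: near_eq_derivable (df i); exact: near_eq_open Ux.
Qed.

Lemma smooth_on_eq U f g : open U -> {in U, f =1 g} -> smooth_on U f -> smooth_on U g.
Proof.
move=> oU fg sf s x Ux.
apply: (@has_partials_eq U (iter_partial s f)) => //; first exact: iter_partial_eq.
by move=> y Uy; exact: sf.
Qed.

Lemma smooth_on_sub U V f : V `<=` U -> smooth_on U f -> smooth_on V f.
Proof. by move=> VU sf s x /VU; exact: sf. Qed.

Lemma smooth_partials U f : smooth_on U f -> has_partials U f.
Proof. by move=> sf x; exact: (sf [::]). Qed.

Lemma smooth_on_partial U f i : smooth_on U f -> smooth_on U (partial i f).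
Proof. by move=> sf s; exact: sf (i :: s). Qed.

Lemma smooth_on_local U f :
 (forall x, U x -> exists V, [/\ V x, open V & smooth_on V f]) -> smooth_on U f.
Proof. by move=> h s x /h[V [Vx _ sf]]; exact: sf. Qed.

(* A family of functions each of whose members is continuous with first partials
  that agree with members of the family consists of smooth functions. *)
Lemma smooth_coind U (P : set (pt -> R)) : open U ->
 (forall f, P f -> has_partials U f) ->
 (forall f i, P f -> exists2 g, P g & {in U, partial i f =1 g}) ->
 forall f, P f -> smooth_on U f.
Proof.
move=> oU hP dP f Pf s.
suff [g Pg fg] : exists2 g, P g & {in U, iter_partial s f =1 g}.
 move=> x Ux; apply: (@has_partials_eq U g) => //; last exact: hP.
 by move=> y Uy; rewrite fg.
elim: s f Pf => [|i s IH] f Pf; first by exists f.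
have [g Pg fg] := dP f i Pf; have [k Pk gk] := IH g Pg.
exists k => // y Uy; rewrite -gk//=; exact: (@iter_partial_eq U).
Qed.

(** Turns a directional derivative into a derivative in one real variable, to which the
    one-dimensional chain rule applies. *)
Lemma derive_line (V W : normedModType R) (f : V -> W) (x v : V) :
 'D_v f x = 'D_1 (fun h : R => f (h *: v + x)) 0.
Proof.
rewrite /derive; set g1 := fun h : R => h^-1 *: _; set g2 := fun h : R => h^-1 *: _.
suff -> : g1 = g2 by [].
apply/funext => h; rewrite /g2 /=; congr (_ *: (f (_ + _) - f _)).
 by rewrite addr0; congr (_ *: _); rewrite -[RHS]/(h * 1) mulr1.
by rewrite scale0r add0r.
Qed.

Lemma is_derive_comp1 (V : normedModType R) (phi : R -> R) (dphi : R) (f : V -> R) (x v : V) : is_derive (f x) 1 phi dphi ->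
 derivable f x v -> is_derive x v (fun y => phi (f y)) (dphi * 'D_v f x).
Proof.
move=> [dp ep] df; have d1 := proj1 (derivable1P f x v) df.
have fx : f (0 *: v + x) = f x by rewrite scale0r add0r.
have dp' : derivable phi (f (0 *: v + x)) 1 by rewrite fx; exact: dp.
split.
 apply/derivable1P/derivable1_diffP.
 apply: (@differentiable_comp _ _ _ _ (fun h : R => f (h *: v + x)) phi).
  exact: (proj1 (derivable1_diffP _ _) d1).
 exact: (proj1 (derivable1_diffP _ _) dp').
rewrite derive_line -derive1E.
rewrite (derive1_comp d1 dp') !derive1E fx ep.
by rewrite -derive_line.
Qed.

Lemma partialD i f g x : derivable f x (bv i) -> derivable g x (bv i) ->
 partial i (fun y => f y + g y) x = partial i f x + partial i g x.
Proof. by move=> df dg; rewrite /partial deriveD. Qed.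

Lemma partialB i f g x : derivable f x (bv i) -> derivable g x (bv i) ->
 partial i (fun y => f y - g y) x = partial i f x - partial i g x.
Proof. by move=> df dg; rewrite /partial deriveB. Qed.

Lemma partialM i f g x : derivable f x (bv i) -> derivable g x (bv i) ->
 partial i (fun y => f y * g y) x = partial i f x * g x + f x * partial i g x.
Proof.
move=> df dg; rewrite /partial (deriveM df dg).
by rewrite addrC [X in X + _]mulrC.
Qed.

Lemma partialZ i (a : R) f x : derivable f x (bv i) ->
 partial i (fun y => a * f y) x = a * partial i f x.
Proof. by move=> df; apply: deriveZ. Qed.

Lemma partial_cst i (a : R) x : partial i (fun=> a) x = 0.
Proof. exact: derive_cst. Qed.

Lemma has_partialsD U f g : has_partials U f -> has_partials U g ->
 has_partials U (fun x => f x + g x).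
Proof.
move=> hf hg x Ux; have [cf df] := hf x Ux; have [cg dg] := hg x Ux.
split=> [|i]; [exact: (continuousD cf cg)|exact: (derivableD (df i) (dg i))].
Qed.

Lemma has_partialsM U f g : has_partials U f -> has_partials U g ->
 has_partials U (fun x => f x * g x).
Proof.
move=> hf hg x Ux; have [cf df] := hf x Ux; have [cg dg] := hg x Ux.
split=> [|i]; [exact: (continuousM cf cg)|exact: (derivableM (df i) (dg i))].
Qed.

Lemma smooth_cst U (a : R) : smooth_on U (fun=> a).
Proof. exact: smooth_on_cst. Qed.

Lemma smoothD U f g : open U -> smooth_on U f -> smooth_on U g ->
 smooth_on U (fun x => f x + g x).
Proof. by move=> oU sf sg; exact: smooth_onD. Qed.

Lemma smoothM U f g : open U -> smooth_on U f -> smooth_on U g ->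
 smooth_on U (fun x => f x * g x).
Proof. by move=> oU sf sg; exact: smooth_onM. Qed.

Lemma smoothZ U a f : open U -> smooth_on U f -> smooth_on U (fun x => a * f x).
Proof. by move=> oU sf; exact: (smoothM oU (@smooth_cst U a) sf). Qed.

Lemma smoothN U f : open U -> smooth_on U f -> smooth_on U (fun x => - f x).
Proof.
move=> oU sf; apply: (smooth_on_eq oU _ (smoothZ (-1) oU sf)) => x _.
by rewrite mulN1r.
Qed.

Lemma smoothB U f g : open U -> smooth_on U f -> smooth_on U g ->
 smooth_on U (fun x => f x - g x).
Proof. by move=> oU sf sg; exact: (smoothD oU sf (smoothN oU sg)). Qed.

Lemma smooth_sum U (I : Type) (s : seq I) (F : I -> pt -> R) : open U ->
 (forall j, smooth_on U (F j)) -> smooth_on U (fun x => \sum_(j <- s) F j x).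
Proof.
move=> oU sF; elim: s => [|j s IH].
 by rewrite (_ : (fun x => _) = fun=> 0); [exact: smooth_cst|apply/funext => x; rewrite big_nil].
rewrite (_ : (fun x => _) = fun x => F j x + \sum_(k <- s) F k x); first exact: (smoothD oU (sF j) IH).
by apply/funext => x; rewrite big_cons.
Qed.

Inductive smooth_span U (Q : set (pt -> R)) : (pt -> R) -> Prop :=
| SpanGen a q : smooth_on U a -> Q q -> smooth_span U Q (fun x => a x * q x)
| SpanAdd f g : smooth_span U Q f -> smooth_span U Q g ->
  smooth_span U Q (fun x => f x + g x).

(** If the partials of the generators stay in the module over the smooth functions, Leibniz's rule
    makes the whole module stable under partials, and [smooth_coind] applies. Each use amounts to
    naming generators: the powers of 1/f, the square root of f, the iterated partials of h evaluated
    along a map. *)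
Lemma smooth_module U (Q : set (pt -> R)) : open U ->
 (forall q, Q q -> has_partials U q) ->
 (forall q i, Q q -> exists2 g, smooth_span U Q g & {in U, partial i q =1 g}) ->
 forall q, Q q -> smooth_on U q.
Proof.
move=> oU hQ dQ q Qq.
have hS f : smooth_span U Q f -> has_partials U f.
 elim=> [a p sa Qp|f1 f2 _ h1 _ h2]; last exact: has_partialsD.
 apply: has_partialsM; [exact: smooth_partials|exact: hQ].
have sM a f : smooth_on U a -> smooth_span U Q f ->
  exists2 g, smooth_span U Q g & {in U, forall x, a x * f x = g x}.
 move=> sa; elim=> [b p sb Qp|f1 f2 _ [g1 S1 e1] _ [g2 S2 e2]].
  exists (fun x => (a x * b x) * p x); last by move=> x _; rewrite mulrA.
  exact: (SpanGen (smoothM oU sa sb) Qp).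
 exists (fun x => g1 x + g2 x); first exact: SpanAdd.
 by move=> x Ux; rewrite mulrDr e1// e2.
have S1 := SpanGen (@smooth_cst U 1) Qq.
apply: (@smooth_on_eq U (fun x => 1 * q x)) => //.
 by move=> x _; rewrite mul1r.
apply: (@smooth_coind U (smooth_span U Q)) => // f i.
elim=> [a p sa Qp|f1 f2 S1' [g1 G1 e1] S2' [g2 G2 e2]].
 have [g Sg pg] := dQ p i Qp; have [k Sk gk] := sM a g sa Sg.
 exists (fun x => partial i a x * p x + k x).
  exact: (SpanAdd (SpanGen (smooth_on_partial i sa) Qp) Sk).
 move=> x Ux; have Ux' := set_mem Ux.
 have [_ da] := smooth_partials sa Ux'; have [_ dp] := hQ p Qp x Ux'.
 by rewrite (partialM (da i) (dp i)) (pg x Ux) (gk x Ux).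
exists (fun x => g1 x + g2 x); first exact: SpanAdd.
move=> x Ux; have Ux' := set_mem Ux.
have [_ d1] := hS f1 S1' x Ux'; have [_ d2] := hS f2 S2' x Ux'.
by rewrite (partialD (d1 i) (d2 i)) (e1 x Ux) e2.
Qed.

Lemma smoothV U f : open U -> (forall x, U x -> f x != 0) -> smooth_on U f ->
 smooth_on U (fun x => (f x)^-1).
Proof.
move=> oU f0 sf.
pose Q : set _ := [set q | exists n, q = fun x => (f x)^-1 ^+ n].
have hV : has_partials U (fun x => (f x)^-1).
 move=> x Ux; have [cf df] := smooth_partials sf Ux; have fx := f0 x Ux.
 by split=> [|i]; [exact: cvgV|exact: derivableV].
have hn n : has_partials U (fun x => (f x)^-1 ^+ n).
 elim: n => [|n IH].
  rewrite (_ : (fun x => _) = fun=> 1); last by apply/funext => x; rewrite expr0.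
  exact/smooth_partials/smooth_cst.
 rewrite (_ : (fun x => _) = fun x => (f x)^-1 * (f x)^-1 ^+ n).
  exact: has_partialsM.
 by apply/funext => x; rewrite exprS.
have Q1 : Q (fun x => (f x)^-1) by exists 1%N; apply/funext => x; rewrite expr1.
apply: (smooth_module oU _ _ Q1) => [_ [n ->]|_ i [n ->]]; first exact: hn.
exists (fun x => (- n%:R * partial i f x) * (f x)^-1 ^+ n.+1).
 apply: SpanGen; last by exists n.+1.
 exact: (smoothZ _ oU (smooth_on_partial i sf)).
move=> x /set_mem Ux; have fx := f0 x Ux; have [cf df] := smooth_partials sf Ux.
elim: n => [|n IH].
 rewrite (_ : (fun x => _) = fun=> 1)//.
 by rewrite partial_cst oppr0 !mul0r.
rewrite (_ : (fun x => _) = fun x => (f x)^-1 * (f x)^-1 ^+ n); last first.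
 by apply/funext => y; rewrite exprS.
have [_ d1] := hV x Ux; have [_ d2] := hn n x Ux.
rewrite (partialM (d1 i) (d2 i)) IH /partial (deriveV fx (df i)).
rewrite -[X in X * _ + _]/(- _ ^- 2 * partial i f x) -/(partial i f x) !exprSr.
by field.
Qed.

(** The single generator sqrt f suffices, its partials being f' / (2 f) times itself. *)
Lemma smooth_sqrt U f : open U -> (forall x, U x -> 0 < f x) -> smooth_on U f ->
 smooth_on U (fun x => sqrt (f x)).
Proof.
move=> oU f0 sf.
have dS x : U x -> forall i, is_derive x (bv i) (fun x => sqrt (f x))
  ((2 * sqrt (f x))^-1 * partial i f x).
 move=> Ux i; have fx := f0 x Ux; have [_ df] := smooth_partials sf Ux.
 by apply: is_derive_comp1; [exact: is_derive1_sqrt|exact: df].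
pose Q : set (pt -> R) := [set fun x => sqrt (f x)].
apply: (smooth_module oU (Q := Q)) => //.
 move=> _ -> x Ux; have [cf _] := smooth_partials sf Ux; split.
  by apply: (@continuous_comp _ _ _ f sqrt) => //; exact: sqrt_continuous.
 by move=> i; have [] := dS x Ux i.
move=> _ i ->.
exists (fun x => (partial i f x * (2 * f x)^-1) * sqrt (f x)).
 have s2 : smooth_on U (fun x => (2 * f x)^-1).
  apply: (smoothV oU _ (smoothZ 2 oU sf)) => x /f0 fx.
  by rewrite gt_eqF// mulr_gt0.
 by apply: SpanGen; first exact: (smoothM oU (smooth_on_partial i sf) s2).
move=> x /set_mem Ux; have fx := f0 x Ux; rewrite /partial.
have [_ ->] := dS x Ux i; rewrite /partial.
have s0 : sqrt (f x) != 0 by rewrite sqrtr_eq0 -ltNge.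
move: (sqr_sqrtr (ltW fx)) s0; set s := sqrt _; set D := 'D_ _ _ _.
by move: s D => s D <- s0; field.
Qed.

(** The segment is parametrised by [0, 1], so that k may have either sign. *)
Lemma partial_mvt i f x (k : R) :
 (forall t : R, 0 <= t <= 1 -> derivable f (x + (t * k) *: bv i) (bv i)) ->
 exists2 t : R, 0 <= t <= 1 & f (x + k *: bv i) - f x =
  k * partial i f (x + (t * k) *: bv i).
Proof.
move=> df; pose v := bv i; pose F (t : R) := f (x + (t * k) *: v).
have dF (t : R) : 0 <= t <= 1 -> is_derive t (1 : R) F (k * partial i f (x + (t * k) *: v)).
 move=> t01; have d0 := df t t01.
 pose g s := f (s *: v + (x + t * k *: v)).
 have dg : is_derive (0 : R) (1 : R) g (partial i f (x + (t * k) *: v)).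
  split; first exact: (proj1 (derivable1P f _ _) d0).
  exact: (esym (derive_line f _ v)).
 have Fg : F = (fun s => g ((s - t) * k)).
  apply/funext => s; rewrite /F /g; congr f.
  by rewrite addrCA -scalerDl mulrBl subrK.
 have lin : is_derive t (1 : R) (fun s : R => (s - t) * k) k.
  have h1 : is_derive t (1 : R) (fun s : R => s - t) (1 - 0) by apply: is_deriveB.
  have := is_deriveM h1 (is_derive_cst k t 1).
  by rewrite scaler0 add0r subr0 -[X in is_derive _ _ _ X]/(k * 1) mulr1.
 rewrite Fg; split.
  apply/derivable1_diffP; apply: (@differentiable_comp _ _ _ _ (fun s : R => (s - t) * k) g).
   by apply/derivable1_diffP; case: lin.
  by apply/derivable1_diffP; rewrite subrr mul0r; case: dg.
 rewrite -derive1E (derive1_comp (f := fun s : R => (s - t) * k) (g := g)).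
 - by rewrite !derive1E subrr mul0r; case: dg => _ ->; case: lin => _ ->; rewrite mulrC.
 - by case: lin.
 - by rewrite subrr mul0r; case: dg.
have [||c c01] := @MVT_segment R F (fun t => k * partial i f (x + (t * k) *: v)) 0 1 ler01.
- by move=> t; rewrite in_itv/= => /andP[t0 t1]; apply: dF; rewrite !ltW.
- apply: derivable_within_continuous => t; rewrite in_itv/= => t01.
 by have [] := dF t t01.
rewrite subr0 mulr1 /F mul0r scale0r addr0 mul1r => e.
by exists c.
Qed.

End SmoothCalculus.

(** * The chain rule and smooth step functions *)

Section ChainRule.
Implicit Types (U V : set pt) (f g h : pt -> R) (x : pt) (i : 'I_2).

Lemma is_derive_cvg (W : normedModType R) (f : W -> R) (x v : W) (l : R) :
 (fun t : R => t^-1 * (f (t *: v + x) - f x)) @ 0^' --> l -> is_derive x v f l.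
Proof.
move=> h; split; first by apply/cvg_ex; exists l; exact: h.
exact: cvg_lim.
Qed.

Lemma is_deriveP_cvg (W : normedModType R) (f : W -> R) (x v : W) :
 derivable f x v -> (fun t : R => t^-1 * (f (t *: v + x) - f x)) @ 0^' --> 'D_v f x.
Proof. exact. Qed.

Lemma cvg_pt (T : Type) (F : set_system T) {FF : Filter F} (f g : T -> R) (a b : R) :
 f @ F --> a -> g @ F --> b -> (fun t => (f t, g t) : pt) @ F --> ((a, b) : pt).
Proof. by move=> fa gb; exact: (@cvg_pair _ _ _ F (nbhs a) (nbhs b) _ _ _ f g). Qed.

Lemma is_derive_linear f x v : (forall t, f (t *: v + x) = t * f v + f x) -> is_derive x v f (f v).
Proof.
move=> fl; apply: is_derive_cvg; apply: cvg_near_cst.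
near=> t; rewrite fl addrK mulKf//; near: t; exact: nbhs_dnbhs_neq.
Unshelve. all: by end_near. Qed.

Lemma is_derive_fst x (v : pt) : is_derive x v (fun y : pt => y.1) v.1.
Proof. exact: (is_derive_linear (f := fst)). Qed.

Lemma is_derive_snd x (v : pt) : is_derive x v (fun y : pt => y.2) v.2.
Proof. exact: (is_derive_linear (f := snd)). Qed.

Lemma smooth_coord U f : open U -> continuous f -> (forall x v, is_derive x v f (f v)) ->
 smooth_on U f.
Proof.
move=> oU cf df; pose Q : set (pt -> R) := [set f] `|` [set fun=> 1].
have sp (a : R) : smooth_span U Q (fun=> a * 1).
 by apply: (@SpanGen U Q (fun=> _) (fun=> 1)); [exact: smooth_cst|right].
apply: (@smooth_module U Q oU); last by left.
 move=> q [->|->]; last exact/smooth_partials/smooth_cst.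
 by move=> x _; split=> [|i]; [exact: cf|case: (df x (bv i))].
move=> q i [->|->]; [exists (fun=> f (bv i) * 1)|exists (fun=> 0 * 1)] => //.
 by move=> x _; rewrite mulr1; case: (df x (bv i)).
by move=> x _; rewrite partial_cst mulr1.
Qed.

Lemma smooth_fst U : open U -> smooth_on U (fun y : pt => y.1).
Proof. by move=> oU; apply: smooth_coord => // x; [exact: cvg_fst|exact: is_derive_fst]. Qed.

Lemma smooth_snd U : open U -> smooth_on U (fun y : pt => y.2).
Proof. by move=> oU; apply: smooth_coord => // x; [exact: cvg_snd|exact: is_derive_snd]. Qed.

Lemma prod_norm_lt (x : pt) (r : R) : (`|x| < r) = (`|x.1| < r) && (`|x.2| < r).
Proof. by rewrite gt_max. Qed.

Lemma prod_norm_le (x : pt) (r : R) : (`|x| <= r) = (`|x.1| <= r) && (`|x.2| <= r).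
Proof. by rewrite ge_max. Qed.

Lemma open_ball_sub V x : open V -> V x ->
 exists2 r : R, 0 < r & forall y : pt, `|y - x| < r -> V y.
Proof.
move=> oV Vx; have /nbhs_ballP[r /= r0 rV] : nbhs x V by exact: open_nbhs_nbhs.
by exists r => // y yx; apply: rV; rewrite -ball_normE /= distrC.
Qed.

(** The increment is split at the corner (x.1, y.2). Both legs stay in the ball because the norm of
    the plane is the sup norm. *)
Lemma increment_mvt V h x (r : R) : has_partials V h ->
 (forall y : pt, `|y - x| < r -> V y) ->
 forall y : pt, `|y - x| < r -> exists z1 z2 : pt,
  [/\ `|z1 - x| <= `|y - x|, `|z2 - x| <= `|y - x| &
   h y - h x = (y.1 - x.1) * partial o0 h z1 + (y.2 - x.2) * partial o1 h z2].
Proof.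
move=> hV rV y yr; pose w : pt := (x.1, y.2).
have bnd (t a : R) : 0 <= t <= 1 -> `|t * a| <= `|a|.
 by move=> /andP[t0 t1]; rewrite normrM ger0_norm// ler_piMl.
have /andP[y1 y2] : (`|(y - x).1| <= `|y - x|) && (`|(y - x).2| <= `|y - x|) by rewrite -prod_norm_le.
have le1 (t : R) : 0 <= t <= 1 -> `|w + (t * (y.1 - x.1)) *: bv o0 - x| <= `|y - x|.
 move=> t01; rewrite prod_norm_le /= -![_ *: _]/(_ * _) mulr1 mulr0 addr0 y2 andbT addrAC subrr add0r.
 exact: le_trans (bnd t _ t01) _.
have le2 (t : R) : 0 <= t <= 1 -> `|x + (t * (y.2 - x.2)) *: bv o1 - x| <= `|y - x|.
 move=> t01; rewrite prod_norm_le /= -![_ *: _]/(_ * _) mulr1 mulr0 addr0 subrr normr0 normr_ge0 /=.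
 rewrite addrAC subrr add0r; exact: le_trans (bnd t _ t01) _.
have [|t t01 e1] := @partial_mvt o0 h w (y.1 - x.1).
 by move=> t t01; have [_] := hV _ (rV _ (le_lt_trans (le1 t t01) yr)); exact.
have [|s s01 e2] := @partial_mvt o1 h x (y.2 - x.2).
 by move=> s s01; have [_] := hV _ (rV _ (le_lt_trans (le2 s s01) yr)); exact.
exists (w + (t * (y.1 - x.1)) *: bv o0), (x + (s * (y.2 - x.2)) *: bv o1).
split; [exact: le1|exact: le2|rewrite -e1 -e2].
have -> : w + (y.1 - x.1) *: bv o0 = y.
 by rewrite [RHS]surjective_pairing; congr (_, _); rewrite /= -[_ *: _]/(_ * _) ?mulr1 ?mulr0 ?addr0// addrC subrK.
have -> : x + (y.2 - x.2) *: bv o1 = w.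
 by rewrite [x in LHS]surjective_pairing; congr (_, _); rewrite /= -[_ *: _]/(_ * _) ?mulr1 ?mulr0 ?addr0// addrC subrK.
by rewrite addrA subrK.
Qed.

(** [smooth_on] speaks of partial derivatives only, so the differentiability of h has to come from
    their continuity, through the mean value formula on two legs. *)
Lemma is_derive_comp2 V h g1 g2 x (v : pt) : open V -> has_partials V h ->
 (forall i, {for (g1 x, g2 x), continuous (partial i h)}) -> V (g1 x, g2 x) ->
 derivable g1 x v -> derivable g2 x v ->
 is_derive x v (fun y => h (g1 y, g2 y))
  (partial o0 h (g1 x, g2 x) * 'D_v g1 x + partial o1 h (g1 x, g2 x) * 'D_v g2 x).
Proof.
move=> oV hV ch Vp d1 d2; set p : pt := (g1 x, g2 x) in ch Vp *.
have [r r0 rV] := open_ball_sub oV Vp.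
pose G t : pt := (g1 (t *: v + x), g2 (t *: v + x)).
have inc := increment_mvt hV rV.
(* Outside the ball the intermediate points are set to p; only small t matter in the limit. *)
have /choice[z hz] t : exists z : pt * pt, `|G t - p| < r ->
  [/\ `|z.1 - p| <= `|G t - p|, `|z.2 - p| <= `|G t - p| &
   h (G t) - h p = ((G t).1 - p.1) * partial o0 h z.1 + ((G t).2 - p.2) * partial o1 h z.2].
 have [Gr|Gr] := ltP `|G t - p| r; last by exists (p, p).
 by have [z1 [z2 [? ? ?]]] := inc _ Gr; exists (z1, z2).
have cg g : derivable g x v -> (fun t : R => g (t *: v + x)) @ 0^' --> g x.
 move=> dg; have /derivable1_diffP/differentiable_continuous := proj1 (derivable1P g x v) dg.
 have -> : g x = g (0 *: v + x) by rewrite scale0r add0r.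
 by move/continuous_withinNx.
have cG : `|G t - p| @[t --> 0^'] --> (0 : R).
 have c : `|G t - p| @[t --> (0 : R)^'] --> `|p - p|.
  by apply: cvg_norm; exact: (cvgB (cvg_pt (cg _ d1) (cg _ d2)) (cvg_cst p)).
 by move: c; rewrite [p - p]subrr normr0.
have nG : \forall t \near (0 : R)^', `|G t - p| < r by exact: (cvgr_lt 0).
have cz (k : pt * pt -> pt) : (forall t, `|G t - p| < r -> `|k (z t) - p| <= `|G t - p|) ->
  k (z t) @[t --> (0 : R)^'] --> p.
 move=> hk; apply/cvgrPdist_lt => e e0.
 have nGe : \forall t \near (0 : R)^', `|G t - p| < e by exact: (cvgr_lt 0 cG).
 by apply: filterS2 nG nGe => t tr te; rewrite distrC; exact: le_lt_trans (hk t tr) te.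
have cz1 : partial o0 h (z t).1 @[t --> (0)^'] --> partial o0 h p.
 apply: (cvg_comp (fun t => (z t).1)); last exact: ch.
 by apply: cz => t /hz[].
have cz2 : partial o1 h (z t).2 @[t --> 0^'] --> partial o1 h p.
 apply: (cvg_comp (fun t => (z t).2)); last exact: ch.
 by apply: cz => t /hz[].
apply: is_derive_cvg.
have -> : partial o0 h p * 'D_v g1 x + partial o1 h p * 'D_v g2 x =
  'D_v g1 x * partial o0 h p + 'D_v g2 x * partial o1 h p by ring.
apply: cvg_trans (cvgD (cvgM (is_deriveP_cvg d1) cz1) (cvgM (is_deriveP_cvg d2) cz2)).
apply: near_eq_cvg; apply: filterS nG => t /hz[_ _ e].
by rewrite e !fctE /=; ring.
Qed.

Lemma smooth_comp2 U V h g1 g2 : open U -> open V -> smooth_on V h ->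
 smooth_on U g1 -> smooth_on U g2 -> (forall x, U x -> V (g1 x, g2 x)) ->
 smooth_on U (fun x => h (g1 x, g2 x)).
Proof.
move=> oU oV sh s1 s2 UV.
pose Q : set _ := [set q | exists s, q = fun x => iter_partial s h (g1 x, g2 x)].
have shs s : smooth_on V (iter_partial s h).
 by move=> t y Vy; rewrite /iter_partial -foldl_cat; exact: sh.
have dc s x i : U x -> is_derive x (bv i) (fun x => iter_partial s h (g1 x, g2 x))
  (partial o0 (iter_partial s h) (g1 x, g2 x) * partial i g1 x +
  partial o1 (iter_partial s h) (g1 x, g2 x) * partial i g2 x).
 move=> Ux; apply: (is_derive_comp2 oV (smooth_partials (shs s))).
 - move=> j; exact: (smooth_partials (smooth_on_partial j (shs s)) (UV x Ux)).1.
 - exact: UV.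
 - exact: (smooth_partials s1 Ux).2.
 - exact: (smooth_partials s2 Ux).2.
apply: (@smooth_module U Q oU); last by exists [::].
 move=> _ [s ->] x Ux; split=> [|i]; last by case: (dc s x i Ux).
 have c1 := (smooth_partials s1 Ux).1; have c2 := (smooth_partials s2 Ux).1.
 apply: (@continuous_comp _ _ _ (fun x => _)).
  exact: (cvg_pt c1 c2).
 exact: (smooth_partials (shs s) (UV x Ux)).1.
move=> _ i [s ->].
exists (fun x => partial i g1 x * iter_partial (rcons s o0) h (g1 x, g2 x) +
  partial i g2 x * iter_partial (rcons s o1) h (g1 x, g2 x)).
 apply: SpanAdd.
  apply: (@SpanGen _ Q (partial i g1) (fun x => iter_partial (rcons s o0) h (g1 x, g2 x))).
   exact: smooth_on_partial.
  by exists (rcons s o0).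
 apply: (@SpanGen _ Q (partial i g2) (fun x => iter_partial (rcons s o1) h (g1 x, g2 x))).
  exact: smooth_on_partial.
 by exists (rcons s o1).
move=> x /set_mem Ux; have [_ e] := dc s x i Ux.
rewrite /partial e /iter_partial !foldl_rcons.
by rewrite mulrC [X in _ + X]mulrC.
Qed.

(** The functions t^-n exp(-1/t), extended by zero. Differentiation maps this family into
    combinations of its own members, so all of them are smooth. *)
Definition flat_exp (n : nat) (t : R) : R :=
 if 0 < t then t^-1 ^+ n * expR (- t^-1) else 0.

(** From (s / m)^m <= exp s with s = 1/t and m = n + 2. A quadratic bound is what makes the
    derivative at 0 exist and vanish. *)
Lemma flat_exp_le n (t : R) : `|flat_exp n t| <= (n.+2%:R ^+ n.+2) * t ^+ 2.
Proof.
rewrite /flat_exp; case: ifPn => t0; last first.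
 by rewrite normr0; apply: mulr_ge0; [exact: exprn_ge0|exact: sqr_ge0].
have ti : 0 < t^-1 by rewrite invr_gt0.
rewrite ger0_norm ?mulr_ge0 ?exprn_ge0 ?(ltW ti)//.
set m := n.+2; have m0 : 0 < (m%:R : R) by [].
have h : (t^-1 / m%:R) ^+ m <= expR (t^-1).
 have -> : expR (t^-1) = expR (t^-1 / m%:R) ^+ m.
  by rewrite -expRM_natl; congr expR; field; rewrite !gt_eqF.
 rewrite lerXn2r ?nnegrE ?divr_ge0 ?(ltW ti)//.
 by apply: le_trans (expR_ge1Dx _); rewrite lerDr.
rewrite expRN ler_pdivrMr ?expR_gt0//.
apply: (@le_trans _ _ (m%:R ^+ m * t ^+ 2 * (t^-1 / m%:R) ^+ m)); last first.
 by rewrite ler_wpM2l// mulr_ge0 ?sqr_ge0// exprn_ge0// ltW.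
rewrite exprMn exprVn /m !exprS; apply: le_of_eq.
rewrite !exprVn; field.
by rewrite !gt_eqF ?exprn_gt0.
Qed.

Lemma is_derive_flat_exp n (t : R) :
 is_derive t 1 (flat_exp n) (- n%:R * flat_exp n.+1 t + flat_exp n.+2 t).
Proof.
have [t0|t0] := ltP 0 t.
 have tn : t != 0 by rewrite gt_eqF.
 have dV : is_derive t 1 (fun s : R => s^-1) (- t ^- 2 *: 1).
  by split; [apply: derivableV|rewrite deriveV//; congr (_ *: _); exact: derive_id].
 have dphi : is_derive (t^-1) 1 (fun y : R => y ^+ n * expR (- y))
   (n%:R * t^-1 ^+ n.-1 * expR (- t^-1) - t^-1 ^+ n * expR (- t^-1)).
  have dN : is_derive (t^-1 : R) 1 (fun y : R => - y) (- 1) by exact: is_deriveN.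
  have dX : is_derive t^-1 1 (fun y : R => y ^+ n) (n%:R * t^-1 ^+ n.-1 *: 1).
   by split; [exact: exprn_derivable|rewrite exp_derive].
  have dE : is_derive (t^-1 : R) 1 (fun y : R => expR (- y)) (expR (- t^-1) * - 1).
   have [dn en] := dN; have := is_derive_comp1 (is_derive_expR (- t^-1)) dn.
   by rewrite en.
  apply: is_derive_eq (is_deriveM dX dE) _.
  by rewrite -![_ *: _]/(_ * _); ring.
 have [d1 e1] := is_derive_comp1 dphi (let: DeriveDef d _ := dV in d).
 have eqn : {near t, (fun s => s^-1 ^+ n * expR (- s^-1)) =1 flat_exp n}.
  have n0 : \near t, 0 < t by exact: lt_nbhsr.
  by apply: filterS n0 => s s0; rewrite /flat_exp s0.
 split; first exact: near_eq_derivable eqn d1.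
 have [_ eV] := dV; rewrite -(near_eq_derive _ eqn) e1 eV /flat_exp t0.
 rewrite -[_ *: 1]/(_ * 1) mulr1 !exprS; case: n {dphi d1 e1 eqn} => [|n] /=.
  by rewrite oppr0 !expr0; field.
 rewrite [t^-1 ^+ n.+1]exprS expr0; move: (t^-1 ^+ n) (expR _) => y z.
 by field.
have f0 m s : s <= 0 -> flat_exp m s = 0 by move=> s0; rewrite /flat_exp ltNge s0.
rewrite !f0// mulr0 addr0.
move: t0; rewrite le_eqVlt => /orP[/eqP->|t0].
 (* At t = 0 the difference quotient is at most C |h| by [flat_exp_le]. *)
 apply: is_derive_cvg; apply/cvgr0Pnorm_le => e e0.
 pose C : R := n.+2%:R ^+ n.+2; have C0 : 0 < C by rewrite exprn_gt0.
 have d0 : 0 < e / C by rewrite divr_gt0.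
 near=> h; have hn : h != 0 by near: h; exact: nbhs_dnbhs_neq.
 have hs : `|h| <= e / C by near: h; apply: dnbhs0_le.
 rewrite addr0 (f0 n 0 (lexx _)) subr0 -[h *: 1]/(h * 1) mulr1 normrM normfV.
 rewrite ler_pdivrMl ?normr_gt0//; apply: le_trans (flat_exp_le n h) _.
 rewrite -(real_normK (num_real h)) (_ : C * _ = `|h| * (`|h| * C)); last by ring.
 by rewrite ler_wpM2l// -ler_pdivlMr.
have eqn : {near t, (fun=> 0) =1 flat_exp n}.
 have n0 : \near t, t < 0 by exact: lt_nbhsl.
 by apply: filterS n0 => s s0; rewrite f0// ltW.
split; first exact: near_eq_derivable eqn (derivable_cst _ _ _).
by rewrite -(near_eq_derive _ eqn) derive_cst.
Unshelve. all: by end_near. Qed.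

Lemma smooth_flat_exp n : smooth_on [set: pt] (fun x => flat_exp n x.1).
Proof.
pose Q : set (pt -> R) := [set q | exists n, q = fun x => flat_exp n x.1].
have dQ m x i : is_derive x (bv i) (fun x => flat_exp m x.1)
  ((- m%:R * flat_exp m.+1 x.1 + flat_exp m.+2 x.1) * (bv i).1).
 have [d e] := is_derive_fst x (bv i).
 by have := is_derive_comp1 (is_derive_flat_exp m x.1) d; rewrite e.
apply: (@smooth_module setT Q openT); last by exists n.
 move=> _ [m ->] x _; split=> [|i]; last by case: (dQ m x i).
 apply: continuous_comp; first exact: cvg_fst.
 have [d _] := is_derive_flat_exp m x.1.
 exact/differentiable_continuous/derivable1_diffP.
move=> _ i [m ->].
exists (fun x => (- m%:R * (bv i).1) * flat_exp m.+1 x.1 +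
  (bv i).1 * flat_exp m.+2 x.1).
 apply: SpanAdd.
  apply: SpanGen; last by exists m.+1.
  exact: smooth_cst.
 apply: SpanGen; last by exists m.+2.
 exact: smooth_cst.
by move=> x _; have [_ e] := dQ m x i; rewrite /partial e; ring.
Qed.

Definition smooth_step (t : R) : R := flat_exp 0 t / (flat_exp 0 t + flat_exp 0 (1 - t)).

Lemma flat_exp_ge0 n t : 0 <= flat_exp n t.
Proof.
rewrite /flat_exp; case: ifPn => // t0.
by rewrite mulr_ge0// exprn_ge0// invr_ge0 ltW.
Qed.

Lemma flat_exp_gt0 n t : 0 < t -> 0 < flat_exp n t.
Proof. by move=> t0; rewrite /flat_exp t0 mulr_gt0 ?expR_gt0// exprn_gt0// invr_gt0. Qed.

Lemma flat_exp_eq0 n t : t <= 0 -> flat_exp n t = 0.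
Proof. by move=> t0; rewrite /flat_exp ltNge t0. Qed.

Lemma smooth_step_den t : 0 < flat_exp 0 t + flat_exp 0 (1 - t).
Proof.
have [t0|t0] := ltP 0 t; first by rewrite ltr_pwDl ?flat_exp_gt0 ?flat_exp_ge0.
by rewrite ltr_wpDl ?flat_exp_ge0// flat_exp_gt0// subr_gt0 (le_lt_trans t0).
Qed.

Lemma smooth_step_eq0 t : t <= 0 -> smooth_step t = 0.
Proof. by move=> t0; rewrite /smooth_step flat_exp_eq0// mul0r. Qed.

Lemma smooth_step_eq1 t : 1 <= t -> smooth_step t = 1.
Proof.
move=> t1; rewrite /smooth_step (@flat_exp_eq0 _ (1 - t)) ?subr_le0// addr0 divff//.
by rewrite gt_eqF// flat_exp_gt0// (lt_le_trans ltr01).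
Qed.

Lemma smooth_step_ge0 t : 0 <= smooth_step t.
Proof. by rewrite divr_ge0 ?flat_exp_ge0// ltW// smooth_step_den. Qed.

Lemma smooth_step_le1 t : smooth_step t <= 1.
Proof. by rewrite ler_pdivrMr ?smooth_step_den// mul1r lerDl flat_exp_ge0. Qed.

Lemma smooth_step_gt0 t : 0 < t -> 0 < smooth_step t.
Proof. by move=> t0; rewrite divr_gt0 ?smooth_step_den// flat_exp_gt0. Qed.

Lemma smooth_smooth_step : smooth_on [set: pt] (fun x => smooth_step x.1).
Proof.
have s1 := smooth_flat_exp 0.
have s2 : smooth_on [set: pt] (fun x => flat_exp 0 (1 - x.1)).
 have sa : smooth_on [set: pt] (fun x : pt => 1 - x.1).
  exact: (smoothB openT (@smooth_cst _ 1) (smooth_fst openT)).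
 exact: (smooth_comp2 openT openT s1 sa (@smooth_cst _ 0) (fun _ _ => I)).
apply: (smoothM openT s1); apply: smoothV openT _ (smoothD openT s1 s2) => x _.
by rewrite gt_eqF// smooth_step_den.
Qed.

End ChainRule.

(** * Lebesgue integration on the plane *)

Section PlaneIntegration.
Implicit Types (U V : set pt) (f g h : pt -> R) (x : pt) (i : 'I_2).

Lemma measurable_fun_gt d (T : measurableType d) (D : set T) (f : T -> R) :
 (forall a : R, measurable (D `&` [set x | a < f x])) -> measurable_fun D f.
Proof.
move=> h; move=> mD; apply: (measurability _ (RGenOInfty.measurableE R)) => //.
move=> _ [_ [a ->] <-]; rewrite (_ : _ `&` _ = D `&` [set x | a < f x])//.
by apply/seteqP; split => x [Dx]; rewrite /= in_itv andbT.
Qed.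

(** The sigma-algebra here is the product one; an open set is the countable union of the rational
    boxes that it contains. *)
Lemma open_measurable2 U : open U -> measurable (U : set mpt).
Proof.
move=> oU.
pose box (q : rat * rat * rat * rat) : set pt :=
 `]ratr q.1.1.1, ratr q.1.1.2[%classic `*` `]ratr q.1.2, ratr q.2[%classic.
pose F (n : nat) : set mpt := if unpickle n is Some q then
 if `[< box q `<=` U >] then box q else set0 else set0.
have -> : U = \bigcup_n F n.
 apply/seteqP; split => [x Ux|x [n _]]; last first.
  by rewrite /F; case: unpickle => // q; case: asboolP => // bU /bU.
 have [r r0 rU] := open_ball_sub oU Ux.
 have lt1 (a : R) : a - r < a by rewrite gtrBl.
 have lt2 (a : R) : a < a + r by rewrite ltrDl.
 have [a1 ha1] := rat_in_itvoo (lt1 x.1); have [b1 hb1] := rat_in_itvoo (lt2 x.1).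
 have [a2 ha2] := rat_in_itvoo (lt1 x.2); have [b2 hb2] := rat_in_itvoo (lt2 x.2).
 move: ha1 hb1 ha2 hb2; rewrite !in_itv/= => /andP[? ?] /andP[? ?] /andP[? ?] /andP[? ?].
 have [n hn] : exists n, unpickle n = Some (a1, b1, a2, b2).
  by exists (pickle (a1, b1, a2, b2)); exact: pickleK.
 exists n; first exact: I.
 rewrite /F hn.
 case: asboolP => [_|]; first by split; rewrite /= in_itv/=; apply/andP.
 case=> y [/=]; rewrite !in_itv/= => /andP[? ?] /andP[? ?].
 apply: rU; rewrite prod_norm_lt /=; apply/andP; split; rewrite ltr_norml; apply/andP; split; lra.
apply: bigcupT_measurable => n; rewrite /F; case: unpickle => // q.
by case: ifP => // _; apply: measurableX.
Qed.

Lemma continuous_on_measurable2 U f : open U -> (forall x, U x -> {for x, continuous f}) ->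
 measurable_fun (U : set mpt) (f : mpt -> R).
Proof.
move=> oU cf; apply: measurable_fun_gt => a; apply: open_measurable2.
rewrite openE => x [Ux afx]; apply: filterI; first exact: open_nbhs_nbhs.
have /cvgr_gt := cf x Ux; exact.
Qed.

Lemma continuous_measurable2 f : continuous f -> mfP (f : mpt -> R).
Proof. by move=> cf; apply: (@continuous_on_measurable2 setT f openT) => x _; exact: cf. Qed.

Lemma square_itv (x : pt) (r : R) : [set y : pt | `|x - y| <= r] =
 `[x.1 - r, x.1 + r]%classic `*` `[x.2 - r, x.2 + r]%classic.
Proof.
apply/seteqP; split => y /=; rewrite prod_norm_le !in_itv/= !ler_norml.
 by move=> /andP[/andP[? ?] /andP[? ?]]; split; apply/andP; split; lra.
by move=> [/andP[? ?] /andP[? ?]]; apply/andP; split; apply/andP; split; lra.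
Qed.

Lemma square0 (r : R) : [set x : pt | `|x| <= r] = [set y | `|0 - y| <= r].
Proof. by apply/seteqP; split => x /=; rewrite sub0r normrN. Qed.

Lemma compact_square (x : pt) (r : R) : compact [set y : pt | `|y - x| <= r].
Proof. by under eq_set do rewrite distrC; rewrite square_itv; apply: compact_setX; exact: segment_compact. Qed.

Lemma compact_box (B : R) : compact [set x : pt | `|x| <= B].
Proof. by have := @compact_square 0 B; under eq_set do rewrite subr0. Qed.

Lemma compact_bound (T : topologicalType) (K : set T) (f : T -> R) : compact K ->
 (forall q, K q -> {for q, continuous f}) -> exists2 C : R, 0 < C & forall q, K q -> `|f q| <= C.
Proof.
move=> cK cf; have : compact (f @` K).
 apply: continuous_compact => //; apply: continuous_in_subspaceT => x /set_mem; exact: cf.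
move=> /compact_bounded [N [_ hN]]; exists (`|N| + 1) => //.
by move=> x Kx; apply: hN; [rewrite (le_lt_trans (ler_norm _))// ltrDl|exists x].
Qed.

Lemma open_norm_gt (B : R) : open [set y : pt | B < `|y|].
Proof.
rewrite openE => y /= By; have h := @norm_continuous R pt y.
exact: @cvgr_gt R pt _ _ _ _ h B By.
Qed.

Definition bsupp f := exists B : R, forall x, f x != 0 -> `|x| <= B.

Lemma bsupp_pos f : bsupp f -> exists2 B : R, 0 < B & forall x, B <= `|x| -> f x = 0.
Proof.
move=> [B hB]; exists (`|B| + 1) => //.
move=> x Bx; apply/eqP/negPn/negP => /hB h.
have : `|B| + 1 <= `|B| by apply: le_trans Bx (le_trans h (ler_norm _)).
by rewrite gerDl ler10.
Qed.

Lemma bsuppMr f g : bsupp g -> bsupp (fun x => f x * g x).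
Proof.
by move=> [B hB]; exists B => x h; apply: hB; apply: contraNneq h => ->; rewrite mulr0.
Qed.

Lemma bsuppD f g : bsupp f -> bsupp g -> bsupp (fun x => f x + g x).
Proof.
move=> [B hB] [C hC]; exists (Num.max B C) => x h; rewrite le_max.
have [fx|fx] := eqVneq (f x) 0; last by rewrite hB.
by rewrite hC ?orbT//; apply: contraNneq h => ->; rewrite fx addr0.
Qed.

Lemma bsupp_partial f i : bsupp f -> bsupp (partial i f).
Proof.
move=> /bsupp_pos[B B0 hB]; exists B => x; rewrite leNgt; apply: contraNN => Bx.
have oV := @open_norm_gt B.
rewrite (@partial_eq [set y : pt | B < `|y|] f (fun=> 0) i oV _ x (mem_set Bx)) ?partial_cst//.
by move=> y /set_mem /ltW /hB.
Qed.

Lemma bsupp_bounded f : continuous f -> bsupp f -> exists2 C : R, 0 < C & forall x, `|f x| <= C.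
Proof.
move=> cf [B hB]; have [C C0 hC] := compact_bound (@compact_box B) (fun x _ => cf x).
exists C => // x; have [->|/hB/hC//] := eqVneq (f x) 0.
by rewrite normr0 ltW.
Qed.

Lemma Leb_rect (A B : set (measurableTypeR R)) : measurable A -> measurable B ->
 Leb (A `*` B) = (@lebesgue_measure R A * @lebesgue_measure R B)%E.
Proof. by move=> mA mB; rewrite -product_measure1E. Qed.

Lemma measurable_square x (r : R) : measurable ([set y | `|x - y| <= r] : set mpt).
Proof. by rewrite square_itv; apply: measurableX; exact: measurable_itv. Qed.

Lemma Leb_square x (r : R) : 0 <= r -> Leb [set y | `|x - y| <= r] = (4 * r ^+ 2)%:E.
Proof.
move=> r0; rewrite square_itv Leb_rect; [|exact: measurable_itv..].
rewrite !lebesgue_measure_itv /= !lte_fin.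
have [r1|r1] := ltP 0 r.
 rewrite !ifT; [|lra|lra]; rewrite -!EFinB -EFinM; congr EFin; ring.
have -> : r = 0 by apply/eqP; rewrite eq_le r0 r1.
by rewrite !addr0 !subr0 !ltxx mule0 expr0n /= mulr0.
Qed.

Lemma measurable_box (B : R) : measurable ([set x : pt | `|x| <= B] : set mpt).
Proof. by rewrite square0; exact: measurable_square. Qed.

Lemma Leb_box_fin (B : R) : (Leb [set x : pt | (`|x| <= B)%R] < +oo)%E.
Proof.
have [B0|B0] := ltP B 0; last by rewrite square0 Leb_square// ltry.
rewrite (_ : [set _ | _] = set0) ?measure0//; apply/seteqP; split => // x /= h.
by have := le_lt_trans h B0; rewrite normr_lt0.
Qed.

Lemma bsupp_integ f : mfP (f : mpt -> R) -> bsupp f ->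
 (exists C : R, forall x, `|f x| <= C) -> integ Leb (f : mpt -> R).
Proof.
move=> mf [B hB] [C hC].
have mD := measurable_box B.
have fD : EFin \o f = (EFin \o f) \_ [set x : pt | `|x| <= B].
 apply/funext => x; rewrite patchE /=; case: ifPn => // /negP nD.
 by congr EFin; apply/eqP/negPn/negP => /hB h; apply: nD; apply/mem_set.
rewrite /integ fD; apply/(integrable_mkcond _ mD).
apply: measurable_bounded_integrable => //; first exact: Leb_box_fin.
 exact: measurable_funTS.
exists C; split; first exact: num_real.
by move=> M CM x _; apply: le_trans _ (ltW CM).
Qed.

Lemma Cc_integ f : continuous f -> bsupp f -> integ Leb (f : mpt -> R).
Proof.
move=> cf sf; have [C _ hC] := bsupp_bounded cf sf.
apply: bsupp_integ => //; first exact: continuous_measurable2.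
by exists C.
Qed.

Lemma int_deriv0 (F f : R -> R) (B : R) : 0 < B -> continuous f ->
 (forall t : R, is_derive t (1 : R) F (f t)) -> (forall t, B <= `|t| -> F t = 0) ->
 (forall t, B <= `|t| -> f t = 0) -> (\int[@lebesgue_measure R]_t (f t)%:E = 0)%E.
Proof.
move=> B0 cf dF F0 f0.
have -> : (fun t => (f t)%:E) = ((fun t => (f t)%:E) \_ `[- B, B]%classic).
 apply/funext => t; rewrite patchE; case: ifPn => // /negP nB.
 rewrite f0// leNgt; apply/negP => tB; apply: nB; apply/mem_set.
 by rewrite /= in_itv /= -ler_norml ltW.
rewrite -integral_mkcond.
have cF t : {for t, continuous F}.
 by have [d _] := dF t; exact/differentiable_continuous/derivable1_diffP.
rewrite (@continuous_FTC2 _ f F).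
- by rewrite !F0 ?subee// ?normrN gtr0_norm.
- by rewrite -subr_gt0 opprK addr_gt0.
- by apply: continuous_subspaceT.
- split=> [t _| |]; first by case: (dF t).
  exact/cvg_at_right_filter/cF.
 exact/cvg_at_left_filter/cF.
- by move=> t; rewrite derive1E; case: (dF t).
Qed.

Lemma is_derive_slice1 f (y t : R) : derivable f (t, y) (bv o0) ->
 is_derive t 1 (fun s => f (s, y)) (partial o0 f (t, y)).
Proof.
move=> df; have e : (fun h : R => h^-1 * (f ((h *: (1 : R) + t), y) - f (t, y))) =
  (fun h : R => h^-1 * (f (h *: bv o0 + (t, y)) - f (t, y))).
 apply/funext => h; congr (_ * (f _ - _)); congr (_, _).
 by rewrite /= -[_ *: _]/(_ * _) mulr0 add0r.
apply: is_derive_cvg; rewrite e; exact: is_deriveP_cvg.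
Qed.

Lemma is_derive_slice2 f (y t : R) : derivable f (y, t) (bv o1) ->
 is_derive t 1 (fun s => f (y, s)) (partial o1 f (y, t)).
Proof.
move=> df; have e : (fun h : R => h^-1 * (f (y, (h *: (1 : R) + t)) - f (y, t))) =
  (fun h : R => h^-1 * (f (h *: bv o1 + (y, t)) - f (y, t))).
 apply/funext => h; congr (_ * (f _ - _)); congr (_, _).
 by rewrite /= -[_ *: _]/(_ * _) mulr0 add0r.
apply: is_derive_cvg; rewrite e; exact: is_deriveP_cvg.
Qed.

Lemma continuous_slice1 f (y : R) : continuous f -> continuous (fun t : R => f (t, y)).
Proof.
move=> cf t; apply: continuous_comp; last exact: cf.
by apply: cvg_pt; [|exact: cvg_cst].
Qed.

Lemma continuous_slice2 f (y : R) : continuous f -> continuous (fun t : R => f (y, t)).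
Proof.
move=> cf t; apply: (@continuous_comp _ _ _ (fun t : R => _ : pt) f); last exact: cf.
by apply: cvg_pt; [exact: cvg_cst|].
Qed.

Lemma ord2P i : i = o0 \/ i = o1.
Proof. by case: i => [[|[|]]]// ?; [left|right]; exact: val_inj. Qed.

(** Fubini's theorem reduces the claim to the fundamental theorem of calculus on lines. Every
    integration by parts below rests on this form. *)
Lemma int_partial0 f i : smooth_on setT f -> bsupp f ->
 (\int[Leb]_x (partial i f x) = 0).
Proof.
move=> sf bf; have sp := smooth_on_partial i sf; have bp := bsupp_partial i bf.
have cp : continuous (partial i f) by move=> x; exact: (smooth_partials sp (x := x) I).1.
have ip := Cc_integ cp bp.
have [B1 B10 hB1] := bsupp_pos bf; have [B2 B20 hB2] := bsupp_pos bp.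
have hf x : Num.max B1 B2 <= `|x| -> f x = 0 by rewrite ge_max => /andP[/hB1].
have hp x : Num.max B1 B2 <= `|x| -> partial i f x = 0 by rewrite ge_max => /andP[_ /hB2].
have B0 : 0 < Num.max B1 B2 by rewrite lt_max B10.
have df x : forall j, derivable f x (bv j) := (smooth_partials sf (x := x) I).2.
have nl (t y : R) : `|t| <= `|((t, y) : pt)| by rewrite prod_normE le_max lexx.
have nr (t y : R) : `|t| <= `|((y, t) : pt)| by rewrite prod_normE le_max lexx orbT.
rewrite /Rintegral; have [] := ord2P i => ei; subst i.
 rewrite -(integral21_prod_meas1 ip) /fubini_G /=.
 under eq_integral => y _ do rewrite (@int_deriv0 (fun t => f (t, y)) (fun t => partial o0 f (t, y)) _ B0
  (@continuous_slice1 _ y cp) (fun t => is_derive_slice1 (df (t, y) o0))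
  (fun t ht => hf _ (le_trans ht (nl t y))) (fun t ht => hp _ (le_trans ht (nl t y)))).
 by rewrite integral0.
rewrite -(integral12_prod_meas1 ip) /fubini_F /=.
under eq_integral => y _ do rewrite (@int_deriv0 (fun t => f (y, t)) (fun t => partial o1 f (y, t)) _ B0
 (@continuous_slice2 _ y cp) (fun t => is_derive_slice2 (df (y, t) o1))
 (fun t ht => hf _ (le_trans ht (nr t y))) (fun t ht => hp _ (le_trans ht (nr t y)))).
by rewrite integral0.
Qed.

End PlaneIntegration.

(** * Compactly supported smooth functions determine integrable functions *)

Section PlaneDensity.
Implicit Types (U V : set pt) (f g : pt -> R) (x : pt) (i : 'I_2).

Definition Cc f := smooth_on setT f /\ bsupp f.

Lemma Cc_continuous f : Cc f -> continuous f.
Proof. by move=> [sf _] x; exact: (smooth_partials sf I).1. Qed.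

Lemma Cc_measurable f : Cc f -> mfP (f : mpt -> R).
Proof. by move=> cf; apply: continuous_measurable2; exact: Cc_continuous. Qed.

Lemma Cc_int f : Cc f -> integ Leb (f : mpt -> R).
Proof. by move=> cf; apply: Cc_integ; [exact: Cc_continuous|case: cf]. Qed.

Lemma CcM f g : smooth_on setT f -> Cc g -> Cc (fun x => f x * g x).
Proof. by move=> sf [sg bg]; split; [exact: (smoothM openT sf sg)|exact: bsuppMr]. Qed.

Lemma Cc_sqr f : Cc f -> Cc (fun x => f x ^+ 2).
Proof. by move=> cf; exact: (CcM cf.1 cf). Qed.

Lemma CcD f g : Cc f -> Cc g -> Cc (fun x => f x + g x).
Proof. by move=> [sf bf] [sg bg]; split; [exact: (smoothD openT sf sg)|exact: bsuppD]. Qed.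

Lemma CcZ a f : Cc f -> Cc (fun x => a * f x).
Proof. by move=> cf; apply: CcM => //; exact: smooth_cst. Qed.

Lemma Cc_partial i f : Cc f -> Cc (partial i f).
Proof. by move=> [sf bf]; split; [exact: smooth_on_partial|exact: bsupp_partial]. Qed.

Lemma smooth_affine_step (a b c : R) :
 smooth_on [set: pt] (fun x => smooth_step (a * x.1 + b * x.2 + c)).
Proof.
have sa : smooth_on [set: pt] (fun x : pt => a * x.1 + b * x.2 + c).
 exact: (smoothD openT (smoothD openT (smoothZ a openT (smooth_fst openT))
  (smoothZ b openT (smooth_snd openT))) (@smooth_cst _ c)).
exact: (smooth_comp2 openT openT (@smooth_smooth_step) sa (smooth_cst 0)).
Qed.

(* A bump of height at most 1, positive exactly on the open box, that tends to the
  indicator of the box as m tends to infinity. *)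
Definition box_bump (a b c d m : R) (x : pt) : R :=
 smooth_step (m * (x.1 - a)) * smooth_step (m * (b - x.1)) *
 (smooth_step (m * (x.2 - c)) * smooth_step (m * (d - x.2))).

Lemma smooth_box_bump a b c d m : smooth_on setT (box_bump a b c d m).
Proof.
have e (u v w : R) f : (forall x : pt, u * x.1 + v * x.2 + w = f x) ->
  smooth_on [set: pt] (fun x => smooth_step (f x)).
 by move=> /funext <-; exact: smooth_affine_step.
apply: (smoothM openT); apply: (smoothM openT).
- by apply: (e m 0 (- m * a)) => x; ring.
- by apply: (e (- m) 0 (m * b)) => x; ring.
- by apply: (e 0 m (- m * c)) => x; ring.
- by apply: (e 0 (- m) (m * d)) => x; ring.
Qed.

Lemma box_bump_ge0 a b c d m x : 0 <= box_bump a b c d m x.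
Proof. by rewrite /box_bump; do 2!apply: mulr_ge0; exact: smooth_step_ge0. Qed.

Lemma box_bump_le1 a b c d m x : box_bump a b c d m x <= 1.
Proof. have p s t : 0 <= smooth_step s * smooth_step t :> R /\ smooth_step s * smooth_step t <= 1 :> R.
 by split; [rewrite mulr_ge0 ?smooth_step_ge0|rewrite mulr_ile1 ?smooth_step_ge0 ?smooth_step_le1].
by rewrite /box_bump mulr_ile1//; [exact: (p _ _).1|exact: (p _ _).1|exact: (p _ _).2|exact: (p _ _).2]. Qed.

Lemma box_bump_eq0 a b c d m x : 0 <= m ->
 ~~ [&& a < x.1, x.1 < b, c < x.2 & x.2 < d] -> box_bump a b c d m x = 0.
Proof.
move=> m0; have s0 (t : R) : t <= 0 -> smooth_step (m * t) = 0.
 by move=> t0; rewrite smooth_step_eq0// mulr_ge0_le0.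
rewrite !negb_and -!leNgt /box_bump => /or4P[] h.
- by rewrite s0 ?subr_le0// !mul0r.
- by rewrite (@s0 (b - _)) ?subr_le0// mulr0 mul0r.
- by rewrite (@s0 (_ - c)) ?subr_le0// mul0r mulr0.
- by rewrite (@s0 (d - _)) ?subr_le0// !mulr0.
Qed.

Lemma box_bump_gt0 a b c d m x : 0 < m ->
 [&& a < x.1, x.1 < b, c < x.2 & x.2 < d] -> 0 < box_bump a b c d m x.
Proof.
move=> m0 /and4P[*]; rewrite /box_bump.
by do 2!apply: mulr_gt0; apply: smooth_step_gt0; apply: mulr_gt0; rewrite ?subr_gt0.
Qed.

Lemma Cc_box_bump a b c d m : 0 <= m -> Cc (box_bump a b c d m).
Proof.
move=> m0; split; first exact: smooth_box_bump.
exists (`|a| + `|b| + `|c| + `|d|) => x x0.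
have : [&& a < x.1, x.1 < b, c < x.2 & x.2 < d].
 by apply: contraNT x0 => h; rewrite box_bump_eq0.
move=> /and4P[h1 h2 h3 h4]; rewrite prod_norm_le !ler_norml.
have [a1 a2] := (ler_norm a, ler_norm (- a)); have [b1 b2] := (ler_norm b, ler_norm (- b)).
have [c1 c2] := (ler_norm c, ler_norm (- c)); have [d1 d2] := (ler_norm d, ler_norm (- d)).
have [? [? [? ?]]] := (normr_ge0 a, (normr_ge0 b, (normr_ge0 c, normr_ge0 d))).
rewrite !normrN in a2 b2 c2 d2; apply/andP; split; apply/andP; split; lra.
Qed.

Lemma box_bump_cvg a b c d x :
 box_bump a b c d n%:R x @[n --> \oo] -->
  ([&& a < x.1, x.1 < b, c < x.2 & x.2 < d]%:R : R).
Proof.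
have [|h] := boolP [&& a < x.1, x.1 < b, c < x.2 & x.2 < d]; last first.
 by apply: cvg_near_cst; apply: nearW => n; rewrite box_bump_eq0.
have st (t s : R) : t < s -> \forall n \near \oo, smooth_step (n%:R * (s - t)) = 1.
 rewrite -subr_gt0 => t0; have [N hN] := near_invS t0; exists N.+1 => // [[//|n]] /= Nn.
 by rewrite smooth_step_eq1// -ler_pdivrMl ?ltr0n// mulr1 ltW// hN.
move=> /and4P[/st h1 /st h2 /st h3 /st h4]; apply: cvg_near_cst.
apply: filterS2 (filterI h1 h2) (filterI h3 h4) => n [e1 e2] [e3 e4].
by rewrite /box_bump e1 e2 e3 e4 !mulr1.
Qed.

Definition open_boxes : set (set pt) :=
 [set E | exists a b c d : R, E = [set x | [&& a < x.1, x.1 < b, c < x.2 & x.2 < d]]].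

(** The Dynkin class argument in [orth_Cc] asks for a generating family closed under
    intersections. *)
Lemma measurable_open_boxes : @measurable _ mpt = <<s open_boxes >>.
Proof.
apply/seteqP; split; last first.
 apply: smallest_sub; first exact: sigma_algebra_measurable.
 move=> _ [a [b [c [d ->]]]].
 rewrite (_ : [set x | _] = `]a, b[%classic `*` `]c, d[%classic).
  by apply: measurableX; exact: measurable_itv.
 apply/seteqP; split => x /=; rewrite !in_itv/=; first by move=> /and4P[-> -> -> ->].
 by move=> [/andP[-> ->] /andP[-> ->]].
pose T' := g_sigma_algebraType open_boxes.
have boxE (a b c d : nat -> R) : measurable (\bigcup_n [set x : pt | [&& a n < x.1, x.1 < b n, c n < x.2 & x.2 < d n]] : set T').
 by apply: bigcupT_measurable => n; apply: sub_sigma_algebra; exists (a n), (b n), (c n), (d n).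
have arch (x : pt) : exists n : nat, (- n%:R < x.1 < n%:R) && (- n%:R < x.2 < n%:R).
 by exists (Num.truncn `|x|).+1; rewrite -!ltr_norml -prod_norm_lt truncnS_gt.
have m1 : measurable_fun [set: T'] (fst : T' -> mT).
 apply: measurable_fun_gt => a; rewrite setTI.
 rewrite (_ : [set x | _] = \bigcup_n [set x : pt | [&& a < x.1, x.1 < n%:R, - n%:R < x.2 & x.2 < n%:R]]); first exact: boxE.
 apply/seteqP; split => [x /= ax|x [n _ /and4P[]//]].
 by have [n /andP[/andP[_ n1] /andP[n2 n3]]] := arch x; exists n => //=; apply/and4P.
have m2 : measurable_fun [set: T'] (snd : T' -> mT).
 apply: measurable_fun_gt => a; rewrite setTI.
 rewrite (_ : [set x | _] = \bigcup_n [set x : pt | [&& - n%:R < x.1, x.1 < n%:R, a < x.2 & x.2 < n%:R]]); first exact: boxE.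
 apply/seteqP; split => [x /= ax|x [n _ /and4P[]//]].
 by have [n /andP[/andP[n1 n2] /andP[_ n3]]] := arch x; exists n => //=; apply/and4P.
rewrite measurable_prod_measurableType.
apply: smallest_sub; first exact: smallest_sigma_algebra.
move=> _ [A mA [B mB <-]]; rewrite (_ : A `*` B = (fst @^-1` A) `&` (snd @^-1` B))//.
apply: (@measurableI _ T').
 by have := m1 measurableT A mA; rewrite setTI.
by have := m2 measurableT B mB; rewrite setTI.
Qed.

(** Bumps converging to the indicator of a box, dominated by |w|, show that w has zero integral over
    every box; a Dynkin class argument passes to all measurable sets. *)
Lemma orth_Cc (w : mpt -> R) : integ Leb w ->
 (forall f, Cc f -> (\int[Leb]_x (w x * f x) = 0)) -> w = cst 0 %[ae Leb].
Proof.
move=> wi h; have mw := integ_meas wi.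
have key (G : nat -> pt -> R) (g : mpt -> R) : (forall n, Cc (G n)) -> (forall n x, 0 <= G n x <= 1) ->
  mfP g -> (forall x, G n x @[n --> \oo] --> g x) ->
  integ Leb (fun x => w x * g x) /\ (\int[Leb]_x (w x * g x) = 0).
 move=> cG G01 mg Gg.
 have mF n : mfP (fun x => w x * G n x).
  by apply: measurable_funM => //; exact: Cc_measurable.
 have bF n x : `|w x * G n x| <= `|w x|.
  by have /andP[g0 g1] := G01 n x; rewrite normrM ler_piMr// ger0_norm.
 have cF : {ae Leb, forall x, w x * G n x @[n --> \oo] --> w x * g x}.
  by apply: aeW => x; apply: cvgM => //; exact: cvg_cst.
 have [i1] := int_dominated mF (measurable_funM mw mg) (integ_norm wi) bF cF.
 rewrite (_ : (fun n => _) = fun=> 0); last by apply/funext => n; exact: h.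
 by move=> /cvg0_eq0.
have box0 (a b c d : R) (E := [set x : pt | [&& a < x.1, x.1 < b, c < x.2 & x.2 < d]]) :
  (\int[Leb]_(x in E) (w x)%:E = 0)%E.
 have mE : measurable (E : set mpt).
  by rewrite measurable_open_boxes; apply: sub_sigma_algebra; exists a, b, c, d.
 have [n|n x||x|i1 e] := key (fun n => box_bump a b c d n%:R) (\1_E).
 - exact: Cc_box_bump.
 - by rewrite box_bump_ge0 box_bump_le1.
 - exact: measurable_indic.
 - rewrite indicE; have := @box_bump_cvg a b c d x; rewrite (_ : (x \in E) = [&& a < x.1, x.1 < b, c < x.2 & x.2 < d])//.
  by apply/idP/idP => [/set_mem//|]; move/mem_set.
 have := int_EFin i1; rewrite e => e'; apply: etrans (esym e').
 rewrite [LHS]integral_mkcond; apply: eq_integral => x _.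
 by rewrite patchE indicE; case: (x \in E); rewrite ?mulr1 ?mulr0.
have eE E : measurable E -> (\int[Leb]_(x in E) (w x)%:E)%E = (\int[Leb]_(x in E) w x)%R%:E.
 by move=> mE; rewrite fineK//; apply: integrable_fin_num => //; exact: integrableS wi.
(* Needed for complements in the Dynkin class; these bumps exhaust the plane. *)
have T0 : (\int[Leb]_x (w x)%:E = 0)%E.
 have [n|n x||x|_ e] := key (fun n => box_bump (- n%:R) n%:R (- n%:R) n%:R 1) (fun=> 1).
 - exact: Cc_box_bump.
 - by rewrite box_bump_ge0 box_bump_le1.
 - exact: measurable_cst.
 - apply: cvg_near_cst; exists (Num.truncn (`|x| + 1)).+1 => // n /= Nn.
  have xn : `|x| + 1 < n%:R.
   by apply: lt_le_trans (truncnS_gt _) _; rewrite ler_nat.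
  have : `|x| <= n%:R - 1 by lra.
  rewrite prod_norm_le !ler_norml => /andP[/andP[? ?] /andP[? ?]].
  by rewrite /box_bump !mul1r !smooth_step_eq1 ?mulr1//; lra.
 by rewrite eE//; congr EFin; rewrite -[RHS]e; apply: eq_int => x; rewrite mulr1.
have all0 E : measurable E -> (\int[Leb]_(x in E) (w x)%:E = 0)%E.
 rewrite measurable_open_boxes; apply: (@dynkin_induction _ mpt open_boxes
  (fun E => (\int[Leb]_(x in E) (w x)%:E = 0)%E)) => //.
 - exact: measurable_open_boxes.
 - move=> _ _ [a [b [c [d ->]]]] [a' [b' [c' [d' ->]]]].
  exists (Num.max a a'), (Num.min b b'), (Num.max c c'), (Num.min d d').
  apply/seteqP; split => x /=.
   by move=> [/and4P[? ? ? ?] /and4P[? ? ? ?]]; rewrite !gt_max !lt_min; apply/and4P; split; apply/andP.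
  by rewrite !gt_max !lt_min => /and4P[/andP[? ?] /andP[? ?] /andP[? ?] /andP[? ?]]; split; apply/and4P.
 - by move=> _ [a [b [c [d ->]]]]; exact: box0.
 - move=> D mD D0; rewrite eE; last exact: measurableC.
  have := @Rintegral_setU _ mpt R Leb D (~` D) w mD (measurableC mD).
  rewrite setUCr => /(_ wi); rewrite disj_set2E setICr eqxx => /(_ isT).
  move: T0; rewrite eE// => -[->]; move: D0; rewrite eE// => -[->].
  by rewrite add0r => <-.
 - move=> F mF tF F0; rewrite integral_bigcup//.
   by apply: eseries0 => n _ _; exact: F0.
  by apply: integrableS wi => //; exact: bigcupT_measurable.
have : ae_eq Leb setT (EFin \o w) (cst 0%E).
 apply: (@integral_ae_eq _ _ _ Leb setT measurableT (cst 0%E) (EFin \o w)) => //.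
 by move=> E _ mE; rewrite (all0 E mE) integral0.
by apply: filterS => x /(_ I) [].
Qed.

End PlaneDensity.

(** * Density in L2 and convolution *)

Section Mollifier.
Implicit Types (f g K : pt -> R) (v : mpt -> R) (x y z : pt) (i : 'I_2).

Lemma int_zero d (T : measurableType d) (mu : {measure set T -> \bar R}) : (\int[mu]_x (0 : R) = 0).
Proof. by rewrite /Rintegral integral0. Qed.

Lemma Cc_sq f : Cc f -> sq_integ Leb (f : mpt -> R).
Proof. by move=> cf; split; [exact: Cc_measurable|exact: (Cc_int (Cc_sqr cf))]. Qed.

Lemma Cc_bounded f : Cc f -> exists2 C : R, 0 < C & forall x, `|f x| <= C.
Proof. by move=> cf; apply: bsupp_bounded; [exact: Cc_continuous|case: cf]. Qed.

Lemma int_Cc_mul v f : sq_integ Leb v -> Cc f -> integ Leb (fun x => v x * f x).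
Proof. by move=> sv /Cc_sq sf; exact: sq_integM. Qed.

(** By [orth_dense] a class orthogonal to all test functions has to vanish. Such a class may fail to
    be integrable, so it is multiplied by bumps before [orth_Cc] is applied. *)
Lemma Cc_dense v (e : R) : sq_integ Leb v -> 0 < e ->
 exists2 f, Cc f & (\int[Leb]_x ((v x - f x) ^+ 2) < e).
Proof.
move=> sv e0; have H := hilbert_L2 Leb.
pose V := [set u : L2 Leb | exists2 f, Cc f & L2_repr u = (f : mpt -> R) %[ae Leb]].
have sV : subspace V.
 split.
  exists (fun=> 0); last exact: L2_repr0.
  by split; [exact: smooth_cst|exists 0 => x; rewrite eqxx].
 move=> a u w [f cf uf] [g cg wg]; exists (fun x => a * f x + g x).
  exact: (CcD (CcZ a cf) cg).
 have := L2_reprP_lin a u w.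
 by apply: filterS3 uf wg => x /(_ I) h1 /(_ I) h2 /(_ I) -> _; rewrite h1 h2.
have orth u : (forall w, V w -> inner Leb u w = 0) -> u = 0.
 move=> hu; apply: L2_eq.
 have su := L2_reprP u.
 have z (n : nat) : (fun x => L2_repr u x * box_bump (- n%:R) n%:R (- n%:R) n%:R 1 x) = cst 0 %[ae Leb].
  have cb := @Cc_box_bump (- n%:R) n%:R (- n%:R) n%:R 1 ler01.
  apply: orth_Cc; first exact: int_Cc_mul.
  move=> f cf; have cbf := CcM cb.1 cf.
  have := hu (L2_class (Cc_sq cbf)) _.
  rewrite (inner_L2 (ae_eq_refl Leb _ _) (L2_classE (Cc_sq cbf)) su.1 (Cc_sq cbf).1) => <-.
   by apply: eq_int => x; rewrite mulrA.
  by exists (fun x => box_bump (- n%:R) n%:R (- n%:R) n%:R 1 x * f x) => //; exact: L2_classE.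
 have := L2_repr0 Leb; have /ae_foralln := z.
 apply: filterS2 => x h /(_ I) -> _ /=.
 have [n hn] : exists n : nat, `|x| < n%:R.
  by exists (Num.truncn `|x|).+1; exact: truncnS_gt.
 move: hn; rewrite prod_norm_lt !ltr_norml => /andP[/andP[? ?] /andP[? ?]].
 have := h n I => /eqP; rewrite mulf_eq0 => /orP[/eqP//|/eqP b0].
 have : 0 < box_bump (- n%:R) n%:R (- n%:R) n%:R 1 x.
  by apply: box_bump_gt0 => //; apply/and4P.
 by rewrite b0 ltxx.
have s0 : 0 < sqrt e by rewrite sqrtr_gt0.
have [u [f cf uf] h] := orth_dense H sV orth (L2_class sv) s0.
exists f => //.
have := sqr_lt (normr_ge0 _) h; rewrite sqr_sqrtr ?(ltW e0)//.
rewrite L2_norm_sq; apply: le_lt_trans; apply: le_of_eq.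
have ae1 : L2_repr (L2_class sv - u) = (fun x => v x - f x) %[ae Leb].
 have := L2_reprP_lin (-1) u (L2_class sv); rewrite scaleN1r addrC => e1.
 apply: filterS3 e1 uf (L2_classE sv) => x /(_ I) -> /(_ I) -> /(_ I) -> _.
 by rewrite mulN1r addrC.
have m : measurable_fun setT (fun x => v x - f x).
 by apply: measurable_funB; [exact: (proj1 sv)|exact: (proj1 (Cc_sq cf))].
by rewrite (inner_L2 ae1 ae1 m m); apply: eq_int => x; rewrite expr2.
Qed.

Lemma Cc_lipschitz f : Cc f -> exists2 L : R, 0 < L & forall x y, `|f x - f y| <= L * `|x - y|.
Proof.
move=> cf; have [C0 C00 h0] := Cc_bounded (Cc_partial o0 cf).
have [C1 C10 h1] := Cc_bounded (Cc_partial o1 cf).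
exists (C0 + C1); first exact: addr_gt0.
move=> x y; have [z1 [z2 [_ _ ->]]] := @increment_mvt setT f y (`|x - y| + 1)
 (smooth_partials cf.1) (fun _ _ => I) x ltac:(by rewrite ltrDl).
apply: le_trans (ler_normD _ _) _; rewrite !normrM mulrDl.
have /andP[n1 n2] : (`|(x - y).1| <= `|x - y|) && (`|(x - y).2| <= `|x - y|) by rewrite -prod_norm_le.
by apply: lerD; rewrite mulrC ler_pM.
Qed.

Definition conv v K x : R := (\int[Leb]_y (v y * K (x - y))).

Lemma conv_integ v K x : integ Leb v -> Cc K -> integ Leb (fun y => v y * K (x - y)).
Proof.
move=> iv cK; have [C C0 hC] := Cc_bounded cK.
have iC := integZ C (integ_norm iv).
apply: integ_le iC; last by move=> y; rewrite normrM mulrC ler_wpM2r.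
apply: measurable_funM; first exact: (integ_meas iv).
apply: (@continuous_measurable2 (fun y => K (x - y))) => y; apply: continuous_comp; last exact: Cc_continuous.
by apply: cvgB; [exact: cvg_cst|exact: cvg_id].
Qed.

Lemma conv_near v K K' x (e : R) : integ Leb v -> Cc K -> Cc K' -> 0 <= e ->
 (forall z, `|K z - K' z| <= e) -> `|conv v K x - conv v K' x| <= e * (\int[Leb]_y `|v y|).
Proof.
move=> iv cK cK' e0 h; rewrite /conv -intB; [|exact: conv_integ..].
have i0 := integB (conv_integ x iv cK) (conv_integ x iv cK').
apply: le_trans (int_norm_le i0) _.
rewrite -intZ; last exact: integ_norm.
apply: int_le; [exact: integ_norm|exact/integZ/integ_norm|].
by move=> y; rewrite -mulrBr normrM mulrC ler_wpM2r.
Qed.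

Lemma Cc_shift K (a : pt) : Cc K -> Cc (fun z => K (a + z)).
Proof.
move=> [sK [B hB]]; split.
 apply: (@smooth_on_eq setT (fun z : pt => K (a.1 + z.1, a.2 + z.2)) _ openT).
  by move=> z _; congr K; rewrite [RHS]surjective_pairing.
 apply: (@smooth_comp2 setT setT K (fun z => a.1 + z.1) (fun z => a.2 + z.2) openT openT sK _ _ (fun _ _ => I)).
  exact: (smoothD openT (@smooth_cst _ _) (smooth_fst openT)).
 exact: (smoothD openT (@smooth_cst _ _) (smooth_snd openT)).
exists (B + `|a|) => z /hB h; rewrite -[z](addKr a).
by apply: le_trans (ler_normD _ _) _; rewrite normrN addrC lerD2r.
Qed.

Lemma convE v K x y : conv v K (x + y) = conv v (fun z => K (x + z)) y.
Proof. by apply: eq_int => z; rewrite addrA. Qed.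

Lemma conv_continuous v K : integ Leb v -> Cc K -> continuous (conv v K).
Proof.
move=> iv cK x; have [L L0 hL] := Cc_lipschitz cK.
apply/cvgrPdist_le => e e0; set N := (\int[Leb]_y `|v y|).
have N0 : 0 <= N by apply: int_ge0.
have d0 : 0 < e / (L * (N + 1)) by rewrite divr_gt0// mulr_gt0// ltr_wpDl.
have := @nbhsx_ballx _ pt x (e / (L * (N + 1))) d0; apply: filterS => y; rewrite -ball_normE /= => xy.
have -> : conv v K y = conv v (fun z => K (y - x + z)) x by rewrite -convE subrK.
apply: le_trans (conv_near x iv cK (Cc_shift _ cK) (_ : 0 <= L * `|x - y|) _) _.
- by rewrite mulr_ge0// ltW.
- by move=> z; apply: le_trans (hL _ _) _; rewrite opprD addrCA subrr addr0 opprB.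
move: xy; rewrite ltr_pdivlMr ?mulr_gt0 ?ltr_wpDl// => xy; rewrite -/N.
have := normr_ge0 (x - y); nra.
Qed.

Lemma basis_norm i : `|bv i| <= 1.
Proof. by rewrite /basis_vec prod_norm_le; case: ifP => _ /=; rewrite normr0 normr1 ler01 lexx. Qed.

(** The difference quotients of K converge uniformly, with error at most L |t| where L is a
    Lipschitz constant of its partial derivative. *)
Lemma is_derive_conv v K x i : integ Leb v -> Cc K ->
 is_derive x (bv i) (conv v K) (conv v (partial i K) x).
Proof.
move=> iv cK; have [L L0 hL] := Cc_lipschitz (Cc_partial i cK).
set N := (\int[Leb]_y `|v y|).
have N0 : 0 <= N by apply: int_ge0.
have b1 := basis_norm i.
apply: is_derive_cvg; apply/cvgrPdist_le => e e0.
have d0 : 0 < e / (L * (N + 1)) by rewrite divr_gt0// mulr_gt0// ltr_wpDl.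
near=> t; have tn : t != 0 by near: t; exact: nbhs_dnbhs_neq.
have tl : `|t| <= e / (L * (N + 1)) by near: t; exact: dnbhs0_le.
rewrite convE.
pose K' z := t^-1 * K (t *: bv i + z) - t^-1 * K z.
have cK' : Cc K'.
 have c2 := CcD (CcZ t^-1 (Cc_shift (t *: bv i) cK)) (CcZ (- t^-1) cK).
 by rewrite (_ : K' = fun z => t^-1 * K (t *: bv i + z) + - t^-1 * K z)//;
  apply/funext => z; rewrite mulNr.
have -> : t^-1 * (conv v (fun z => K (t *: bv i + z)) x - conv v K x) = conv v K' x.
 rewrite /conv -intB; [|exact: (conv_integ x iv (Cc_shift _ cK))|exact: conv_integ].
 rewrite -intZ; last exact: (integB (conv_integ x iv (Cc_shift _ cK)) (conv_integ x iv cK)).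
 by apply: eq_int => y; rewrite /K'; ring.
apply: le_trans (conv_near x iv (Cc_partial i cK) cK' (_ : 0 <= L * `|t|) _) _.
- by rewrite mulr_ge0// ltW.
- move=> z; have [s s01 es] := @partial_mvt i K z t (fun s _ => (smooth_partials cK.1 (x := _) I).2 i).
 have -> : K' z = partial i K (z + (s * t) *: bv i).
  by rewrite /K' -mulrBr [t *: _ + z]addrC es mulrA mulVf// mul1r.
 apply: le_trans (hL _ _) _; rewrite ler_wpM2l ?(ltW L0)//.
 rewrite opprD addrA subrr add0r normrN normrZ normrM.
 have /andP[s0 s1] := s01; rewrite (ger0_norm s0).
 rewrite -[leRHS]mulr1; apply: ler_pM => //; first by rewrite mulr_ge0.
 by rewrite ler_piMl.
move: tl; rewrite ler_pdivlMr ?mulr_gt0 ?ltr_wpDl// => tl; rewrite -/N.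
have := normr_ge0 t; nra.
Unshelve. all: by end_near. Qed.

Lemma partial_conv v K i : integ Leb v -> Cc K ->
 partial i (conv v K) = conv v (partial i K).
Proof. by move=> iv cK; apply/funext => x; case: (is_derive_conv x i iv cK). Qed.

Lemma smooth_conv v K : integ Leb v -> Cc K -> smooth_on setT (conv v K).
Proof.
move=> iv cK; apply: (@smooth_coind setT [set g | exists2 K', Cc K' & g = conv v K'] openT); last by exists K.
 move=> _ [K' cK' ->] x _; split=> [|i]; first exact: conv_continuous.
 by case: (is_derive_conv x i iv cK').
move=> _ i [K' cK' ->]; exists (conv v (partial i K')).
 by exists (partial i K') => //; exact: Cc_partial.
by move=> x _; rewrite partial_conv.
Qed.

End Mollifier.

(** * Schur's test for kernels supported near the diagonal *)

Section Schur.
Implicit Types (f g K : pt -> R) (v : mpt -> R) (x y z : pt) (i j : 'I_2) (n : nat).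

Definition square_ind (r : R) x y : R := (`|x - y| <= r)%R%:R.

Lemma square_ind_ge0 r x y : 0 <= square_ind r x y.
Proof. exact: ler0n. Qed.

Lemma square_ind_le1 r x y : square_ind r x y <= 1.
Proof. by rewrite /square_ind; case: (_ <= r). Qed.

Lemma square_indC r x y : square_ind r x y = square_ind r y x.
Proof. by rewrite /square_ind distrC. Qed.

Lemma Leb_sigma_finite : sigma_finite [set: mpt] Leb.
Proof.
exists (fun n => [set x : pt | `|x| <= n%:R]).
 apply/seteqP; split => // x _; exists (Num.truncn `|x|).+1 => //=.
 exact/ltW/truncnS_gt.
by move=> n; split; [exact: measurable_box|exact: Leb_box_fin].
Qed.

(** A copy of [Leb] that carries the sigma-finite structure which Tonelli's theorem asks for. *)
Definition plane_measure : set mpt -> \bar R := Leb.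
HB.instance Definition _ := Measure.copy plane_measure (Measure.sort Leb).
HB.instance Definition _ := Measure_isSigmaFinite.Build _ _ _ plane_measure Leb_sigma_finite.

Lemma square_indE x r : square_ind r x = (\1_[set y | `|x - y| <= r] : mpt -> R).
Proof.
apply/funext => y; rewrite /square_ind indicE; congr (nat_of_bool _)%:R.
by apply/idP/idP => [h|/set_mem//]; exact/mem_set.
Qed.

Lemma measurable_square_ind x r : mfP (square_ind r x : mpt -> R).
Proof. by rewrite square_indE; apply: measurable_indic; exact: measurable_square. Qed.

Lemma integ_square_ind x r : 0 <= r -> integ Leb (square_ind r x : mpt -> R).
Proof.
move=> r0; apply: bsupp_integ; first exact: measurable_square_ind.
 exists (`|x| + r) => y; rewrite /square_ind; case: (leP `|x - y| r) => [h _|]; last by rewrite eqxx.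
 by rewrite -[y](subKr x); apply: le_trans (ler_normB _ _) _; rewrite lerD2l.
by exists 1 => y; rewrite ger0_norm ?square_ind_ge0 ?square_ind_le1.
Qed.

Lemma square_ind_sqr r x y : square_ind r x y ^+ 2 = square_ind r x y.
Proof. by rewrite /square_ind; case: (_ <= r); rewrite ?expr1n ?expr0n. Qed.

Lemma int_square_ind x r : 0 <= r -> (\int[Leb]_y square_ind r x y = 4 * r ^+ 2).
Proof.
move=> r0; rewrite square_indE /Rintegral integral_indic ?setIT; last 2 first.
- exact: measurableT.
- exact: measurable_square.
by rewrite Leb_square.
Qed.

Lemma measurable_square_pair v (r : R) : mfP v ->
 measurable_fun [set: mpt * mpt] (fun p => (v p.2 * square_ind r p.1 p.2)%:E).
Proof.
move=> mv; pose F := @measurable_fst _ _ mpt mpt; pose S := @measurable_snd _ _ mpt mpt.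
pose f := @measurable_fst _ _ mT mT; pose s := @measurable_snd _ _ mT mT.
have mE : measurable ([set p : pt * pt | `|p.1 - p.2| <= r] : set (mpt * mpt)).
 have m1 := measurable_funB (measurableT_comp f F) (measurableT_comp f S).
 have m2 := measurable_funB (measurableT_comp s F) (measurableT_comp s S).
 have mI := measurable_itv `[- r, r].
 have := measurableI _ _ (m1 measurableT _ mI) (m2 measurableT _ mI); congr measurable.
 apply/seteqP; split => p /=; rewrite prod_norm_le !ler_norml !in_itv/=.
  by move=> [[_ ->] [_ ->]].
 by move=> /andP[].
apply/measurable_EFinP; apply: measurable_funM; first exact: (measurableT_comp mv S).
rewrite (_ : (fun p : mpt * mpt => square_ind r p.1 p.2) = \1_[set p : pt * pt | `|p.1 - p.2| <= r]).
 exact: measurable_indic.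
apply/funext => p; rewrite /square_ind indicE; congr (nat_of_bool _)%:R.
by apply/idP/idP => [h|/set_mem//]; exact/mem_set.
Qed.

Lemma tonelli_square v (r : R) : mfP v -> (forall y, 0 <= v y) -> 0 <= r ->
 (\int[Leb]_x \int[Leb]_y (v y * square_ind r x y)%:E = (4 * r ^+ 2)%:E * \int[Leb]_y (v y)%:E)%E.
Proof.
move=> mv v0 r0.
pose L : {sigma_finite_measure set mpt -> \bar R} := plane_measure.
pose F (p : mpt * mpt) : \bar R := (v p.2 * square_ind r p.1 p.2)%:E.
have mF : measurable_fun [set: mpt * mpt] F by exact: measurable_square_pair.
have F0 p : (0 <= F p)%E by rewrite lee_fin mulr_ge0// square_ind_ge0.
have := @fubini_tonelli _ _ mpt mpt R L L F mF F0; rewrite /F /= => ->.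
rewrite -ge0_integralZl//; last 3 first.
- exact/measurable_EFinP.
- by move=> y _; rewrite lee_fin.
- by rewrite lee_fin mulr_ge0// sqr_ge0.
apply: eq_integral => y _.
under eq_integral => x _ do rewrite EFinM square_indC.
rewrite ge0_integralZl//; last 3 first.
- by apply/measurable_EFinP; exact: measurable_square_ind.
- by move=> x _; rewrite lee_fin square_ind_ge0.
- by rewrite lee_fin.
rewrite muleC; congr (_ * _)%E.
have := int_EFin (integ_square_ind y r0); rewrite int_square_ind// => ->.
Qed.

(** Cauchy-Schwarz against the kernel itself, whose mass is 4 r^2, followed by Tonelli's theorem to
    integrate in x. *)
Lemma schur v (S : pt -> R) (C r : R) : 0 <= C -> 0 <= r -> sq_integ Leb v ->
 mfP (S : mpt -> R) ->
 (forall x, `|S x| <= C * (\int[Leb]_y (`|v y| * square_ind r x y))) ->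
 sq_integ Leb S /\ (\int[Leb]_x (S x ^+ 2) <= (4 * C * r ^+ 2) ^+ 2 * \int[Leb]_y (v y ^+ 2)).
Proof.
move=> C0 r0 [mv iv2] mS hS.
have mI x := measurable_square_ind x r.
have v20 y : 0 <= v y ^+ 2 by exact: sqr_ge0.
have mv2 : mfP (fun y => v y ^+ 2) by exact: measurable_funX.
have mS2 : mfP (fun x => S x ^+ 2) by exact: measurable_funX.
have ip x : integ Leb (fun y => v y ^+ 2 * square_ind r x y).
 apply: integ_le iv2 => [|y]; first exact: measurable_funM.
 rewrite ger0_norm; first by rewrite ler_piMr// square_ind_le1.
 by rewrite mulr_ge0// square_ind_ge0.
pose P x := (\int[Leb]_y (v y ^+ 2 * square_ind r x y)).
have eP x y : (`|v y| * square_ind r x y) ^+ 2 = v y ^+ 2 * square_ind r x y.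
 by rewrite exprMn real_normK ?num_real// square_ind_sqr.
have S2 x : S x ^+ 2 <= C ^+ 2 * (4 * r ^+ 2) * P x.
 have -> : S x ^+ 2 = `|S x| ^+ 2 by rewrite real_normK ?num_real.
 apply: le_trans (sqr_mono (normr_ge0 _) (hS x)) _; rewrite exprMn -mulrA.
 apply: ler_wpM2l; first exact: sqr_ge0.
 have s1 : sq_integ Leb (fun y => `|v y| * square_ind r x y).
  split; first by apply: measurable_funM => //; exact: measurableT_comp.
  by apply: integ_eq (ip x) => y; rewrite eP.
 have s2 : sq_integ Leb (square_ind r x : mpt -> R).
  by split => //; apply: integ_eq (integ_square_ind x r0) => y; rewrite square_ind_sqr.
 have := int_cauchy_schwarz s1 s2.
 under eq_Rintegral => y _ do rewrite -mulrA -expr2 square_ind_sqr.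
 under [X in _ <= X * _]eq_Rintegral => y _ do rewrite eP.
 under [X in _ <= _ * X]eq_Rintegral => y _ do rewrite square_ind_sqr.
 by rewrite int_square_ind// mulrC.
have tP := tonelli_square mv2 v20 r0.
set D := C ^+ 2 * (4 * r ^+ 2) in S2.
have D0 : 0 <= D by rewrite mulr_ge0 ?sqr_ge0// mulr_ge0// sqr_ge0.
have mPE : mfP (fun x => \int[Leb]_y (v y ^+ 2 * square_ind r x y)%:E)%E.
 pose L : {sigma_finite_measure set mpt -> \bar R} := plane_measure.
 apply: (@measurable_fun_fubini_tonelli_F _ _ mpt mpt R L
  (fun p => (v p.2 ^+ 2 * square_ind r p.1 p.2)%:E)).
 - exact: (@measurable_square_pair (fun y => v y ^+ 2) r mv2).
 - by move=> p; rewrite lee_fin mulr_ge0// square_ind_ge0.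
have le1 : (\int[Leb]_x (S x ^+ 2)%:E <= D%:E * ((4 * r ^+ 2)%:E * \int[Leb]_y (v y ^+ 2)%:E))%E.
 rewrite -tP -ge0_integralZl//.
 - apply: ge0_le_integral => //.
  + by move=> x _; rewrite lee_fin sqr_ge0.
  + exact/measurable_EFinP.
  + exact: measurable_funeM.
  + by move=> x _; rewrite -(int_EFin (ip x)) -EFinM lee_fin; exact: S2.
 - move=> x _; apply: integral_ge0 => y _; rewrite lee_fin mulr_ge0// square_ind_ge0.
rewrite -(int_EFin iv2) -!EFinM in le1.
have iS : integ Leb (fun x => S x ^+ 2).
 apply/integrableP; split; first exact/measurable_EFinP.
 under eq_integral => x _ do rewrite /= ger0_norm ?sqr_ge0//.
 by apply: le_lt_trans le1 _; rewrite ltry.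
split; first by split.
move: le1; rewrite -(int_EFin iS) lee_fin => /le_trans; apply.
by rewrite /D mulrA; apply: le_of_eq; congr (_ * _); ring.
Qed.

Lemma int_kernel_bound v (h : mpt -> R) x (D r : R) : integ Leb v -> 0 <= r -> 0 <= D ->
 mfP h -> (forall y, `|h y| <= D * square_ind r x y) ->
 integ Leb (fun y => v y * h y) /\
 `|(\int[Leb]_y (v y * h y))| <= D * (\int[Leb]_y (`|v y| * square_ind r x y)).
Proof.
move=> iv r0 D0 mh hD.
have hD' y : `|h y| <= D.
 by apply: le_trans (hD y) _; rewrite ler_piMr// square_ind_le1.
have i1 := integM_bounded mh hD' iv.
have i2 : integ Leb (fun y => `|v y| * square_ind r x y).
 apply: (integM_bounded (C := 1) _ _ (integ_norm iv)); first exact: measurable_square_ind.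
 by move=> y; rewrite ger0_norm ?square_ind_ge0 ?square_ind_le1.
split => //; apply: le_trans (int_norm_le i1) _; rewrite -intZ//.
apply: int_le; [exact: integ_norm|exact: integZ|].
by move=> y; rewrite normrM mulrCA ler_wpM2l.
Qed.

Lemma small_support_sq (h : pt -> R) (d B : R) : continuous h -> 0 <= d -> 0 <= B ->
 (forall x, `|h x| <= d) -> (forall x, B < `|x| -> h x = 0) ->
 sq_integ Leb (h : mpt -> R) /\ (\int[Leb]_x (h x ^+ 2) <= d ^+ 2 * (4 * B ^+ 2)).
Proof.
move=> ch d0 B0 hd hB.
have mh := continuous_measurable2 ch.
have i1 := integZ (d ^+ 2) (integ_square_ind (0 : pt) B0).
have le x : `|h x ^+ 2| <= d ^+ 2 * square_ind B (0 : pt) x.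
 rewrite ger0_norm ?sqr_ge0// /square_ind sub0r normrN; case: (leP `|x| B) => [_|/hB ->].
  by rewrite mulr1 -(ger0_norm d0) -[leLHS]real_normK ?num_real// sqr_mono// (ger0_norm d0).
 by rewrite mulr0 expr0n.
have i2 : integ Leb (fun x => h x ^+ 2) by exact: (@integ_le _ _ _ Leb (fun x => h x ^+ 2) _ (measurable_funX 2 mh) le i1).
split; first by split.
rewrite -(int_square_ind (0 : pt) B0) -intZ; last exact: integ_square_ind.
by apply: int_le => // x; apply: le_trans (ler_norm _) (le x).
Qed.

(* Kernel operators obeying a uniform Schur bound converge on all of L2 as soon as
  they converge on compactly supported smooth functions. *)
Lemma schur_cvg (h : nat -> pt -> mpt -> R) (C c : R) : 0 <= C ->
 (forall n x, mfP (h n x)) ->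
 (forall n x y, `|h n x y| <= C * n.+1%:R ^+ 2 * square_ind n.+1%:R^-1 x y) ->
 let T n v x := (\int[Leb]_y (v y * h n x y)) in
 (forall n v, integ Leb v -> continuous (T n v)) ->
 (forall f, Cc f -> exists2 D : R, 0 <= D & forall n x, `|T n f x - c * f x| <= D * n.+1%:R^-1) ->
 forall v, integ Leb v -> sq_integ Leb v ->
 (forall n, sq_integ Leb (T n v : mpt -> R)) /\
 (\int[Leb]_x ((T n v x - c * v x) ^+ 2)) @[n --> \oo] --> (0 : R).
Proof.
move=> C0 mh hb T cT fT v iv sv.
have n0 n : (0 : R) <= n.+1%:R^-1 by rewrite invr_ge0.
have C1 n : 0 <= C * n.+1%:R ^+ 2 by rewrite mulr_ge0// sqr_ge0.
have kb n x w (iw : integ Leb w) := int_kernel_bound iw (n0 n) (C1 n) (mh n x) (hb n x).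
have bd n w : integ Leb w -> sq_integ Leb w -> sq_integ Leb (T n w : mpt -> R) /\
  (\int[Leb]_x (T n w x ^+ 2) <= (4 * C) ^+ 2 * \int[Leb]_y (w y ^+ 2)).
 move=> iw sw.
 have [s1 s2] := schur (C1 n) (n0 n) sw (continuous_measurable2 (cT n w iw)) (fun x => (kb n x w iw).2).
 split => //; apply: le_trans s2 _; apply: le_of_eq.
 congr (_ ^+ 2 * _); have : (n.+1%:R : R) != 0 by rewrite pnatr_eq0.
 by move: (n.+1%:R : R) => k k0; field.
split; first by move=> n; case: (bd n v iv sv).
apply: cvg0_eps => e e0.
(* Writing v as a test function f plus a remainder and using (a + b)^2 <= 2 a^2 + 2 b^2 twice
   charges the remainder with 4 (4 C)^2 + 2 c^2, which is below K. *)
pose K := 4 * (4 * C) ^+ 2 + 4 * c ^+ 2 + 1.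
have K0 : 0 < K by rewrite /K ltr_wpDl// addr_ge0// mulr_ge0// sqr_ge0.
have [f cf fe] := @Cc_dense v (e / (2 * K)) sv ltac:(by rewrite divr_gt0// mulr_gt0).
have [D D0 hD] := fT f cf; have [B B0 fB] := bsupp_pos cf.2.
have hB n x : B + 1 < `|x| -> T n f x - c * f x = 0.
 move=> hx; rewrite fB ?mulr0 ?subr0; last by lra.
 rewrite /T -[RHS](int_zero Leb); apply: eq_int => y.
 have [k|k] := leP B `|y|; first by rewrite fB// mul0r.
 apply/eqP; rewrite mulf_eq0 -[h n x y == 0]normr_le0; apply/orP; right.
 apply: le_trans (hb n x y) _; rewrite /square_ind (_ : (`|x - y| <= _) = false) ?mulr0//.
 apply/negbTE; rewrite -ltNge; apply: (@le_lt_trans _ _ 1); first by rewrite invf_le1// ler1n.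
 by have := ler_normD (x - y) y; rewrite subrK; lra.
pose D' := D ^+ 2 * (4 * (B + 1) ^+ 2).
have D'0 : 0 <= D' by rewrite mulr_ge0 ?sqr_ge0// mulr_ge0// sqr_ge0.
have sf := Cc_sq cf; have if_ := Cc_int cf.
have svf : sq_integ Leb (fun x => v x - f x).
 by have := sq_integD sv (sq_integZ (-1) sf); rewrite (_ : (fun x => _) = fun x => v x - f x)//; apply/funext => x; rewrite mulN1r.
have ivf := integB iv if_.
have D1 : 0 < D' + 1 by rewrite ltr_wpDl.
have h0 : 0 < e / 8 / (D' + 1) by rewrite divr_gt0// divr_gt0.
have [N hN] := near_invS h0.
near=> n.
have nD : D' * n.+1%:R^-1 <= e / 8.
 have hn : n.+1%:R^-1 < e / 8 / (D' + 1).
  by apply: hN; near: n; exact: nbhs_infty_ge.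
 move: hn; rewrite ltr_pdivlMr// => /ltW; apply: le_trans.
 by rewrite mulrC ler_wpM2l// ?invr_ge0// lerDl.
have [s1 s2] := bd n _ ivf svf.
have ch : continuous (fun x => T n f x - c * f x).
 by move=> x; apply: cvgB (cT n f if_ x) (cvgM (cvg_cst c) (Cc_continuous cf (x := x))).
have [s3 s4] := small_support_sq ch (mulr_ge0 D0 (n0 n)) (addr_ge0 (ltW B0) ler01) (hD n) (hB n).
have s5 := sq_integD s1 s3.
have e1 x : T n v x - c * v x = (T n (fun y => v y - f y) x + (T n f x - c * f x)) + (- c) * (v x - f x).
 by rewrite /T; under [X in X + _ + _]eq_Rintegral do rewrite mulrBl; rewrite intB; [ring|exact: (kb n x _ _).1..].
rewrite ger0_norm; last by apply: int_ge0 => x; exact: sqr_ge0.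
under eq_Rintegral do rewrite e1.
apply: le_trans (int_sqD_le s5 (sq_integZ (- c) svf)) _.
have := int_sqD_le s1 s3.
have -> : (\int[Leb]_x ((- c * (v x - f x)) ^+ 2)) = c ^+ 2 * (\int[Leb]_x ((v x - f x) ^+ 2)).
 by rewrite -intZ; [apply: eq_int => x; rewrite exprMn sqrrN|case: svf].
set J := (\int[Leb]_x ((v x - f x) ^+ 2)) in fe s2 *.
set I2 := (\int[Leb]_x ((T n f x - c * f x) ^+ 2)) in s4 *.
set I1 := (\int[Leb]_x (T n (fun y => v y - f y) x ^+ 2)) in s2 *.
set I := (\int[Leb]_x (_ ^+ 2)) => hI.
have J0 : 0 <= J by apply: int_ge0 => x; exact: sqr_ge0.
have I2e : I2 <= e / 8.
 apply: le_trans s4 _; apply: le_trans nD; rewrite /D' exprMn mulrAC ler_wpM2l// expr2.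
 by rewrite ler_piMl ?invr_ge0// invf_le1// ler1n.
have KJ : K * J <= e / 2.
 apply: le_trans (ler_wpM2l (ltW K0) (ltW fe)) _; apply: le_of_eq.
 by field; rewrite gt_eqF.
clear -hI s2 I2e KJ J0; rewrite /K in KJ.
set a := (4 * C) ^+ 2 in s2 KJ *; set b := c ^+ 2 in KJ *.
have b0 : 0 <= b by exact: sqr_ge0.
have : 0 <= b * J by exact: mulr_ge0.
nra.
Unshelve. all: by end_near. Qed.

End Schur.

(** * Mollifiers and Friedrichs' commutator lemma *)

Section Friedrichs.
Implicit Types (f g K a : pt -> R) (v : mpt -> R) (x y z p : pt) (i j : 'I_2) (n : nat) (s r : R).

Lemma smooth_affine f p s : smooth_on setT f -> smooth_on setT (fun y => f (p + s *: y)).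
Proof.
move=> sf; apply: (@smooth_on_eq setT (fun y : pt => f (p.1 + s * y.1, p.2 + s * y.2)) _ openT).
 by move=> z _; congr f; rewrite [RHS]surjective_pairing.
apply: (@smooth_comp2 setT setT f (fun z => p.1 + s * z.1) (fun z => p.2 + s * z.2) openT openT sf _ _ (fun _ _ => I)).
 exact: (smoothD openT (@smooth_cst _ _) (smoothZ s openT (smooth_fst openT))).
exact: (smoothD openT (@smooth_cst _ _) (smoothZ s openT (smooth_snd openT))).
Qed.

Lemma partial_affine f p s i x : smooth_on setT f ->
 partial i (fun y => f (p + s *: y)) x = s * partial i f (p + s *: x).
Proof.
move=> sf.
have e : (fun y : pt => f (p + s *: y)) = (fun y => f (p.1 + s * y.1, p.2 + s * y.2)).
 by apply/funext => y; congr f; rewrite [LHS]surjective_pairing.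
have d1 : is_derive x (bv i) (fun z : pt => p.1 + s * z.1) (s * (bv i).1).
 have := @is_derive_fst x (bv i) => h.
 by have := is_deriveD (is_derive_cst p.1 x (bv i)) (is_deriveZ s h); rewrite add0r.
have d2 : is_derive x (bv i) (fun z : pt => p.2 + s * z.2) (s * (bv i).2).
 have := @is_derive_snd x (bv i) => h.
 by have := is_deriveD (is_derive_cst p.2 x (bv i)) (is_deriveZ s h); rewrite add0r.
have [_] := @is_derive_comp2 setT f (fun z => p.1 + s * z.1) (fun z => p.2 + s * z.2) x (bv i) openT
 (smooth_partials sf) (fun j => (smooth_partials (smooth_on_partial j sf) (x := _) I).1) I
 (@ex_derive _ _ _ _ _ _ _ d1) (@ex_derive _ _ _ _ _ _ _ d2).
rewrite /partial e => ->; rewrite !derive_val.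
have -> : p + s *: x = (p.1 + s * x.1, p.2 + s * x.2) by rewrite [LHS]surjective_pairing.
by have [->|->] := ord2P i; rewrite /= !mulr0 mulr1 ?addr0 ?add0r mulrC.
Qed.

Lemma Cc_affine f p s : s != 0 -> Cc f -> Cc (fun y => f (p + s *: y)).
Proof.
move=> s0 [sf [B hB]]; split; first exact: smooth_affine.
exists (`|s|^-1 * (B + `|p|)) => y /hB h.
rewrite mulrC ler_pdivlMr ?normr_gt0// mulrC -normrZ -[s *: y](addKr p).
by apply: le_trans (ler_normD _ _) _; rewrite normrN addrC lerD2r.
Qed.

Lemma Cc_reflect f x : Cc f -> Cc (fun y => f (x - y)).
Proof.
move=> cf; have h := @Cc_affine f x (-1) _ cf; rewrite (_ : (fun y => f (x - y)) = (fun y => f (x + -1 *: y))).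
 by apply: h; rewrite oppr_eq0 oner_eq0.
by apply/funext => y; rewrite scaleN1r.
Qed.

Lemma partial_reflect f x i y : Cc f -> partial i (fun y => f (x - y)) y = - partial i f (x - y).
Proof.
move=> cf; have := @partial_affine f x (-1) i y cf.1; rewrite scaleN1r mulN1r => <-.
by congr (partial i _ y); apply/funext => z; rewrite scaleN1r.
Qed.

Lemma cutoff (B : R) : 0 <= B -> exists2 f, Cc f & forall x, `|x| <= B -> f x = 1.
Proof.
move=> B0; exists (box_bump (- B - 1) (B + 1) (- B - 1) (B + 1) 1); first exact: Cc_box_bump.
move=> x; rewrite prod_norm_le !ler_norml => /andP[/andP[? ?] /andP[? ?]].
by rewrite /box_bump !mul1r !smooth_step_eq1 ?mulr1//; lra.
Qed.

(** On bounded x the integral equals the convolution of K with a cutoff equal to 1 on a large ball.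
    The partials of this convolution are integrals of partials, hence zero, so the value is constant
    in x. *)
Lemma int_reflect K x : Cc K -> (\int[Leb]_y K (x - y) = \int[Leb]_y K (0 - y)).
Proof.
move=> cK; have [B [B0 hB hBi]] : exists B : R, [/\ 0 < B, (forall w : pt, B <= `|w| -> K w = 0) &
  forall i (w : pt), B <= `|w| -> partial i K w = 0].
 have [B0 B00 h0] := bsupp_pos cK.2; have [B1 B10 h1] := bsupp_pos (bsupp_partial o0 cK.2).
 have [B2 B20 h2] := bsupp_pos (bsupp_partial o1 cK.2).
 exists (B0 + B1 + B2); split; [by rewrite !addr_gt0| |].
  by move=> w hw; apply: h0; lra.
 by move=> i w hw; have [->|->] := ord2P i; [apply: h1|apply: h2]; lra.
have [f cf f1] := @cutoff (`|x| + 1 + B) ltac:(by rewrite addr_ge0// ?ltW// addr_gt0// ltr_wpDl).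
have iv := Cc_int cf.
have e K' z : Cc K' -> (forall w, B <= `|w| -> K' w = 0) -> `|z| < `|x| + 1 ->
  conv f K' z = (\int[Leb]_y K' (z - y)).
 move=> cK' hK' hz; apply: eq_int => y.
 have [h|h] := leP `|y| (`|x| + 1 + B); first by rewrite f1// mul1r.
 rewrite hK' ?mulr0// -(lerD2l `|z|) addrC; apply: le_trans (_ : `|y| <= _).
  by apply/ltW/(lt_trans _ h); rewrite addrC ltrD2r.
 by rewrite -{1}[y](subKr z); exact: ler_normB.
have x1 : `|x| < `|x| + 1 by rewrite ltrDl.
have zero1 : `|0 : pt| < `|x| + 1 by rewrite normr0 ltr_wpDl.
rewrite -(e K x cK hB x1) -(e K 0 cK hB zero1); apply/eqP; rewrite -subr_eq0; apply/eqP.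
have sc := smooth_conv iv cK.
have [z1 [z2 [h1 h2 ->]]] := @increment_mvt setT (conv f K) 0 (`|x| + 1)
 (smooth_partials sc) (fun _ _ => I) x ltac:(by rewrite subr0).
have p0 i z : `|z| < `|x| + 1 -> partial i (conv f K) z = 0.
 move=> hz; rewrite partial_conv// (e _ _ (Cc_partial i cK) _ hz).
  rewrite -[RHS](@oppr0 R) -[X in - X](int_partial0 i (Cc_reflect z cK).1 (Cc_reflect z cK).2).
  rewrite -[RHS]mulN1r -intZ; last exact: (Cc_int (Cc_partial i (Cc_reflect z cK))).
  by apply: eq_int => y; rewrite partial_reflect// mulN1r opprK.
 exact: hBi.
rewrite !subr0 in h1 h2; rewrite !p0 ?mulr0 ?addr0//; exact: le_lt_trans x1.
Qed.

Definition unit_bump : pt -> R := box_bump (-1) 1 (-1) 1 2.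

(** The mass in the denominator is the one seen from the origin; [int_reflect] makes it the same
    from every x. The summand 0 gives the argument the affine shape of [Cc_affine]. *)
Definition moll n : pt -> R := fun x =>
 (\int[Leb]_y unit_bump (n.+1%:R *: (0 - y)))^-1 * unit_bump (0 + n.+1%:R *: x).

Lemma Cc_unit_bump : Cc unit_bump.
Proof. exact: Cc_box_bump. Qed.

Lemma unit_bump_eq0 x : 1 <= `|x| -> unit_bump x = 0.
Proof.
move=> h; apply: box_bump_eq0 => //; apply: contraTN h => /and4P[*].
by rewrite -ltNge prod_norm_lt !ltr_norml; apply/andP; split; apply/andP.
Qed.

Lemma unit_bump_eq1 x : `|x| <= 1 / 2 -> unit_bump x = 1.
Proof.
rewrite prod_norm_le !ler_norml => /andP[/andP[? ?] /andP[? ?]].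
by rewrite /unit_bump /box_bump !smooth_step_eq1 ?mulr1//; lra.
Qed.

Lemma unit_bump_ge0 x : 0 <= unit_bump x.
Proof. exact: box_bump_ge0. Qed.

Lemma unit_bump_le1 x : unit_bump x <= 1.
Proof. exact: box_bump_le1. Qed.

(** The bump is 1 on the sup-norm ball of radius 1/2, whose copy scaled by 1/(n+1) has area
    (n+1)^-2. *)
Lemma mollifier_mass n : n.+1%:R ^- 2 <= (\int[Leb]_y unit_bump (n.+1%:R *: (0 - y))).
Proof.
have n0 : (0 : R) < n.+1%:R by [].
have r0 : 0 <= (2 * n.+1%:R)^-1 :> R by rewrite invr_ge0 mulr_ge0.
have -> : (n.+1%:R ^- 2 : R) = 4 * (2 * n.+1%:R)^-1 ^+ 2.
 move: (n.+1%:R : R) n0 => k k0; field; exact: lt0r_neq0.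
rewrite -(int_square_ind (0 : pt) r0); apply: int_le.
- exact: integ_square_ind.
- have h := @Cc_affine unit_bump 0 (- n.+1%:R) _ Cc_unit_bump.
 have := Cc_int (h ltac:(by rewrite oppr_eq0 pnatr_eq0)); apply: integ_eq => y.
 by rewrite !add0r scalerN scaleNr.
- move=> y; rewrite /square_ind; case: (leP `|0 - y| _) => h; last exact: unit_bump_ge0.
 rewrite unit_bump_eq1// normrZ ger0_norm ?ler0n//.
 by apply: le_trans (ler_wpM2l (ltW n0) h) _; rewrite invfM mulrCA divff ?gt_eqF// mulr1 div1r.
Qed.

Lemma mollifier_mass_gt0 n : 0 < (\int[Leb]_y unit_bump (n.+1%:R *: (0 - y))).
Proof. by apply: lt_le_trans (mollifier_mass n); rewrite invr_gt0 exprn_gt0. Qed.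

Lemma mollifier_mass_inv n : (\int[Leb]_y unit_bump (n.+1%:R *: (0 - y)))^-1 <= n.+1%:R ^+ 2 :> R.
Proof.
rewrite -[leRHS]invrK lef_pV2 ?posrE; first exact: mollifier_mass.
 exact: mollifier_mass_gt0.
by rewrite invr_gt0 exprn_gt0.
Qed.

Lemma Cc_mollifier n : Cc (moll n).
Proof. by apply: CcZ; apply: Cc_affine; [rewrite pnatr_eq0|exact: Cc_unit_bump]. Qed.

Lemma mollifier_ge0 n x : 0 <= moll n x.
Proof. by rewrite mulr_ge0 ?unit_bump_ge0// invr_ge0 ltW// mollifier_mass_gt0. Qed.

Lemma scaled_norm_ge1 n x : n.+1%:R^-1 < `|x| -> 1 <= `|0 + n.+1%:R *: x|.
Proof.
move=> h; rewrite add0r normrZ ger0_norm ?ler0n// -ler_pdivrMl ?ltr0n// mulr1; exact: ltW.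
Qed.

Lemma mollifier_bound n x : `|moll n x| <= n.+1%:R ^+ 2 * square_ind n.+1%:R^-1 0 x.
Proof.
rewrite ger0_norm ?mollifier_ge0// /square_ind sub0r normrN; case: (leP `|x|) => h; last first.
 by rewrite mulr0 /moll unit_bump_eq0 ?mulr0// scaled_norm_ge1.
apply: ler_pM; rewrite ?unit_bump_ge0 ?unit_bump_le1 ?mollifier_mass_inv//.
by rewrite invr_ge0 ltW// mollifier_mass_gt0.
Qed.

Lemma mollifier_eq0 n x : n.+1%:R^-1 < `|x| -> moll n x = 0.
Proof. by move=> h; rewrite /moll unit_bump_eq0 ?mulr0// scaled_norm_ge1. Qed.

Lemma partial_mollifier_bound : exists2 C : R, 0 < C & forall n i x,
 `|partial i (moll n) x| <= C * n.+1%:R ^+ 3 * square_ind n.+1%:R^-1 0 x.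
Proof.
have [C0 C00 h0] := Cc_bounded (Cc_partial o0 Cc_unit_bump).
have [C1 C10 h1] := Cc_bounded (Cc_partial o1 Cc_unit_bump).
exists (C0 + C1); first exact: addr_gt0.
have hC i x : `|partial i unit_bump x| <= C0 + C1.
 by have [->|->] := ord2P i; [apply: le_trans (h0 x) _; rewrite lerDl ltW|apply: le_trans (h1 x) _; rewrite lerDr ltW].
move=> n i x; rewrite /square_ind sub0r normrN.
case: (leP `|x|) => h; last first.
 rewrite mulr0 (_ : partial i (moll n) x = 0) ?normr0 ?lexx//.
 have oV : open [set y : pt | n.+1%:R^-1 < `|y|] by exact: open_norm_gt.
 rewrite (@partial_eq _ (moll n) (fun=> 0) i oV _ x (mem_set h)) ?partial_cst//.
 by move=> y /set_mem hy; rewrite /moll unit_bump_eq0 ?mulr0// scaled_norm_ge1.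
have sa := @smooth_affine unit_bump 0 n.+1%:R Cc_unit_bump.1.
rewrite /moll partialZ; last exact: ((smooth_partials sa (x := x) I).2 i).
rewrite (partial_affine _ _ _ _ Cc_unit_bump.1) normrM mulr1.
have -> : (C0 + C1) * n.+1%:R ^+ 3 = n.+1%:R ^+ 2 * (n.+1%:R * (C0 + C1)) by ring.
have b1 : `|(\int[Leb]_y unit_bump (n.+1%:R *: (0 - y)))^-1| <= n.+1%:R ^+ 2.
 by rewrite ger0_norm ?mollifier_mass_inv// invr_ge0 ltW// mollifier_mass_gt0.
have b2 : `|n.+1%:R * partial i unit_bump (0 + n.+1%:R *: x)| <= n.+1%:R * (C0 + C1).
 by rewrite normrM normr_nat; apply: ler_wpM2l => //; exact: hC.
exact: (ler_pM (normr_ge0 _) (normr_ge0 _) b1 b2).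
Qed.

Lemma partial_mollifier_eq0 n j z : n.+1%:R^-1 < `|z| -> partial j (moll n) z = 0.
Proof.
move=> hz; have [C _ /(_ n j z)] := partial_mollifier_bound.
rewrite /square_ind sub0r normrN; case: (leP `|z| _) => [h|_]; last by rewrite mulr0 normr_le0 => /eqP.
by have := lt_le_trans hz h; rewrite ltxx.
Qed.

Lemma int_mollifier n x : (\int[Leb]_y moll n (x - y) = 1).
Proof.
rewrite (int_reflect x (Cc_mollifier n)) /moll intZ.
 under [X in _ * X]eq_Rintegral => y _ do rewrite add0r.
 by rewrite mulVf// gt_eqF// mollifier_mass_gt0.
have h := Cc_int (Cc_reflect 0 (@Cc_affine unit_bump 0 n.+1%:R _ Cc_unit_bump)).
by apply: h; rewrite pnatr_eq0.
Qed.

Lemma square_ind_sub x y r : square_ind r 0 (x - y) = square_ind r x y.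
Proof. by rewrite /square_ind sub0r normrN. Qed.

Lemma integM_Cc v f : integ Leb v -> Cc f -> integ Leb (fun x => v x * f x).
Proof.
move=> iv cf; have [C _ hC] := Cc_bounded cf.
exact: (integM_bounded (Cc_measurable cf) hC iv).
Qed.

Lemma mollify_cvg v : integ Leb v -> sq_integ Leb v ->
 (forall n, sq_integ Leb (conv v (moll n) : mpt -> R)) /\
 (\int[Leb]_x ((conv v (moll n) x - v x) ^+ 2)) @[n --> \oo] --> (0 : R).
Proof.
move=> iv sv; have cr n x := Cc_reflect x (Cc_mollifier n).
have [] := @schur_cvg (fun n x y => moll n (x - y)) 1 1 ler01 _ _ _ _ v iv sv; last first.
- move=> h1 h2; split => //; suff <- : (fun n => (\int[Leb]_x ((conv v (moll n) x - 1 * v x) ^+ 2))) =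
  (fun n => (\int[Leb]_x ((conv v (moll n) x - v x) ^+ 2))) by exact: h2.
 by apply/funext => n; apply: eq_int => x; rewrite mul1r.
- move=> f cf; have [L L0 hL] := Cc_lipschitz cf; exists L; first exact: ltW.
 move=> n x; rewrite mul1r; have ck := Cc_int (cr n x).
 have i0 := conv_integ x (Cc_int cf) (Cc_mollifier n).
 rewrite -[X in _ - X]mulr1 -[X in _ - _ * X](int_mollifier n x) -intZ// -intB//; last exact: integZ.
 apply: le_trans (int_norm_le (integB i0 (integZ (f x) ck))) _.
 rewrite -[leRHS]mulr1 -[X in _ <= _ * X](int_mollifier n x) -intZ//.
 apply: int_le; [exact: integ_norm (integB i0 (integZ (f x) ck))|exact: integZ|] => y.
 rewrite -mulrBl normrM (ger0_norm (mollifier_ge0 _ _)).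
 have [h|h] := leP `|x - y| n.+1%:R^-1; last by rewrite mollifier_eq0// !mulr0.
 apply: ler_wpM2r; first exact: mollifier_ge0.
 by rewrite distrC; apply: le_trans (hL _ _) _; rewrite ler_wpM2l// ltW.
- by move=> n w iw; exact: conv_continuous (Cc_mollifier n).
- by move=> n x y; rewrite mul1r -square_ind_sub; exact: mollifier_bound.
- by move=> n x; exact: Cc_measurable.
Qed.

(** The commutator is the integral operator with kernel h below. The factor a x - a y, of size 1/n
    on the support, compensates the derivative of the mollifier, of size n^3, and gives a uniform
    Schur bound. On a test function f an integration by parts leaves f' (a x - a y) under the
    integral, which tends to zero. *)
Lemma friedrichs a j v : Cc a -> integ Leb v -> sq_integ Leb v ->
 let Q n x := a x * conv v (partial j (moll n)) x
  - conv (fun y => v y * a y) (partial j (moll n)) x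
  + conv (fun y => v y * partial j a y) (moll n) x in
 (forall n, sq_integ Leb (Q n : mpt -> R)) /\ (\int[Leb]_x (Q n x ^+ 2)) @[n --> \oo] --> (0 : R).
Proof.
move=> ca iv sv Q.
have cm n := Cc_mollifier n; have cdm n := Cc_partial j (cm n); have cda := Cc_partial j ca.
pose h n x y := (a x - a y) * partial j (moll n) (x - y) + partial j a y * moll n (x - y).
have Ti n w : integ Leb w -> (fun x => (\int[Leb]_y (w y * h n x y))) = fun x =>
  a x * conv w (partial j (moll n)) x - conv (fun y => w y * a y) (partial j (moll n)) x
  + conv (fun y => w y * partial j a y) (moll n) x.
 move=> iw; apply/funext => x; have j1 := integZ (a x) (conv_integ x iw (cdm n)).
 have j2 := conv_integ x (integM_Cc iw ca) (cdm n); have j3 := conv_integ x (integM_Cc iw cda) (cm n).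
 rewrite /conv -intZ; last exact: conv_integ (cdm n).
 rewrite -intB// -intD//; last exact: integB.
 by apply: eq_int => y; rewrite /h; ring.
have [L L0 hL] := Cc_lipschitz ca; have [C1 C10 hC1] := partial_mollifier_bound.
have [A A0 hA] := Cc_bounded cda.
have mh n x : mfP (h n x : mpt -> R).
 apply: continuous_measurable2 => y; apply: cvgD; apply: cvgM.
 - by apply: cvgB; [exact: cvg_cst|exact: (Cc_continuous ca)].
 - exact: (Cc_continuous (Cc_reflect x (cdm n))).
 - exact: (Cc_continuous cda).
 - exact: (Cc_continuous (Cc_reflect x (cm n))).
have hb n x y : `|h n x y| <= ((L * C1 + A) * n.+1%:R ^+ 2) * square_ind n.+1%:R^-1 x y.
 rewrite !mulrDl; apply: le_trans (ler_normD _ _) _; apply: lerD; rewrite normrM.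
  have [k|k] := leP `|x - y| n.+1%:R^-1; last first.
   rewrite (partial_mollifier_eq0 j k) normr0 mulr0.
   by rewrite mulr_ge0 ?square_ind_ge0// mulr_ge0 ?sqr_ge0// mulr_ge0// ltW.
  have := hC1 n j (x - y); rewrite square_ind_sub => b1.
  have b2 : `|a x - a y| <= L * n.+1%:R^-1 by apply: le_trans (hL x y) _; rewrite ler_wpM2l// ltW.
  apply: le_trans (ler_pM (normr_ge0 _) (normr_ge0 _) b2 b1) _.
  apply: le_of_eq; have : (n.+1%:R : R) != 0 by rewrite pnatr_eq0.
  by move: (n.+1%:R : R) => k' k0; field.
 rewrite -mulrA; apply: ler_pM => //.
 by rewrite -square_ind_sub; exact: mollifier_bound.
have LA0 : 0 <= L * C1 + A by rewrite addr_ge0 ?mulr_ge0// ltW.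
have [] := @schur_cvg h (L * C1 + A) 0 LA0 mh hb _ _ v iv sv; last first.
- move=> h1 h2; have QE n : (fun x => (\int[Leb]_y (v y * h n x y))) = Q n by exact: Ti.
 split=> [n|]; first by rewrite -QE.
 suff <- : (fun n => (\int[Leb]_x (((\int[Leb]_y (v y * h n x y)) - 0 * v x) ^+ 2))) =
  (fun n => (\int[Leb]_x (Q n x ^+ 2))) by exact: h2.
 by apply/funext => n; apply: eq_int => x; rewrite mul0r subr0 -QE.
- move=> f cf; have cdf := Cc_partial j cf; have [F0 F00 hF] := Cc_bounded cdf.
 exists (F0 * L); first by rewrite mulr_ge0// ltW.
 move=> n x; rewrite mul0r subr0; have ck := Cc_reflect x (cm n).
 have cM g : Cc g -> Cc (fun y => g y * (a x - a y)).
  move=> cg; have := CcD (CcZ (a x) cg) (CcZ (-1) (CcM ca.1 cg)); congr Cc.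
  by apply/funext => y; ring.
 have cG := cM f cf; have cGk := CcM cG.1 ck.
 have df g y : Cc g -> derivable g y (bv j) := fun cg => (smooth_partials cg.1 (x := y) I).2 j.
 have dG y : partial j (fun y => f y * (a x - a y)) y = partial j f y * (a x - a y) - f y * partial j a y.
  have dc : derivable (fun=> a x) y (bv j) by exact: derivable_cst.
  rewrite (partialM (df _ _ cf) (derivableB dc (df _ _ ca))) (partialB dc (df _ _ ca)).
  by rewrite partial_cst sub0r mulrN.
 have eqd y : partial j (fun y => f y * (a x - a y) * moll n (x - y)) y =
   partial j f y * (a x - a y) * moll n (x - y) - f y * h n x y.
  by rewrite (partialM (df _ _ cG) (df _ _ ck)) dG (partial_reflect x j y (cm n)) /h; ring.
 have ih : integ Leb (fun y => f y * h n x y).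
  have [||//] := int_kernel_bound (Cc_int cf) _ _ (mh n x) (hb n x); first by rewrite invr_ge0.
  by rewrite mulr_ge0// sqr_ge0.
 have i1 := Cc_int (CcM (cM _ cdf).1 ck).
 have -> : (\int[Leb]_y (f y * h n x y) = \int[Leb]_y (partial j f y * (a x - a y) * moll n (x - y))).
  apply/eqP; rewrite eq_sym -subr_eq0 -intB//; apply/eqP; rewrite -[RHS](int_partial0 j cGk.1 cGk.2).
  by apply: eq_int => y; rewrite eqd.
 apply: le_trans (int_norm_le i1) _.
 rewrite -[leRHS]mulr1 -[X in _ <= _ * X](int_mollifier n x) -intZ; last exact: (Cc_int ck).
 apply: int_le; [exact: integ_norm|exact: (integZ _ (Cc_int ck))|] => y.
 rewrite normrM (ger0_norm (mollifier_ge0 _ _)).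
 have [k|k] := leP `|x - y| n.+1%:R^-1; last by rewrite mollifier_eq0// !mulr0.
 apply: ler_wpM2r; first exact: mollifier_ge0.
 rewrite normrM -mulrA; apply: ler_pM => //.
 by apply: le_trans (hL _ _) _; rewrite ler_wpM2l// ltW.
- move=> n w iw; rewrite Ti// => x; apply: cvgD; [apply: cvgB|].
 + apply: cvgM; [exact: (Cc_continuous ca)|exact: (conv_continuous iw (cdm n))].
 + exact: (conv_continuous (integM_Cc iw ca) (cdm n)).
 + exact: (conv_continuous (integM_Cc iw cda) (cm n)).
Qed.

End Friedrichs.

(** * Poincare inequality on cells and Rellich's theorem on the plane *)

Section Poincare.
Implicit Types (a b h C : R) (w : pt -> R) (F : mpt -> R).

(** Half open, so that consecutive intervals tile a segment exactly, as in [itv_ind_sum]. *)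
Definition itv_ind a h (s : R) : R := ((a <= s) && (s < a + h))%R%:R.

Lemma itv_ind01 a h s : itv_ind a h s = 0 \/ itv_ind a h s = 1.
Proof. by rewrite /itv_ind; case: (_ && _); [right|left]. Qed.

Lemma itv_ind_norm a h s : `|itv_ind a h s| <= 1.
Proof. by have [->|->] := itv_ind01 a h s; rewrite ?normr0 ?normr1. Qed.

Lemma itv_ind_ge0 a h s : 0 <= itv_ind a h s.
Proof. by have [->|->] := itv_ind01 a h s. Qed.

Lemma itv_indE a h : itv_ind a h = (\1_(`[a, a + h[%classic) : mT -> R).
Proof. by apply/funext => s; rewrite indicE mem_setE in_itv. Qed.

Lemma itv_ind_sqr a h s : itv_ind a h s ^+ 2 = itv_ind a h s.
Proof. by have [->|->] := itv_ind01 a h s; rewrite ?expr0n ?expr1n. Qed.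

Lemma measurable_itv_ind a h : mfT (itv_ind a h : mT -> R).
Proof. by rewrite itv_indE; apply: measurable_indic; exact: measurable_itv. Qed.

Lemma itv_integral a h : 0 < h -> integ lam (itv_ind a h : mT -> R) /\ (\int[lam]_s itv_ind a h s = h).
Proof.
move=> h0; have e : (\int[lam]_s (itv_ind a h s)%:E = h%:E)%E.
 rewrite itv_indE integral_indic ?setIT; last 2 first.
 - exact: measurableT.
 - exact: measurable_itv.
 apply: (etrans (lebesgue_measure_itv _)); rewrite /= lte_fin ltrDl h0 -EFinB; congr EFin; ring.
split; last by rewrite /Rintegral e.
apply/integrableP; split; first by apply/measurable_EFinP; exact: measurable_itv_ind.
under eq_integral => s _ do rewrite /= ger0_norm ?itv_ind_ge0//.
by rewrite e ltry.
Qed.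

Lemma integ_itv a h (f : R -> R) C : 0 < h -> mfT (f : mT -> R) ->
 (forall s, `|f s| <= C) -> integ lam (fun s : mT => f s * itv_ind a h s).
Proof.
move=> h0 mf fC; have [i _] := itv_integral a h0.
by have := integM_bounded mf fC i; apply: integ_eq => s; rewrite mulrC.
Qed.

Lemma ftc_int (f f' : R -> R) a b : a < b -> continuous f' ->
 (forall t : R, is_derive t (1 : R) f (f' t)) ->
 f b - f a = (\int[lam]_s (f' s * ((a <= s) && (s <= b))%R%:R)).
Proof.
move=> ab cf df; have cF t : {for t, continuous f}.
 by have [d _] := df t; exact/differentiable_continuous/derivable1_diffP.
have doo : derivable_oo_LRcontinuous f a b.
 split=> [t _| |]; first by case: (df t).
  exact/cvg_at_right_filter/cF.
 exact/cvg_at_left_filter/cF.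
have fe : {in `]a, b[, f^`()%classic =1 f'} by move=> t _; rewrite derive1E; case: (df t).
have := @continuous_FTC2 R f' f a b ab (continuous_subspaceT cf) doo fe.
rewrite -EFinB /Rintegral => e; transitivity (fine (f b - f a)%:E) => //; rewrite -e; congr fine.
rewrite [LHS]integral_mkcond; apply: eq_integral => s _; rewrite patchE mem_setE in_itv/=.
by case: (_ && _); rewrite /= ?mulr1 ?mulr0.
Qed.

(** Fundamental theorem of calculus and Cauchy-Schwarz on [x, y], whose indicator is then enlarged
    to that of the whole interval. *)
Lemma interval_osc (f f' : R -> R) a h C : 0 < h -> continuous f' ->
 (forall t : R, is_derive t (1 : R) f (f' t)) -> (forall t, `|f' t| <= C) ->
 forall x y, itv_ind a h x = 1 -> itv_ind a h y = 1 ->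
 (f x - f y) ^+ 2 <= h * (\int[lam]_s (f' s ^+ 2 * itv_ind a h s)).
Proof.
move=> h0 cf df fC.
have ind1 s : itv_ind a h s = 1 -> a <= s /\ s < a + h.
 rewrite /itv_ind; case: andP => // _ /eqP; by rewrite eq_sym oner_eq0.
have mf : mfT (f' : mT -> R) by exact: continuous_measurable_fun.
have C0 : 0 <= C by apply: le_trans (fC 0).
have mf2 : mfT (fun s : mT => f' s ^+ 2) by exact: measurable_funX.
have f2C s : `|f' s ^+ 2| <= C ^+ 2 by rewrite normrX; exact: sqr_mono.
have i2 := integ_itv a h0 mf2 f2C.
suff main x y : itv_ind a h x = 1 -> itv_ind a h y = 1 -> x < y ->
  (f x - f y) ^+ 2 <= h * (\int[lam]_s (f' s ^+ 2 * itv_ind a h s)).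
 move=> x y hx hy; have [xy|yx|->] := ltgtP x y; first exact: main.
  by rewrite -sqrrN opprB; exact: main.
 rewrite subrr expr0n mulr_ge0 ?(ltW h0)//; apply: int_ge0 => s.
 by rewrite mulr_ge0 ?sqr_ge0 ?itv_ind_ge0.
move=> hx hy xy; have [ax xh] := ind1 _ hx; have [ay yh] := ind1 _ hy.
pose J (s : R) : R := ((x <= s) && (s <= y))%R%:R.
have JE : J = (\1_(`[x, y]%classic) : mT -> R).
 by apply/funext => s; rewrite indicE mem_setE in_itv.
have J01 s : J s = 0 \/ J s = 1 by rewrite /J; case: (_ && _); [right|left].
have mJ : mfT (J : mT -> R) by rewrite JE; apply: measurable_indic; exact: measurable_itv.
have JI s : J s <= itv_ind a h s.
 rewrite /J /itv_ind; case: (x <= s) /idP => //= xs; case: (s <= y) /idP => //= sy.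
 by rewrite (le_trans ax xs) (le_lt_trans sy yh).
have J0 s : 0 <= J s by have [->|->] := J01 s.
have J1 s : `|J s| <= 1 by have [->|->] := J01 s; rewrite ?normr0 ?normr1.
have [iI eI] := itv_integral a h0.
have iJ : integ lam (J : mT -> R) by apply: integ_le iI => // s; rewrite ger0_norm.
have JJ s : J s ^+ 2 = J s by have [->|->] := J01 s; rewrite ?expr0n ?expr1n.
have s1 : sq_integ lam (fun s : mT => f' s * J s).
 split; first exact: measurable_funM.
 apply: (@integ_eq _ _ _ lam (fun s => J s * f' s ^+ 2)) => [s|]; first by rewrite exprMn JJ mulrC.
 exact: (integM_bounded mf2 f2C iJ).
have s2 : sq_integ lam (J : mT -> R) by split => //; apply: integ_eq iJ => s; rewrite JJ.
have e : f y - f x = (\int[lam]_s (f' s * J s * J s)).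
 rewrite (ftc_int xy cf df); apply: eq_int => s; rewrite -mulrA; congr (_ * _).
 by rewrite -expr2 JJ.
rewrite -sqrrN opprB e; apply: le_trans (int_cauchy_schwarz s1 s2) _.
rewrite mulrC; apply: ler_pM.
- by apply: int_ge0 => s; exact: sqr_ge0.
- by apply: int_ge0 => s; exact: sqr_ge0.
- rewrite -eI; apply: int_le => //; first by case: s2.
 by move=> s; rewrite JJ.
- apply: int_le => //; first by case: s1.
 by move=> s; rewrite exprMn JJ; apply: ler_wpM2l; [exact: sqr_ge0|exact: JI].
Qed.

Lemma fubini21 F : integ Leb F -> (forall t : R, integ lam (fun s : mT => F (s, t))) ->
 integ lam (fun t : mT => (\int[lam]_s F (s, t))) /\
 (\int[Leb]_x F x = \int[lam]_t \int[lam]_s F (s, t)).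
Proof.
move=> iF iS.
have e t : fubini_G lam (EFin \o F) t = (\int[lam]_s F (s, t))%R%:E.
 by rewrite /fubini_G (int_EFin (iS t)).
split.
 have mF : mfP (EFin \o F) by case/integrableP: iF.
 have fE : (EFin \o (fun t : mT => (\int[lam]_s F (s, t)))) = fubini_G lam (EFin \o F).
  by apply/funext => t; rewrite e.
 apply/integrableP; rewrite fE; split; first exact: (measurable_fubini_G iF).
 have lt := proj1 (integrable21ltyP lam lam mF) iF; apply: le_lt_trans lt.
 have mFG : mfP (abse \o (EFin \o F)) by exact: measurableT_comp.
 apply: ge0_le_integral => //.
 - by apply: measurableT_comp => //; exact: (measurable_fubini_G iF).
 - by apply: (measurable_fun_fubini_tonelli_G (abse \o (EFin \o F))) => //; move=> x; exact: abse_ge0.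
 - move=> t _; apply: le_abse_integral => //.
  by case/integrableP: (iS t).
by rewrite /Rintegral -(integral21_prod_meas1 iF); congr fine; apply: eq_integral => t _; rewrite e.
Qed.

Lemma fubini12 F : integ Leb F -> (forall s : R, integ lam (fun t : mT => F (s, t))) ->
 integ lam (fun s : mT => (\int[lam]_t F (s, t))) /\
 (\int[Leb]_x F x = \int[lam]_s \int[lam]_t F (s, t)).
Proof.
move=> iF iS.
have e t : fubini_F lam (EFin \o F) t = (\int[lam]_s F (t, s))%R%:E.
 by rewrite /fubini_F (int_EFin (iS t)).
have h := integrable_fubini_F iF.
split.
 rewrite /integ; suff <- : fubini_F lam (EFin \o F) = EFin \o (fun s : mT => (\int[lam]_t F (s, t))) by exact: h.
 by apply/funext => t; rewrite e.
by rewrite /Rintegral -(integral12_prod_meas1 iF); congr fine; apply: eq_integral => t _; rewrite e.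
Qed.

Definition cell a b h (x : pt) : R := itv_ind a h x.1 * itv_ind b h x.2.

Lemma cell01 a b h x : cell a b h x = 0 \/ cell a b h x = 1.
Proof.
rewrite /cell; have [->|->] := itv_ind01 a h x.1; first by left; rewrite mul0r.
by rewrite mul1r; exact: itv_ind01.
Qed.

Lemma measurable_cell a b h : mfP (cell a b h : mpt -> R).
Proof.
apply: measurable_funM.
 exact: (measurableT_comp (measurable_itv_ind a h) (@measurable_fst _ _ mT mT)).
exact: (measurableT_comp (measurable_itv_ind b h) (@measurable_snd _ _ mT mT)).
Qed.

Lemma Cc_integ_cell w a b h : continuous w -> bsupp w -> integ Leb (fun x : mpt => w x * cell a b h x).
Proof.
move=> cw bw; apply: (integM_bounded (C := 1)) (Cc_integ cw bw); first exact: measurable_cell.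
by move=> x; have [->|->] := cell01 a b h x; rewrite ?normr0 ?normr1.
Qed.

(** [osc_poincare] is used twice: on each horizontal segment, then for the means m over these
    segments, whose oscillation is controlled by the second partial derivative. *)
Lemma cell_poincare w a b h : 0 < h -> Cc w ->
 (\int[Leb]_x (w x ^+ 2 * cell a b h x) <= (h ^+ 2)^-1 * (\int[Leb]_x (w x * cell a b h x)) ^+ 2 +
  h ^+ 2 * (\int[Leb]_x ((partial o0 w x ^+ 2 + partial o1 w x ^+ 2) * cell a b h x))).
Proof.
move=> h0 cw; have [C C0 hC] := Cc_bounded cw; have kw := Cc_continuous cw.
have cw0 := Cc_partial o0 cw; have cw1 := Cc_partial o1 cw.
have cq0 := Cc_sqr cw0; have cq1 := Cc_sqr cw1.
have dw x i : derivable w x (bv i) := (smooth_partials cw.1 (x := x) I).2 i.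
have [iI eI] := itv_integral a h0; have [iJ eJ] := itv_integral b h0.
have r1 u (t : R) : Cc u -> integ lam (fun s : mT => u (s, t) * itv_ind a h s).
 move=> cu; have [B _ hB] := Cc_bounded cu.
 exact: (integ_itv a h0 (continuous_measurable_fun (@continuous_slice1 _ t (Cc_continuous cu))) (fun s => hB (s, t))).
have r2 u (s : R) : Cc u -> integ lam (fun t : mT => u (s, t) * itv_ind b h t).
 move=> cu; have [B _ hB] := Cc_bounded cu.
 exact: (integ_itv b h0 (continuous_measurable_fun (@continuous_slice2 _ s (Cc_continuous cu))) (fun t => hB (s, t))).
have ic u (cu : Cc u) := Cc_integ_cell a b h (Cc_continuous cu) cu.2.
have E21 u : Cc u -> integ lam (fun t : mT => (\int[lam]_s (u (s, t) * itv_ind a h s)) * itv_ind b h t) /\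
  (\int[Leb]_x (u x * cell a b h x) = \int[lam]_t ((\int[lam]_s (u (s, t) * itv_ind a h s)) * itv_ind b h t)).
 move=> cu; have ce t : (fun s => u (s, t) * cell a b h (s, t)) = fun s => itv_ind b h t * (u (s, t) * itv_ind a h s).
  by apply/funext => s; rewrite /cell /=; ring.
 have [|i e] := fubini21 (ic u cu); first by move=> t; rewrite ce; exact/integZ/r1.
 have eq t : (\int[lam]_s (u (s, t) * cell a b h (s, t)) = (\int[lam]_s (u (s, t) * itv_ind a h s)) * itv_ind b h t).
  by rewrite ce intZ 1?mulrC//; exact: r1.
 split; first by apply: integ_eq i => t; rewrite eq.
 by rewrite e; apply: eq_int => t; rewrite eq.
have E12 u : Cc u -> integ lam (fun s : mT => (\int[lam]_t (u (s, t) * itv_ind b h t)) * itv_ind a h s) /\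
  (\int[Leb]_x (u x * cell a b h x) = \int[lam]_s ((\int[lam]_t (u (s, t) * itv_ind b h t)) * itv_ind a h s)).
 move=> cu; have ce s : (fun t => u (s, t) * cell a b h (s, t)) = fun t => itv_ind a h s * (u (s, t) * itv_ind b h t).
  by apply/funext => t; rewrite /cell /=; ring.
 have [|i e] := fubini12 (ic u cu); first by move=> s; rewrite ce; exact/integZ/r2.
 have eq s : (\int[lam]_t (u (s, t) * cell a b h (s, t)) = (\int[lam]_t (u (s, t) * itv_ind b h t)) * itv_ind a h s).
  by rewrite ce intZ 1?mulrC//; exact: r2.
 split; first by apply: integ_eq i => s; rewrite eq.
 by rewrite e; apply: eq_int => s; rewrite eq.
pose m (t : R) := (\int[lam]_s (w (s, t) * itv_ind a h s)).
pose D1 (t : R) := (\int[lam]_s (partial o0 w (s, t) ^+ 2 * itv_ind a h s)).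
pose G2 := (\int[Leb]_x (partial o1 w x ^+ 2 * cell a b h x)).
have [im em] := E21 w cw.
have mC t : `|m t| <= C * h.
 apply: le_trans (int_norm_le (r1 w t cw)) _; rewrite -[X in _ <= _ * X]eI -intZ//.
 apply: int_le; [exact: (integ_norm (r1 w t cw))|exact: integZ|] => s.
 by rewrite normrM (ger0_norm (itv_ind_ge0 _ _ _)) ler_wpM2r// itv_ind_ge0.
have im2 : integ lam (fun t : mT => m t ^+ 2 * itv_ind b h t).
 apply: (@integ_le _ _ _ lam _ (fun t => (C * h) ^+ 2 * itv_ind b h t)); last exact: integZ.
  under eq_fun do rewrite -itv_ind_sqr -exprMn.
  by apply: measurable_funX; exact: (integ_meas im).
 move=> t; rewrite normrM (ger0_norm (itv_ind_ge0 _ _ _)) normrX ler_wpM2r ?itv_ind_ge0//.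
 exact: sqr_mono.
have step1 t : (\int[lam]_s (w (s, t) ^+ 2 * itv_ind a h s) <= h^-1 * m t ^+ 2 + h * (h * D1 t)).
 have [C1 _ hC1] := Cc_bounded cw0.
 apply: (osc_poincare h0 iI eI (itv_ind01 a h)); [exact: r1|exact: (r1 _ t (Cc_sqr cw))|].
 apply: (interval_osc h0 (@continuous_slice1 _ t (Cc_continuous cw0))) => [s|s]; last exact: hC1.
 exact: is_derive_slice1.
have osc2 x y : itv_ind b h x = 1 -> itv_ind b h y = 1 -> (m x - m y) ^+ 2 <= h * (h * G2).
 move=> hx hy; rewrite /m -intB; [|exact: r1..]; have [C2 _ hC2] := Cc_bounded cw1.
 have si : sq_integ lam (itv_ind a h : mT -> R).
  by split; [exact: measurable_itv_ind|apply: integ_eq iI => s; rewrite itv_ind_sqr].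
 have ms z : mfT (fun s : mT => w (s, z)) := continuous_measurable_fun (@continuous_slice1 _ z kw).
 have bd s : `|w (s, x) - w (s, y)| <= C + C by apply: le_trans (ler_normB _ _) (lerD _ _).
 have sw := sq_integM_bounded (measurable_funB (ms x) (ms y)) bd si.
 have := int_cauchy_schwarz sw si.
 under [X in _ <= _ * X]eq_Rintegral do rewrite itv_ind_sqr.
 rewrite eI; under eq_Rintegral do rewrite -mulrA -expr2 itv_ind_sqr mulrBl.
 move=> /le_trans; apply; rewrite mulrC; apply: ler_wpM2l; first exact: ltW.
 have [i12 e12] := E12 _ cq1.
 rewrite /G2 e12 -intZ//; apply: int_le; [by case: sw|exact: integZ|] => s.
 rewrite exprMn itv_ind_sqr mulrA ler_wpM2r ?itv_ind_ge0//.
 apply: (@interval_osc (fun t => w (s, t)) (fun t => partial o1 w (s, t)) b h C2 h0 (@continuous_slice2 _ s (Cc_continuous cw1))) => //.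
 by move=> t; exact: is_derive_slice2.
have step2 := osc_poincare h0 iJ eJ (itv_ind01 b h) im im2 osc2.
have [i1 e1] := E21 _ (Cc_sqr cw); have [i3 e3] := E21 _ cq0.
under [X in _ <= _ + _ * X]eq_Rintegral => x _ do rewrite mulrDl.
rewrite (intD (ic _ cq0) (ic _ cq1)) e3 e1 em.
have : (\int[lam]_t ((\int[lam]_s (w (s, t) ^+ 2 * itv_ind a h s)) * itv_ind b h t)) <=
  (\int[lam]_t (h^-1 * (m t ^+ 2 * itv_ind b h t) + h ^+ 2 * (D1 t * itv_ind b h t))).
 apply: int_le => //; first by apply: integD; exact: integZ.
 move=> t; have := ler_wpM2r (itv_ind_ge0 b h t) (step1 t).
 by move/le_trans; apply; rewrite mulrDl expr2 !mulrA.
rewrite intD ?intZ//; [|exact: integZ..].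
move=> H; exact: (cell_arith h0 H step2).
Qed.

Lemma itv_ind_sum a h n s : 0 < h -> \sum_(k < n) itv_ind (a + k%:R * h) h s = itv_ind a (n%:R * h) s.
Proof.
move=> h0; elim: n => [|n IH].
 by rewrite big_ord0 /itv_ind mul0r addr0; case: leP => //= h1; rewrite ltNge h1.
rewrite big_ord_recr /= IH /itv_ind.
have -> : a + n%:R * h + h = a + n.+1%:R * h by rewrite -natr1; ring.
have nh : 0 <= n%:R * h by rewrite mulr_ge0// ltW.
have nn : a + n%:R * h <= a + n.+1%:R * h by rewrite -natr1 mulrDl mul1r; lra.
have [h1|h1] := leP a s; last first.
 have -> : (a + n%:R * h <= s) = false by apply/negbTE; rewrite -ltNge; lra.
 by rewrite addr0.
have [h2|h2] := leP (a + n%:R * h) s; rewrite /=; first by rewrite add0r.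
by rewrite addr0 (lt_le_trans h2 nn).
Qed.

Lemma grid_poincare w (B : R) (n : nat) (h := 2 * B / n.+1%:R)
  (c := fun k l : 'I_n.+1 => cell (- B + k%:R * h) (- B + l%:R * h) h) :
 0 < B -> Cc w -> (forall x : pt, B <= `|x| -> w x = 0) ->
 (\int[Leb]_x (w x ^+ 2) <= \sum_(k < n.+1) \sum_(l < n.+1) (h ^+ 2)^-1 * (\int[Leb]_x (w x * c k l x)) ^+ 2 +
  h ^+ 2 * (\int[Leb]_x (partial o0 w x ^+ 2 + partial o1 w x ^+ 2))).
Proof.
move=> B0 cw hw.
have h0 : 0 < h by rewrite /h divr_gt0// mulr_gt0.
have nh : n.+1%:R * h = 2 * B by rewrite /h mulrCA divff ?mulr1// pnatr_eq0.
pose G x := partial o0 w x ^+ 2 + partial o1 w x ^+ 2.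
have cG : Cc G by apply: CcD; apply/Cc_sqr/Cc_partial.
have c2 := Cc_sqr cw.
have sumc x : \sum_(k < n.+1) \sum_(l < n.+1) c k l x = itv_ind (- B) (2 * B) x.1 * itv_ind (- B) (2 * B) x.2.
 rewrite -nh -!itv_ind_sum// mulr_suml; apply: eq_bigr => k _.
 by rewrite mulr_sumr.
have s01 x : \sum_(k < n.+1) \sum_(l < n.+1) c k l x <= 1.
 rewrite sumc; have [->|->] := itv_ind01 (- B) (2 * B) x.1; rewrite ?mul0r// mul1r.
 by apply: le_trans (ler_norm _) (itv_ind_norm _ _ _).
have e1 x : w x ^+ 2 = \sum_(k < n.+1) \sum_(l < n.+1) w x ^+ 2 * c k l x.
 under eq_bigr => k _ do rewrite -mulr_sumr.
 rewrite -mulr_sumr sumc; have [hx|/hw ->] := ltP `|x| B; last by rewrite expr0n mul0r.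
 move: hx; rewrite prod_norm_lt !ltr_norml /itv_ind => /andP[/andP[x1 x2] /andP[x3 x4]].
 have -> : - B + 2 * B = B by ring.
 by rewrite !ltW// x2 x4 !mulr1.
have i1 k l : integ Leb (fun x : mpt => w x ^+ 2 * c k l x) := Cc_integ_cell _ _ _ (Cc_continuous c2) c2.2.
have i2 k l : integ Leb (fun x : mpt => G x * c k l x) := Cc_integ_cell _ _ _ (Cc_continuous cG) cG.2.
have -> : (\int[Leb]_x (w x ^+ 2)) = \sum_(k < n.+1) \sum_(l < n.+1) (\int[Leb]_x (w x ^+ 2 * c k l x)).
 under eq_bigr => k _ do rewrite -(int_sum _ (i1 k)).
 rewrite -int_sum; last by move=> k; exact: integ_sum.
 by apply: eq_int => x; exact: e1.
apply: le_trans (_ : \sum_(k < n.+1) \sum_(l < n.+1) ((h ^+ 2)^-1 * (\int[Leb]_x (w x * c k l x)) ^+ 2 +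
  h ^+ 2 * (\int[Leb]_x (G x * c k l x))) <= _).
 by apply: ler_sum => k _; apply: ler_sum => l _; exact: cell_poincare.
under eq_bigr => k _ do rewrite big_split /=.
rewrite big_split /= lerD2l.
under eq_bigr => k _ do rewrite -mulr_sumr -(int_sum _ (i2 k)).
rewrite -mulr_sumr -int_sum; last by move=> k; exact: integ_sum.
apply: ler_wpM2l; first exact: sqr_ge0.
apply: int_le; [by apply: integ_sum => k; exact: integ_sum|exact: Cc_int|] => x.
under eq_bigr => k _ do rewrite -mulr_sumr.
rewrite -mulr_sumr; apply: ler_piMr; last exact: s01.
by rewrite addr_ge0 ?sqr_ge0.
Qed.

(* The finitely many functionals are means over the cells of a fine grid. *)
Lemma plane_rellich (B e : R) : 0 < B -> 0 < e ->
 exists (N : nat) (g : 'I_N -> mpt -> R) (C : R), [/\ 0 < C,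
  forall k, mfP (g k), forall k x, `|g k x| <= 1 &
  forall w, Cc w -> (forall x : pt, B <= `|x| -> w x = 0) ->
  (\int[Leb]_x (w x ^+ 2) <= C * \sum_k (\int[Leb]_x (w x * g k x)) ^+ 2 +
   e * (\int[Leb]_x (partial o0 w x ^+ 2 + partial o1 w x ^+ 2)))].
Proof.
move=> B0 e0.
(* The mesh h lies below both 1 and e, so h^2 <= e. *)
have d0 : 0 < Num.min 1 e / (2 * B) by rewrite divr_gt0 ?mulr_gt0// lt_min ltr01.
have [n /(_ n (leqnn n)) hn] := near_invS d0.
pose h := 2 * B / n.+1%:R.
have h0 : 0 < h by rewrite /h divr_gt0// mulr_gt0.
have hm : h < Num.min 1 e by rewrite /h mulrC -ltr_pdivlMr// mulr_gt0.
have he : h ^+ 2 <= e.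
 move: hm; rewrite lt_min => /andP[h1 h2]; rewrite expr2; apply: le_trans (_ : h * 1 <= _).
  by rewrite ler_wpM2l// ltW.
 by rewrite mulr1 ltW.
exists #|{: 'I_n.+1 * 'I_n.+1}|.
pose c (k l : 'I_n.+1) := cell (- B + k%:R * h) (- B + l%:R * h) h.
exists (fun k => c (enum_val k).1 (enum_val k).2), (h ^+ 2)^-1; split.
- by rewrite invr_gt0 exprn_gt0.
- by move=> k; exact: measurable_cell.
- move=> k x; rewrite /c; have [->|->] := cell01 (- B + (enum_val k).1%:R * h) (- B + (enum_val k).2%:R * h) h x; by rewrite ?normr0 ?normr1.
move=> w cw hw; apply: le_trans (grid_poincare n B0 cw hw) _; rewrite -/h; apply: lerD; last first.
 apply: ler_wpM2r => //; apply: int_ge0 => x; by rewrite addr_ge0 ?sqr_ge0.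
rewrite (pair_bigA _ (fun k l => (h ^+ 2)^-1 * (\int[Leb]_x (w x * c k l x)) ^+ 2)) /=.
rewrite -mulr_sumr ler_wpM2l//; first by rewrite invr_ge0 exprn_ge0// ltW.
by rewrite (reindex (@enum_val _ (fun _ => true)))//; exact/onW_bij/enum_val_bij.
Qed.

End Poincare.

(** * Hadamard's lemma *)

Section Hadamard.
Implicit Types (f g : pt -> R) (p x y : pt) (i : 'I_2) (k : nat).

Definition unit_ind (t : R) : R := ((0 <= t) && (t <= 1))%R%:R.

Lemma unit_ind01 t : unit_ind t = 0 \/ unit_ind t = 1 /\ 0 <= t <= 1.
Proof. by rewrite /unit_ind; case: andP => h; [right|left]; split => //; apply/andP. Qed.

Lemma unit_indE : unit_ind = (\1_(`[0, 1]%classic) : mT -> R).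
Proof. by apply/funext => s; rewrite indicE mem_setE in_itv. Qed.

Lemma measurable_unit_ind : mfT (unit_ind : mT -> R).
Proof. by rewrite unit_indE; apply: measurable_indic; exact: measurable_itv. Qed.

Lemma unit_integral : integ lam (unit_ind : mT -> R) /\ (\int[lam]_s unit_ind s = 1).
Proof.
have p s : 0 <= unit_ind s by have [->|[-> _]] := unit_ind01 s.
have e : (\int[lam]_s (unit_ind s)%:E = 1%:E)%E.
 rewrite unit_indE integral_indic ?setIT; last 2 first.
 - exact: measurableT.
 - exact: measurable_itv.
 by apply: (etrans (lebesgue_measure_itv _)); rewrite /= lte_fin ltr01 -EFinB subr0.
split; last by rewrite /Rintegral e.
apply/integrableP; split; first by apply/measurable_EFinP; exact: measurable_unit_ind.
under eq_integral => s _ do rewrite /= ger0_norm ?p//.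
by rewrite e ltry.
Qed.

Lemma unit_int_bound (u : R -> R) (C : R) : mfT (u : mT -> R) ->
 (forall t, 0 <= t <= 1 -> `|u t| <= C) ->
 integ lam (fun t : mT => u t * unit_ind t) /\ `|(\int[lam]_t (u t * unit_ind t))| <= C.
Proof.
move=> mu hC; have [iI eI] := unit_integral.
have le t : `|u t * unit_ind t| <= C * unit_ind t.
 by have [->|[-> /hC h]] := unit_ind01 t; rewrite ?mulr0 ?normr0// !mulr1.
have mf : mfT (fun t : mT => u t * unit_ind t).
 by apply: measurable_funM => //; exact: measurable_unit_ind.
have i1 : integ lam (fun t : mT => u t * unit_ind t) := integ_le mf le (integZ C iI).
split => //; apply: le_trans (int_norm_le i1) _; rewrite -[leRHS]mulr1 -[X in _ * X]eI -intZ//.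
by apply: int_le; [exact: integ_norm|exact: integZ|].
Qed.

(** A mean of g over the segment from p to x; the weight t^k records the factors t produced by
    differentiation in x, so that the family is stable under partials. *)
Definition ray_mean p k g x : R := (\int[lam]_t (t ^+ k * g (p + t *: (x - p)) * unit_ind t)).

Lemma continuous_ray p g x : continuous g -> continuous (fun t : R => g (p + t *: (x - p))).
Proof.
move=> cg t; apply: (@continuous_comp _ _ _ (fun t : R => p + t *: (x - p)) g); last exact: cg.
by apply: cvgD; [exact: cvg_cst|apply: cvgZ; [exact: cvg_id|exact: cvg_cst]].
Qed.

Lemma ray_measurable p k g x : continuous g ->
 mfT (fun t : mT => t ^+ k * g (p + t *: (x - p))).
Proof.
move=> cg; apply: continuous_measurable_fun => t; apply: cvgM; first exact: exprn_continuous.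
exact: continuous_ray.
Qed.

Lemma ray_norm_le1 (t : R) k : 0 <= t <= 1 -> `|t ^+ k| <= 1.
Proof. by move=> /andP[t0 t1]; rewrite normrX ger0_norm// exprn_ile1. Qed.

Lemma ray_integ p k g x : Cc g -> integ lam (fun t : mT => t ^+ k * g (p + t *: (x - p)) * unit_ind t).
Proof.
move=> cg; have [C C0 hC] := Cc_bounded cg.
apply: (@unit_int_bound (fun t => t ^+ k * g (p + t *: (x - p))) C (ray_measurable p k x (Cc_continuous cg)) _).1 => t t01.
by rewrite normrM -[leRHS]mul1r; apply: ler_pM => //; exact: ray_norm_le1.
Qed.

Lemma ray_continuous p k g : Cc g -> continuous (ray_mean p k g).
Proof.
move=> cg x; have [L L0 hL] := Cc_lipschitz cg; have kg := Cc_continuous cg.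
apply/cvgrPdist_le => e e0; have d0 : 0 < e / L by rewrite divr_gt0.
have := @nbhsx_ballx _ pt x (e / L) d0; apply: filterS => y; rewrite -ball_normE /= => xy.
rewrite /ray_mean -intB; [|exact: ray_integ..].
under eq_Rintegral => t _ do rewrite -mulrBl.
apply: (@unit_int_bound (fun t => t ^+ k * g (p + t *: (x - p)) - t ^+ k * g (p + t *: (y - p))) e _ _).2.
 by apply: measurable_funB; exact: ray_measurable.
move=> t t01; rewrite -mulrBr normrM -[leRHS]mul1r; apply: ler_pM => //; first exact: ray_norm_le1.
apply: le_trans (hL _ _) _; rewrite opprD addrACA subrr add0r -scalerBr opprB addrA subrK normrZ.
have /andP[t0 t1] := t01; rewrite (ger0_norm t0).
move: xy; rewrite ltr_pdivlMr// mulrC => /ltW; apply: le_trans.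
by rewrite ler_wpM2l ?(ltW L0)// ler_piMl.
Qed.

Lemma is_derive_ray p k g x i : Cc g ->
 is_derive x (bv i) (ray_mean p k g) (ray_mean p k.+1 (partial i g) x).
Proof.
move=> cg; have cdg := Cc_partial i cg; have [L L0 hL] := Cc_lipschitz cdg.
have kg := Cc_continuous cg; have kdg := Cc_continuous cdg.
apply: is_derive_cvg; apply/cvgrPdist_le => e e0.
have d0 : 0 < e / L by rewrite divr_gt0.
have b1 := basis_norm i.
near=> s; have sn : s != 0 by near: s; exact: nbhs_dnbhs_neq.
have sl : `|s| <= e / L by near: s; exact: dnbhs0_le.
rewrite /ray_mean -intB; [|exact: ray_integ..].
rewrite -intZ; last by apply: integB; exact: ray_integ.
rewrite -intB; [|exact: ray_integ|by apply: integZ; apply: integB; exact: ray_integ].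
pose u (t : R) := t ^+ k.+1 * partial i g (p + t *: (x - p)) -
 s^-1 * (t ^+ k * g (p + t *: (s *: bv i + x - p)) - t ^+ k * g (p + t *: (x - p))).
rewrite (_ : (\int[lam]_t _) = (\int[lam]_t (u t * unit_ind t))); last first.
 by apply: eq_int => t; rewrite /u; ring.
apply: (@unit_int_bound u e _ _).2.
 apply: measurable_funB; first exact: ray_measurable.
 apply: measurable_funM => //; apply: measurable_funB; exact: ray_measurable.
move=> t t01; have /andP[t0 t1] := t01.
have [r r01 er] := @partial_mvt i g (p + t *: (x - p)) (t * s) (fun r _ => (smooth_partials cg.1 (x := _) I).2 i).
have ea : p + t *: (s *: bv i + x - p) = p + t *: (x - p) + (t * s) *: bv i.
 by rewrite -addrA scalerDr scalerA addrA [in LHS]addrAC.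
have -> : u t = t ^+ k.+1 * (partial i g (p + t *: (x - p)) - partial i g (p + t *: (x - p) + (r * (t * s)) *: bv i)).
 rewrite /u ea -mulrBr er exprS; field; exact: sn.
rewrite normrM -[leRHS]mul1r; apply: ler_pM => //; first exact: ray_norm_le1.
apply: le_trans (hL _ _) _; rewrite opprD addrA subrr add0r normrN normrZ !normrM.
have /andP[r0 r1] := r01; rewrite (ger0_norm r0) (ger0_norm t0).
move: sl; rewrite ler_pdivlMr// mulrC; apply: le_trans; rewrite ler_wpM2l ?(ltW L0)//.
have h1 : t * `|s| <= `|s| by rewrite ler_piMl.
have h2 : r * (t * `|s|) <= `|s| by apply: le_trans h1; rewrite ler_piMl// mulr_ge0.
apply: le_trans h2; apply: ler_piMr => //; by rewrite !mulr_ge0.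
Unshelve. all: by end_near. Qed.

Lemma smooth_ray p k g : Cc g -> smooth_on setT (ray_mean p k g).
Proof.
move=> cg; apply: (@smooth_coind setT [set h | exists j g', Cc g' /\ h = ray_mean p j g'] openT); last by exists k, g.
 move=> _ [j [g' [cg' ->]]] x _; split=> [|i]; first exact: ray_continuous.
 by case: (is_derive_ray p j x i cg').
move=> _ i [j [g' [cg' ->]]]; exists (ray_mean p j.+1 (partial i g')).
 by exists j.+1, (partial i g'); split => //; exact: Cc_partial.
by move=> x _; case: (is_derive_ray p j x i cg').
Qed.

(** The fundamental theorem of calculus along the segment from p to x. Because the two factors are
    smooth, a derivation at p is determined by its values on the coordinates. *)
Lemma hadamard f p x : Cc f -> f x - f p =
 (x.1 - p.1) * ray_mean p 0 (partial o0 f) x + (x.2 - p.2) * ray_mean p 0 (partial o1 f) x.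
Proof.
move=> cf; have c0 := Cc_partial o0 cf; have c1 := Cc_partial o1 cf.
pose phi (t : R) := f (p + t *: (x - p)).
pose dphi (t : R) := partial o0 f (p + t *: (x - p)) * (x.1 - p.1) + partial o1 f (p + t *: (x - p)) * (x.2 - p.2).
have dP (t : R) : is_derive t (1 : R) phi (dphi t).
 apply: is_derive_cvg.
 have d1 := @is_derive_fst (p + t *: (x - p)) (x - p); have d2 := @is_derive_snd (p + t *: (x - p)) (x - p).
 have := @is_derive_comp2 setT f (fun y => y.1) (fun y => y.2) (p + t *: (x - p)) (x - p) openT
  (smooth_partials cf.1) (fun j => (smooth_partials (smooth_on_partial j cf.1) (x := _) I).1) I
  (@ex_derive _ _ _ _ _ _ _ d1) (@ex_derive _ _ _ _ _ _ _ d2).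
 rewrite !derive_val -!surjective_pairing => h'.
 case: h' => dv ev; have := is_deriveP_cvg dv; rewrite ev.
 apply: cvg_trans; apply: near_eq_cvg; apply: nearW => s /=.
 congr (_ * (_ - _)); rewrite /phi -?surjective_pairing; congr f.
 rewrite [RHS]surjective_pairing /=; congr (_, _); rewrite -![_ *: _]/(_ * _); ring.
have cd : continuous dphi.
 by move=> t; apply: cvgD; (apply: cvgM; last exact: cvg_cst); apply: continuous_ray; exact: Cc_continuous.
have := ftc_int ltr01 cd dP; rewrite {1 2}/phi scale1r scale0r addr0 subrKC => ->.
have i0 := ray_integ p 0 x c0; have i1 := ray_integ p 0 x c1.
rewrite /ray_mean -(intZ _ i0) -(intZ _ i1) -(intD (integZ _ i0) (integZ _ i1)).
by apply: eq_int => t; rewrite /dphi /unit_ind !expr0 !mul1r; ring.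
Qed.

End Hadamard.

Lemma Cc_sum2 (t : 'I_2 -> R * R -> R) : (forall i, Cc (t i)) -> Cc (fun x => \sum_i t i x).
Proof.
move=> ct; have := CcD (ct o0) (ct o1); congr Cc; apply/funext => x; exact/esym/sum_ord2.
Qed.

Lemma partial_sum2 i (t : 'I_2 -> R * R -> R) x :
 (forall j, derivable (t j) x (bv i)) ->
 partial i (fun y => \sum_j t j y) x = \sum_j partial i (t j) x.
Proof.
move=> d; rewrite sum_ord2 -(partialD (d o0) (d o1)); congr (partial i _ x).
by apply/funext => y; exact: sum_ord2.
Qed.

(** * Weighted energy inequality for weak solutions on the plane *)

Section Caccioppoli.
Implicit Types (x : pt) (i j : 'I_2).
Context (a : 'I_2 -> 'I_2 -> pt -> R) (rho W F : pt -> R) (v : mpt -> R) (E Lam : R) (n0 : nat).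
Hypothesis ca : forall i j, Cc (a i j).
Hypothesis asym : forall i j x, a i j x = a j i x.
Hypothesis crho : Cc rho.
Hypothesis cW : Cc W.
Hypothesis cF : Cc F.
Hypothesis iv : integ Leb v.
Hypothesis sv : sq_integ Leb v.
Hypothesis Lam0 : 0 < Lam.

Definition quad_form x (xi : 'I_2 -> R) := \sum_i \sum_j a i j x * xi i * xi j.

Hypothesis qpos : forall x xi, 0 <= quad_form x xi.
Hypothesis ell : forall x xi, F x != 0 -> \sum_i xi i ^+ 2 <= Lam * quad_form x xi.
(** The weak equation div(a grad v) = E rho v tested against the mollifier centred at x, all
    derivatives being on the mollifier. It is asked where F is nonzero and for large n, when the
    mollifier is supported where the equation holds. *)
Hypothesis weak : forall n x, (n0 <= n)%N -> F x != 0 ->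
 \sum_i \sum_j (conv (fun y => v y * a i j y) (partial i (partial j (moll n))) x -
  conv (fun y => v y * partial j (a i j) y) (partial i (moll n)) x) =
 E * conv (fun y => v y * rho y) (moll n) x.
Hypothesis hardyF : forall w, smooth_on setT w ->
 (\int[Leb]_x (W x * (F x * w x) ^+ 2) <=
  \int[Leb]_x quad_form x (fun i => partial i (fun z => F z * w z)%R x)).

(** The difference between a times the gradient of the mollified v and the mollified flux; it tends
    to zero in L2 by [friedrichs]. *)
Definition commutator n i j x := a i j x * conv v (partial j (moll n)) x
  - conv (fun y => v y * a i j y) (partial j (moll n)) x
  + conv (fun y => v y * partial j (a i j) y) (moll n) x.

(** Young's inequality; the derivative of F w is absorbed by ellipticity where F is nonzero. The
    constants del / (2 Lam) and del / 4 anticipate the two terms of the sum over j and the four of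
    the double sum. *)
Let commutator_error n x (w := conv v (moll n)) (del b : R) : 0 < del ->
 (forall x, `|F x| <= b) -> (forall i x, `|partial i F x| <= b) ->
 \sum_i \sum_j (F x * partial i (fun z => F z * w z) x + F x * w x * partial i F x) * commutator n i j x <=
 del * quad_form x (fun i => partial i (fun z => F z * w z) x) + del * w x ^+ 2 +
 (Lam / (2 * del) * b ^+ 2 + b ^+ 4 / del) * \sum_i \sum_j commutator n i j x ^+ 2.
Proof.
move=> d0 Fb dFb; have b0 : 0 <= b := le_trans (normr_ge0 _) (Fb x).
have K0 : 0 <= Lam / (2 * del) * b ^+ 2 + b ^+ 4 / del.
 apply: addr_ge0; last by rewrite divr_ge0 ?exprn_ge0// ltW.
 by rewrite mulr_ge0 ?exprn_ge0// divr_ge0 ?(ltW Lam0)// mulr_ge0// ltW.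
have S0 : 0 <= \sum_i \sum_j commutator n i j x ^+ 2 by rewrite !sumr_ge0// => i _; rewrite sumr_ge0// => j _; exact: sqr_ge0.
set psi := fun z => F z * w z.
have [F0|Fx] := eqVneq (F x) 0.
 rewrite big1 => [|i _]; last by rewrite big1// => j _; rewrite F0 !mul0r addr0 mul0r.
 apply: addr_ge0; last exact: mulr_ge0.
 by apply: addr_ge0; rewrite mulr_ge0 ?sqr_ge0// ltW.
have term i j : (F x * partial i psi x + F x * w x * partial i F x) * commutator n i j x <=
  del / (2 * Lam) * partial i psi x ^+ 2 + del / 4 * w x ^+ 2 +
  (Lam / (2 * del) * b ^+ 2 + b ^+ 4 / del) * commutator n i j x ^+ 2.
 set Q := commutator n i j x; have k1 : 0 < del / (2 * Lam) by rewrite divr_gt0// mulr_gt0.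
 have k2 : 0 < del / 4 by rewrite divr_gt0.
 have y1 := young (partial i psi x) (F x * Q) k1.
 have y2 := young (w x) (F x * partial i F x * Q) k2.
 have F2 : F x ^+ 2 <= b ^+ 2 by rewrite -real_normK ?num_real//; exact: sqr_mono.
 have dF2 : partial i F x ^+ 2 <= b ^+ 2 by rewrite -real_normK ?num_real//; exact: sqr_mono.
 have z1 : (4 * (del / (2 * Lam)))^-1 * (F x * Q) ^+ 2 <= Lam / (2 * del) * b ^+ 2 * Q ^+ 2.
  rewrite (_ : (4 * (del / (2 * Lam)))^-1 = Lam / (2 * del)); last by field; rewrite !gt_eqF.
  rewrite exprMn mulrA; apply: ler_wpM2r; first exact: sqr_ge0.
  by apply: ler_wpM2l => //; rewrite divr_ge0 ?(ltW Lam0)// mulr_ge0// ltW.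
 have z2 : (4 * (del / 4))^-1 * (F x * partial i F x * Q) ^+ 2 <= b ^+ 4 / del * Q ^+ 2.
  rewrite (_ : (4 * (del / 4))^-1 = del^-1); last by field; rewrite !gt_eqF.
  rewrite exprMn mulrA ler_wpM2r ?sqr_ge0// mulrC ler_wpM2r ?invr_ge0 ?(ltW d0)//.
  by rewrite exprMn (exprD b 2 2); apply: ler_pM => //; exact: sqr_ge0.
 move: y1 y2 z1 z2.
 rewrite (_ : partial i psi x * (F x * Q) = F x * partial i psi x * Q); last by ring.
 rewrite (_ : w x * (F x * partial i F x * Q) = F x * w x * partial i F x * Q); last by ring.
 move: (_ * (F x * Q) ^+ 2) (_ * (F x * partial i F x * Q) ^+ 2) => A1 A2 y1 y2 z1 z2.
 rewrite mulrDl [X in _ <= _ + X]mulrDl.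
 by move: y1 y2 z1 z2; move: (_ * Q) (_ * Q) (_ * w x ^+ 2) (_ * Q ^+ 2) (_ * Q ^+ 2) (_ * partial i psi x ^+ 2) => *; lra.
apply: (@le_trans _ _ (\sum_i \sum_j (del / (2 * Lam) * partial i psi x ^+ 2 + del / 4 * w x ^+ 2 +
  (Lam / (2 * del) * b ^+ 2 + b ^+ 4 / del) * commutator n i j x ^+ 2))).
 by apply: ler_sum => i _; apply: ler_sum => j _.
have := ell (fun i => partial i psi x) Fx.
rewrite (quad_sum (fun i => partial i psi x ^+ 2) (fun i j => commutator n i j x ^+ 2)).
move: (\sum_i partial i psi x ^+ 2) (quad_form x _) => p q h.
rewrite lerD2r; apply: lerD; last by rewrite mulrA (mulrC 4) divfK ?pnatr_eq0.
have h' : del / Lam * p <= del * q.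
 by rewrite -mulrA ler_wpM2l ?(ltW d0)// ler_pdivrMl.
apply: le_trans h'; apply: le_of_eq.
by field; rewrite gt_eqF.
Qed.

(** The divergence of F^2 w times the mollified flux integrates to zero. Hardy's inequality for F w
    then bounds the energy from below, except for the fraction del of it that is spent on the
    commutators. *)
Let caccioppoli_step n (w := conv v (moll n)) (z := conv (fun y => v y * rho y) (moll n))
  (del b : R) : (n0 <= n)%N -> 0 < del -> del < 1 ->
 (forall x, `|F x| <= b) -> (forall i x, `|partial i F x| <= b) ->
 ((1 - del) * \int[Leb]_x (W x * F x ^+ 2 * w x * w x) + E * \int[Leb]_x (F x ^+ 2 * w x * z x) <=
  \int[Leb]_x (quad_form x (fun i => partial i F x) * w x * w x) + del * \int[Leb]_x (w x ^+ 2) +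
  (Lam / (2 * del) * b ^+ 2 + b ^+ 4 / del) * \sum_i \sum_j \int[Leb]_x (commutator n i j x ^+ 2)).
Proof.
move=> nn d0 d1 Fb dFb; set K := Lam / _ * _ + _.
have cm := Cc_mollifier n; have cdm i := Cc_partial i cm.
have iva i j : integ Leb (fun y => v y * a i j y) := integM_Cc iv (ca i j).
have ivd i j k : integ Leb (fun y => v y * partial k (a i j) y) := integM_Cc iv (Cc_partial k (ca i j)).
have sw : smooth_on setT w := smooth_conv iv cm.
have sz : smooth_on setT z := smooth_conv (integM_Cc iv crho) cm.
pose psi y := F y * w y.
have cpsi : Cc psi by have := CcM sw cF; congr Cc; apply/funext => y; exact: mulrC.
have cFpsi : Cc (fun y => F y * psi y) := CcM cF.1 cpsi.
pose B i y := \sum_j (conv (fun y => v y * a i j y) (partial j (moll n)) y -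
  conv (fun y => v y * partial j (a i j) y) (moll n) y).
have sB i : smooth_on setT (B i).
 apply: (@smooth_sum setT _ (index_enum _) _ openT) => j.
 exact: (smoothB openT (smooth_conv (iva i j) (cdm j)) (smooth_conv (ivd i j j) cm)).
have sQ i j : smooth_on setT (commutator n i j).
 have s1 := smoothM openT (ca i j).1 (smooth_conv iv (cdm j)).
 exact: (smoothD openT (smoothB openT s1 (smooth_conv (iva i j) (cdm j))) (smooth_conv (ivd i j j) cm)).
have dw i x : partial i w x = conv v (partial i (moll n)) x by rewrite /w partial_conv.
have der f i x : smooth_on setT f -> derivable f x (bv i) by move=> sf; exact: (smooth_partials sf (x := x) I).2.
have dpsi i x : partial i psi x = partial i F x * w x + F x * partial i w x.
 by rewrite /psi partialM//; [exact: der cF.1|exact: der sw].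
pose D i x := F x * partial i psi x + F x * w x * partial i F x.
have dFpsi i x : partial i (fun y => F y * psi y) x = D i x.
 rewrite partialM; [|exact: der cF.1|exact: der cpsi.1].
 by rewrite /D /psi; ring.
pose g i y := (F y * psi y) * B i y.
have cg i : Cc (g i) by have := CcM (sB i) cFpsi; congr Cc; apply/funext => y; exact: mulrC.
have dB i x : partial i (B i) x = \sum_j (conv (fun y => v y * a i j y) (partial i (partial j (moll n))) x -
  conv (fun y => v y * partial j (a i j) y) (partial i (moll n)) x).
 have s1 j := smooth_conv (iva i j) (cdm j); have s2 j := smooth_conv (ivd i j j) cm.
 rewrite (@partial_sum2 i (fun j y => conv _ _ y - conv _ _ y)) => [|j]; last exact: der (smoothB openT (s1 j) (s2 j)).
 apply: eq_bigr => j _; rewrite partialB; [|exact: der (s1 j)|exact: der (s2 j)].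
 by rewrite (partial_conv i (iva i j) (cdm j)) (partial_conv i (ivd i j j) cm).
have BE i x : B i x = \sum_j (a i j x * partial j w x - commutator n i j x).
 by apply: eq_bigr => j _; rewrite /commutator dw; ring.
pose err x := \sum_i \sum_j D i x * commutator n i j x.
have cquad (xi : 'I_2 -> pt -> R) : (forall i, smooth_on setT (xi i)) -> Cc (fun x => quad_form x (fun i => xi i x)).
 move=> sxi; have t i j : Cc (fun x => a i j x * xi i x * xi j x).
  have := CcM (sxi j) (CcM (sxi i) (ca i j)).
  by congr Cc; apply/funext => y; ring.
 exact: (Cc_sum2 (fun i => Cc_sum2 (t i))).
have cq1 : Cc (fun x => quad_form x (fun i => partial i psi x)).
 by apply: cquad => i; exact: (Cc_partial i cpsi).1.
have cq2 : Cc (fun x => quad_form x (fun i => partial i F x)).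
 by apply: cquad => i; exact: (Cc_partial i cF).1.
have cq3 : Cc (fun x => quad_form x (fun i => partial i F x) * w x * w x).
 by have := CcM sw (CcM sw cq2); congr Cc; apply/funext => y; ring.
have cz : Cc (fun x => F x ^+ 2 * w x * z x).
 by have := CcM sz cFpsi; congr Cc; apply/funext => y; rewrite /psi; ring.
have cD i : Cc (D i).
 have := CcD (CcM (Cc_partial i cpsi).1 cF) (CcM (Cc_partial i cF).1 cpsi).
 by congr Cc; apply/funext => y; rewrite /D /psi; ring.
have cerr : Cc err.
 have t i j : Cc (fun x => D i x * commutator n i j x).
  by have := CcM (sQ i j) (cD i); congr Cc; apply/funext => y; exact: mulrC.
 exact: (Cc_sum2 (fun i => Cc_sum2 (t i))).
(* The divergence is split by [quad_product] into the energy of F w, the energy of the weight F and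
   the commutator part; the equation enters through [e2]. *)
have ident x : \sum_i partial i (g i) x = E * (F x ^+ 2 * w x * z x) +
  quad_form x (fun i => partial i psi x) - quad_form x (fun i => partial i F x) * w x * w x - err x.
 have e1 : \sum_i partial i (g i) x = \sum_i D i x * B i x + F x ^+ 2 * w x * \sum_i partial i (B i) x.
  rewrite mulr_sumr -big_split; apply: eq_bigr => i _.
  rewrite /g partialM; [|exact: der cFpsi.1|exact: der (sB i)].
  by rewrite dFpsi /psi /=; ring.
 have e2 : F x ^+ 2 * w x * \sum_i partial i (B i) x = E * (F x ^+ 2 * w x * z x).
  have [->|Fx] := eqVneq (F x) 0; first by rewrite expr2 !mul0r mulr0.
  rewrite (eq_bigr _ (fun i _ => dB i x)) (weak nn Fx) -/z; ring.
 rewrite e1 e2 [LHS]addrC -addrA -addrA; congr (_ + _).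
 under eq_bigr => i _ do rewrite BE.
 rewrite (@quad_product _ (fun i j => a i j x) (fun i j => commutator n i j x) (fun i => partial i F x)
  (fun i => partial i w x) (fun i => partial i psi x) (F x) (w x) (asym o1 o0 x) (fun i => dpsi i x)).
 by rewrite -addrA.
have ig : (\int[Leb]_x (\sum_i partial i (g i) x) = 0).
 rewrite int_sum => [|i]; last exact: (Cc_int (Cc_partial i (cg i))).
 by apply: big1 => i _; have [s1 s2] := cg i; exact: int_partial0.
have j1 := Cc_int cz; have j2 := Cc_int cq1; have j3 := Cc_int cq3; have j4 := Cc_int cerr.
have main : (E * \int[Leb]_x (F x ^+ 2 * w x * z x) + \int[Leb]_x (quad_form x (fun i => partial i psi x)) -
  \int[Leb]_x (quad_form x (fun i => partial i F x) * w x * w x) - \int[Leb]_x err x = 0).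
 rewrite -ig; under [RHS]eq_Rintegral => x _ do rewrite ident.
 rewrite intB//; last by apply: integB => //; apply: integD => //; exact: integZ.
 rewrite intB//; last by apply: integD => //; exact: integZ.
 by rewrite intD ?intZ//; exact: integZ.
have [sqw _] := mollify_cvg iv sv.
have sqQ i j : sq_integ Leb (commutator n i j : mpt -> R) by have [h _] := friedrichs j (ca i j) iv sv; exact: h.
have isum : integ Leb (fun x : mpt => \sum_i \sum_j commutator n i j x ^+ 2).
 by apply: integ_sum => i; apply: integ_sum => j; exact: (sqQ i j).2.
have errb : (\int[Leb]_x err x <= del * \int[Leb]_x (quad_form x (fun i => partial i psi x)) +
  del * \int[Leb]_x (w x ^+ 2) + K * \sum_i \sum_j \int[Leb]_x (commutator n i j x ^+ 2)).
 have -> : (\sum_i \sum_j \int[Leb]_x (commutator n i j x ^+ 2) = \int[Leb]_x (\sum_i \sum_j commutator n i j x ^+ 2)).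
  rewrite int_sum => [|i]; last by apply: integ_sum => j; exact: (sqQ i j).2.
  by apply: eq_bigr => i _; rewrite int_sum// => j; exact: (sqQ i j).2.
 have k1 := integZ del j2; have k2 := integZ del (sqw n).2; have k3 := integZ K isum.
 rewrite -!intZ//; last exact: (sqw n).2.
 rewrite -intD// -intD//; last exact: integD.
 apply: int_le => //; first by apply: integD => //; exact: integD.
 by move=> x; exact: commutator_error.
have hd : (\int[Leb]_x (W x * F x ^+ 2 * w x * w x) <= \int[Leb]_x (quad_form x (fun i => partial i psi x))).
 apply: le_trans (hardyF sw); apply: le_of_eq.
 by apply: eq_int => x; ring.
have {}hd : ((1 - del) * \int[Leb]_x (W x * F x ^+ 2 * w x * w x) <= (1 - del) * \int[Leb]_x (quad_form x (fun i => partial i psi x))).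
 by apply: ler_wpM2l hd; rewrite subr_ge0 ltW.
move: main errb hd; move: (\int[Leb]_x quad_form x _) (\int[Leb]_x err x) (K * _).
move: (E * _) (del * \int[Leb]_x _) ((1 - del) * \int[Leb]_x _) (\int[Leb]_x (_ * w x * w x)) => e1 e2 e3 e4 q0 er Q1.
rewrite mulrBl mul1r; lra.
Qed.

(** First n tends to infinity at fixed del, then del is chosen from the supposed gap. No derivative
    of v survives, so square integrability of v gives a meaning to every term. *)
Lemma caccioppoli :
 (\int[Leb]_x (W x * F x ^+ 2 * v x * v x) + E * \int[Leb]_x (F x ^+ 2 * v x * (v x * rho x)) <=
  \int[Leb]_x (quad_form x (fun i => partial i F x) * v x * v x)).
Proof.
have [b1 b10 hb1] := Cc_bounded cF.
have [b2 b20 hb2] := Cc_bounded (Cc_partial o0 cF).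
have [b3 b30 hb3] := Cc_bounded (Cc_partial o1 cF).
pose b := b1 + b2 + b3.
have Fb x : `|F x| <= b by apply: le_trans (hb1 x) _; rewrite /b -addrA lerDl addr_ge0// ltW.
have dFb i x : `|partial i F x| <= b.
 have [->|->] := ord2P i; first by apply: le_trans (hb2 x) _; rewrite /b -addrA addrC -addrA lerDl addr_ge0// ltW.
 by apply: le_trans (hb3 x) _; rewrite /b lerDr addr_ge0// ltW.
have [sw cw] := mollify_cvg iv sv.
have ivr := integM_Cc iv crho; have [br _ hbr] := Cc_bounded crho.
have svr : sq_integ Leb (fun y => v y * rho y).
 have := sq_integM_bounded (Cc_measurable crho) hbr sv.
 by under eq_fun do rewrite mulrC.
have [sz czz] := mollify_cvg ivr svr.
have bmul f : Cc f -> mfP (f : mpt -> R) /\ exists B : R, forall x, `|f x| <= B.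
 by move=> cf; split; [exact: Cc_measurable cf|have [B _ hB] := Cc_bounded cf; exists B].
have cFF := Cc_sqr cF; have cWF := CcM cW.1 cFF.
have cq : Cc (fun x => quad_form x (fun i => partial i F x)).
 have t i j : Cc (fun x => a i j x * partial i F x * partial j F x).
  have := CcM (Cc_partial j cF).1 (CcM (Cc_partial i cF).1 (ca i j)).
  by congr Cc; apply/funext => y; ring.
 exact: (Cc_sum2 (fun i => Cc_sum2 (t i))).
have [m1 [B1 h1]] := bmul _ cWF; have [m2 [B2 h2]] := bmul _ cFF; have [m3 [B3 h3]] := bmul _ cq.
have l1 := int_bilinear_cvg m1 h1 sw sw sv sv cw cw.
have l2 := int_bilinear_cvg m2 h2 sw sz sv svr cw czz.
have l3 := int_bilinear_cvg m3 h3 sw sw sv sv cw cw.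
have l4 : (\int[Leb]_x (conv v (moll n) x ^+ 2)) @[n --> \oo] --> (\int[Leb]_x (v x ^+ 2)).
 have n1 (x : mpt) : `|(1 : R)| <= 1 by rewrite normr1.
 have := int_bilinear_cvg (measurable_cst (1 : R)) n1 sw sw sv sv cw cw.
 under eq_fun do under eq_Rintegral do rewrite mul1r -expr2.
 by under eq_Rintegral do rewrite mul1r -expr2.
have l5 : (\sum_i \sum_j \int[Leb]_x (commutator n i j x ^+ 2)) @[n --> \oo] --> (0 : R).
 have t i j : (\int[Leb]_x (commutator n i j x ^+ 2)) @[n --> \oo] --> (0 : R).
  by have [_ h] := friedrichs j (ca i j) iv sv; exact: h.
 exact: (cvg0_sum2 (fun i => cvg0_sum2 (t i))).
set I1 := (\int[Leb]_x (_ * v x * v x)) in l1 *.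
set I2 := (\int[Leb]_x (F x ^+ 2 * v x * _)) in l2 *.
set I3 := (\int[Leb]_x (quad_form _ _ * v x * v x)) in l3 *.
set I4 := (\int[Leb]_x (v x ^+ 2)) in l4 *.
have step (del : R) : 0 < del -> del < 1 -> 0 <= I3 + del * I4 - ((1 - del) * I1 + E * I2).
 move=> d0 d1; set K := Lam / (2 * del) * b ^+ 2 + b ^+ 4 / del.
 have cM (k : R) (s : nat -> R) (l : R) : s @ \oo --> l -> (fun n => k * s n) @ \oo --> k * l.
  by move=> h; apply: cvgM => //; exact: cvg_cst.
 have cD (s t : nat -> R) (l m : R) : s @ \oo --> l -> t @ \oo --> m -> (fun n => s n + t n) @ \oo --> l + m.
  by move=> h1' h2'; exact: cvgD.
 have cB (s t : nat -> R) (l m : R) : s @ \oo --> l -> t @ \oo --> m -> (fun n => s n - t n) @ \oo --> l - m.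
  by move=> h1' h2'; exact: cvgB.
 have c1 := cB _ _ _ _ (cD _ _ _ _ (cD _ _ _ _ l3 (cM del _ _ l4)) (cM K _ _ l5)) (cD _ _ _ _ (cM (1 - del) _ _ l1) (cM E _ _ l2)).
 rewrite mulr0 addr0 in c1; apply: (cvg_ge0 (n0 := n0) _ c1) => n nn.
 by rewrite subr_ge0; exact: caccioppoli_step.
rewrite leNgt; apply/negP => lt.
have I40 : 0 <= I4 by exact: int_sq_ge0.
pose gap := I1 + E * I2 - I3; have g0 : 0 < gap by rewrite subr_gt0.
pose del := gap / (2 * (gap + `|I1| + I4)).
have s0 : 0 < gap + `|I1| + I4 by rewrite -addrA ltr_pwDl// addr_ge0.
have d0 : 0 < del by rewrite divr_gt0// mulr_gt0.
have d1 : del < 1.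
 rewrite ltr_pdivrMr ?mul1r ?mulr_gt0//.
 by have := normr_ge0 I1; lra.
have := step del d0 d1.
have e : del * (gap + `|I1| + I4) = gap / 2 by rewrite /del; field; rewrite gt_eqF.
exact: (absorb_arith erefl g0 d0 e (ler_norm I1)).
Qed.

End Caccioppoli.

End Plane.

Lemma det2 (R : comNzRingType) (F : 'I_2 -> 'I_2 -> R) :
 \det (\matrix_(i, j) F i j) = F o0 o0 * F o1 o1 - F o0 o1 * F o1 o0.
Proof.
rewrite (expand_det_row _ o0) sum_ord2 /cofactor !det_mx11 !mxE /=.
have -> : lift o0 0 = o1 :> 'I_2 by exact: val_inj.
have -> : lift o1 0 = o0 :> 'I_2 by exact: val_inj.
by rewrite mul1r mulN1r mulrN.
Qed.

Local Notation cmap := chart_map.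
Local Notation cdom := chart_dom.
Local Notation cinv := chart_inv.

(** * Smooth functions on a surface *)

Section Surface.
Context (R : realType) (M : topologicalType) (S : smooth_surface R M).
Local Notation pt := (R * R)%type.
Local Notation bv := (basis_vec R).
Local Notation cvec := (coord_vec S).
Local Notation smooth := (smooth_fun S).

Section SmoothFun.
Implicit Types (c d : chart R M) (f g h : M -> R) (q p : M) (O V W : set M) (x y : pt) (i : 'I_2).

Definition chart_img c : set pt := cmap c @` cdom c.

(** The image under the chart of [cdom c] intersected with W, see [chart_preE], in a form whose
    membership unfolds to conditions on [cinv c x]. *)
Definition chart_pre c W : set pt := [set x | chart_img c x /\ W (cinv c x)].

Lemma chart_imgP c q : cdom c q -> chart_img c (cmap c q).
Proof. by move=> cq; exists q. Qed.

Lemma chart_invK c x : chart_img c x -> cmap c (cinv c x) = x.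
Proof. by move=> [q cq <-]; rewrite chart_mapK. Qed.

Lemma chart_inv_dom c x : chart_img c x -> cdom c (cinv c x).
Proof. by move=> [q cq <-]; rewrite chart_mapK. Qed.

Lemma chart_preE c W : cmap c @` (cdom c `&` W) = chart_pre c W.
Proof.
apply/seteqP; split => [_ [q [cq Wq] <-]|x [cx Wx]].
 by split; [exact: chart_imgP|rewrite chart_mapK].
by exists (cinv c x); [split=> //; exact: chart_inv_dom|exact: chart_invK].
Qed.

Lemma chart_preP c W q : cdom c q -> W q -> chart_pre c W (cmap c q).
Proof. by move=> cq Wq; split; [exact: chart_imgP|rewrite chart_mapK]. Qed.

Lemma open_pre c W : open W -> open (chart_pre c W).
Proof.
move=> oW; rewrite openE => x [cx Wx]; apply: filterI.
 by apply: open_nbhs_nbhs; split => //; exact: chart_img_open.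
by apply: (@chart_inv_continuous _ _ c x cx W); exact: open_nbhs_nbhs.
Qed.

Arguments open_pre : clear implicits.
Arguments open_pre c {W} _.

Lemma open_chart_map c (V : set pt) : open V -> open [set q | cdom c q /\ V (cmap c q)].
Proof.
move=> oV; rewrite openE => q [cq Vq]; apply: filterI.
 by apply: open_nbhs_nbhs; split => //; exact: chart_dom_open.
by apply: (@chart_map_continuous _ _ c q cq V); exact: open_nbhs_nbhs.
Qed.

Lemma smooth_funE W f : smooth W f <->
 forall c, atlas S c -> smooth_on (chart_pre c W) (f \o cinv c).
Proof. by split=> h c Ac; have := h c Ac; rewrite chart_preE. Qed.

Lemma smooth_fun_sub V W f : V `<=` W -> smooth W f -> smooth V f.
Proof.
move=> VW /smooth_funE sf; apply/smooth_funE => c Ac s x [cx Vx].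
by apply: (sf c Ac); split => //; exact: VW.
Qed.

Lemma smooth_fun_eq W f g : open W -> (forall q, W q -> f q = g q) -> smooth W f -> smooth W g.
Proof.
move=> oW fg /smooth_funE sf; apply/smooth_funE => c Ac.
apply: smooth_on_eq (open_pre c oW) _ (sf c Ac) => x /set_mem[cx Wx].
exact: fg.
Qed.

Lemma smooth_fun_local W f :
 (forall q, W q -> exists2 V, V q & smooth V f) -> smooth W f.
Proof.
move=> h; apply/smooth_funE => c Ac s x [cx Wx].
have [V Vq /smooth_funE sf] := h _ Wx; apply: sf; by [].
Qed.

Lemma smooth_fun_cst W (a : R) : smooth W (fun=> a).
Proof. by move=> c _; exact: smooth_cst. Qed.

Lemma smooth_funD W f g : open W -> smooth W f -> smooth W g ->
 smooth W (fun q => f q + g q).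
Proof.
move=> oW /smooth_funE sf /smooth_funE sg; apply/smooth_funE => c Ac.
exact: smoothD (open_pre c oW) (sf c Ac) (sg c Ac).
Qed.

Lemma smooth_funM W f g : open W -> smooth W f -> smooth W g ->
 smooth W (fun q => f q * g q).
Proof.
move=> oW /smooth_funE sf /smooth_funE sg; apply/smooth_funE => c Ac.
exact: smoothM (open_pre c oW) (sf c Ac) (sg c Ac).
Qed.

Lemma smooth_funB W f g : open W -> smooth W f -> smooth W g ->
 smooth W (fun q => f q - g q).
Proof.
move=> oW /smooth_funE sf /smooth_funE sg; apply/smooth_funE => c Ac.
exact: smoothB (open_pre c oW) (sf c Ac) (sg c Ac).
Qed.

Lemma smooth_fun_sum W (I : Type) (s : seq I) (F : I -> M -> R) : open W ->
 (forall k, smooth W (F k)) -> smooth W (fun q => \sum_(k <- s) F k q).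
Proof.
move=> oW sF; elim: s => [|i s IH].
 by apply: (smooth_fun_eq oW _ (@smooth_fun_cst W 0)) => q _; rewrite big_nil.
by apply: smooth_fun_eq oW _ (smooth_funD oW (sF i) IH) => q; rewrite big_cons.
Qed.

Lemma smooth_funV W f : open W -> (forall q, W q -> f q != 0) -> smooth W f ->
 smooth W (fun q => (f q)^-1).
Proof.
move=> oW f0 /smooth_funE sf; apply/smooth_funE => c Ac.
apply: smoothV (open_pre c oW)  _ (sf c Ac) => x [cx Wx]; exact: f0.
Qed.

Lemma smooth_fun_comp2 W (V : set pt) (h : pt -> R) f g : open W -> open V -> smooth_on V h ->
 smooth W f -> smooth W g -> (forall q, W q -> V (f q, g q)) ->
 smooth W (fun q => h (f q, g q)).
Proof.
move=> oW oV sh /smooth_funE sf /smooth_funE sg fV; apply/smooth_funE => c Ac.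
apply: (smooth_comp2 (open_pre c oW) oV sh (sf c Ac) (sg c Ac)) => x [cx Wx]; exact: fV.
Qed.

Lemma smooth_fun_sqrt W f : open W -> (forall q, W q -> 0 < f q) -> smooth W f ->
 smooth W (fun q => sqrt (f q)).
Proof.
move=> oW f0 /smooth_funE sf; apply/smooth_funE => c Ac.
apply: (@smooth_sqrt _ _ (f \o cinv c) (open_pre c oW)  _ (sf c Ac)) => x [cx Wx]; exact: f0.
Qed.

Lemma smooth_fun_step W f : open W -> smooth W f -> smooth W (fun q => smooth_step (f q)).
Proof.
move=> oW sf; exact: (smooth_fun_comp2 oW openT (@smooth_smooth_step R) sf sf (fun _ _ => I)).
Qed.

Lemma smooth_fun_chart c W (h : pt -> R) : atlas S c -> open W -> W `<=` cdom c ->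
 smooth_on (chart_pre c W) h -> smooth W (fun q => h (cmap c q)).
Proof.
move=> Ac oW Wc sh; apply/smooth_funE => d Ad.
have oU := open_pre d oW.
have sU : smooth_on (chart_pre d W) (transition d c o0) /\ smooth_on (chart_pre d W) (transition d c o1).
 by split; move=> s x [dx Wx]; apply: (atlas_smooth Ad Ac); rewrite chart_preE; split => //; exact: Wc.
apply: (@smooth_on_eq _ _ (fun x => h (transition d c o0 x, transition d c o1 x)) _ oU).
 by move=> x _; rewrite /transition /Defs.coord /= -surjective_pairing.
apply: (smooth_comp2 oU (open_pre c oW) sh sU.1 sU.2) => x [dx Wx].
rewrite /transition /Defs.coord /= -surjective_pairing; apply: chart_preP => //; exact: Wc.
Qed.

Lemma smooth_fun_coord c i : atlas S c -> smooth (cdom c) (fun q => Defs.coord i (cmap c q)).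
Proof.
move=> Ac; have oc := @chart_dom_open _ _ c; have oU := open_pre c oc.
apply: (smooth_fun_chart Ac oc (@subset_refl _ _)).
by have [->|->] := ord2P i; [exact: (smooth_fst oU)|exact: (smooth_snd oU)].
Qed.

(** Extension by zero: f is smooth on W, vanishes on the open complement of K, and these two open
    sets cover M. *)
Lemma smooth_fun_ext W (K : set M) f : open W -> closed K -> K `<=` W -> smooth W f ->
 (forall q, ~ K q -> f q = 0) -> smooth setT f.
Proof.
move=> oW cK KW sf f0; apply: smooth_fun_local => q _.
have [Kq|nKq] := pselect (K q); first by exists W => //; exact: KW.
exists (~` K) => //; apply: (smooth_fun_eq (closed_openC cK) _ (@smooth_fun_cst (~` K) 0)) => p Kp.
by rewrite f0.
Qed.

Lemma smooth_fun_continuous W f q : open W -> W q -> smooth W f -> {for q, continuous f}.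
Proof.
move=> oW Wq /smooth_funE sf; have [c Ac cq] := atlas_cover S q.
have Pq := chart_preP cq Wq.
have [cf _] := smooth_partials (sf c Ac) (x := cmap c q) Pq.
have := @continuous_comp _ _ _ (cmap c) (f \o cinv c) q (chart_map_continuous cq) cf.
rewrite /prop_for /continuous_at /= chart_mapK//; apply: cvg_trans.
apply: near_eq_cvg; near=> p; rewrite /= chart_mapK//; near: p.
by apply: open_nbhs_nbhs; split => //; exact: chart_dom_open.
Unshelve. all: by end_near. Qed.

Lemma Cinf_smooth (f : Cinf S) : smooth setT f.
Proof. by case: f => f /= /set_mem. Qed.

Lemma Cinf_smoothW W (f : Cinf S) : smooth W (f : M -> R).
Proof. by apply: smooth_fun_sub (Cinf_smooth f). Qed.

Lemma Cinf_continuous (f : Cinf S) : continuous (f : M -> R).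
Proof. by move=> q; exact: (smooth_fun_continuous openT I (Cinf_smooth f)). Qed.

Definition mkCinf f (sf : smooth setT f) : Cinf S := MkCinf (mem_set sf : f \in smooth_pred S).

Lemma Cinf_eq (f g : Cinf S) : (forall q, f q = g q) -> f = g.
Proof. by move=> fg; apply/val_inj/funext. Qed.

Lemma Cinf_smooth_on c (f : Cinf S) : atlas S c -> smooth_on (chart_img c) (f \o cinv c).
Proof.
move=> Ac s x cx; have /smooth_funE h := Cinf_smooth f; apply: (h c Ac); by split.
Qed.

Lemma CinfD_E (f g : Cinf S) q : (f + g) q = f q + g q. Proof. by []. Qed.
Lemma CinfB_E (f g : Cinf S) q : (f - g) q = f q - g q. Proof. by []. Qed.
Lemma CinfN_E (f : Cinf S) q : (- f) q = - f q. Proof. by []. Qed.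
Lemma CinfM_E (f g : Cinf S) q : (f * g) q = f q * g q. Proof. by []. Qed.
Lemma CinfZ_E a (f : Cinf S) q : (a *: f) q = a * f q. Proof. by []. Qed.
Lemma Cinf1_E q : (1 : Cinf S) q = 1. Proof. by []. Qed.
Lemma Cinf0_E q : (0 : Cinf S) q = 0. Proof. by []. Qed.
Lemma Cinf_sum_E (I : Type) (s : seq I) (F : I -> Cinf S) q :
 (\sum_(i <- s) F i) q = \sum_(i <- s) F i q.
Proof. by elim: s => [|i s IH]; rewrite ?big_nil// !big_cons CinfD_E IH. Qed.
Lemma CinfX_E n (f : Cinf S) q : (f ^+ n) q = f q ^+ n.
Proof. by elim: n => [|n IH]; rewrite ?expr0// !exprS CinfM_E IH. Qed.
Definition CinfE := (CinfD_E, CinfB_E, CinfN_E, CinfM_E, CinfZ_E, Cinf1_E, Cinf0_E, Cinf_sum_E, CinfX_E).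

Lemma compact_chart_inv c (K : set pt) : compact K -> K `<=` chart_img c -> compact (cinv c @` K).
Proof.
move=> cK Kc; apply: continuous_compact => //; apply: continuous_in_subspaceT => x /set_mem Kx.
by apply: chart_inv_continuous; exact: Kc.
Qed.

Lemma bump_at q O : open O -> O q -> exists (chi : Cinf S) (K V : set M),
 [/\ compact K, K `<=` O, open V, V q & [/\ V `<=` K, forall p, 0 <= chi p <= 1,
  forall p, ~ K p -> chi p = 0 & forall p, V p -> chi p = 1]].
Proof.
move=> oO Oq; have [c Ac cq] := atlas_cover S q.
have oP := open_pre c oO; have Pq := chart_preP cq Oq.
have [r r0 hr] := open_ball_sub oP Pq.
set x0 := cmap c q in Pq hr.
(* The scale 2 / r makes the bump equal to 1 within distance r / 4 of [x0] and zero beyond r / 2,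
   inside the chart. *)
pose h (x : pt) : R := unit_bump ((- (2 / r)) *: x0 + (2 / r) *: x).
have t0 : 0 < 2 / r by rewrite divr_gt0.
have hn (x : pt) : `|(- (2 / r)) *: x0 + (2 / r) *: x| = 2 / r * `|x - x0|.
 by rewrite scaleNr addrC -scalerBr normrZ gtr0_norm.
have sh : smooth_on setT h by exact: (smooth_affine _ _ (Cc_unit_bump R).1).
pose KR := [set x : pt | `|x - x0| <= r / 2].
have KRr : KR `<=` chart_pre c O.
 by move=> x /= xr; apply: hr; apply: le_lt_trans xr _; lra.
have cKR : compact KR by exact: compact_square.
pose K := cinv c @` KR.
have cK : compact K by apply: compact_chart_inv => // x /KRr[].
have KO : K `<=` O `&` cdom c.
 by move=> _ [x /KRr[cx Ox] <-]; split => //; exact: chart_inv_dom.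
pose f p := if pselect (cdom c p) then h (cmap c p) else 0.
have f0 p : ~ K p -> f p = 0.
 rewrite /f; case: pselect => // cp nK; apply: unit_bump_eq0; rewrite hn leNgt; apply/negP => hlt.
 apply: nK; exists (cmap c p); last exact: chart_mapK.
 rewrite /KR /=; move: hlt; rewrite mulrC -ltr_pdivlMr// mul1r invf_div => /ltW; apply: le_trans.
 by rewrite le_eqVlt eqxx.
have oc := @chart_dom_open _ _ c.
have sf : smooth setT f.
 apply: (smooth_fun_ext oc (compact_closed (surface_hausdorff S) cK) _ _ f0); first by move=> p /KO[].
 apply: (@smooth_fun_eq _ (fun p => h (cmap c p)) f oc).
  by move=> p cp; rewrite /f; case: pselect.
 apply: (smooth_fun_chart Ac oc (@subset_refl _ _)) => s x _; exact: sh.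
pose VR := [set x : pt | `|x - x0| < r / 4].
have oVR : open VR.
 rewrite (_ : VR = ball x0 (r / 4)); first exact: ball_open.
 by apply/seteqP; split => x /=; rewrite -ball_normE /= distrC.
exists (mkCinf sf), K, [set p | cdom c p /\ VR (cmap c p)]; split => //.
- by move=> p /KO[].
- exact: open_chart_map.
- by split => //; rewrite /VR /= subrr normr0 divr_gt0.
split.
- move=> p [cp Vp]; exists (cmap c p); last exact: chart_mapK.
 by rewrite /KR /=; apply/ltW/(lt_trans Vp); lra.
- move=> p; change (0 <= f p <= 1); rewrite /f; case: pselect => cp; last by rewrite lexx ler01.
 by rewrite /h unit_bump_ge0 unit_bump_le1.
- exact: f0.
- move=> p [cp Vp]; change (f p = 1); rewrite /f; case: pselect => // cp'; apply: unit_bump_eq1; rewrite hn.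
 apply/ltW; rewrite mulrAC ltr_pdivrMr//; move: Vp; rewrite /VR /=; lra.
Qed.

(** Tangent vectors act on global functions only; this trades a locally defined smooth function for
    a global one with the same germ at q. *)
Lemma globalize q W f : open W -> W q -> smooth W f ->
 exists (g : Cinf S) (V : set M), [/\ open V, V q, V `<=` W & forall p, V p -> g p = f p].
Proof.
move=> oW Wq sf; have [chi [K [V [cK KW oV Vq [VK c01 c0 c1]]]]] := bump_at oW Wq.
have sg : smooth setT (fun p => chi p * f p).
 apply: (smooth_fun_ext oW (compact_closed (surface_hausdorff S) cK) KW).
  exact: (@smooth_funM W chi f oW (Cinf_smoothW (W := W) chi) sf).
 by move=> p /c0 ->; rewrite mul0r.
exists (mkCinf sg), V; split => //; first by move=> p /VK/KW.
by move=> p /c1 /= ->; rewrite mul1r.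
Qed.

End SmoothFun.

Arguments open_pre c {W} _.

(** * Tangent vectors as derivations *)

Section Tangent.
Implicit Types (c : chart R M) (f g h : Cinf S) (q p : M) (O V W : set M) (x : pt) (i j : 'I_2) (v w : Cinf S -> R).

Lemma tangent0 v q : tangent S q v -> v 0 = 0.
Proof. by move=> [lv _]; have := lv 1 0 0; rewrite scale1r addr0 mul1r => e; apply: (@addrI _ (v 0)); rewrite addr0. Qed.

Lemma tangentD v q f g : tangent S q v -> v (f + g) = v f + v g.
Proof. by move=> [lv _]; rewrite -{1}[f]scale1r lv mul1r. Qed.

Lemma tangentZ v q a f : tangent S q v -> v (a *: f) = a * v f.
Proof. by move=> tv; have := tv.1 a f 0; rewrite addr0 (tangent0 tv) addr0. Qed.

Lemma tangentB v q f g : tangent S q v -> v (f - g) = v f - v g.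
Proof. by move=> tv; rewrite -scaleN1r (tangentD _ _ tv) (tangentZ _ _ tv) mulN1r. Qed.

Lemma tangentM v q f g : tangent S q v -> v (f * g) = f q * v g + g q * v f.
Proof. by move=> [_]; exact. Qed.

Lemma tangent1 v q : tangent S q v -> v 1 = 0.
Proof.
move=> tv; have := tangentM 1 1 tv; rewrite mulr1 !CinfE !mul1r => e.
by apply: (@addrI _ (v 1)); rewrite addr0 -e.
Qed.

Lemma tangent_sum v q (I : Type) (s : seq I) (F : I -> Cinf S) : tangent S q v ->
 v (\sum_(k <- s) F k) = \sum_(k <- s) v (F k).
Proof.
move=> tv; elim: s => [|k s IH]; rewrite ?big_nil; first exact: tangent0 tv.
by rewrite !big_cons (tangentD _ _ tv) IH.
Qed.

(** A bump at q supported in V kills f - g, and Leibniz's rule applied to their product shows that v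
    does too. *)
Lemma tangent_local v q V f g : tangent S q v -> open V -> V q -> (forall p, V p -> f p = g p) -> v f = v g.
Proof.
move=> tv oV Vq fg; have [chi [K [V' [cK KV oV' V'q [V'K c01 c0 c1]]]]] := bump_at oV Vq.
have e : (f - g) * chi = 0.
 apply: Cinf_eq => p; rewrite !CinfE; have [/KV/fg ->|/c0 ->] := pselect (K p); last by rewrite mulr0.
 by rewrite subrr mul0r.
have := tangentM (f - g) chi tv; rewrite e (tangent0 tv) !CinfE (fg q Vq) subrr mul0r add0r c1// mul1r.
by rewrite (tangentB _ _ tv) => /esym/eqP; rewrite subr_eq0 => /eqP.
Qed.

(** Coordinates as global smooth functions that agree with those of the chart on O, since a
    derivation cannot be applied to the chart map itself. *)
Definition coords c (y : 'I_2 -> Cinf S) O :=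
 [/\ atlas S c, open O, O `<=` cdom c &
  forall p i, O p -> y i p = Defs.coord i (cmap c p)].

Lemma coordinates_at c q : atlas S c -> cdom c q -> exists y O, coords c y O /\ O q.
Proof.
move=> Ac cq; have oc := @chart_dom_open _ _ c.
have [y0 [V0 [oV0 V0q V0c h0]]] := globalize oc cq (smooth_fun_coord o0 Ac).
have [y1 [V1 [oV1 V1q V1c h1]]] := globalize oc cq (smooth_fun_coord o1 Ac).
exists (fun i => if i == o0 then y0 else y1), (V0 `&` V1); split => //; split => //.
- exact: openI.
- by move=> p [/V0c].
- by move=> p i [Vp0 Vp1]; have [->|->] := ord2P i; [exact: h0|exact: h1].
Qed.

Lemma coordinates_cover q : exists c y W, coords c y W /\ W q.
Proof.
have [c Ac cq] := atlas_cover S q; have [y [W cW]] := coordinates_at Ac cq.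
by exists c, y, W.
Qed.

(** The image of K is compact, hence closed in the plane, so the extension by zero is smooth
    there. *)
Lemma chart_ext c (f : M -> R) (K : set M) : atlas S c -> compact K -> K `<=` cdom c ->
 smooth (cdom c) f -> (forall p, ~ K p -> f p = 0) ->
 exists2 F : pt -> R, Cc F &
  (forall p, cdom c p -> F (cmap c p) = f p) /\ (forall x, F x != 0 -> (cmap c @` K) x).
Proof.
move=> Ac cK Kc sf f0.
pose F x := if pselect (chart_img c x) then f (cinv c x) else 0.
have cKc : compact (cmap c @` K).
 apply: continuous_compact => //; apply: continuous_in_subspaceT => p /set_mem Kp.
 by apply: chart_map_continuous; exact: Kc.
have F0 x : ~ (cmap c @` K) x -> F x = 0.
 rewrite /F; case: pselect => // cx nK; apply: f0 => Kp; apply: nK.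
 by exists (cinv c x) => //; exact: chart_invK.
have Hs : smooth_on setT F.
 apply: smooth_on_local => x _; have [cx|ncx] := pselect (chart_img c x).
  exists (chart_img c); split => //; first exact: chart_img_open.
  have oc : open (chart_img c) by exact: chart_img_open.
  apply: (smooth_on_eq (f := f \o cinv c) oc) => [y /set_mem cy|].
   by rewrite /F; case: pselect.
  have /smooth_funE h := sf; move=> s z cz; apply: (h c Ac); split => //; exact: chart_inv_dom.
 have oK : open (~` (cmap c @` K)).
  by apply: closed_openC; apply: compact_closed => //; exact: norm_hausdorff.
 exists (~` (cmap c @` K)); split => //.
  by move=> [p Kp px]; apply: ncx; rewrite -px; apply: chart_imgP; exact: Kc.
 by apply: (smooth_on_eq (f := fun=> 0) oK) => [y /set_mem yK|]; [rewrite F0|exact: smooth_cst].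
have Fn x : F x != 0 -> (cmap c @` K) x.
 by move=> Fx; apply: contrapT => /F0 e; move: Fx; rewrite e eqxx.
exists F; first split => //.
 have [C _ hC] := @compact_bound R _ _ (fun x : pt => `|x|) cKc (fun x _ => @norm_continuous _ _ x).
 by exists C => x /Fn/hC; rewrite normr_id.
by split => // p cp; rewrite /F; case: pselect => [cx|[]]; [rewrite chart_mapK|exact: chart_imgP].
Qed.

(** Near q, f is f(q) plus the sum of (y_i - y_i(q)) h_i with h_i smooth, by Hadamard's lemma in the
    chart; a derivation at q sees only the numbers h_i(q). *)
Lemma tangent_hadamard c y O q f : coords c y O -> O q ->
 exists h : 'I_2 -> R, forall v, tangent S q v -> v f = \sum_i v (y i) * h i.
Proof.
move=> [Ac oO Oc hy] Oq; have cq := Oc q Oq.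
have [chi [K [V [cK KO oV Vq [VK c01 c0 c1]]]]] := bump_at oO Oq.
have Kc : K `<=` cdom c by move=> p /KO/Oc.
have [F cF [hF _]] := @chart_ext c (chi * f) K Ac cK Kc (Cinf_smoothW (chi * f))
 (fun p nK => ltac:(by rewrite CinfM_E c0// mul0r)).
have oc := @chart_dom_open _ _ c.
have sH j : smooth (cdom c) (fun p => ray_mean (cmap c q) 0 (partial j F) (cmap c p)).
 apply: (smooth_fun_chart Ac oc (@subset_refl _ _)) => s x _.
 exact: (smooth_ray _ _ (Cc_partial j cF)).
have [h0 [V0 [oV0 V0q V0c e0]]] := globalize oc cq (sH o0).
have [h1 [V1 [oV1 V1q V1c e1]]] := globalize oc cq (sH o1).
exists (fun i => if i == o0 then h0 q else h1 q) => v tv.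
have -> : v f = v ((f q) *: (1 : Cinf S) + ((y o0 - (y o0 q) *: (1 : Cinf S)) * h0 + (y o1 - (y o1 q) *: (1 : Cinf S)) * h1)).
 apply: (tangent_local tv (openI oV (openI oV0 oV1))) => // p [Vp [V0p V1p]].
 rewrite !CinfE e0// e1//; have cp := V0c p V0p.
 have Op : O p by exact/KO/VK.
 have := hadamard (cmap c q) (cmap c p) cF.
 rewrite (hF p cp) (hF q cq) !CinfE c1// c1// !mul1r => /eqP; rewrite subr_eq addrC => /eqP ->.
 by rewrite !hy// /Defs.coord /= !mulr1.
rewrite !(tangentD _ _ tv) (tangentZ _ _ tv) (tangent1 tv) mulr0 add0r !(tangentM _ _ tv) !CinfE !mulr1 !subrr !mul0r !add0r.
rewrite !(tangentB _ _ tv) !(tangentZ _ _ tv) (tangent1 tv) !mulr0 !subr0.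
by rewrite sum_ord2 /= mulrC [X in _ + X]mulrC.
Qed.

Lemma chart_partials c f q i : atlas S c -> cdom c q ->
 derivable (f \o cinv c) (cmap c q) (bv i).
Proof.
move=> Ac cq; exact: ((smooth_partials (Cinf_smooth_on f Ac) (chart_imgP cq)).2 i).
Qed.

Lemma coord_vec_tangent c q i : atlas S c -> cdom c q -> tangent S q (cvec c i q).
Proof.
move=> Ac cq; split => [a f g|f g]; rewrite /coord_vec.
 have df := @chart_partials c f q i Ac cq; have dg := @chart_partials c g q i Ac cq.
 have da : derivable (a *: ((f : M -> R) \o cinv c)) (cmap c q) (bv i) by exact: derivableZ.
 by have := partialD da dg; rewrite (partialZ _ df); exact.
have df := @chart_partials c f q i Ac cq; have dg := @chart_partials c g q i Ac cq.
by have := partialM df dg; rewrite /= chart_mapK// mulrC addrC => <-.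
Qed.

Lemma coord_vec_coord c y O q i j : coords c y O -> O q -> cvec c i q (y j) = (i == j)%:R.
Proof.
move=> [Ac oO Oc hy] Oq; have cq := Oc q Oq.
have oP := open_pre c oO; have Pq := chart_preP cq Oq.
have -> : cvec c i q (y j) = partial i (Defs.coord j) (cmap c q).
 apply: (@partial_eq R _ (y j \o cinv c) (Defs.coord j) i oP _ _ (mem_set Pq)) => x /set_mem[cx Ox].
 by rewrite /= hy// chart_invK.
have [->|->] := ord2P j; rewrite /partial /Defs.coord /=.
 have [_ ->] := @is_derive_fst R (cmap c q) (bv i).
 by have [->|->] := ord2P i.
have [_ ->] := @is_derive_snd R (cmap c q) (bv i).
by have [->|->] := ord2P i.
Qed.

Lemma tangent_coords c y O q v f : coords c y O -> O q -> tangent S q v ->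
 v f = \sum_i v (y i) * cvec c i q f.
Proof.
move=> cy Oq tv; have [h hh] := tangent_hadamard f cy Oq.
have [Ac _ Oc _] := cy; have cq := Oc q Oq.
rewrite hh//; apply: eq_bigr => i _; congr (_ * _).
rewrite (hh _ (coord_vec_tangent i Ac cq)) (bigD1 i)//= (coord_vec_coord i i cy Oq) eqxx mul1r big1 ?addr0// => j ji.
by rewrite (coord_vec_coord i j cy Oq) eq_sym (negbTE ji) mul0r.
Qed.

End Tangent.

(** * The cometric of an anchored Euclidean bundle *)

Section Cometric.
Context (B : anchored_euclidean_bundle S).
Local Notation E := (bundle B).
Local Notation sp := scalar_product.
Implicit Types (q p : M) (f g h phi psi : Cinf S) (O V W : set M) (i j : 'I_2) (e : frame E).

Lemma anchorD q (v w : E q) f : anchor (v + w) f = anchor v f + anchor w f.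
Proof. by rewrite -{1}[v]scale1r anchor_linear scale1r. Qed.

Lemma anchor0 q f : anchor (0 : E q) f = 0.
Proof. by have := anchorD 0 0 f (q := q); rewrite addr0 => h; apply: (@addrI _ (anchor (0 : E q) f)); rewrite addr0. Qed.

Lemma anchorZ q a (v : E q) f : anchor (a *: v) f = a * anchor v f.
Proof. by rewrite -{1}[a *: v]addr0 anchor_linear; change (a * anchor v f + anchor (0 : E q) f = a * anchor v f); rewrite anchor0 addr0. Qed.

Lemma spDl q (u v w : E q) : sp (u + v) w = sp u w + sp v w.
Proof. by rewrite -[u]scale1r scalar_product_linear mul1r scale1r. Qed.

Lemma sp0l q (w : E q) : sp 0 w = 0.
Proof. by have := spDl 0 0 w; rewrite addr0 => h; apply: (@addrI _ (sp 0 w)); rewrite addr0. Qed.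

Lemma spZl q a (v w : E q) : sp (a *: v) w = a * sp v w.
Proof. by rewrite -[a *: v]addr0 scalar_product_linear sp0l addr0. Qed.

Lemma spDr q (u v w : E q) : sp w (u + v) = sp w u + sp w v.
Proof. by rewrite scalar_product_sym spDl !(scalar_product_sym w). Qed.

Lemma spZr q a (v w : E q) : sp w (a *: v) = a * sp w v.
Proof. by rewrite scalar_product_sym spZl scalar_product_sym. Qed.

Lemma sp_eq0 q (v : E q) : (forall w, sp v w = 0) -> v = 0.
Proof.
move=> h; apply/eqP/negPn/negP => v0; have := scalar_product_pos v0.
by rewrite h ltxx.
Qed.

Lemma frame_dec e q (v : E q) : frame_dom e q -> exists a b : R, v = a *: frame_vec e q o0 + b *: frame_vec e q o1.
Proof. by move=> /frame_basis/(_ v)[a [-> _]]; exists (a o0), (a o1); rewrite sum_ord2. Qed.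

Lemma frame_indep e q (a b : R) : frame_dom e q ->
 a *: frame_vec e q o0 + b *: frame_vec e q o1 = 0 -> a = 0 /\ b = 0.
Proof.
move=> eq0 h; have [c [_ uc]] := frame_basis eq0 (0 : E q).
pose k (x y : R) (i : 'I_2) := if i == o0 then x else y.
have h1 := uc (k a b) ltac:(by rewrite sum_ord2).
have h2 := uc (k 0 0) ltac:(by rewrite sum_ord2 /= !scale0r addr0).
have e12 : k a b = k 0 0 by rewrite -h1 -h2.
by split; [have := congr1 (@^~ o0) e12|have := congr1 (@^~ o1) e12].
Qed.

Definition gram e q i j : R := sp (frame_vec e q i) (frame_vec e q j).
Definition gram_det e q : R := gram e q o0 o0 * gram e q o1 o1 - gram e q o0 o1 ^+ 2.

(** Gram-Schmidt: z is orthogonal to w, and its squared length is [sp w w] times the determinant. *)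
Lemma gram_det_gt0 e q : frame_dom e q -> 0 < gram_det e q.
Proof.
move=> eq0; set u := frame_vec e q o0; set w := frame_vec e q o1.
have w0 : w != 0.
 apply/eqP => w0; have := @frame_indep e q 0 1 eq0; rewrite -/w w0 scaler0 scale0r addr0 => /(_ erefl)[_ /eqP].
 by rewrite oner_eq0.
have ww := scalar_product_pos w0.
pose z := sp w w *: u - sp u w *: w.
have z0 : z != 0.
 apply/eqP => z0; have [/eqP] := @frame_indep e q (sp w w) (- sp u w) eq0 ltac:(by rewrite scaleNr).
 by rewrite gt_eqF.
have := scalar_product_pos z0.
have -> : sp z z = sp w w * gram_det e q.
 rewrite /z -scaleNr !(spDl, spDr, spZl, spZr) /gram_det /gram -/u -/w (scalar_product_sym w u); ring.
by rewrite pmulr_rgt0.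
Qed.

Lemma sharp_ex q phi : exists v : E q, forall w, sp v w = anchor w phi.
Proof.
have [e _ eq0] := frames_cover E q.
have d0 := gram_det_gt0 eq0; set d := gram_det e q in d0.
set u := frame_vec e q o0; set w := frame_vec e q o1.
pose a := (anchor u phi * sp w w - anchor w phi * sp u w) / d.
pose b := (anchor w phi * sp u u - anchor u phi * sp u w) / d.
exists (a *: u + b *: w) => x; have [s [t ->]] := frame_dec x eq0.
rewrite -/u -/w !(spDl, spDr, spZl, spZr) !(anchorD, anchorZ) (scalar_product_sym w u) /a /b.
have : d != 0 by rewrite gt_eqF.
by rewrite /d /gram_det /gram -/u -/w => ?; field.
Qed.

(** The Riesz representative, in the fibre, of the linear form sending w to [anchor w phi]. Its
    anchor is the gradient of phi off the singular set, but it exists at every point. *)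
Definition sharp phi q : E q := xget 0 [set v | forall w, sp v w = anchor w phi].

Lemma sharpP phi q (w : E q) : sp (sharp phi q) w = anchor w phi.
Proof. by apply: (@xgetPex _ 0 [set v : E q | forall w, sp v w = anchor w phi]); exact: sharp_ex. Qed.

Lemma sharp_unique phi q (v : E q) : (forall w, sp v w = anchor w phi) -> v = sharp phi q.
Proof.
move=> h; apply/eqP; rewrite -subr_eq0; apply/eqP/sp_eq0 => w.
by rewrite -scaleN1r spDl spZl h sharpP mulN1r subrr.
Qed.

(** The inverse metric paired with two differentials. In a frame it is polynomial in the anchored
    frame vectors and the Gram matrix, divided by [gram_det], hence smooth across the singular
    set. *)
Definition cometric phi psi q : R := anchor (sharp phi q) psi.

Lemma cometric_sp phi psi q : cometric phi psi q = sp (sharp psi q) (sharp phi q).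
Proof. by rewrite sharpP. Qed.

Lemma cometricC phi psi q : cometric phi psi q = cometric psi phi q.
Proof. by rewrite !cometric_sp scalar_product_sym. Qed.

Lemma cometric_tangent phi q : tangent S q (fun psi => cometric phi psi q).
Proof. exact: anchor_tangent. Qed.

Lemma cometric_ge0 phi q : 0 <= cometric phi phi q.
Proof.
rewrite cometric_sp; have [->|h] := eqVneq (sharp phi q) 0; first by rewrite sp0l.
exact/ltW/scalar_product_pos.
Qed.

(** The determinant of the two anchored frame vectors evaluated on (phi, psi); for coordinates it
    vanishes exactly on the singular set. *)
Definition frame_jac e phi psi q : R :=
 anchor (frame_vec e q o0) phi * anchor (frame_vec e q o1) psi -
 anchor (frame_vec e q o1) phi * anchor (frame_vec e q o0) psi.

Lemma cometric_frame e phi psi q (a := fun i => anchor (frame_vec e q i) phi)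
  (b := fun i => anchor (frame_vec e q i) psi) : frame_dom e q ->
 cometric phi psi q = (a o0 * b o0 * gram e q o1 o1
  - (a o0 * b o1 + a o1 * b o0) * gram e q o0 o1
  + a o1 * b o1 * gram e q o0 o0) / gram_det e q.
Proof.
move=> eq0; have d0 := gram_det_gt0 eq0; have dn : gram_det e q != 0 by rewrite gt_eqF.
have [s [t es]] := frame_dec (sharp phi q) eq0.
have h0 := sharpP phi (frame_vec e q o0); have h1 := sharpP phi (frame_vec e q o1).
rewrite /cometric es !(anchorD, anchorZ).
rewrite es !(spDl, spZl) in h0 h1; rewrite (scalar_product_sym (frame_vec e q o1) (frame_vec e q o0)) in h0.
rewrite -/(gram e q _ _) -?/(gram e q o0 o1) in h0 h1.
rewrite /a /b -h0 -h1 /=; move: dn; rewrite /gram_det => dn.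
by rewrite -!/(gram e q _ _); field.
Qed.

(** Multiplicativity of determinants: the matrix of the cometric is A G^-1 A^T, with A the anchored
    frame and G its Gram matrix. *)
Lemma cometric_gram e phi psi q : frame_dom e q ->
 cometric phi phi q * cometric psi psi q - cometric phi psi q ^+ 2 = frame_jac e phi psi q ^+ 2 / gram_det e q.
Proof.
move=> eq0; have d0 := gram_det_gt0 eq0; have dn : gram_det e q != 0 by rewrite gt_eqF.
rewrite !(cometric_frame _ _ eq0) /frame_jac; move: dn; rewrite /gram_det => dn; field; exact: dn.
Qed.

Lemma gram_smooth e i j : frames e -> smooth (frame_dom e) (fun q => gram e q i j).
Proof. by move=> fe; exact: scalar_product_smooth. Qed.

Lemma gram_det_smooth e : frames e -> smooth (frame_dom e) (gram_det e).
Proof.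
move=> fe; have oe := @frame_dom_open _ _ _ e.
have s2 := smooth_funM oe (gram_smooth o0 o1 fe) (gram_smooth o0 o1 fe).
have := smooth_funB oe (smooth_funM oe (gram_smooth o0 o0 fe) (gram_smooth o1 o1 fe)) s2.
by apply: (smooth_fun_eq oe) => q _; rewrite /gram_det expr2.
Qed.

Lemma frame_jac_smooth e phi psi : frames e -> smooth (frame_dom e) (frame_jac e phi psi).
Proof.
move=> fe; have oe := @frame_dom_open _ _ _ e.
exact: (smooth_funB oe (smooth_funM oe (anchor_smooth fe o0 phi) (anchor_smooth fe o1 psi))
 (smooth_funM oe (anchor_smooth fe o1 phi) (anchor_smooth fe o0 psi))).
Qed.

Lemma cometric_smooth phi psi : smooth setT (cometric phi psi).
Proof.
apply: smooth_fun_local => q _; have [e fe eq0] := frames_cover E q.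
exists (frame_dom e) => //; have oe := @frame_dom_open _ _ _ e.
have a0 := anchor_smooth fe o0 phi; have a1 := anchor_smooth fe o1 phi.
have b0 := anchor_smooth fe o0 psi; have b1 := anchor_smooth fe o1 psi.
have g00 := gram_smooth o0 o0 fe; have g01 := gram_smooth o0 o1 fe; have g11 := gram_smooth o1 o1 fe.
have dV := smooth_funV oe (fun p ep => lt0r_neq0 (gram_det_gt0 ep)) (gram_det_smooth fe).
have n := smooth_funD oe (smooth_funB oe (smooth_funM oe (smooth_funM oe a0 b0) g11)
 (smooth_funM oe (smooth_funD oe (smooth_funM oe a0 b1) (smooth_funM oe a1 b0)) g01))
 (smooth_funM oe (smooth_funM oe a1 b1) g00).
apply: (smooth_fun_eq oe _ (smooth_funM oe n dV)) => p ep.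
by rewrite (cometric_frame _ _ ep).
Qed.

Definition Gam phi psi : Cinf S := mkCinf (cometric_smooth phi psi).

Lemma GamE phi psi q : Gam phi psi q = cometric phi psi q.
Proof. by []. Qed.

Lemma GamC phi psi : Gam phi psi = Gam psi phi.
Proof. by apply: Cinf_eq => q; exact: cometricC. Qed.

Lemma Gam_tangent phi q : tangent S q (fun psi => Gam phi psi q).
Proof. exact: cometric_tangent. Qed.

Lemma GamDr phi f g : Gam phi (f + g) = Gam phi f + Gam phi g.
Proof. by apply: Cinf_eq => q; rewrite (tangentD f g (Gam_tangent phi q)). Qed.

Lemma GamZr phi a f : Gam phi (a *: f) = a *: Gam phi f.
Proof. by apply: Cinf_eq => q; rewrite (tangentZ a f (Gam_tangent phi q)). Qed.

Lemma GamBr phi f g : Gam phi (f - g) = Gam phi f - Gam phi g.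
Proof. by apply: Cinf_eq => q; rewrite (tangentB f g (Gam_tangent phi q)). Qed.

Lemma GamMr phi f g : Gam phi (f * g) = f * Gam phi g + g * Gam phi f.
Proof. by apply: Cinf_eq => q; rewrite (tangentM f g (Gam_tangent phi q)). Qed.

Lemma GamDl phi f g : Gam (f + g) phi = Gam f phi + Gam g phi.
Proof. by rewrite !(GamC _ phi) GamDr. Qed.

Lemma GamZl phi a f : Gam (a *: f) phi = a *: Gam f phi.
Proof. by rewrite !(GamC _ phi) GamZr. Qed.

Lemma GamBl phi f g : Gam (f - g) phi = Gam f phi - Gam g phi.
Proof. by rewrite !(GamC _ phi) GamBr. Qed.

Lemma GamMl phi f g : Gam (f * g) phi = f * Gam g phi + g * Gam f phi.
Proof. by rewrite !(GamC _ phi) GamMr. Qed.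

Lemma Gam1r phi : Gam phi 1 = 0.
Proof. by apply: Cinf_eq => q; rewrite (tangent1 (Gam_tangent phi q)). Qed.

Lemma Gam_ge0 phi q : 0 <= Gam phi phi q.
Proof. exact: cometric_ge0. Qed.

Lemma Gam_local phi f g V q : open V -> V q -> (forall p, V p -> f p = g p) -> Gam phi f q = Gam phi g q.
Proof. by move=> oV Vq fg; exact: (tangent_local (Gam_tangent phi q) oV Vq fg). Qed.

Lemma Gam_local2 f g V q : open V -> V q -> (forall p, V p -> f p = g p) -> Gam f f q = Gam g g q.
Proof.
by move=> oV Vq fg; rewrite (Gam_local f oV Vq fg) GamC (Gam_local g oV Vq fg).
Qed.

(** The Gram determinant of two differentials for the cometric. For coordinates it is det g^ij, the
    inverse square of the area density. *)
Definition Wron phi psi : Cinf S := Gam phi phi * Gam psi psi - Gam phi psi * Gam phi psi.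

Lemma WronE e phi psi q : frame_dom e q -> Wron phi psi q = frame_jac e phi psi q ^+ 2 / gram_det e q.
Proof. by move=> eq0; rewrite -(cometric_gram _ _ eq0) /Wron !CinfE !GamE expr2. Qed.

Lemma Wron_ge0 phi psi q : 0 <= Wron phi psi q.
Proof.
have [e _ eq0] := frames_cover E q; rewrite (WronE _ _ eq0).
by rewrite divr_ge0 ?sqr_ge0// ltW// gram_det_gt0.
Qed.

Lemma Gam_coords c (y : 'I_2 -> Cinf S) O phi psi q : coords c y O -> O q ->
 Gam phi psi q = \sum_i Gam phi (y i) q * cvec c i q psi.
Proof. by move=> cy Oq; exact: (tangent_coords psi cy Oq (Gam_tangent phi q)). Qed.

Lemma frame_jac_coords c (y : 'I_2 -> Cinf S) O e phi psi q : coords c y O -> O q ->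
 frame_jac e phi psi q = frame_jac e (y o0) (y o1) q *
  (cvec c o0 q phi * cvec c o1 q psi - cvec c o1 q phi * cvec c o0 q psi).
Proof.
move=> cy Oq; rewrite /frame_jac.
have h i f := tangent_coords f cy Oq (anchor_tangent (frame_vec e q i)).
rewrite (h o0 phi) (h o1 phi) (h o0 psi) (h o1 psi) !sum_ord2; ring.
Qed.

(** The distribution consists of global fields, so a combination of local frame vectors has to be
    cut off. That the result comes from a smooth section is checked in every other frame through the
    transition matrices. *)
Lemma frame_field_ex e (K : set M) (chi : Cinf S) (a : 'I_2 -> R) : frames e -> compact K ->
 K `<=` frame_dom e -> (forall p, ~ K p -> chi p = 0) ->
 exists2 X, Defs.distribution B X & forall q f, frame_dom e q ->
  X f q = chi q * \sum_k a k * anchor (frame_vec e q k) f.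
Proof.
move=> fe cK Ke c0; have oe := @frame_dom_open _ _ _ e.
have clK : closed K := compact_closed (surface_hausdorff S) cK.
pose sigma q : E q := if pselect (frame_dom e q) then chi q *: \sum_k a k *: frame_vec e q k else 0.
have anchorS q f : anchor (sigma q) f = if pselect (frame_dom e q) then
  chi q * \sum_k a k * anchor (frame_vec e q k) f else 0.
 rewrite /sigma; case: pselect => eq0; last by rewrite anchor0.
 by rewrite anchorZ !sum_ord2 anchorD !anchorZ.
have sX f : smooth setT (fun q => anchor (sigma q) f).
 apply: (smooth_fun_ext oe clK Ke); last first.
  by move=> p /c0 e0; rewrite anchorS e0; case: pselect => // ?; rewrite mul0r.
 have s0 := smooth_funM oe (@smooth_fun_cst (frame_dom e) (a o0)) (anchor_smooth fe o0 f).
 have s1 := smooth_funM oe (@smooth_fun_cst (frame_dom e) (a o1)) (anchor_smooth fe o1 f).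
 apply: (smooth_fun_eq oe _ (smooth_funM oe (Cinf_smoothW chi) (smooth_funD oe s0 s1))) => p ep.
 by rewrite anchorS; case: pselect => // ?; rewrite sum_ord2.
pose X f := mkCinf (sX f).
exists X; last by move=> q f eq0; rewrite /X /= anchorS; case: pselect.
split; first by move=> q; exact: (anchor_tangent (sigma q)).
exists sigma => // e' fe'; have oe' := @frame_dom_open _ _ _ e'.
have [C [sC hC]] := frames_smooth fe' fe.
exists (fun i q => if pselect (frame_dom e q) then chi q * \sum_k a k * C i k q else 0); split.
 move=> i; apply: smooth_fun_local => q e'q; have [eq0|neq] := pselect (frame_dom e q).
  exists (frame_dom e' `&` frame_dom e) => //; have oI := openI oe' oe.
  have s0 := smooth_funM oI (@smooth_fun_cst (frame_dom e' `&` frame_dom e) (a o0)) (sC i o0).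
  have s1 := smooth_funM oI (@smooth_fun_cst (frame_dom e' `&` frame_dom e) (a o1)) (sC i o1).
  apply: (smooth_fun_eq oI _ (smooth_funM oI (Cinf_smoothW chi) (smooth_funD oI s0 s1))) => p [_ ep].
  by case: pselect => // ?; rewrite sum_ord2.
 exists (~` K); first by move=> /Ke.
 apply: (smooth_fun_eq (closed_openC clK) _ (@smooth_fun_cst (~` K) 0)) => p /c0 ->.
 by case: pselect => // ?; rewrite mul0r.
move=> q e'q; rewrite /sigma; case: pselect => eq0 /=; last by rewrite big1// => i _; rewrite scale0r.
rewrite !sum_ord2 !(hC q e'q eq0) !sum_ord2 !scalerDr !scalerA !mulrDr !scalerDl !mulrA.
by rewrite addrACA.
Qed.

End Cometric.

End Surface.

Arguments open_pre {R M} c {W} _.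

(** * Transfer of integrals along a map *)

Section Transfer.
Context d1 d2 (X : measurableType d1) (Y : measurableType d2) (R : realType).
Context (nu : {measure set X -> \bar R}) (lam : {measure set Y -> \bar R}).
Context (D : set X) (psi : Y -> X) (g : Y -> R).
Hypothesis mD : measurable D.
Hypothesis mpsi : measurable_fun setT psi.
Hypothesis mg : measurable_fun setT g.
Hypothesis g0 : forall y, 0 <= g y.
Hypothesis nuE : forall B, measurable B ->
 nu (B `&` D) = (\int[lam]_y (\1_B (psi y) * g y)%:E)%E.

Local Open Scope ereal_scope.
Import HBNNSimple.

(** First step of the usual passage from sets, where [nuE] is the claim, to simple, nonnegative and
    real functions. *)
Lemma transfer_nnsfun (h : {nnsfun X >-> R}) :
 \int[nu]_(x in D) (h x)%:E = \int[lam]_y ((h (psi y))%:E * (g y)%:E).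
Proof.
have mEg : measurable_fun setT (EFin \o g) by apply/measurable_EFinP.
have mhr r : measurable_fun setT (fun y => (r * \1_(h @^-1` [set r]) (psi y))%:E).
 apply/measurable_EFinP/measurable_funM => //.
 exact: (measurableT_comp _ mpsi).
transitivity (\int[nu]_(x in D) \sum_(y \in range h) (y * \1_(h @^-1` [set y]) x)%:E).
 by apply: eq_integral => t tE; rewrite fimfunE -fsumEFin.
rewrite ge0_integral_fsum//; last 2 first.
- by move=> r; apply/measurable_funTS/measurable_EFinP/measurable_funM.
- by move=> r x _; exact: nnfun_muleindic_ge0.
transitivity (\int[lam]_y \sum_(r \in range h) (r * \1_(h @^-1` [set r]) (psi y))%:E * (g y)%:E); last first.
 apply: eq_integral => y _; rewrite -ge0_mule_fsuml => [|r]; last exact: nnfun_muleindic_ge0.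
 by rewrite fsumEFin// -(fimfunE _ (psi y)).
rewrite ge0_integral_fsum//; last 2 first.
- by move=> r; apply: emeasurable_funM.
- by move=> r y _; rewrite mule_ge0 ?lee_fin ?g0//; exact: nnfun_muleindic_ge0.
apply: eq_fsbigr => r rh.
rewrite integralZl_indic_nnsfun// integral_indic// nuE//.
rewrite -ge0_integralZl//.
- by apply: eq_integral => y _; rewrite EFinM EFinM muleA.
- apply/measurable_EFinP/measurable_funM => //; exact: (measurableT_comp _ mpsi).
- by move=> y _; rewrite lee_fin mulr_ge0.
- by move: rh; rewrite inE => -[t _ <-]; rewrite lee_fin.
Qed.

Lemma transfer_ge0 (f : X -> \bar R) : (forall x, 0 <= f x) -> measurable_fun setT f ->
 \int[nu]_(x in D) f x = \int[lam]_y (f (psi y) * (g y)%:E).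
Proof.
move=> f0 mf; pose h := nnsfun_approx measurableT mf.
have hc x : EFin \o h^~ x @ \oo --> f x by apply: cvg_nnsfun_approx => // *; exact: f0.
have hn (x : X) a b : (a <= b)%N -> (h a x <= h b x)%R by move=> ab; exact/lefP/nd_nnsfun_approx.
transitivity (limn (fun n => \int[nu]_(x in D) (h n x)%:E)).
 rewrite -monotone_convergence//.
 - by apply: eq_integral => x _; apply/esym/cvg_lim => //; exact: hc.
 - by move=> n; apply/measurable_funTS/measurable_EFinP.
 - by move=> n x _; rewrite lee_fin.
 - by move=> x _ a b ab; rewrite lee_fin; exact: hn.
under eq_fun do rewrite transfer_nnsfun.
rewrite -monotone_convergence//.
- apply: eq_integral => y _; apply/cvg_lim => //; apply: cvgeZr => //; exact: hc.
- move=> n; apply: emeasurable_funM; last by apply/measurable_EFinP.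
 by apply/measurable_EFinP; exact: (measurableT_comp _ mpsi).
- by move=> n y _; rewrite mule_ge0 ?lee_fin.
- by move=> y _ a b ab; rewrite lee_wpmul2r ?lee_fin//; exact: hn.
Qed.

Lemma transfer_integral (f : X -> R) : measurable_fun setT f -> (forall x, ~ D x -> f x = 0%R) ->
 \int[nu]_x (f x)%:E = \int[lam]_y (f (psi y) * g y)%:E.
Proof.
move=> mf f0; have mEf : measurable_fun setT (EFin \o f) by apply/measurable_EFinP.
rewrite (_ : \int[nu]_x _%:E = \int[nu]_(x in D) (f x)%:E); last first.
 rewrite [RHS]integral_mkcond; apply: eq_integral => x _; rewrite patchE.
 by case: ifPn => // /negP Dx; rewrite f0// => /mem_set.
rewrite integralE [RHS]integralE; congr (_ - _).
 rewrite transfer_ge0//; first last.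
  by apply: measurable_funepos.
 by apply: eq_integral => y _; rewrite !funeposE -!EFin_max -EFinM maxr_pMl// mul0r.
rewrite transfer_ge0//; first last.
 by apply: measurable_funeneg.
by apply: eq_integral => y; rewrite !funenegE -!EFin_max -EFinM maxr_pMl// mul0r mulNr.
Qed.

End Transfer.

(** * Auxiliary inequalities and compactness arguments *)

Lemma Cc_int_gt0 (R : realType) (f : R * R -> R) x : Cc f -> (forall z, 0 <= f z) -> 0 < f x ->
 (0 < \int[lebesgue2 R]_z (f z)).
Proof.
move=> cf f0 fx.
have oV : open [set z | f x / 2 < f z].
 rewrite openE => z fz; exact: (cvgr_gt _ (Cc_continuous cf (x := z))).
have Vx : [set z | f x / 2 < f z] x by rewrite /= ltr_pdivrMr// mulr_natr mulr2n ltrDl.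
have [r r0 hr] := open_ball_sub oV Vx.
have r20 : 0 < r / 2 by rewrite divr_gt0.
have i1 := integ_square_ind x (ltW r20); have i2 := integZ (f x / 2) i1.
apply: (@lt_le_trans _ _ (\int[lebesgue2 R]_z (f x / 2 * square_ind (r / 2) x z))).
 by rewrite intZ// int_square_ind ?ltW// !mulr_gt0 ?invr_gt0// exprn_gt0.
apply: int_le => //; first exact: Cc_int.
move=> z; rewrite /square_ind; case: (leP `|x - z|) => h; last by rewrite mulr0.
rewrite mulr1; apply/ltW/hr; rewrite distrC; apply: le_lt_trans h _.
by rewrite ltr_pdivrMr// mulr_natr ltrDl.
Qed.

(* T = G d^2, Gam(T,T) = d^2 h, Delta T = d s; gq, hq, sq are the values at the centre. *)
Lemma singular_bounds_arith (R : realFieldType) (G h s d T gam lap gq hq sq X C : R) :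
 0 < gq -> gq / 2 < G -> h < hq + 1 -> s * s < sq + 1 -> 0 <= hq -> 0 <= sq -> 0 <= X ->
 T = G * (d * d) -> gam = d * d * h -> lap = d * s ->
 C = 1 + 2 * (hq + 1) / gq + 2 * (sq + 1) / gq + X ->
 0 < C /\ gam <= C * T /\ lap ^+ 2 <= C * T.
Proof.
move=> g0 gG hh ss h0 s0 x0 -> -> -> eC.
have hg : (hq + 1) = 2 * (hq + 1) / gq * (gq / 2) by field; rewrite gt_eqF.
have sg : sq + 1 = 2 * (sq + 1) / gq * (gq / 2) by field; rewrite gt_eqF.
have p1 : 0 <= 2 * (hq + 1) / gq by rewrite divr_ge0; lra.
have p2 : 0 <= 2 * (sq + 1) / gq by rewrite divr_ge0; lra.
have G0 : 0 < G by lra.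
have C0 : 0 < C by rewrite eC; lra.
have CG t : 0 <= t -> t <= C -> t * (gq / 2) <= C * G.
 by move=> t0 tC; apply: ler_pM => //; [lra|exact: ltW].
have dd : 0 <= d * d by rewrite -expr2 sqr_ge0.
split => //; split.
 rewrite [leRHS](_ : _ = d * d * (C * G)); last by ring.
 apply: ler_wpM2l => //; apply: le_trans (ltW hh) _; rewrite [leLHS]hg; apply: CG => //.
 by rewrite eC; lra.
rewrite [leRHS](_ : _ = d * d * (C * G)); last by ring.
rewrite [leLHS](_ : _ = d * d * (s * s)); last by ring.
apply: ler_wpM2l => //; apply: le_trans (ltW ss) _; rewrite [leLHS]sg; apply: CG => //.
by lra.
Qed.

Lemma compact_margin (R : realType) (K U : set (R * R)) : compact K -> open U -> K `<=` U ->
 exists2 r : R, 0 < r & forall x y, K x -> `|y - x| <= r -> U y.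
Proof.
move=> cK oU KU.
have /compact_near_coveringP/(_ _ 0^'+ (fun r x => forall y, `|y - x| <= r -> U y) _) := cK.
case.
 move=> x Kx; have [e e0 he] := open_ball_sub oU (KU x Kx).
 have e2 : 0 < e / 2 by rewrite divr_gt0.
 exists ([set z | `|x - z| < e / 2], [set r | r < e / 2]).
  split => /=; last exact: nbhs_right_lt.
  by have := @nbhsx_ballx _ (R * R)%type x (e / 2) e2; apply: filterS => z; rewrite -ball_normE.
 move=> [z r] [/= xz re] y yz; apply: he.
 rewrite -(subrK z y) -addrA; apply: le_lt_trans (ler_normD _ _) _.
 by rewrite (distrC z x); lra.
move=> e e0 he; exists (e / 2); first by rewrite divr_gt0.
move=> x y Kx; apply: (he) => //=; last by rewrite divr_gt0.
by rewrite sub0r normrN gtr0_norm ?divr_gt0// ltr_pdivrMr// mulr_natr ltrDl.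
Qed.

(** Regroups the derivatives of a_ij d_j xi when xi is a reflected mollifier: X' is the derivative
    before reflection, whence the sign. *)
Lemma divergence_sum (R : comNzRingType) (al Y : 'I_2 -> 'I_2 -> R) (dA : 'I_2 -> 'I_2 -> 'I_2 -> R) (X X' : 'I_2 -> R) :
 (forall k i j, dA k i j = dA k j i) -> (forall i, X i = - X' i) ->
 \sum_i \sum_j (dA i i j * X j + al i j * Y i j) = \sum_i \sum_j (al i j * Y i j - dA j i j * X' i).
Proof.
move=> e hX; rewrite !sum_ord2 !hX e (e o1 o1 o0); ring.
Qed.

(* The coefficient is r j^4 (m (2 b + b^2 r) + (L r - c) (1 + b r)^2). *)
Lemma ae_and d (T : measurableType d) (R : realType) (mu : {measure set T -> \bar R}) (P Q : T -> Prop) :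
 {ae mu, forall x, P x} -> {ae mu, forall x, Q x} -> {ae mu, forall x, P x /\ Q x}.
Proof. by move=> h1 h2; apply: filterS2 h1 h2. Qed.

(** Here r stands for sqrt T, m for [Gam r r] and j for 1 / (1 + b r). The terms m j^2 and m j^4
    cancel to leading order, and the remainder, about 2 b m r, must beat c r. For r <= 1 / (2 C) one
    has m >= 1 / (2 C), which dictates b = C (c + 1); for larger r the constant L wins. *)
Lemma agmon_arith (R : realFieldType) (m r j c L b C D : R) : 0 < C -> 0 <= c -> 0 <= m ->
 C^-1 - C * r ^+ 2 <= m -> 0 < r -> r <= D -> j * (1 + b * r) = 1 ->
 b = C * (c + 1) -> L = 2 * c * b + c * b ^+ 2 * D + (c + 1) * (2 * C) ->
 ((1 + b * D) ^+ 4)^-1 * r <= (m / r ^+ 2 - c / r + L) * (r * j) ^+ 2 - j ^+ 4 * m.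
Proof.
move=> C0 c0 m0 mC r0 rD jE bE LE.
have b0 : 0 < b by rewrite bE mulr_gt0//; lra.
have br0 : 0 < 1 + b * r by rewrite ltr_pwDl// mulr_ge0 ?ltW.
have jv : j = (1 + b * r)^-1 by apply: (mulIf (lt0r_neq0 br0)); rewrite jE mulVf// gt_eqF.
have rn : r != 0 by rewrite gt_eqF.
pose X := m * (2 * b + b ^+ 2 * r) + (L * r - c) * (1 + b * r) ^+ 2.
have -> : (m / r ^+ 2 - c / r + L) * (r * j) ^+ 2 - j ^+ 4 * m = j ^+ 4 * r * X.
 by rewrite /X jv; field; rewrite rn gt_eqF.
have j0 : 0 < j by rewrite jv invr_gt0.
have kj : ((1 + b * D) ^+ 4)^-1 <= j ^+ 4.
 have hD : 0 < 1 + b * D by rewrite ltr_pwDl// mulr_ge0 ?(ltW b0)// (le_trans (ltW r0)).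
 rewrite jv -exprVn; apply: lerXn2r; rewrite ?nnegrE ?invr_ge0 ?(ltW hD) ?(ltW br0)//.
 by rewrite lef_pV2 ?posrE// lerD2l ler_wpM2l// ltW.
have b2 : 0 <= b ^+ 2 by exact: sqr_ge0.
have q1 : 1 <= (1 + b * r) ^+ 2 by rewrite exprn_ege1// lerDl mulr_ge0 ?ltW.
have L0 : 0 <= L.
 by rewrite LE !addr_ge0 ?mulr_ge0 ?(ltW b0) ?(ltW C0)// ?(le_trans (ltW r0) rD)// addr_ge0.
have X1 : 1 <= X.
 have [rs|rl] := leP r (2 * C)^-1.
  have r2 : C * r ^+ 2 <= (2 * C)^-1.
   have h : r ^+ 2 <= (2 * C)^-1 ^+ 2 by apply: lerXn2r rs; rewrite ?nnegrE ?invr_ge0 ?mulr_ge0// ltW.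
   apply: le_trans (ler_wpM2l (ltW C0) h) _.
   rewrite (_ : C * _^-1 ^+ 2 = (2 * C)^-1 / 2); last by field; rewrite gt_eqF.
   by rewrite ler_pdivrMr// ler_peMr// ?invr_ge0 ?mulr_ge0 ?ltW//; lra.
  have mb : (2 * C)^-1 <= m.
   apply: le_trans mC; rewrite -subr_ge0.
   have -> : C^-1 - C * r ^+ 2 - (2 * C)^-1 = (2 * C)^-1 - C * r ^+ 2 by field; rewrite gt_eqF.
   by rewrite subr_ge0.
  have h1 : c + 1 <= m * (2 * b).
   have -> : c + 1 = (2 * C)^-1 * (2 * b) by rewrite bE; field; rewrite gt_eqF.
   by rewrite ler_wpM2r// mulr_ge0// ltW.
  have h2 : 0 <= m * (b ^+ 2 * r) by rewrite !mulr_ge0// ltW.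
  have h3 : r * (2 * c * b + c * b ^+ 2 * r) <= L * r * (1 + b * r) ^+ 2.
   have hL : 2 * c * b + c * b ^+ 2 * r <= L.
    rewrite LE -addrA lerD2l -[leLHS]addr0 lerD//; first by rewrite ler_wpM2l// mulr_ge0.
    by rewrite mulr_ge0 ?addr_ge0// mulr_ge0// ltW.
   apply: le_trans (ler_wpM2l (ltW r0) hL) _; rewrite mulrC.
   by apply: ler_peMr => //; rewrite mulr_ge0// ltW.
  rewrite /X; move: h1 h2 h3 => h1 h2 h3.
  have -> : m * (2 * b + b ^+ 2 * r) + (L * r - c) * (1 + b * r) ^+ 2 =
    m * (2 * b) + m * (b ^+ 2 * r) + L * r * (1 + b * r) ^+ 2 - c - r * (2 * c * b + c * b ^+ 2 * r) by ring.
  lra.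
 have h1 : c + 1 <= L * r.
  have -> : c + 1 = (c + 1) * (2 * C) * (2 * C)^-1 by field; rewrite gt_eqF.
  apply: ler_pM; rewrite ?invr_ge0 ?mulr_ge0 ?addr_ge0 ?(ltW C0) ?(ltW rl)//.
  rewrite LE lerDr addr_ge0// !mulr_ge0// ?(ltW b0)//; exact: le_trans (ltW r0) rD.
 have h2 : 0 <= m * (2 * b + b ^+ 2 * r) by rewrite mulr_ge0// addr_ge0 ?mulr_ge0// ltW.
 rewrite -[X in X <= _]add0r; apply: lerD => //; apply: le_trans q1 _.
 rewrite -[leLHS]mul1r ler_wpM2r ?sqr_ge0//; lra.
apply: (@le_trans _ _ (j ^+ 4 * r)); first by rewrite ler_wpM2r// ltW.
by rewrite ler_peMr// mulr_ge0 ?exprn_ge0 ?ltW.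
Qed.

(** Cayley-Hamilton in dimension two: (tr G) G - det G is the nonnegative matrix G^2. *)
Lemma gram_elliptic (R : realDomainType) (g : 'I_2 -> 'I_2 -> R) (xi : 'I_2 -> R) :
 g o1 o0 = g o0 o1 ->
 (g o0 o0 * g o1 o1 - g o0 o1 * g o0 o1) * (\sum_i xi i ^+ 2) <=
 (g o0 o0 + g o1 o1) * \sum_i \sum_j g i j * xi i * xi j.
Proof.
rewrite !sum_ord2 => ->; rewrite -subr_ge0.
move: (g o0 o0) (g o0 o1) (g o1 o1) (xi o0) (xi o1) => a b d x z.
have -> : (a + d) * (a * x * x + b * x * z + (b * z * x + d * z * z)) - (a * d - b * b) * (x ^+ 2 + z ^+ 2) =
 (a * x + b * z) ^+ 2 + (b * x + d * z) ^+ 2 by ring.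
by rewrite addr_ge0 ?sqr_ge0.
Qed.

(** Allows the functionals to be indexed by any finite type, such as the pairs of a chart and a
    functional of that chart. *)
Lemma totally_bounded_finite (R : realType) (V : normedModType R) (X : set V) :
 (forall e : R, 0 < e -> exists (I : finType) (l : I -> V -> R) (B d : R), [/\ 0 < d,
  forall k u, X u -> `|l k u| <= B &
  forall u v, X u -> X v -> (forall k, `|l k u - l k v| <= d) -> `|u - v| < e]) ->
 totally_bounded X.
Proof.
move=> H; apply: totally_bounded_functionals => e /H[I [l [B [d [d0 hB hd]]]]].
exists #|I|, (fun k => l (enum_val k)), B, d; split => // [k|u v Xu Xv h]; first exact: hB.
by apply: hd => // k; rewrite -(enum_rankK k).
Qed.

Section CompactCover.
Context (R : realType) (M : ptopologicalType).
Implicit Types (q p : M).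

Lemma compact_finite (V : M -> set M) : compact [set: M] ->
 (forall q, open (V q) /\ V q q) -> exists N (a : 'I_N -> M), forall p, exists k, V (a k) p.
Proof.
rewrite compact_cover => cM hV.
have [D _ hD] := cM M setT V (fun q _ => (hV q).1) (fun q _ => ex_intro2 _ _ q I (hV q).2).
pose s := finmap.enum_fset D; exists (size s), (fun k : 'I_(size s) => nth point s k) => p.
have [q Dq Vq] := hD p I.
have qs : (index q s < size s)%N by rewrite index_mem.
by exists (Ordinal qs); rewrite nth_index.
Qed.

(** The property is monotone in its constant, so the sum of the absolute values of finitely many
    local constants serves everywhere. *)
Lemma compact_local_bound (P : R -> M -> Prop) : compact [set: M] ->
 (forall q, exists C V, [/\ open V, V q & forall p, V p -> P C p]) ->
 (forall C C' p, C <= C' -> P C p -> P C' p) -> exists C, forall p, P C p.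
Proof.
move=> cM loc mono.
have /choice[f hf] q : exists CV : R * set M, [/\ open CV.2, CV.2 q & forall p, CV.2 p -> P CV.1 p].
 by have [C [V h]] := loc q; exists (C, V).
have hq q : open (f q).2 /\ (f q).2 q by case: (hf q).
have [N [a ha]] := compact_finite cM hq.
exists (\sum_(k < N) `|(f (a k)).1|) => p; have [k Vk] := ha p.
have [_ _ h] := hf (a k); apply: mono (h p Vk).
by rewrite (bigD1 k)//=; apply: le_trans (ler_norm _) _; rewrite lerDl sumr_ge0.
Qed.

End CompactCover.

Section LaplaceBeltrami.
Context (R : realType) (M : ptopologicalType) (S : smooth_surface R M).
Context (A : almost_riemannian S).
Local Notation bv := (basis_vec R).
Local Notation cvec := (coord_vec S).
Local Notation smooth := (smooth_fun S).
Local Notation lap := (laplace_beltrami A).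
Local Notation HBat q := ([set v + w | v in distribution_at A q & w in bracket_at A q] = tangent S q).

(** * The singular set, the gradient and the area density in coordinates *)

Section Singular.
Local Notation E := (bundle A).
Local Notation sp := scalar_product.
Implicit Types (q p : M) (f g h phi psi : Cinf S) (O V W : set M) (i j : 'I_2) (e : frame E) (y : 'I_2 -> Cinf S).

Lemma distribution_atE q : distribution_at A q = [set anchor v | v in [set: E q]].
Proof.
apply/seteqP; split => [_ [X [_ [sigma _ hX]] <-]|_ [v _ <-]].
 by exists (sigma q).
have [e fe eq0] := frames_cover E q; have oe := @frame_dom_open _ _ _ e.
have [chi [K [V [cK Ke oV Vq [VK c01 c0 c1]]]]] := bump_at S oe eq0.
have [a [b ->]] := frame_dec v eq0.
have [X DX hX] := @frame_field_ex _ _ _ A e K chi (fun i => if i == o0 then a else b) fe cK Ke c0.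
exists X => //; apply/funext => f; rewrite /field_at hX// c1// mul1r sum_ord2 /=.
by rewrite anchorD !anchorZ.
Qed.

(** A vanishing determinant means a nontrivial relation between the two anchored frame vectors,
    which leaves one generator for D(q); conversely, in dimension below 2 both are multiples of one
    vector. *)
Lemma singular_jac c y O e q : coords c y O -> O q -> frame_dom e q ->
 singular_set A q <-> frame_jac e (y o0) (y o1) q = 0.
Proof.
move=> cy Oq eq0.
set u := frame_vec e q o0; set w := frame_vec e q o1.
have ev i : distribution_at A q (anchor (frame_vec e q i)) by rewrite distribution_atE; exists (frame_vec e q i).
split=> [[n n2 [b [_ hb]]]|J0].
 have [lin2 hlin] : exists l : Cinf S -> R, forall i, exists t : R, anchor (frame_vec e q i) = t *: l.
  case: n n2 b hb => [|[|//]] _ b hb.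
   exists 0 => i; have := ev i; rewrite hb => -[a _ <-]; exists 0.
   by rewrite big_ord0 scaler0.
  exists (b o0) => i; have := ev i; rewrite hb => -[a _ <-]; exists (a o0).
  by rewrite big_ord1.
 have [s hs] := hlin o0; have [t ht] := hlin o1.
 rewrite /frame_jac hs ht !fctE -![_ *: _]/(_ * _); ring.
have [a [b [ab0 h]]] : exists a b : R, (a != 0 \/ b != 0) /\ forall f, a * anchor u f + b * anchor w f = 0.
 have zero (a b : R) : (forall i, a * anchor u (y i) + b * anchor w (y i) = 0) ->
   forall f, a * anchor u f + b * anchor w f = 0.
  move=> hy f; rewrite -!anchorZ -anchorD (tangent_coords f cy Oq (anchor_tangent _)) sum_ord2.
  by rewrite !anchorD !anchorZ !hy !mul0r addr0.
 have ord i : i = o0 \/ i = o1 := ord2P i.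
 have [w0|w0] := eqVneq (anchor w (y o0)) 0; last first.
  exists (anchor w (y o0)), (- anchor u (y o0)); split; first by left.
  apply: zero => i; have [->|->] := ord i; first by ring.
  by move: J0; rewrite /frame_jac -/u -/w => J0; rewrite -[RHS]oppr0 -J0; ring.
 have [w1|w1] := eqVneq (anchor w (y o1)) 0; last first.
  exists (anchor w (y o1)), (- anchor u (y o1)); split; first by left.
  apply: zero => i; have [->|->] := ord i; last by ring.
  by move: J0; rewrite /frame_jac -/u -/w => J0; rewrite -[RHS]J0; ring.
 exists 0, 1; split; first by right; exact: oner_neq0.
 by apply: zero => i; have [->|->] := ord i; rewrite ?w0 ?w1; ring.
have aZ t (v : E q) : anchor (t *: v) = t *: (anchor v : Cinf S -> R) by apply/funext => f; rewrite anchorZ.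
have span (l m : E q) r : (forall v, exists s t, v = s *: l + t *: m) -> (forall f, anchor m f = r * anchor l f) ->
  distribution_at A q = [set t *: (anchor l : Cinf S -> R) | t in [set: R]].
 move=> lm ml; rewrite distribution_atE; apply/seteqP; split => [_ [v _ <-]|_ [t _ <-]]; last by exists (t *: l).
 have [s [t ->]] := lm v; exists (s + t * r) => //.
 by apply/funext => f; rewrite anchorD !anchorZ ml fctE -[_ *: _]/(_ * _); ring.
have [l hl] : exists l : E q, distribution_at A q = [set t *: (anchor l : Cinf S -> R) | t in [set: R]].
 case: ab0 => [a0|b0].
  exists w; apply: (span w u (- (b / a))) => [v|f].
   by have [s [t ->]] := frame_dec v eq0; exists t, s; rewrite addrC.
  by apply: (mulfI a0); apply/eqP; rewrite -subr_eq0 -(h f); apply/eqP; field.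
 exists u; apply: (span u w (- (a / b))) => [v|f]; first exact: frame_dec.
 by apply: (mulfI b0); apply/eqP; rewrite -subr_eq0 -(h f); apply/eqP; field.
have [l0|l0] := pselect (anchor l = (0 : Cinf S -> R)).
 exists 0%N => //; exists (fun _ => 0); split => [a' _ []//|].
 rewrite hl; apply/seteqP; split => [_ [t _ <-]|_ [a' _ <-]].
  by exists (fun _ => 0) => //; rewrite big_ord0 l0 scaler0.
 by exists 0 => //; rewrite big_ord0 scale0r.
exists 1%N => //; exists (fun _ => anchor l); split.
 move=> a' ; rewrite big_ord1 => a0 i; rewrite (ord1 i); apply/eqP/negPn/negP => n0; apply: l0.
 by rewrite -[anchor l]scale1r -(mulVf n0) -scalerA a0 scaler0.
rewrite hl; apply/seteqP; split => [_ [t _ <-]|_ [a' _ <-]].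
 by exists (fun _ => t) => //; rewrite big_ord1.
by exists (a' o0) => //; rewrite big_ord1.
Qed.

Lemma singular_Wron c y O q : coords c y O -> O q ->
 singular_set A q <-> Wron A (y o0) (y o1) q = 0.
Proof.
move=> cy Oq; have [e fe eq0] := frames_cover E q.
rewrite (WronE _ _ eq0) (singular_jac cy Oq eq0); split => [->|/eqP]; first by rewrite expr0n mul0r.
rewrite mulf_eq0 sqrf_eq0 invr_eq0 => /orP[/eqP//|].
by rewrite gt_eqF// gram_det_gt0.
Qed.

(** Cramer's rule in the coordinates y, with [frame_jac] as the determinant. *)
Lemma anchor_bij q : ~ singular_set A q ->
 (forall t, tangent S q t -> exists v : E q, anchor v = t) /\
 (forall v w : E q, anchor v = anchor w -> v = w).
Proof.
move=> nZ; have [c [y [W [cy Wq]]]] := coordinates_cover S q.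
have [e fe eq0] := frames_cover E q.
set u := frame_vec e q o0; set w := frame_vec e q o1.
have J0 : frame_jac e (y o0) (y o1) q != 0.
 by apply/eqP => J0; apply: nZ; apply/(singular_jac cy Wq eq0).
split=> [t tt|v v' vv].
 pose J := frame_jac e (y o0) (y o1) q.
 exists (((t (y o0) * anchor w (y o1) - t (y o1) * anchor w (y o0)) / J) *: u +
     ((anchor u (y o0) * t (y o1) - anchor u (y o1) * t (y o0)) / J) *: w).
 apply/funext => f; rewrite (tangent_coords f cy Wq tt) (tangent_coords f cy Wq (anchor_tangent _)).
 apply: eq_bigr => i _; congr (_ * _); rewrite anchorD !anchorZ.
 by move: J0; rewrite /J /frame_jac -/u -/w => J0; have [->|->] := ord2P i; field.
have [a [b ev]] := frame_dec (v - v') eq0; rewrite -/u -/w in ev.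
have h i : a * anchor u (y i) + b * anchor w (y i) = 0.
 rewrite -!anchorZ -anchorD -ev -scaleN1r anchorD anchorZ vv; ring.
have a0 : a = 0.
 apply: (mulIf J0); rewrite mul0r /frame_jac -/u -/w.
 transitivity ((a * anchor u (y o0) + b * anchor w (y o0)) * anchor w (y o1) -
   (a * anchor u (y o1) + b * anchor w (y o1)) * anchor w (y o0)); first by ring.
 by rewrite !h !mul0r subrr.
have b0 : b = 0.
 apply: (mulIf J0); rewrite mul0r /frame_jac -/u -/w.
 transitivity ((a * anchor u (y o1) + b * anchor w (y o1)) * anchor u (y o0) -
   (a * anchor u (y o0) + b * anchor w (y o0)) * anchor u (y o1)); first by ring.
 by rewrite !h !mul0r subrr.
by apply/eqP; rewrite -subr_eq0 ev a0 b0 !scale0r addr0.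
Qed.

Lemma metric_anchor q (v w : E q) : ~ singular_set A q -> metric A q (anchor v) (anchor w) = sp v w.
Proof.
move=> nZ; have [_ inj] := anchor_bij nZ.
have h x : anchor_inv A q (anchor x) = x.
 by apply: inj; apply: (@xgetPex _ 0 [set e : E q | anchor e = anchor x]); exists x.
by rewrite /metric !h.
Qed.

Lemma gradientE phi q : ~ singular_set A q -> gradient A phi q = anchor (sharp A phi q).
Proof.
move=> nZ; have [surj _] := anchor_bij nZ.
apply: xget_unique => [|v [tv hv]].
 split; first exact: anchor_tangent.
 by move=> w /surj[e <-]; rewrite metric_anchor// sharpP.
have [e ev] := surj v tv; rewrite -ev; congr anchor; apply: sharp_unique => w.
by rewrite -(metric_anchor _ _ nZ) ev hv//; exact: anchor_tangent.
Qed.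

Lemma componentsE c y O q v i : coords c y O -> O q -> tangent S q v ->
 components c q v i = v (y i).
Proof.
move=> cy Oq tv.
suff -> : components c q v = fun j => v (y j) by [].
apply: xget_unique => [|b hb].
 apply/funext => f; rewrite (tangent_coords f cy Oq tv) fct_sumE.
 by apply: eq_bigr => j _.
apply/funext => j; rewrite hb fct_sumE (bigD1 j)//= big1 => [|k kj].
 by rewrite addr0 fctE -[_ *: _]/(_ * _) (coord_vec_coord j j cy Oq) eqxx mulr1.
by rewrite fctE -[_ *: _]/(_ * _) (coord_vec_coord k j cy Oq) (negbTE kj) mulr0.
Qed.

(** The Gram matrix G of the coordinate vectors is inverse to the matrix H of the cometric on
    coordinates, because [sharp] of a coordinate is an H-combination of the lifted coordinate
    vectors. So the density is (det H)^(-1/2), which blows up at the singular set. *)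
Lemma area_densityE c y O q : coords c y O -> O q -> ~ singular_set A q ->
 area_density A c (cmap c q) = (sqrt (Wron A (y o0) (y o1) q))^-1.
Proof.
move=> cy Oq nZ; have [Ac oO Oc hy] := cy; have cq := Oc q Oq.
rewrite /area_density chart_mapK//; have [surj inj] := anchor_bij nZ.
have [s0 h0] := surj _ (coord_vec_tangent o0 Ac cq).
have [s1 h1] := surj _ (coord_vec_tangent o1 Ac cq).
pose s i := if i == o0 then s0 else s1.
have hs i : anchor (s i) = cvec c i q by have [->|->] := ord2P i.
pose G i j := sp (s i) (s j); pose H i j := Gam A (y i) (y j) q.
have dual i k : \sum_j H i j * G j k = (i == k)%:R.
 have -> : \sum_j H i j * G j k = sp (\sum_j H i j *: s j) (s k) by rewrite !sum_ord2 spDl !spZl.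
 rewrite -(_ : sharp A (y i) q = \sum_j H i j *: s j); last first.
  apply: inj; apply/funext => f; rewrite sum_ord2 anchorD !anchorZ !hs.
  by rewrite -[LHS]/(Gam A (y i) f q) (Gam_coords _ _ _ cy Oq) sum_ord2.
 by rewrite sharpP hs (coord_vec_coord k i cy Oq) eq_sym.
have -> : (\matrix_(i, j) metric A q (cvec c i q) (cvec c j q)) = \matrix_(i, j) G i j.
 by apply/matrixP => i j; rewrite !mxE -!hs metric_anchor.
have -> : \det (\matrix_(i, j) G i j) = (Wron A (y o0) (y o1) q)^-1.
 have e : \det (\matrix_(i, j) H i j) * \det (\matrix_(i, j) G i j) = 1.
  rewrite -det_mulmx (_ : _ *m _ = 1%:M) ?det1//; apply/matrixP => i k; rewrite !mxE -dual.
  by apply: eq_bigr => j _; rewrite !mxE.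
 have eH : \det (\matrix_(i, j) H i j) = Wron A (y o0) (y o1) q.
  rewrite det2 /H !CinfE.
  by rewrite (GamC _ (y o1) (y o0)).
 rewrite eH in e; have W0 : Wron A (y o0) (y o1) q != 0.
  by apply/eqP => W0; move: e; rewrite W0 mul0r => /eqP; rewrite eq_sym oner_eq0.
 by apply: (mulfI W0); rewrite e divff.
by rewrite sqrtrV// Wron_ge0.
Qed.

End Singular.

Opaque Gam Wron.
Local Notation Gam := (Gam A).
Local Notation Wron := (Wron A).

(** * Partitions of unity and the transversality forced by the step-two condition *)

Section LocalStructure.
Local Notation E := (bundle A).
Implicit Types (q p : M) (f g h phi psi : Cinf S) (O V W : set M) (i j : 'I_2) (e : frame E) (y : 'I_2 -> Cinf S).

Lemma open_Cinf_gt f (a : R) : open [set p | a < f p].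
Proof.
rewrite openE => q; have := @Cinf_continuous _ _ _ f q => /cvgr_gt; exact.
Qed.

Lemma closed_Cinf_ge f (a : R) : closed [set p | a <= f p].
Proof.
rewrite -[X in closed X]setCK; apply: open_closedC.
rewrite (_ : ~` _ = [set p | f p < a]); last by apply/seteqP; split => p /=; rewrite ltNge => /negP.
by rewrite openE => q aq; have := @Cinf_continuous _ _ _ f q => /cvgr_lt; exact.
Qed.

Lemma open_Cinf_lt f (a : R) : open [set p | f p < a].
Proof.
rewrite openE => q; have := @Cinf_continuous _ _ _ f q => /cvgr_lt; exact.
Qed.

(** The squares sum to 1, the form that suits the localisation of quadratic expressions; the bumps
    are divided by the square root of the sum of their squares. *)
Lemma partition_unity : compact [set: M] ->
 exists N (c : 'I_N -> chart R M) (y : 'I_N -> 'I_2 -> Cinf S) (O K : 'I_N -> set M) (eta : 'I_N -> Cinf S),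
 [/\ forall k, coords (c k) (y k) (O k), forall k, compact (K k) /\ K k `<=` O k,
  forall k p, ~ K k p -> eta k p = 0 & forall p, \sum_k eta k p ^+ 2 = 1].
Proof.
move=> cM.
pose P q c (y : 'I_2 -> Cinf S) U K V (chi : Cinf S) := [/\ coords c y U, compact K /\ K `<=` U,
 open V /\ V q, forall p, ~ K p -> chi p = 0 & forall p, V p -> chi p = 1].
have h q : exists c y U K V chi, P q c y U K V chi.
 have [c [y [W [cy Wq]]]] := coordinates_cover S q.
 have [_ oW _ _] := cy; have [chi [K [V [cK KW oV Vq [_ _ c0 c1]]]]] := bump_at S oW Wq.
 by exists c, y, W, K, V, chi.
have [cc {}h] := choice h; have [yy {}h] := choice h; have [oo {}h] := choice h.
have [kk {}h] := choice h; have [vv {}h] := choice h; have [xx {}h] := choice h.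
have hq q : open (vv q) /\ vv q q by case: (h q).
have [N [a ha]] := compact_finite cM hq.
pose s : Cinf S := \sum_(k < N) xx (a k) ^+ 2.
have es p : s p = \sum_(k < N) xx (a k) p ^+ 2.
 by rewrite /s Cinf_sum_E; apply: eq_bigr => k _; rewrite CinfX_E.
have s0 p : 0 < s p.
 have [k Vk] := ha p; have [_ _ _ _ h1] := h (a k).
 by rewrite es (bigD1 k)// h1// expr1n ltr_pwDl// sumr_ge0// => l _; rewrite sqr_ge0.
have sq := smooth_fun_sqrt openT (fun p _ => s0 p) (Cinf_smooth s).
have sq0 p : [set: M] p -> sqrt (s p) != 0 by move=> _; rewrite gt_eqF// sqrtr_gt0.
pose r := mkCinf (smooth_funV openT sq0 sq).
exists N, (cc \o a), (yy \o a), (oo \o a), (kk \o a), (fun k => xx (a k) * r); split.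
- by move=> k; case: (h (a k)).
- by move=> k; case: (h (a k)).
- by move=> k p nK; have [_ _ _ h0 _] := h (a k); rewrite CinfE h0// mul0r.
move=> p; under eq_bigr => k _ do rewrite CinfE exprMn.
by rewrite -mulr_suml /= exprVn sqr_sqrtr ?ltW// -es divff// gt_eqF.
Qed.

Lemma smooth_coord_vec c y O i f : coords c y O ->
 smooth O (fun p => cvec c i p f).
Proof.
move=> [Ac oO Oc _].
apply: (@smooth_fun_chart _ _ S c O _ Ac oO Oc) => s x [cx _].
exact: (smooth_on_partial i (Cinf_smooth_on f Ac)).
Qed.

Section HypothesisHB.
(** The section refutes this situation: d, the determinant of the frame near q, vanishes at q
    together with its derivatives along the distribution. *)
Context (q : M) (c : chart R M) (y : 'I_2 -> Cinf S) (W : set M) (e : frame E) (d : Cinf S) (V : set M).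
Context (cy : coords c y W) (Wq : W q) (fe : frames e) (eq0 : frame_dom e q).
Context (oV : open V) (Vq : V q) (Ve : V `<=` frame_dom e).
Context (hd : forall p, V p -> d p = frame_jac e (y o0) (y o1) p) (dq : d q = 0).
Context (dd : forall v : E q, anchor v d = 0).
Implicit Types X Y : Cinf S -> Cinf S.
Local Notation D := (Defs.distribution A).

Definition field_jac X Y : Cinf S := X (y o0) * Y (y o1) - X (y o1) * Y (y o0).

Lemma field_tangent X : D X -> tangent S q (fun f => X f q).
Proof. by move=> [h]. Qed.

(** Both fields are combinations of the frame near q, so their determinant is that of the
    coefficients times d. *)
Lemma field_jac_mul X Y : D X -> D Y -> exists (m : Cinf S) (U : set M), [/\ open U, U q &
 forall p, U p -> field_jac X Y p = (m * d) p].
Proof.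
move=> [_ [sg ssg hX]] [_ [sg' ssg' hY]].
have [a [sa ha]] := ssg e fe; have [b [sb hb]] := ssg' e fe.
have oe := @frame_dom_open _ _ _ e.
have sm := smooth_funB oe (smooth_funM oe (sa o0) (sb o1)) (smooth_funM oe (sa o1) (sb o0)).
have [m [U [oU Uq Ue hm]]] := globalize oe eq0 sm.
exists m, (U `&` V); split; [exact: openI|by []|] => p [Up Vp].
have ep := Ve Vp.
have eX f : X f p = a o0 p * anchor (frame_vec e p o0) f + a o1 p * anchor (frame_vec e p o1) f.
 have := congr1 (fun u => u f) (hX p); rewrite /field_at ha// sum_ord2 anchorD !anchorZ; exact.
have eY f : Y f p = b o0 p * anchor (frame_vec e p o0) f + b o1 p * anchor (frame_vec e p o1) f.
 have := congr1 (fun u => u f) (hY p); rewrite /field_at hb// sum_ord2 anchorD !anchorZ; exact.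
rewrite !CinfE hm// hd// !eX !eY /frame_jac; ring.
Qed.

Lemma field_jac_eq0 X Y : D X -> D Y -> field_jac X Y q = 0.
Proof.
by move=> DX DY; have [m [U [oU Uq ->//]]] := field_jac_mul DX DY; rewrite CinfE dq mulr0.
Qed.

Lemma field_jac_deriv0 X Y Z : D X -> D Y -> D Z -> Z (field_jac X Y) q = 0.
Proof.
move=> DX DY DZ; have tZ := field_tangent DZ; have [m [U [oU Uq h]]] := field_jac_mul DX DY.
rewrite (tangent_local tZ oU Uq h) (tangentM m d tZ) dq mul0r addr0.
have [_ [sg _ hZ]] := DZ; have := congr1 (fun u => u d) (hZ q); rewrite /field_at dd => ->.
by rewrite mulr0.
Qed.

(** The derivative along X of the determinant of X and Y is the divergence of X times that
    determinant plus the determinant of X and [X, Y]. The first two quantities vanish at q because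
    of d, hence so does the last. *)
Lemma bracket_parallel X Y : D X -> D Y ->
 X (y o0) q * bracket X Y (y o1) q - X (y o1) q * bracket X Y (y o0) q = 0.
Proof.
move=> DX DY; have tX := field_tangent DX; have tY := field_tangent DY.
have h0 := field_jac_eq0 DX DY; have h1 := field_jac_deriv0 DX DY DX.
rewrite (tangentB _ _ tX) !(tangentM _ _ tX) in h1.
rewrite /field_jac !CinfE in h0.
rewrite /bracket !CinfE.
rewrite !(tangent_coords (X _) cy Wq tX) !sum_ord2 in h1.
rewrite !(tangent_coords _ cy Wq tY) !sum_ord2.
move: h0 h1.
set a0 := X (y o0) q; set a1 := X (y o1) q; set b0 := Y (y o0) q; set b1 := Y (y o1) q.
set u := X (Y (y o1)) q; set w := X (Y (y o0)) q.
set d00 := cvec c o0 q (X (y o0)); set d10 := cvec c o1 q (X (y o0)).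
set d01 := cvec c o0 q (X (y o1)); set d11 := cvec c o1 q (X (y o1)).
move=> h0 h1.
transitivity (a0 * u + b1 * (a0 * d00 + a1 * d10) - (a1 * w + b0 * (a0 * d01 + a1 * d11)) -
  (d00 + d11) * (a0 * b1 - a1 * b0)); first by ring.
by rewrite h1 h0 mulr0 subrr.
Qed.

Lemma bracketC X Y f p : bracket X Y f p = - bracket Y X f p.
Proof. by rewrite opprB. Qed.

(** All values X(q) and [X, Y](q) are killed by one nonzero covector (l0, l1), so they cannot span
    the tangent space. If every field vanishes at q, so does every bracket; otherwise the covector
    is the annihilator of one nonzero X0(q), to which all other fields are parallel at q. *)
Lemma transverse_contradiction :
 HBat q -> False.
Proof.
move=> HB.
suff [l0 [l1 [l0l1 hD hB]]] : exists l0 l1 : R, [/\ l0 != 0 \/ l1 != 0,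
  forall X, D X -> l0 * X (y o0) q + l1 * X (y o1) q = 0 &
  forall X Y, D X -> D Y -> l0 * bracket X Y (y o0) q + l1 * bracket X Y (y o1) q = 0].
 have all0 t : tangent S q t -> l0 * t (y o0) + l1 * t (y o1) = 0.
  rewrite -HB => -[_ [X DX <-] [_ [n [a [w [hw ->]]]] <-]].
  have hk k : l0 * w k (y o0) + l1 * w k (y o1) = 0.
   by have [X1 DX1 [Y1 DY1 <-]] := hw k; exact: hB.
  rewrite !fct_sumE !mulrDr addrACA hD// add0r !mulr_sumr -big_split big1//= => k _.
  change (l0 * (a k * w k (y o0)) + l1 * (a k * w k (y o1)) = 0).
  by rewrite mulrCA (mulrCA l1) -mulrDr hk mulr0.
 have [Ac _ Wc _] := cy; have cq := Wc q Wq.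
 have e0 := all0 _ (coord_vec_tangent o0 Ac cq); have e1 := all0 _ (coord_vec_tangent o1 Ac cq).
 rewrite !(coord_vec_coord _ _ cy Wq) mulr1 mulr0 addr0 in e0.
 rewrite !(coord_vec_coord _ _ cy Wq) mulr1 mulr0 add0r in e1.
 by move: l0l1; rewrite e0 e1 eqxx; case.
have [[X0 [DX0 hX0]]|none] := pselect (exists X, D X /\ (X (y o0) q != 0 \/ X (y o1) q != 0)); last first.
 have z X i : D X -> X (y i) q = 0.
  by move=> DX; apply/eqP/negPn/negP => n0; apply: none; exists X; split => //; have [ei|ei] := ord2P i; rewrite -ei; [left|right].
 have zf X f : D X -> X f q = 0.
  by move=> DX; rewrite (tangent_coords f cy Wq (field_tangent DX)) sum_ord2 !z// !mul0r addr0.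
 exists 1, 0; split; [by left; exact: oner_neq0|by move=> X DX; rewrite !z// !mulr0 addr0|].
 move=> X Y DX DY; have zb f : bracket X Y f q = 0.
  by rewrite /bracket CinfB_E (zf X (Y f) DX) (zf Y (X f) DY) subrr.
 by rewrite !zb !mulr0 addr0.
exists (- X0 (y o1) q), (X0 (y o0) q); split.
- by case: hX0 => h; [right|left; rewrite oppr_eq0].
- move=> X DX; have := field_jac_eq0 DX0 DX; rewrite /field_jac !CinfE => <-; ring.
move=> X Y DX DY.
set b0 := bracket X Y (y o0) q; set b1 := bracket X Y (y o1) q.
have key Z : D Z -> Z (y o0) q * b1 - Z (y o1) q * b0 = 0 ->
  Z (y o0) q != 0 \/ Z (y o1) q != 0 -> - X0 (y o1) q * b0 + X0 (y o0) q * b1 = 0.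
 move=> DZ; have := field_jac_eq0 DX0 DZ; rewrite /field_jac !CinfE.
 set p0 := X0 (y o0) q; set p1 := X0 (y o1) q; set x0 := Z (y o0) q; set x1 := Z (y o1) q.
 move=> h1 h2 [n0|n0]; apply: (mulfI n0); rewrite mulr0.
  transitivity (p0 * (x0 * b1 - x1 * b0) + b0 * (p0 * x1 - p1 * x0)); first by ring.
  by rewrite h1 h2 !mulr0 addr0.
 transitivity (p1 * (x0 * b1 - x1 * b0) + b1 * (p0 * x1 - p1 * x0)); first by ring.
 by rewrite h1 h2 !mulr0 addr0.
have [hx|hx] := pselect (X (y o0) q != 0 \/ X (y o1) q != 0).
 by apply: (key X DX _ hx); exact: bracket_parallel.
have [hy|hy] := pselect (Y (y o0) q != 0 \/ Y (y o1) q != 0).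
 apply: (key Y DY _ hy); rewrite /b0 /b1 !(bracketC X Y).
 by have := bracket_parallel DY DX => h; rewrite !mulrN -opprB opprK -[RHS]oppr0 -h; ring.
have z Z f : D Z -> ~ (Z (y o0) q != 0 \/ Z (y o1) q != 0) -> Z f q = 0.
 move=> DZ nz; have [z0 z1] : Z (y o0) q = 0 /\ Z (y o1) q = 0.
  by split; apply/eqP/negPn/negP => h; apply: nz; [left|right].
 by rewrite (tangent_coords f cy Wq (field_tangent DZ)) sum_ord2 z0 z1 !mul0r addr0.
have zb f : bracket X Y f q = 0.
 by rewrite /bracket CinfB_E (z X (Y f) DX hx) (z Y (X f) DY hy) subrr.
by rewrite /b0 /b1 !zb !mulr0 addr0.
Qed.

End HypothesisHB.

(** [Gam d d q = 0] would make [sharp] of d vanish at q, hence all derivatives of d along the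
    distribution. *)
Lemma singular_transverse q c y W e (d : Cinf S) V :
 coords c y W -> W q -> frames e -> frame_dom e q -> open V -> V q -> V `<=` frame_dom e ->
 (forall p, V p -> d p = frame_jac e (y o0) (y o1) p) -> singular_set A q ->
 HBat q -> 0 < Gam d d q.
Proof.
move=> cy Wq fe eq0 oV Vq Ve hd Zq HB; rewrite lt_neqAle Gam_ge0 andbT eq_sym.
apply/eqP => G0; apply: (transverse_contradiction cy Wq fe eq0 oV Vq Ve hd _ _ HB).
 by rewrite hd//; apply/(singular_jac cy Wq eq0).
have s0 : sharp A d q = 0.
 apply/eqP/negPn/negP => n0; have := scalar_product_pos n0.
 by rewrite sharpP -[anchor _ _]/(Gam d d q) G0 ltxx.
by move=> v; rewrite -sharpP s0 sp0l.
Qed.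

(* Near every point, the function [T] is a positive function times the square of the
  determinant [d] of a local frame; [Wron] of the coords is another such product. *)
Lemma local_structure N (cc : 'I_N -> chart R M) (yy : 'I_N -> 'I_2 -> Cinf S) (OO : 'I_N -> set M) q c
  (y : 'I_2 -> Cinf S) W : (forall k, coords (cc k) (yy k) (OO k)) ->
 (forall p, exists k, OO k p) -> coords c y W -> W q ->
 (forall p : M, HBat p) ->
 exists (G h d : Cinf S) V, [/\ open V, V q, V `<=` W &
  [/\ forall p, V p -> (\sum_k Wron (yy k o0) (yy k o1)) p = (G * (d * d)) p,
   forall p, V p -> Wron (y o0) (y o1) p = (h * (d * d)) p,
   forall p, V p -> 0 < G p, forall p, V p -> 0 < h p & singular_set A q -> 0 < Gam d d q]].
Proof.
move=> cyy cov cy Wq HB; have [e fe eq0] := frames_cover E q.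
have oe := @frame_dom_open _ _ _ e; have [Ac oW Wc hy] := cy.
have oI := openI oe oW.
pose J k p := cvec c o0 p (yy k o0) * cvec c o1 p (yy k o1) -
 cvec c o1 p (yy k o0) * cvec c o0 p (yy k o1).
have sJ k : smooth (frame_dom e `&` W) (J k).
 have sv i f := smooth_fun_sub (@subIsetr _ (frame_dom e) W) (smooth_coord_vec i f cy).
 exact: (smooth_funB oI (smooth_funM oI (sv _ _) (sv _ _)) (smooth_funM oI (sv _ _) (sv _ _))).
have sh : smooth (frame_dom e `&` W) (fun p => (gram_det e p)^-1).
 apply: (smooth_funV oI) => [p [ep]|]; first by rewrite gt_eqF// gram_det_gt0.
 exact: (smooth_fun_sub (@subIsetl _ _ _) (gram_det_smooth fe)).
have sG : smooth (frame_dom e `&` W) (fun p => (\sum_k J k p * J k p) * (gram_det e p)^-1).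
 apply: (smooth_funM oI _ sh); apply: (@smooth_fun_sum _ _ S _ _ (index_enum _) (fun k p => J k p * J k p) oI) => k.
 exact: (smooth_funM oI (sJ k) (sJ k)).
have sd := smooth_fun_sub (@subIsetl _ _ W) (frame_jac_smooth (y o0) (y o1) fe).
have Iq : (frame_dom e `&` W) q by [].
have [h [V1 [oV1 V1q V1I h1]]] := globalize oI Iq sh.
have [G [V2 [oV2 V2q V2I h2]]] := globalize oI Iq sG.
have [d [V3 [oV3 V3q V3I h3]]] := globalize oI Iq sd.
exists G, h, d, (V1 `&` (V2 `&` V3)); split.
- exact: (openI oV1 (openI oV2 oV3)).
- by [].
- by move=> p [/V1I[]].
split.
- move=> p [V1p [V2p V3p]]; have [ep Wp] := V1I p V1p.
 rewrite !CinfE h2// h3// mulr_suml !mulr_suml; apply: eq_bigr => k _.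
 rewrite (WronE _ _ ep) (frame_jac_coords _ _ _ cy Wp) -/(J k p); ring.
- move=> p [V1p [V2p V3p]]; have [ep Wp] := V1I p V1p.
 by rewrite (WronE _ _ ep) !CinfE h1// h3// expr2 mulrC.
- move=> p [V1p [V2p V3p]]; have [ep Wp] := V1I p V1p.
 rewrite h2// divr_gt0 ?gram_det_gt0//.
 have [k Ok] := cov p; rewrite (bigD1 k)//= ltr_pwDl//; last by apply: sumr_ge0 => l; rewrite sqr_ge0.
 rewrite lt_neqAle sqr_ge0 andbT eq_sym sqrf_eq0; apply/eqP => J0.
 (* [J k] is the Jacobian between two coordinate systems at p; its product with the inverse Jacobian
    is 1. *)
 have [Ack oOk Okc hyk] := cyy k; have ckp := Okc p Ok.
 have tk i := coord_vec_tangent i Ack ckp.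
 have m i j := tangent_coords (yy k j) cy Wp (tk i).
 have d00 := m o0 o0; have d01 := m o0 o1; have d10 := m o1 o0; have d11 := m o1 o1.
 rewrite !(coord_vec_coord _ _ (cyy k) Ok) !sum_ord2 /= in d00 d01 d10 d11.
 have : (1 : R) = (cvec (cc k) o0 p (y o0) * cvec (cc k) o1 p (y o1) -
   cvec (cc k) o0 p (y o1) * cvec (cc k) o1 p (y o0)) * J k p.
  have det (a0 a1 b0 b1 u0 u1 w0 w1 : R) : 1 = a0 * u0 + a1 * u1 -> 0 = a0 * w0 + a1 * w1 ->
    0 = b0 * u0 + b1 * u1 -> 1 = b0 * w0 + b1 * w1 -> 1 = (a0 * b1 - a1 * b0) * (u0 * w1 - u1 * w0).
   move=> e1 e2 e3 e4; transitivity ((a0 * u0 + a1 * u1) * (b0 * w0 + b1 * w1) - (a0 * w0 + a1 * w1) * (b0 * u0 + b1 * u1)).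
    by rewrite -e1 -e2 -e3 -e4 mul0r subr0 mulr1.
   ring.
  exact: det d00 d01 d10 d11.
 by rewrite J0 mulr0 => /eqP; rewrite oner_eq0.
- by move=> p [V1p _]; have [ep Wp] := V1I p V1p; rewrite h1// invr_gt0 gram_det_gt0.
move=> Zq; apply: (singular_transverse cy Wq fe eq0 oV3 V3q _ h3 Zq (HB q)).
by move=> p /V3I[].
Qed.

End LocalStructure.

(** * Riemannian area and Laplacian in charts *)

Context (omega : {measure set (borel M) -> \bar R}).
Hypothesis omegaA : riemannian_area A omega.
Local Notation bM := (borel M).
Local Notation mfM := (measurable_fun [set: bM]).
Local Notation off K f := (forall p, ~ K p -> f p = 0).
Local Notation pt := (R * R)%type.
Local Notation mpt := (measurableTypeR R * measurableTypeR R)%type.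
Local Notation mfP := (measurable_fun [set: mpt]).
Local Notation Leb := (lebesgue2 R).
Local Notation Z := (singular_set A).
Local Notation Lap := (laplace_operator A omega).
Local Notation ip := (inner omega).
Implicit Types (c : chart R M) (q p : M) (O V W K : set M) (x : pt).
Implicit Types (f g phi psi F sg : Cinf S) (y : 'I_2 -> Cinf S).

Lemma Wron_gt0 c y O q : coords c y O -> O q -> ~ Z q -> 0 < Wron (y o0) (y o1) q.
Proof.
by move=> cy Oq nZ; rewrite lt0r Wron_ge0 andbT; apply/eqP => /(singular_Wron cy Oq).
Qed.

Lemma closed_singular : closed Z.
Proof.
rewrite -[Z]setCK closedC openE => q nZq; have [c [y [W [cy Wq]]]] := coordinates_cover S q.
have [_ oW _ _] := cy; have oI := openI oW (open_Cinf_gt (Wron (y o0) (y o1)) 0).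
apply: filterS (open_nbhs_nbhs (conj oI (conj Wq (Wron_gt0 cy Wq nZq)))) => p [Wp p0] /(singular_Wron cy Wp) p1.
by have /= := p0; rewrite [X in 0 < X]p1 ltxx.
Qed.

Lemma open_regular : open (~` Z).
Proof. exact: closed_openC closed_singular. Qed.

Lemma open_borel O : open O -> measurable (O : set (borel M)).
Proof. by move=> oO; exact: sub_sigma_algebra. Qed.

Lemma measurable_singular : measurable (Z : set (borel M)).
Proof. by rewrite -[Z]setCK; apply: measurableC; apply: open_borel; exact: open_regular. Qed.

Lemma continuous_borel (f : M -> R) : continuous f -> mfM (f : bM -> R).
Proof.
move=> cf; apply: measurable_fun_gt => a; rewrite setTI; apply: open_borel.
by rewrite openE => q; have /cvgr_gt := cf q; exact.
Qed.

Lemma Cinf_borel (f : Cinf S) : mfM (f : bM -> R).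
Proof. by apply: continuous_borel; exact: Cinf_continuous. Qed.

(** The area density, set to zero where its value is meaningless, which makes it measurable on the
    plane. *)
Definition weight c x : R := if pselect (chart_pre c (~` Z) x) then area_density A c x else 0.

Lemma weightE c x : chart_pre c (~` Z) x -> weight c x = area_density A c x.
Proof. by rewrite /weight; case: pselect. Qed.

Lemma weight_eq0 c x : ~ chart_pre c (~` Z) x -> weight c x = 0.
Proof. by rewrite /weight; case: pselect. Qed.

Lemma weight_ge0 c x : 0 <= weight c x.
Proof. by rewrite /weight; case: pselect => // ?; exact: sqrtr_ge0. Qed.

Lemma weight_coords c y O q : coords c y O -> O q -> ~ Z q ->
 weight c (cmap c q) = (sqrt (Wron (y o0) (y o1) q))^-1.
Proof.
move=> cy Oq nZ; rewrite weightE; first exact: area_densityE cy Oq nZ.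
by have [_ _ Oc _] := cy; exact: chart_preP (Oc q Oq) nZ.
Qed.

Lemma smooth_weight c : atlas S c -> smooth_on (chart_pre c (~` Z)) (weight c).
Proof.
move=> Ac; apply: smooth_on_local => x [cx nZ]; have cq := chart_inv_dom cx.
have [y [W [cy Wq]]] := coordinates_at Ac cq; have [_ oW Wc _] := cy.
have oI := openI oW open_regular.
exists (chart_pre c (W `&` ~` Z)); split; first by split.
 exact: open_pre.
have w0 p (h : (W `&` ~` Z) p) := Wron_gt0 cy h.1 h.2.
have s1 := smooth_fun_sqrt oI w0 (Cinf_smoothW (Wron (y o0) (y o1))).
have n0 p : (W `&` ~` Z) p -> sqrt (Wron (y o0) (y o1) p) != 0 by move=> /w0 h; rewrite gt_eqF// sqrtr_gt0.
have /smooth_funE/(_ c Ac) := smooth_funV oI n0 s1; apply: smooth_on_eq; first exact: open_pre.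
move=> z /set_mem[cz [Wz nZz]]; rewrite /= -{2}[z](chart_invK cz).
by rewrite (weight_coords cy Wz nZz).
Qed.

Lemma open_chart_regular c : open (cdom c `&` ~` Z).
Proof. by apply: openI; [exact: chart_dom_open|exact: open_regular]. Qed.

Lemma smooth_weight_map c : atlas S c ->
 smooth (cdom c `&` ~` Z) (fun q => weight c (cmap c q)).
Proof.
move=> Ac; apply: (smooth_fun_chart (c := c) Ac (open_chart_regular c)); first by move=> q [].
by apply: smooth_on_sub (smooth_weight Ac) => x [cx []].
Qed.

Lemma weight_gt0 c x : atlas S c -> chart_pre c (~` Z) x -> 0 < weight c x.
Proof.
move=> Ac [cx nZ]; have [y [W [cy Wq]]] := coordinates_at Ac (chart_inv_dom cx).
by rewrite -(chart_invK cx) (weight_coords cy Wq nZ) invr_gt0 sqrtr_gt0 (Wron_gt0 cy Wq nZ).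
Qed.

Lemma measurable_weight c : atlas S c -> mfP (weight c : mpt -> R).
Proof.
move=> Ac; have oP := open_pre c open_regular.
have mP := open_measurable2 oP.
rewrite -(setUv (chart_pre c (~` Z))); apply/(measurable_funU _ mP (measurableC mP)); split.
 apply: continuous_on_measurable2 => // x Px; exact: (smooth_partials (smooth_weight Ac) Px).1.
have h : {in ~` chart_pre c (~` Z), (fun=> 0 : R) =1 weight c}.
 by move=> x /set_mem nP; rewrite weight_eq0.
exact: @eq_measurable_fun _ _ mpt R _ _ _ h _.
Qed.

(* cinv c, with a constant value off its domain so as to be measurable *)
Definition chart_point c x : borel M := if pselect (chart_img c x) then cinv c x else point.

Lemma chart_pointE c x : chart_img c x -> chart_point c x = cinv c x.
Proof. by rewrite /chart_point; case: pselect. Qed.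

Lemma measurable_chart_point c : mfP (chart_point c : mpt -> borel M).
Proof.
have oI : open (chart_img c) := @chart_img_open _ _ c.
have mI := open_measurable2 oI.
rewrite -(setUv (chart_img c)); apply/(measurable_funU _ mI (measurableC mI)); split.
 apply: (@measurability _ _ mpt (borel M) _ _ (@open M)); first by [].
 move=> _ [U oU <-]; rewrite (_ : _ `&` _ = chart_pre c U); first by apply: open_measurable2; exact: open_pre.
 by apply/seteqP; split => x [cx Ux]; split => //; move: Ux; rewrite /= chart_pointE.
have h : {in ~` chart_img c, (fun=> point : borel M) =1 chart_point c}.
 by move=> x /set_mem nI; rewrite /chart_point; case: pselect.
exact: (@eq_measurable_fun _ _ mpt _ _ _ _ h).
Qed.

Lemma chart_transfer c (f : M -> R) : atlas S c -> mfM (f : bM -> R) ->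
 (forall q, ~ (cdom c `\` Z) q -> f q = 0) ->
 (\int[omega]_q (f q)%:E = \int[Leb]_x (f (chart_point c x) * weight c x)%:E)%E.
Proof.
move=> Ac mf f0.
have oD := open_chart_regular c : open (cdom c `\` Z).
apply: (transfer_integral (open_borel oD) (measurable_chart_point c) (measurable_weight Ac) (weight_ge0 c)) => //.
move=> B mB; have mBD : measurable (B `&` (cdom c `\` Z) : set (borel M)).
 by apply: measurableI => //; exact: open_borel.
rewrite (omegaA.2 c _ Ac mBD)//.
apply: (etrans (@integral_mkcond _ mpt R Leb _ _)).
apply: eq_integral => x _; rewrite patchE.
have [[cx nZ]|nP] := pselect (chart_pre c (~` Z) x); last first.
 rewrite weight_eq0// mulr0; case: ifPn => // /set_mem[q [_ [cq nZ]] qx].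
 by case: nP; rewrite -qx; exact: chart_preP.
rewrite chart_pointE// weightE// indicE; case: ifPn => [/set_mem[q [Bq [cq _]] qx]|nB].
 by rewrite -qx chart_mapK// mem_set// mul1r.
rewrite memNset ?mul0r// => Bx; move/negP: nB; apply; apply/mem_set.
exists (cinv c x); last exact: chart_invK.
by split => //; split => //; exact: chart_inv_dom.
Qed.

Lemma chart_int c (f : M -> R) : atlas S c -> mfM (f : bM -> R) ->
 (forall q, ~ (cdom c `\` Z) q -> f q = 0) ->
 (\int[omega]_q f q = \int[Leb]_x (f (chart_point c x) * weight c x)).
Proof. by move=> Ac mf f0; rewrite /Rintegral (chart_transfer Ac mf f0). Qed.

Lemma chart_integ c (f : M -> R) : atlas S c -> mfM (f : bM -> R) ->
 (forall q, ~ (cdom c `\` Z) q -> f q = 0) ->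
 integ omega (f : bM -> R) <-> integ Leb (fun x : mpt => f (chart_point c x) * weight c x).
Proof.
move=> Ac mf f0.
have mw : mfP (fun x : mpt => f (chart_point c x) * weight c x).
 apply: measurable_funM; last exact: measurable_weight.
 exact: (measurableT_comp mf (@measurable_chart_point c)).
have e : (\int[omega]_q `|(f q)%:E| = \int[Leb]_x `|(f (chart_point c x) * weight c x)%:E|)%E.
 have mnf : mfM (fun q : bM => `|f q|) by exact: measurableT_comp.
 rewrite (chart_transfer Ac mnf) => [|q /f0 ->]; last by rewrite normr0.
 by apply: eq_integral => x _; rewrite /= normrM (ger0_norm (weight_ge0 c x)).
split=> /integrableP[_ h]; apply/integrableP; split; try exact/measurable_EFinP; first by rewrite -e.
by move: h; rewrite -e.
Qed.

Lemma compact_closedM K : compact K -> closed K.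
Proof. exact: compact_closed (surface_hausdorff S). Qed.

Lemma test_functionP phi : test_function A phi <->
 exists K, [/\ compact K, K `<=` ~` Z & off K phi].
Proof.
split=> [[cK KZ]|[K [cK KZ h]]].
 exists (closure [set q | phi q != 0]); split => // q nK.
 by apply/eqP/negPn/negP => fq; apply: nK; exact: subset_closure.
have sK : closure [set q | (phi : M -> R) q != 0] `<=` K.
 rewrite (closure_id K).1; last exact: compact_closedM.
 by apply: closure_subset => q /= fq; apply: contrapT => /h e; rewrite e eqxx in fq.
split; last exact: subset_trans sK KZ.
by apply: subclosed_compact cK sK; exact: closed_closure.
Qed.

(** Obtained by differentiating the relation weight^2 det g^ij = 1. *)
Lemma weight_partial c y O q i : coords c y O -> O q -> ~ Z q ->
 derivable (weight c) (cmap c q) (bv i) /\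
 partial i (weight c) (cmap c q) =
  - (2^-1 * weight c (cmap c q) * cvec c i q (Wron (y o0) (y o1)) / Wron (y o0) (y o1) q).
Proof.
move=> cy Oq nZ; have [Ac oO Oc _] := cy; have cq := Oc q Oq.
have w0 := Wron_gt0 cy Oq nZ; set tau := Wron (y o0) (y o1) in w0 *.
have dw := (smooth_partials (smooth_weight Ac) (chart_preP cq nZ)).2 i.
have dt := @chart_partials _ _ _ c tau q i Ac cq.
split => //.
have oP := open_pre c (openI oO (open_regular)).
have Pq : chart_pre c (O `&` ~` Z) (cmap c q) by exact: chart_preP.
have wE p : O p -> ~ Z p -> weight c (cmap c p) ^+ 2 * tau p = 1.
 move=> Op nZp; rewrite (weight_coords cy Op nZp) exprVn sqr_sqrtr ?Wron_ge0// mulVf//.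
 by rewrite gt_eqF// (Wron_gt0 cy Op nZp).
have e1 : {in chart_pre c (O `&` ~` Z), (fun z => weight c z * weight c z * (tau \o cinv c) z) =1 fun=> 1 : R}.
 by move=> z /set_mem[cz [Oz nZz]]; rewrite -{1 2}(chart_invK cz) -expr2 /= wE.
have := @partial_eq R _ _ _ i oP e1 _ (mem_set Pq); rewrite partial_cst.
rewrite (partialM (derivableM dw dw) dt) (partialM dw dw) /comp chart_mapK//.
rewrite -[(weight c * weight c) _]/(weight c (cmap c q) * weight c (cmap c q)).
have := wE q Oq nZ; rewrite -/(cvec c i q tau).
have ww : 0 < weight c (cmap c q) by apply: weight_gt0 => //; exact: chart_preP.
move: (weight c _) ww (partial i _ _) (cvec c i q tau) (tau q) w0 => w ww w' t' t t0 h1 h2.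
have e2 : (w' + 2^-1 * w * t' / t) * (2 * w * t) = 0.
 by rewrite -h2; field; rewrite gt_eqF.
have nz : 2 * w * t != 0 by rewrite !mulf_neq0// ?pnatr_eq0// gt_eqF.
by move/eqP: e2; rewrite mulf_eq0 (negbTE nz) orbF addr_eq0 => /eqP.
Qed.

Lemma closed_chart_image c K : compact K -> K `<=` cdom c -> closed (cmap c @` K).
Proof.
move=> cK Kc; apply: compact_closed; first exact: (@norm_hausdorff _ pt).
apply: continuous_compact cK; apply: continuous_in_subspaceT => q /set_mem /Kc.
exact: chart_map_continuous.
Qed.

Lemma partial_off c K (h : pt -> R) x i : compact K -> K `<=` cdom c ->
 (forall z, ~ (cmap c @` K) z -> h z = 0) -> ~ (cmap c @` K) x -> partial i h x = 0.
Proof.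
move=> cK Kc h0 nK; have oK := closed_openC (closed_chart_image cK Kc).
rewrite (@partial_eq R _ h (fun=> 0) i oK _ _ (mem_set nK)) ?partial_cst// => t /set_mem; exact: h0.
Qed.

(** The weight is smooth only off the singular set, but f vanishes near that set and near the edge
    of the chart. The product of the two is therefore a test function on the plane, through which
    integrals over M are computed. *)
Lemma chart_pull c K f : atlas S c -> compact K -> K `<=` cdom c `\` Z -> off K f ->
 exists2 F : pt -> R, Cc F & [/\ forall x, F x = f (chart_point c x) * weight c x,
  forall x, ~ (cmap c @` K) x -> F x = 0, integ omega (f : bM -> R) &
  (\int[omega]_q f q = \int[Leb]_x F x)].
Proof.
move=> Ac cK Kc f0; have oD := open_chart_regular c.
have Kd : K `<=` cdom c by move=> q /Kc[].
have s1 := smooth_funM oD (Cinf_smoothW f) (smooth_weight_map Ac).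
have z q : ~ K q -> f q * weight c (cmap c q) = 0 by move=> /f0 ->; rewrite mul0r.
have s2 := @smooth_fun_ext _ _ _ _ K _ oD (compact_closedM cK) Kc s1 z.
have [F cF [hF sF]] := @chart_ext _ _ _ c _ K Ac cK Kd (smooth_fun_sub (@subsetT _ _) s2) z.
have FE x : F x = f (chart_point c x) * weight c x.
 have [cx|ncx] := pselect (chart_img c x).
  by rewrite -{1}(chart_invK cx) hF ?chart_invK ?chart_pointE//; exact: chart_inv_dom.
 rewrite weight_eq0; last by case.
 rewrite mulr0; apply/eqP/negPn/negP => /sF[q Kq qx]; apply: ncx; rewrite -qx.
 by apply: chart_imgP; exact: Kd.
have fD q : ~ (cdom c `\` Z) q -> f q = 0 by move=> nD; apply: f0 => /Kc.
exists F => //; split => //.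
- by move=> x nx; apply/eqP/negP => /negP; exact: contra_not (sF x) nx.
- apply/(chart_integ Ac (Cinf_borel f) fD).
 by apply: integ_eq (Cc_int cF) => x; rewrite FE.
rewrite (chart_int Ac (Cinf_borel f) fD); apply: eq_int => x; exact/esym/FE.
Qed.

(** The formula for g says that weight times g is the Euclidean divergence of weight times f; the
    second term is the logarithmic derivative of the weight. *)
Lemma divergence_chart c y O K (f : 'I_2 -> Cinf S) g : coords c y O -> compact K -> K `<=` O `\` Z ->
 (forall i q, ~ K q -> f i q = 0) -> off K g ->
 (forall q, O q -> ~ Z q -> g q = \sum_i (cvec c i q (f i) -
   2^-1 * f i q * cvec c i q (Wron (y o0) (y o1)) / Wron (y o0) (y o1) q)) ->
 (\int[omega]_q g q = 0).
Proof.
move=> cy cK KO f0 g0 hg; have [Ac oO Oc _] := cy.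
have Kc : K `<=` cdom c `\` Z by move=> q /KO[/Oc].
have [G cG [GE Gs _ ->]] := chart_pull Ac cK Kc g0.
have hF i := cid2 (chart_pull Ac cK Kc (f0 i)).
pose F i := s2val (hF i).
have cF i : Cc (F i) := s2valP (hF i).
have FE i x : F i x = f i (chart_point c x) * weight c x by have [h _ _ _] := s2valP' (hF i); exact: h.
have Fs i x : ~ (cmap c @` K) x -> F i x = 0 by have [_ h _ _] := s2valP' (hF i); exact: h.
have GE' x : G x = \sum_i partial i (F i) x.
 have [[q Kq qx]|nK] := pselect ((cmap c @` K) x); last first.
  by rewrite Gs// big1// => i _; exact: partial_off cK (fun q Kq => (Kc q Kq).1) (Fs i) nK.
 have [Oq nZq] := KO q Kq; have cq := Oc q Oq.
 have cx : chart_img c x by rewrite -qx; exact: chart_imgP.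
 rewrite GE chart_pointE// -qx chart_mapK// hg// mulr_suml; apply: eq_bigr => i _.
 have oP := open_pre c (openI oO (open_regular)).
 have Pq : chart_pre c (O `&` ~` Z) (cmap c q) by exact: chart_preP.
 have e1 : {in chart_pre c (O `&` ~` Z), F i =1 (fun z => (f i \o cinv c) z * weight c z)}.
  by move=> z /set_mem[cz _]; rewrite FE chart_pointE.
 have [dw ew] := weight_partial i cy Oq nZq.
 rewrite (@partial_eq R _ _ _ i oP e1 _ (mem_set Pq)) (partialM (@chart_partials _ _ _ c _ q i Ac cq) dw).
 by rewrite ew /coord_vec /= chart_mapK//; ring.
under eq_Rintegral => x _ do rewrite GE'.
rewrite int_sum => [|i]; last by apply: Cc_int; exact: Cc_partial.
by apply: big1 => i _; have [sF bF] := cF i; exact: int_partial0.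
Qed.

(** The expression rho^-1 d_i(rho g^ij d_j phi) with rho = (det g^ij)^(-1/2): the sum is d_i(g^ij
    d_j phi), the other term comes from the derivative of log rho. *)
Definition lap_coords c y phi q : R :=
 \sum_i cvec c i q (Gam phi (y i)) -
 2^-1 * Gam phi (Wron (y o0) (y o1)) q / Wron (y o0) (y o1) q.

(** [divergence] is computed in the particular chart [chart_at]. This treats that chart; [laplaceE]
    extends the formula to all others. *)
Lemma laplace_at phi q y O : coords (chart_at S q) y O -> O q -> ~ Z q ->
 lap phi q = lap_coords (chart_at S q) y phi q.
Proof.
set c := chart_at S q => cy Oq nZ; have [Ac oO Oc _] := cy; have cq := Oc q Oq.
rewrite /laplace_beltrami /divergence -/c /lap_coords (Gam_coords A phi _ cy Oq).
have oP := open_pre c (openI oO (open_regular)).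
have Pq : chart_pre c (O `&` ~` Z) (cmap c q) by exact: chart_preP.
have wE := weightE (chart_preP cq nZ); have w0 := weight_gt0 Ac (chart_preP cq nZ).
have e1 i : {in chart_pre c (O `&` ~` Z), (fun x => area_density A c x *
  components c (cinv c x) (gradient A phi (cinv c x)) i) =1
  fun z => weight c z * (Gam phi (y i) \o cinv c) z}.
 move=> z /set_mem[cz [Oz nZz]]; rewrite weightE// gradientE//.
 rewrite (componentsE i cy Oz) //; last exact: anchor_tangent.
under eq_bigr => i _.
 have [dw ew] := weight_partial i cy Oq nZ.
 rewrite (@partial_eq R _ _ _ i oP (e1 i) _ (mem_set Pq)) (partialM dw (@chart_partials _ _ _ c _ q i Ac cq)).
 rewrite ew /= chart_mapK// -/(cvec c i q _).
 over.
rewrite -wE mulr_sumr; rewrite -mulrA mulr_suml mulr_sumr -sumrB; apply: eq_bigr => i _ .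
have := Wron_gt0 cy Oq nZ; move: (Wron _ _ q) (weight c _) w0 => t w w0 t0.
by field; rewrite !gt_eqF.
Qed.

Lemma Gam_off K phi psi q : closed K -> (off K phi) -> ~ K q -> Gam phi psi q = 0.
Proof.
move=> cK f0 nK; rewrite GamC (@Gam_local _ _ _ A psi phi 0 _ q (closed_openC cK) nK f0).
exact: tangent0 (Gam_tangent A psi q).
Qed.

Lemma lap_coords_smooth c y O phi : coords c y O -> smooth (O `&` ~` Z) (lap_coords c y phi).
Proof.
move=> cy; have [Ac oO Oc _] := cy; have oI := openI oO open_regular.
have s1 i : smooth (O `&` ~` Z) (fun q => cvec c i q (Gam phi (y i))).
 exact: (smooth_fun_sub (@subIsetl _ O (~` Z)) (smooth_coord_vec i (Gam phi (y i)) cy)).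
have s2 := smooth_funV oI (fun p Wp => lt0r_neq0 (Wron_gt0 cy Wp.1 Wp.2)) (Cinf_smoothW _).
have s3 := smooth_funM oI (Cinf_smoothW (2^-1 *: Gam phi (Wron (y o0) (y o1)))) s2.
exact: smooth_funB oI (@smooth_fun_sum _ _ _ _ _ _ _ oI s1) s3.
Qed.

Lemma green_chart c y O K phi psi g : coords c y O -> compact K -> K `<=` O `\` Z ->
 (forall i q, ~ K q -> psi q * Gam phi (y i) q = 0) -> off K g ->
 (forall q, O q -> ~ Z q -> g q = psi q * lap_coords c y phi q + Gam phi psi q) ->
 (\int[omega]_q g q = 0).
Proof.
move=> cy cK KO f0 g0 hg; have [Ac oO Oc _] := cy.
apply: (@divergence_chart c y O K (fun i => psi * Gam phi (y i)) g cy cK KO) => // q Oq nZ.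
have cq := Oc q Oq; rewrite hg//.
have e i : cvec c i q (psi * Gam phi (y i)) =
  psi q * cvec c i q (Gam phi (y i)) + Gam phi (y i) q * cvec c i q psi.
 exact: (tangentM _ _ (coord_vec_tangent i Ac cq)).
rewrite (Gam_coords A phi psi cy Oq) /lap_coords (Gam_coords A phi _ cy Oq).
rewrite mulrBr mulr_sumr mulr_sumr mulr_suml mulr_sumr -sumrB -big_split; apply: eq_bigr => i _.
rewrite [X in _ = X - _]e; change ((psi * Gam phi _) q) with (psi q * Gam phi (y i) q).
by rewrite /=; ring.
Qed.

(** Both expressions satisfy Green's formula for the same area, so their difference h has zero
    integral against chi h for a bump chi at q. As chi h^2 >= 0, this forces h(q) = 0. *)
Lemma lap_coords_eq c y O c' y' O' phi q : coords c y O -> coords c' y' O' ->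
 O q -> O' q -> ~ Z q -> lap_coords c y phi q = lap_coords c' y' phi q.
Proof.
move=> cy cy' Oq O'q nZ; have [Ac oO Oc _] := cy; have [Ac' oO' Oc' _] := cy'.
have oI := openI (openI oO oO') open_regular.
have Iq : (O `&` O' `&` ~` Z) q by [].
have sub1 : (O `&` O') `&` ~` Z `<=` O `&` ~` Z by move=> p [[]].
have sub2 : (O `&` O') `&` ~` Z `<=` O' `&` ~` Z by move=> p [[]].
have s1 := smooth_fun_sub sub1 (lap_coords_smooth phi cy).
have s2 := smooth_fun_sub sub2 (lap_coords_smooth phi cy').
have [h [V [oV Vq VI hE]]] := globalize oI Iq (smooth_funB oI s1 s2).
have [l [V2 [oV2 V2q V2I lE]]] := globalize oI Iq s1.
have [chi [K [V3 [cK KV oV3 V3q [V3K c01 c0 c1]]]]] := bump_at S (openI oV oV2) (conj Vq V2q).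
apply/eqP; rewrite -subr_eq0; apply/negPn/negP => hq.
have {}hq : h q != 0 by rewrite hE.
pose psi := chi * h.
have psi0 p : ~ K p -> psi p = 0 by move=> /c0; rewrite CinfM_E => ->; rewrite mul0r.
have clK := compact_closedM cK.
have f0 (z : 'I_2 -> Cinf S) i p : ~ K p -> psi p * Gam phi (z i) p = 0 by move=> /psi0 ->; rewrite mul0r.
pose g := psi * l + Gam phi psi.
have g0 p : ~ K p -> g p = 0.
 by move=> nK; rewrite CinfD_E CinfM_E psi0// mul0r add0r GamC (Gam_off phi clK psi0 nK).
have KI p : K p -> ((O `&` O') `&` ~` Z) p by move=> /KV[/VI].
have KO : K `<=` O `\` Z by move=> p /KI[[]].
have KO' : K `<=` O' `\` Z by move=> p /KI[[]].
have i1 : (\int[omega]_p g p = 0).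
 apply: (green_chart cy cK KO (f0 y) g0) => p Op nZp.
 rewrite CinfD_E CinfM_E; have [Kp|nK] := pselect (K p); last by rewrite psi0// !mul0r.
 by have [_ V2p] := KV p Kp; rewrite lE.
have g'0 p : ~ K p -> (g - psi * h) p = 0.
 by move=> nK; rewrite CinfB_E g0// CinfM_E psi0// mul0r subr0.
have i2 : \int[omega]_p (g - psi * h) p = 0.
 apply: (green_chart cy' cK KO' (f0 y') g'0) => p Op nZp.
 rewrite CinfB_E CinfD_E !CinfM_E; have [Kp|nK] := pselect (K p); last by rewrite c0// !mul0r subr0.
 by have [Vp V2p] := KV p Kp; rewrite lE// hE//; ring.
have Kc : K `<=` cdom c `\` Z by move=> p /KO[/Oc].
have [F1 _ [_ _ I1 _]] := chart_pull Ac cK Kc g0.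
have [F2 _ [_ _ I2 _]] := chart_pull Ac cK Kc g'0.
have p0 p : ~ K p -> (psi * h) p = 0 by move=> nK; rewrite CinfM_E psi0// mul0r.
have [F cF [FE _ _ e]] := chart_pull Ac cK Kc p0.
have : (\int[Leb]_x F x = 0).
 rewrite -e; transitivity (\int[omega]_p (g p - (g - psi * h) p)); last by rewrite intB// i2 subr0.
 by apply: eq_int => p; rewrite CinfB_E opprB addrC subrK.
have cq := Oc q Oq.
have Fq : 0 < F (cmap c q).
 have P : chart_pre c (~` Z) (cmap c q) by exact: chart_preP.
 rewrite FE (chart_pointE P.1) chart_mapK// mulr_gt0 ?weight_gt0// !CinfM_E c1// mul1r -expr2.
 by rewrite lt0r sqrf_eq0 hq sqr_ge0.
move=> i0; have := Cc_int_gt0 cF _ Fq; rewrite i0 ltxx => /(_ _)/negP; apply => //.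
move=> x; rewrite FE mulr_ge0 ?weight_ge0// !CinfM_E -mulrA mulr_ge0 ?sqr_ge0//.
by have /andP[] := c01 (chart_point c x).
Qed.

Lemma atlas_chart_at q : atlas S (chart_at S q) /\ cdom (chart_at S q) q.
Proof. by rewrite /chart_at; case: cid2. Qed.

Lemma laplaceE phi q c y O : coords c y O -> O q -> ~ Z q ->
 lap phi q = lap_coords c y phi q.
Proof.
move=> cy Oq nZ; have [Ac cq] := atlas_chart_at q.
have [y' [W [cy' Wq]]] := coordinates_at Ac cq.
by rewrite (laplace_at phi cy' Wq nZ); exact: lap_coords_eq cy' cy Wq Oq nZ.
Qed.

Lemma laplace_smooth phi : smooth (~` Z) (lap phi).
Proof.
apply: smooth_fun_local => q nZ; have [c [y [W [cy Wq]]]] := coordinates_cover S q; have [_ oW _ _] := cy.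
exists (W `&` ~` Z) => //; apply: smooth_fun_eq (lap_coords_smooth phi cy).
 exact: openI oW (open_regular).
by move=> p [Wp nZp]; rewrite (laplaceE phi cy Wp nZp).
Qed.

Lemma laplace_off K phi q : closed K -> (off K phi) -> ~ K q -> ~ Z q ->
 lap phi q = 0.
Proof.
move=> clK f0 nK nZ; have [Ac cq] := atlas_chart_at q.
have [y [W [cy Wq]]] := coordinates_at Ac cq; rewrite (laplaceE phi cy Wq nZ) /lap_coords.
rewrite (Gam_off _ clK f0 nK) mulr0 mul0r subr0 big1// => i _.
have t := coord_vec_tangent i Ac cq.
rewrite (tangent_local (g := 0) t (closed_openC clK) nK); first exact: tangent0 t.
by move=> p nKp; rewrite (Gam_off _ clK f0 nKp).
Qed.

Definition test_pair K phi g := [/\ compact K, K `<=` ~` Z, off K phi,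
 forall q, ~ Z q -> g q = lap phi q & off K g].

(** The Laplacian vanishes off K, so it extends by zero across the singular set, where the values of
    [laplace_beltrami] itself mean nothing. *)
Lemma test_laplace K phi : compact K -> K `<=` ~` Z -> (off K phi) ->
 exists g : Cinf S, (forall q, ~ Z q -> g q = lap phi q) /\ (off K g).
Proof.
move=> cK KZ f0; have clK := compact_closedM cK.
pose G q := if pselect (Z q) then 0 else lap phi q.
have G0 q : ~ K q -> G q = 0 by rewrite /G; case: pselect => //= nZ nK; exact: laplace_off clK f0 nK nZ.
have sG : smooth (~` Z) G.
 apply: smooth_fun_eq (laplace_smooth phi); first exact: open_regular.
 by move=> q nZ; rewrite /G; case: pselect.
exists (mkCinf (smooth_fun_ext open_regular clK KZ sG G0)); split=> [q nZ|p nK]; last exact: G0.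
by change (G q = lap phi q); rewrite /G; case: pselect.
Qed.

(** * Green's formula on the compact surface *)

Hypothesis cM : compact [set: M].

Lemma closed_compactM K : closed K -> compact K.
Proof. by move=> cK; apply: subclosed_compact cK cM _. Qed.

Lemma test_integ K f : compact K -> K `<=` ~` Z -> off K f -> integ omega (f : bM -> R).
Proof.
move=> cK KZ f0.
have [N [cc [yy [OO [KK [eta [cyy hK e0 e1]]]]]]] := partition_unity cM.
apply: (@integ_eq _ _ _ _ (fun q : bM => \sum_k (eta k * eta k * f) q)).
 move=> q; under eq_bigr => k _ do rewrite !CinfM_E -expr2.
 by rewrite -mulr_suml (e1 q) mul1r.
apply: integ_sum => k; have [Ac oO Oc _] := cyy k.
have [cKk KO] := hK k; have cI : compact (KK k `&` K).
 by apply: closed_compactM; apply: closedI; exact: compact_closedM.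
have sI : KK k `&` K `<=` cdom (cc k) `\` Z by move=> p [/KO/Oc ? /KZ].
have z p : ~ (KK k `&` K) p -> (eta k * eta k * f) p = 0.
 move=> nI; rewrite !CinfM_E; have [Kp|nK] := pselect (KK k p); last by rewrite e0// !mul0r.
 by rewrite f0 ?mulr0// => Kp'; apply: nI.
by have [_ _ [_ _ h _]] := chart_pull Ac cI sI z.
Qed.

(** The support conditions are put on products, so that either phi or psi may be the function
    supported in K. Localisation replaces psi by eta_k^2 psi, which sum to psi. *)
Lemma green K phi psi g : compact K -> K `<=` ~` Z ->
 (forall p f, ~ K p -> psi p * Gam phi f p = 0) -> (forall p, ~ K p -> Gam phi psi p = 0) ->
 (forall q, ~ Z q -> g q = psi q * lap phi q) -> off K g ->
 (\int[omega]_q g q = - \int[omega]_q Gam psi phi q).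
Proof.
move=> cK KZ f0 f1 gE g0; have clK := compact_closedM cK.
have [N [cc [yy [OO [KK [eta [cyy hK e0 e1]]]]]]] := partition_unity cM.
have e1' : \sum_k eta k * eta k = 1.
 by apply: Cinf_eq => q; rewrite Cinf_sum_E -[RHS](e1 q); apply: eq_bigr => k _; rewrite CinfM_E expr2.
pose G k := eta k * eta k * g + Gam phi (eta k * eta k * psi).
have G0 p k : ~ K p -> G k p = 0.
 by move=> nK; rewrite CinfD_E CinfM_E g0// mulr0 add0r GamMr CinfD_E CinfM_E (f1 p nK) mulr0 add0r CinfM_E f0.
have h k : (\int[omega]_q G k q = 0).
 have [Ac oO Oc _] := cyy k; have [cKk KO] := hK k; have clKk := compact_closedM cKk.
 have cI : compact (KK k `&` K) by apply: closed_compactM; apply: closedI.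
 have sI : KK k `&` K `<=` OO k `\` Z by move=> p [/KO ? /KZ].
 have z p : ~ KK k p -> (eta k * eta k * psi) p = 0 by move=> nK; rewrite !CinfM_E e0// !mul0r.
 have z' p : ~ KK k p -> (eta k * eta k * g) p = 0 by move=> nK; rewrite !CinfM_E e0// !mul0r.
 apply: (green_chart (cyy k) cI sI (phi := phi) (psi := eta k * eta k * psi)) => [i p nI|p nI|q Oq nZ].
 - have [Kp|nK] := pselect (KK k p); last by rewrite z// mul0r.
  by rewrite CinfM_E -mulrA f0 ?mulr0// => Kp'; apply: nI.
 - have [Kp|nK] := pselect (KK k p); first by apply: G0 => Kp'; apply: nI.
  by rewrite CinfD_E z'// add0r GamC (Gam_off _ clKk z nK).
 - by rewrite CinfD_E [X in X + _]CinfM_E gE// (laplaceE phi (cyy k) Oq nZ) [in RHS]CinfM_E mulrA.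
have I1 : integ omega (g : bM -> R) by exact: (@test_integ K g).
have I2 : integ omega (fun q : bM => Gam psi phi q).
 by apply: (@test_integ K (Gam psi phi)) => // p nK; rewrite GamC f1.
apply/eqP; rewrite -addr_eq0 -intD//; apply/eqP.
transitivity (\int[omega]_q (\sum_k G k q)).
 apply: eq_int => q; rewrite -Cinf_sum_E big_split /=.
 have -> : \sum_k Gam phi (eta k * eta k * psi) = Gam phi psi.
  rewrite -[in RHS](mul1r psi) -e1' mulr_suml; apply: Cinf_eq => p.
  by rewrite (tangent_sum _ _ (Gam_tangent A phi p)) Cinf_sum_E.
 rewrite -mulr_suml e1' mul1r (GamC A phi).
 by change (g q + Gam psi phi q = g q + Gam psi phi q).
rewrite int_sum => [|k]; first by rewrite big1.
by apply: (@test_integ K) => // p; exact: G0.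
Qed.

(** * The function T vanishing on the singular set *)

Section SingularFunction.
Hypothesis HB : forall q : M,
  HBat q.

Lemma Gam_sq_weight (G d f : Cinf S) : Gam (G * (d * d)) f = d * (d * Gam G f + 2 *: (G * Gam d f)).
Proof.
rewrite GamMl GamMl; apply: Cinf_eq => q; rewrite !CinfE; ring.
Qed.

Lemma coord_vecM c y O f g q i : coords c y O -> O q ->
 cvec c i q (f * g) = f q * cvec c i q g + g q * cvec c i q f.
Proof.
by move=> [Ac _ Oc _] Oq; exact: tangentM _ _ (coord_vec_tangent i Ac (Oc q Oq)).
Qed.

Lemma coord_vec_local c y O V f g q i : coords c y O -> O q -> open V -> V q ->
 (forall p, V p -> f p = g p) -> cvec c i q f = cvec c i q g.
Proof.
by move=> [Ac _ Oc _] Oq; exact: tangent_local (coord_vec_tangent i Ac (Oc q Oq)).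
Qed.

(* where T = G d^2 and det g^ij = h d^2, the singular terms of order 0 in d cancel in Delta T *)
Lemma laplace_sq_weight c y W V (T G h d : Cinf S) p : coords c y W -> open V -> V `<=` W ->
 (forall p, V p -> T p = (G * (d * d)) p) ->
 (forall p, V p -> Wron (y o0) (y o1) p = (h * (d * d)) p) -> (forall p, V p -> 0 < h p) ->
 V p -> ~ Z p -> lap T p =
  d p * (\sum_i cvec c i p (d * Gam G (y i) + 2 *: (G * Gam d (y i))) -
   (d p * Gam G h p + 2 * (G p * Gam d h p)) * (2 * h p)^-1).
Proof.
move=> cy oV VW TE wE h0 Vp nZ; have Wp := VW p Vp.
pose b f := d * Gam G f + 2 *: (G * Gam d f).
have -> : d p * Gam G h p + 2 * (G p * Gam d h p) = b h p by [].
have GT f p' : V p' -> Gam T f p' = (d * b f) p'.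
 by move=> Vp'; rewrite GamC (Gam_local A f oV Vp' TE) GamC Gam_sq_weight.
rewrite (laplaceE T cy Wp nZ) /lap_coords.
rewrite (eq_bigr (fun i => d p * cvec c i p (b (y i)) + b (y i) p * cvec c i p d)); last first.
 move=> i; rewrite (coord_vec_local i cy Wp oV Vp (GT _)) (coord_vecM _ _ i cy Wp) //.
have s1 : \sum_i b (y i) p * cvec c i p d = b d p.
 rewrite [RHS]CinfD_E CinfM_E CinfZ_E CinfM_E (Gam_coords A G d cy Wp) (Gam_coords A d d cy Wp).
 rewrite !mulr_sumr -big_split; apply: eq_bigr => i _.
 by rewrite CinfD_E CinfM_E CinfZ_E CinfM_E /=; ring.
rewrite [X in X - _](_ : _ = d p * \sum_i cvec c i p (b (y i)) + b d p); last first.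
 by rewrite -s1 mulr_sumr -big_split.
have s2 : Gam T (Wron (y o0) (y o1)) p = d p * (d p * (d p * b h p) + 2 * (h p * (d p * b d p))).
 rewrite (Gam_local A T oV Vp wE) GamC Gam_sq_weight CinfM_E CinfD_E CinfM_E CinfZ_E CinfM_E.
 rewrite (GamC A h) (GamC A d) !GT// ![(d * _) p]CinfM_E; ring.
rewrite s2 wE// !CinfM_E.
have dn : d p != 0.
 apply/eqP => d0; apply: nZ; apply/(singular_Wron cy Wp).
 by rewrite [LHS]wE// !CinfM_E d0 !mulr0.
have := h0 p Vp.
move: (h p) (d p) dn (b h p) (b d p) (\sum_i _) => hp dp dn bh bd s hp0.
by field; rewrite gt_eqF.
Qed.

(** With k and s smooth, [Gam T T] is d^2 k and Delta T is d s, which gives the upper bounds. At a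
    singular point k(q) = 4 G^2 [Gam d d] > 0, whence the lower bound on [Gam T T]; near a regular
    point 1/C - C T is nonpositive for large C and that bound is trivial. *)
Lemma singular_function_local (T : Cinf S) q c y W V (G h d : Cinf S) :
 coords c y W -> open V -> V q -> V `<=` W ->
 (forall p, V p -> T p = (G * (d * d)) p) ->
 (forall p, V p -> Wron (y o0) (y o1) p = (h * (d * d)) p) ->
 (forall p, V p -> 0 < G p) -> (forall p, V p -> 0 < h p) -> (Z q -> 0 < Gam d d q) ->
 exists C V', [/\ open V', V' q & forall p, V' p -> 0 < C /\ (Gam T T p <= C * T p /\
  (T p * (C^-1 - C * T p) <= Gam T T p / 4 /\ (~ Z p -> lap T p ^+ 2 <= C * T p)))].
Proof.
move=> cy oV Vq VW TE wE G0 h0 dZ; have [Ac oW Wc _] := cy.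
(* [Gam T f] is d times [b f] near q, by [Gam_sq_weight]. *)
pose b f := d * Gam G f + 2 *: (G * Gam d f).
pose k := d * b G + 2 *: (G * b d).
have GTT p : V p -> Gam T T p = d p * d p * k p.
 move=> Vp; rewrite (Gam_local2 A oV Vp TE) Gam_sq_weight -/(b _).
 have bE f : b (G * (d * d)) = d * (d * b G + 2 *: (G * b d)).
  rewrite /b !(GamC A _ (G * _)) !Gam_sq_weight; apply: Cinf_eq => z; rewrite !CinfE; ring.
 by rewrite CinfM_E (bE G) [X in _ * X]CinfM_E -/k mulrA.
have ss : smooth V (fun p => \sum_i cvec c i p (b (y i)) - b h p * (2 * h p)^-1).
 have s1 i := smooth_fun_sub VW (smooth_coord_vec i (b (y i)) cy).
 have n0 p : V p -> 2 * h p != 0 by move=> Vp; rewrite mulf_neq0 ?pnatr_eq0// gt_eqF// h0.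
 have s2 := smooth_funM oV (Cinf_smoothW (b h)) (smooth_funV oV n0 (Cinf_smoothW (2 *: h))).
 exact: (smooth_funB oV (@smooth_fun_sum _ _ _ _ _ (index_enum _) (fun i p => cvec c i p (b (y i))) oV s1) s2).
have [s [V1 [oV1 V1q V1V sE]]] := globalize oV Vq ss.
have lapT p : V1 p -> ~ Z p -> lap T p = d p * s p.
 by move=> V1p nZ; rewrite sE//; exact: laplace_sq_weight cy oV VW TE wE h0 (V1V p V1p) nZ.
have T0 p : V p -> 0 <= T p.
 by move=> Vp; rewrite TE// !CinfM_E mulr_ge0 ?(ltW (G0 p Vp))// -expr2 sqr_ge0.
have [X [U [X0 oU Uq hU]]] : exists X U, [/\ 0 <= X, open U, U q & forall p (C : R), (V `&` U) p -> 1 <= C -> X <= C ->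
  T p * (C^-1 - C * T p) <= Gam T T p / 4].
 have g0 := G0 q Vq.
 have [Zq|nZq] := pselect (Z q).
  have dq : d q = 0.
   have /(singular_Wron cy (VW q Vq)) := Zq; rewrite wE// !CinfM_E => /eqP.
   by rewrite !mulf_eq0 (gt_eqF (h0 q Vq)) orbb => /eqP.
  have kq : 0 < k q.
   rewrite !CinfE dq !mul0r !add0r !mulr_gt0 ?dZ//.
  (* Near q, G < 2 G(q) and k > k(q) / 2, so the required G <= C k / 4 follows from C >= 16 G(q) /
     k(q). *)
  exists (8 * (2 * G q) / k q), ([set p | k q / 2 < k p] `&` [set p | G p < 2 * G q]); split.
  - by rewrite divr_ge0// ?(ltW kq)// !mulr_ge0// ltW.
  - by apply: openI; [exact: open_Cinf_gt|exact: open_Cinf_lt].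
  - by split; rewrite /mkset; lra.
  move=> p C [Vp [kp0 Gp0]] C1 XC; have kp : k q / 2 < k p := kp0; have Gp : G p < 2 * G q := Gp0; have C0 : 0 < C by lra.
  apply: (@le_trans _ _ (T p * C^-1)).
   by rewrite ler_wpM2l ?T0// lerBlDr lerDl mulr_ge0 ?T0// ltW.
  rewrite GTT// TE// !CinfM_E ler_pdivrMr// [leLHS]mulrC [leRHS](_ : _ = d p * d p * (k p / 4 * C)); last by field.
  rewrite ler_wpM2l ?sqr_ge0//.
  apply: le_trans (ltW Gp) _; apply: (@le_trans _ _ (k q / 8 * C)); last by rewrite ler_wpM2r; lra.
  by move: XC; rewrite ler_pdivrMr//; lra.
 have Tq : 0 < T q.
  rewrite lt0r T0// andbT; apply/eqP => T0q; apply: nZq; apply/(singular_Wron cy (VW q Vq)).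
  move: T0q; rewrite TE// wE// !CinfM_E => /eqP; rewrite !mulf_eq0 (gt_eqF g0) orbb => /eqP ->.
  by rewrite !mulr0.
 exists (2 / T q), [set p | T q / 2 < T p]; split.
 - by rewrite divr_ge0// ltW.
 - exact: open_Cinf_gt.
 - by rewrite /mkset; lra.
 move=> p C [Vp Tp0] C1 XC; have C0 : 0 < C by lra.
 apply: (@le_trans _ _ 0); last by rewrite divr_ge0// Gam_ge0.
 rewrite mulr_ge0_le0 ?T0// subr_le0.
 have h1 : C^-1 <= 1 by rewrite invf_le1.
 apply: le_trans h1 _; have : 1 <= C * (T q / 2).
  by move: XC; rewrite ler_pdivrMr// => XC; rewrite mulrA ler_pdivlMr// mul1r.
 by move=> h2; apply: le_trans h2 _; rewrite ler_wpM2l ?(ltW C0)//; exact: (ltW Tp0).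
pose C := 1 + 2 * (`|k q| + 1) / G q + 2 * (s q * s q + 1) / G q + X.
exists C, ((V1 `&` U) `&` ([set p | G q / 2 < G p] `&` ([set p | k p < `|k q| + 1] `&` [set p | (s * s) p < s q * s q + 1]))).
have g0 := G0 q Vq; split.
- apply: openI; first exact: openI.
 apply: openI; first exact: open_Cinf_gt.
 by apply: openI; exact: open_Cinf_lt.
- by split => //; split; last split; rewrite /mkset ?CinfM_E ?ltrDl//; [lra|rewrite ltr_pwDr// ler_norm].
move=> p [[V1p Up] [Gp [kp sp]]]; have Vp := V1V p V1p.
have ar l := @singular_bounds_arith R _ (k p) (s p) (d p) (T p) _ l (G q) `|k q| _ X C
 g0 Gp kp sp (normr_ge0 _) ltac:(by rewrite sqr_ge0) X0 (TE p Vp) (GTT p Vp).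
have [C0 [b1 _]] := ar _ erefl erefl.
have q1 : 0 <= 2 * (`|k q| + 1) / G q by rewrite divr_ge0 ?(ltW g0)// mulr_ge0// addr_ge0.
have q2 : 0 <= 2 * (s q * s q + 1) / G q by rewrite divr_ge0 ?(ltW g0)// mulr_ge0// addr_ge0// -expr2 sqr_ge0.
split => //; split => //; split.
 by apply: hU => //; rewrite /C; lra.
by move=> nZ; have [_ [_ b2]] := ar _ (lapT p V1p nZ) erefl.
Qed.

(** T sums det g^ij over all coordinate systems of the partition. These coordinates are global
    functions, so each summand is smooth and nonnegative on M, and at each point a summand whose
    coordinates are valid there vanishes only on the singular set. *)
Lemma singular_function : exists (T : Cinf S) (C : R), [/\ 0 < C, forall q, 0 <= T q,
 forall q, T q = 0 <-> Z q &
 [/\ forall q, Gam T T q <= C * T q, forall q, T q * (C^-1 - C * T q) <= Gam T T q / 4 &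
   forall q, ~ Z q -> lap T q ^+ 2 <= C * T q]].
Proof.
have [N [cc [yy [OO [KK [eta [cyy hK e0 e1]]]]]]] := partition_unity cM.
have cov p : exists k, OO k p.
 apply: contrapT => nc; have := e1 p; rewrite big1 => [/esym/eqP|k _]; first by rewrite oner_eq0.
 by rewrite e0 ?expr0n// => /(hK k).2 Op; apply: nc; exists k.
pose T := \sum_k Wron (yy k o0) (yy k o1).
have T0 q : 0 <= T q by rewrite Cinf_sum_E sumr_ge0// => k _; exact: Wron_ge0.
have TZ q : T q = 0 <-> Z q.
 have [k Ok] := cov q; split=> [/eqP|Zq].
  rewrite Cinf_sum_E psumr_eq0 => [/allP/(_ k)|i _]; last exact: Wron_ge0.
  by rewrite mem_index_enum => /(_ isT)/eqP/(singular_Wron (cyy k) Ok).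
 have [c [y [W [cy Wq]]]] := coordinates_cover S q.
 have [G [h [d [V [oV Vq VW [TE wE G0 h0 _]]]]]] := local_structure cyy cov cy Wq HB.
 have /(singular_Wron cy Wq) := Zq; rewrite wE// TE// !CinfM_E => /eqP.
 by rewrite !mulf_eq0 (gt_eqF (h0 q Vq)) orbb => /eqP ->; rewrite !mulr0.
pose P (C : R) p := 0 < C /\ (Gam T T p <= C * T p /\
  (T p * (C^-1 - C * T p) <= Gam T T p / 4 /\ (~ Z p -> lap T p ^+ 2 <= C * T p))).
have [C hC] : exists C, forall p, P C p.
 apply: (compact_local_bound cM).
  move=> q; have [c [y [W [cy Wq]]]] := coordinates_cover S q.
  have [G [h [d [V [oV Vq VW [TE wE G0 h0 dZ]]]]]] := local_structure cyy cov cy Wq HB.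
  exact: singular_function_local cy oV Vq VW TE wE G0 h0 dZ.
 move=> C C' p CC' [C0 [a1 [a2 a3]]]; have C'0 : 0 < C' := lt_le_trans C0 CC'.
 have CT : C * T p <= C' * T p by rewrite ler_wpM2r.
 split => //; split; first exact: le_trans a1 CT.
 split; last by move=> nZ; apply: le_trans CT; exact: a3.
 apply: le_trans a2; apply: ler_wpM2l => //; apply: lerB => //.
 by rewrite lef_pV2.
exists T, C; split => //; first by have [] := hC point.
by split=> q; have [_ [? [? ?]]] := hC q.
Qed.

End SingularFunction.

(** * Cutoffs and Rellich's theorem in a chart of the surface *)

Lemma smooth_cutoff K W : compact K -> open W -> K `<=` W ->
 exists (chi : Cinf S) K' N, [/\ compact K' /\ K' `<=` W, open N, K `<=` N,
  forall p, N p -> chi p = 1 & off K' chi].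
Proof.
move=> cK oW KW; have clK := compact_closedM cK.
pose P q (b : Cinf S) (Kq V : set M) := [/\ compact Kq /\ Kq `<=` W, open V /\ V q,
 forall p, 0 <= b p, off Kq b & forall p, K p -> V p -> b p = 1].
have h q : exists b Kq V, P q b Kq V.
 have [Kq|nK] := pselect (K q).
  have [b [Kb [V [cKb KbW oV Vq [VK b01 b0 b1]]]]] := bump_at S oW (KW q Kq).
  by exists b, Kb, V; split => // [p|p _]; [have /andP[] := b01 p|exact: b1].
 exists 0, set0, (~` K); split => //; first by split => //; exact: compact0.
 by split => //; exact: closed_openC.
have [b hb] := choice h; have [Kq {}hb] := choice hb; have [V {}hb] := choice hb.
have oV q : open (V q) /\ V q q by have [_ [? ?]] := hb q.
have [N [a ha]] := compact_finite cM oV.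
pose B := \sum_k b (a k).
have b0 k p : 0 <= b (a k) p by have [_ _ h0 _ _] := hb (a k); exact: h0.
(* The sum B is at least 1 on K, hence above 1/2 near K, where the step of 2 B equals 1. *)
have sB := smooth_fun_step openT (Cinf_smooth (2 *: B)).
exists (mkCinf sB), (\bigcup_(k in [set: 'I_N]) Kq (a k)), [set p | 2^-1 < B p]; split.
- split; last by move=> p [k _]; have [[_ h0] _ _ _ _] := hb (a k); exact: h0.
 apply: closed_compactM; apply: closed_bigcup => [|k _]; first exact: finite_finset.
 by have [[cKk _] _ _ _ _] := hb (a k); exact: (compact_closedM).
- exact: open_Cinf_gt.
- move=> p Kp; have [k Vk] := ha p; have [_ _ _ _ b1] := hb (a k).
 rewrite /mkset Cinf_sum_E (bigD1 k)//= b1//.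
 have : 0 <= \sum_(i < N | i != k) b (a i) p by rewrite sumr_ge0.
 lra.
- move=> p /= Bp; change (smooth_step (2 * B p) = 1).
 by apply: smooth_step_eq1; lra.
- move=> p nK; change (smooth_step (2 * B p) = 0); apply: smooth_step_eq0.
 rewrite Cinf_sum_E big1// => k _.
 by have [_ _ _ h0 _] := hb (a k); apply: h0 => Kp; apply: nK; exists k.
Qed.

Lemma ext_mul K (P : M -> R) psi : compact K -> K `<=` ~` Z -> smooth (~` Z) P ->
 (off K psi) -> exists g : Cinf S, forall p, g p = P p * psi p.
Proof.
move=> cK KZ sP f0; have oZ := open_regular.
have s1 := smooth_funM oZ sP (Cinf_smoothW psi).
have z q : ~ K q -> P q * psi q = 0 by move=> /f0 ->; rewrite mulr0.
by exists (mkCinf (smooth_fun_ext oZ (compact_closedM cK) KZ s1 z)).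
Qed.

Lemma weight_laplace c y O phi q : coords c y O -> O q -> ~ Z q ->
 weight c (cmap c q) * lap phi q =
 \sum_i partial i (fun x => weight c x * (Gam phi (y i) \o cinv c) x) (cmap c q).
Proof.
move=> cy Oq nZ; have [Ac oO Oc _] := cy; have cq := Oc q Oq.
rewrite (laplaceE phi cy Oq nZ) /lap_coords (Gam_coords A phi (Wron _ _) cy Oq).
rewrite mulrBr mulr_sumr mulr_sumr mulr_suml mulr_sumr -sumrB; apply: eq_bigr => i _.
have [dw ew] := weight_partial i cy Oq nZ.
rewrite (partialM dw (@chart_partials _ _ _ c _ q i Ac cq)) ew.
rewrite -[partial i _ _]/(cvec c i q _).
rewrite -[(Gam phi _ \o cinv c) _]/(Gam phi _ _) chart_mapK//.
ring.
Qed.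

Lemma lift_ex c K (xi : pt -> R) : atlas S c -> compact K -> K `<=` cdom c -> smooth_on setT xi ->
 (forall p, cdom c p -> ~ K p -> xi (cmap c p) = 0) ->
 exists phi : Cinf S, (forall p, cdom c p -> phi p = xi (cmap c p)) /\ (off K phi).
Proof.
move=> Ac cK Kc sxi x0; have oc := @chart_dom_open _ _ c.
pose f p := if pselect (cdom c p) then xi (cmap c p) else 0.
have f0 p : ~ K p -> f p = 0 by rewrite /f; case: pselect => //= cp nK; exact: x0.
have sf : smooth (cdom c) f.
 have s1 : smooth (cdom c) (fun q => xi (cmap c q)).
  by apply: (smooth_fun_chart (c := c) Ac oc) => //; exact: smooth_on_sub sxi.
 by apply: smooth_fun_eq s1 => // p cp; rewrite /f; case: pselect.
exists (mkCinf (smooth_fun_ext oc (compact_closedM cK) Kc sf f0)); split=> p h; last exact: f0.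
by change (f p = xi (cmap c p)); rewrite /f; case: pselect.
Qed.

Lemma coord_vec_lift c V phi (xi : pt -> R) q i : atlas S c -> open V -> V `<=` cdom c ->
 (forall p, V p -> phi p = xi (cmap c p)) -> V q ->
 cvec c i q phi = partial i xi (cmap c q).
Proof.
move=> Ac oV Vc h Vq; have oP := open_pre c oV.
have Pq : chart_pre c V (cmap c q) by apply: chart_preP => //; exact: Vc.
apply: (@partial_eq R _ _ xi i oP _ _ (mem_set Pq)) => z /set_mem[cz Vz].
by rewrite /= h// chart_invK.
Qed.

Lemma Gam_coords2 c y O phi psi q : coords c y O -> O q ->
 Gam phi psi q = \sum_i \sum_j Gam (y i) (y j) q * cvec c i q phi * cvec c j q psi.
Proof.
move=> cy Oq; rewrite (Gam_coords A phi psi cy Oq) exchange_big /=; apply: eq_bigr => j _.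
rewrite GamC (Gam_coords A _ phi cy Oq) mulr_suml; apply: eq_bigr => i _.
by rewrite GamC.
Qed.

(** Counterpart of [chart_pull] for functions that are merely measurable; H has to be matched on the
    image of K and to vanish elsewhere. *)
Lemma pull_int c K (f : M -> R) (H : pt -> R) : atlas S c -> K `<=` cdom c `\` Z ->
 mfM (f : bM -> R) -> off K f ->
 (forall q, K q -> H (cmap c q) = f q * weight c (cmap c q)) ->
 (forall x, ~ (cmap c @` K) x -> H x = 0) ->
 (integ omega (f : bM -> R) <-> integ Leb (H : mpt -> R)) /\
 (\int[omega]_q f q = \int[Leb]_x H x).
Proof.
move=> Ac Kc mf f0 h1 h2.
have e x : H x = f (chart_point c x) * weight c x.
 have [[q Kq <-]|nK] := pselect ((cmap c @` K) x).
  have [cq _] := Kc q Kq.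
  by rewrite h1// chart_pointE ?chart_mapK//; exact: chart_imgP.
 rewrite h2//; have [cx|ncx] := pselect (chart_img c x); last by rewrite weight_eq0 ?mulr0// => -[].
 rewrite chart_pointE// f0 ?mul0r// => Kx; apply: nK; exists (cinv c x) => //; exact: chart_invK.
have fD q : ~ (cdom c `\` Z) q -> f q = 0 by move=> nD; apply: f0 => /Kc.
rewrite (_ : H = fun x => f (chart_point c x) * weight c x); last exact/funext.
split; first exact: (chart_integ Ac mf fD).
exact: chart_int.
Qed.

Lemma Cinf_bounded f : exists2 B : R, 0 < B & forall q, `|f q| <= B.
Proof.
have [B B0 hB] := compact_bound cM (fun q _ => @Cinf_continuous _ _ _ f q).
by exists B => // q; exact: hB.
Qed.

Lemma Gam_comp (h : R -> R) f (G : Cinf S) phi q : smooth_on setT (fun x : pt => h x.1) -> (forall p, G p = h (f p)) ->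
 Gam phi G q = partial o0 (fun x : pt => h x.1) (f q, 0) * Gam phi f q.
Proof.
move=> sh GE; have [c Ac cq] := atlas_cover S q; have [y [W [cy Wq]]] := coordinates_at Ac cq.
rewrite (Gam_coords A phi G cy Wq) (Gam_coords A phi f cy Wq) mulr_sumr; apply: eq_bigr => i _.
rewrite mulrCA; congr (_ * _).
have dh : is_derive (f q) 1 h (partial o0 (fun x : pt => h x.1) (f q, 0)).
 exact: (@is_derive_slice1 R (fun x => h x.1) 0 (f q) ((smooth_partials sh (x := _) I).2 o0)).
have df := @chart_partials _ _ _ c f q i Ac cq.
rewrite -{1}(chart_mapK cq) in dh.
have := is_derive_comp1 dh df => -[_ e].
rewrite -[RHS]e; congr partial; apply/funext => x; exact: GE.
Qed.

(** The difference of the two sides is the squared norm of g df - f dg at q. *)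
Lemma Gam_mul_le f g q : Gam (f * g) (f * g) q <= 2 * (g q ^+ 2 * Gam f f q) + 2 * (f q ^+ 2 * Gam g g q).
Proof.
have h := Gam_ge0 A (g q *: f - f q *: g) q.
have e1 : Gam (g q *: f - f q *: g) (g q *: f - f q *: g) q =
  g q ^+ 2 * Gam f f q - 2 * (f q * g q * Gam f g q) + f q ^+ 2 * Gam g g q.
 by rewrite GamBl !GamBr !GamZl !GamZr (GamC A g f) !CinfE; ring.
have e2 : Gam (f * g) (f * g) q = g q ^+ 2 * Gam f f q + 2 * (f q * g q * Gam f g q) + f q ^+ 2 * Gam g g q.
 by rewrite GamMl !GamMr (GamC A g f) !CinfE; ring.
by move: h; lra.
Qed.

Lemma chart_bounds c y O K : coords c y O -> compact K -> K `<=` O `\` Z ->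
 exists B W L : R, [/\ 0 < B, 0 < W, 0 < L & forall p, K p ->
  [/\ `|cmap c p| < B, weight c (cmap c p) <= W, 1 <= W * weight c (cmap c p) &
   forall f, \sum_i cvec c i p f ^+ 2 <= L * Gam f f p]].
Proof.
move=> cy cK KOZ; have [Ac oO Oc yE] := cy.
pose tr := Gam (y o0) (y o0) + Gam (y o1) (y o1).
pose tau := Wron (y o0) (y o1).
have tau0 p : K p -> 0 < tau p by move=> Kp; have [Op nZ] := KOZ p Kp; exact: (Wron_gt0 cy Op nZ).
have ct : continuous (fun p => sqrt (tau p)).
 by move=> p; apply: continuous_comp; [exact: Cinf_continuous|exact: sqrt_continuous].
have civ p : K p -> {for p, continuous (fun p => (sqrt (tau p))^-1)}.
 by move=> Kp; apply: cvgV; [rewrite gt_eqF// sqrtr_gt0; exact: tau0|exact: ct].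
have [B B0 hB] := @compact_bound R _ _ (fun p => `|cmap c p|) cK (fun p Kp =>
 continuous_comp (chart_map_continuous (Oc _ (KOZ p Kp).1)) (@norm_continuous _ _ _)).
have [W1 W10 hW1] := compact_bound cK civ.
have [W2 W20 hW2] := compact_bound cK (fun p _ => ct p).
have [L L0 hL] := compact_bound cK (fun p _ => @Cinf_continuous _ _ _ tr p).
exists (B + 1), (W1 + W2), (L * W1 ^+ 2); split; rewrite ?addr_gt0 ?mulr_gt0// => p Kp.
have [Op nZ] := KOZ p Kp; have t0 := tau0 p Kp; have s0 : 0 < sqrt (tau p) by rewrite sqrtr_gt0.
have h1 : (sqrt (tau p))^-1 <= W1 by apply: le_trans (ler_norm _) (hW1 p Kp).
have h2 : sqrt (tau p) <= W2 by apply: le_trans (ler_norm _) (hW2 p Kp).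
have i0 : 0 < (sqrt (tau p))^-1 by rewrite invr_gt0.
rewrite (weight_coords cy Op nZ) -/tau; split.
- by apply: (@le_lt_trans _ _ B); [have := hB p Kp; rewrite normr_id|rewrite ltrDl].
- by apply: le_trans h1 _; rewrite lerDl ltW.
- rewrite -(@mulfV _ (sqrt (tau p))) ?gt_eqF//; apply: ler_wpM2r; first exact: ltW.
 by apply: le_trans h2 _; rewrite lerDr ltW.
move=> f; have G0 := Gam_ge0 A f p.
have hg := @gram_elliptic R (fun i j => Gam (y i) (y j) p) (fun i => cvec c i p f) (congr1 (fun h : Cinf S => h p) (GamC A _ _)).
have e : \sum_i \sum_j Gam (y i) (y j) p * cvec c i p f * cvec c j p f = Gam f f p.
 by rewrite (Gam_coords2 f f cy Op).
have {}hg : tau p * (\sum_i cvec c i p f ^+ 2) <= tr p * Gam f f p by move: hg; rewrite e.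
have hl : tr p <= L by apply: le_trans (ler_norm _) (hL p Kp).
have {}hg : tau p * (\sum_i cvec c i p f ^+ 2) <= L * Gam f f p.
 by apply: le_trans hg _; exact: ler_wpM2r.
have iv : (tau p)^-1 <= W1 ^+ 2.
 by rewrite -{1}(sqr_sqrtr (ltW t0)) -exprVn; apply: sqr_mono => //; exact: ltW.
apply: (@le_trans _ _ ((tau p)^-1 * (L * Gam f f p))); first by rewrite mulrC ler_pdivlMr// mulrC.
by rewrite mulrAC [leRHS]mulrC; apply: ler_wpM2r => //; rewrite mulr_ge0// ltW.
Qed.

Definition chart_lift c f : pt -> R := fun x => if pselect (chart_img c x) then f (cinv c x) else 0.

Lemma chart_lift_Cc c K f : atlas S c -> compact K -> K `<=` cdom c -> off K f ->
 [/\ Cc (chart_lift c f), forall p, cdom c p -> chart_lift c f (cmap c p) = f p &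
  forall x, ~ (cmap c @` K) x -> chart_lift c f x = 0].
Proof.
move=> Ac cK Kc f0; have [F cF [FE F0]] := chart_ext Ac cK Kc (Cinf_smoothW f) f0.
have -> : chart_lift c f = F.
 apply/funext => x; rewrite /chart_lift; case: pselect => [ix|nx].
  by rewrite -FE ?chart_invK//; exact: chart_inv_dom.
 apply/esym/eqP/negP => /negP/F0[p Kp e]; apply: nx; exists p => //; exact: Kc.
split => // x nx; apply/eqP/negP => /negP; exact: contra_not (F0 x) nx.
Qed.

(** [plane_rellich] read in a chart; W and L compare areas and energies with the Euclidean ones.
    Additivity on differences is what lets the functionals separate two elements of a ball. *)
Lemma chart_rellich c y O K (e : R) : coords c y O -> compact K -> K `<=` O `\` Z -> 0 < e ->
 exists N (l : 'I_N -> Cinf S -> R) (D : R), [/\ 0 <= D,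
  forall j f g, off K f -> off K g -> l j (f - g) = l j f - l j g,
  forall j f, off K f -> (\int[omega]_q (f q ^+ 2) <= 1) -> `|l j f| <= D &
  forall f, off K f -> (forall j, `|l j f| <= 1) ->
   (\int[omega]_q (f q ^+ 2) <= e * (1 + \int[omega]_q Gam f f q))].
Proof.
move=> cy cK KOZ e0; have [Ac oO Oc yE] := cy.
have KcZ : K `<=` cdom c `\` Z by move=> p /KOZ[/Oc].
have Kc : K `<=` cdom c by move=> p /KcZ[].
have [B [W [L [B0 W0 L0 hK]]]] := chart_bounds cy cK KOZ.
have e2 : 0 < e / (W * (L * W)) by rewrite divr_gt0// !mulr_gt0.
have [N [g [C [C0 mg g1 hr]]]] := plane_rellich B0 e2.
(* Scaling the cell integrals by s turns a bound 1 into 1 / s, so that C times the sum of N squares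
   is at most e / W. *)
pose s := 1 + C * N%:R * W / e.
have s1 : 1 <= s by rewrite lerDl divr_ge0// ?(ltW e0)// !mulr_ge0 ?(ltW C0) ?(ltW W0).
have s0 : 0 < s by exact: lt_le_trans s1.
have [zeta czeta zeta1] := cutoff (ltW B0).
have lc f (f0 : off K f) := chart_lift_Cc Ac cK Kc f0.
have li f j : off K f -> integ Leb (fun x : mpt => chart_lift c f x * g j x).
 by move=> f0; have [cl _ _] := lc f f0; exact: (integM_bounded (mg j) (g1 j) (Cc_int cl)).
have lB f x : off K f -> B <= `|x| -> chart_lift c f x = 0.
 move=> f0 Bx; have [_ _] := lc f f0; apply => -[p Kp xp]; have [h _ _ _] := hK p Kp.
 by move: Bx; rewrite -xp leNgt h.
have pull0 f x : off K f -> ~ (cmap c @` K) x -> f (chart_point c x) * weight c x = 0.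
 move=> f0 nx; have [[p [cp nZ] xp]|nx'] := pselect ((cmap c @` (cdom c `&` ~` Z)) x).
  rewrite -xp chart_pointE ?chart_mapK//; last exact: chart_imgP.
  by rewrite f0 ?mul0r// => Kp; apply: nx; exists p.
 by rewrite weight_eq0 ?mulr0// -chart_preE.
have pointE p : K p -> chart_point c (cmap c p) = p.
 by move=> /Kc cp; rewrite chart_pointE ?chart_mapK//; exact: chart_imgP.
have sqs f : off K f ->
  (\int[Leb]_x (chart_lift c f x ^+ 2) <= W * \int[omega]_q (f q ^+ 2)) /\
  (\int[omega]_q (f q ^+ 2) <= W * \int[Leb]_x (chart_lift c f x ^+ 2)).
 move=> f0; have [cl lE l0] := lc f f0.
 have ff0 p : ~ K p -> (f * f) p = 0 by move=> nK; rewrite CinfM_E f0// mul0r.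
 have [F cF [FE Fs _ FI]] := chart_pull Ac cK KcZ ff0.
 have -> : (\int[omega]_q (f q ^+ 2) = \int[Leb]_x F x).
  by rewrite -FI; apply: eq_int => q; rewrite CinfM_E expr2.
 have i1 := (Cc_sq cl).2; have i2 := Cc_int cF.
 rewrite -!intZ//; split; apply: int_le => //; try exact: integZ.
  move=> x; rewrite FE; have [[p Kp <-]|nx] := pselect ((cmap c @` K) x); last first.
   by rewrite pull0// l0// expr0n mulr0.
  have [_ _ h _] := hK p Kp; rewrite lE ?pointE//; last exact: Kc.
  by rewrite CinfM_E mulrCA -expr2 -[leLHS]mulr1; apply: ler_wpM2l => //; exact: sqr_ge0.
 move=> x; rewrite FE; have [[p Kp <-]|nx] := pselect ((cmap c @` K) x); last first.
  by rewrite pull0// l0// expr0n mulr0.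
 have [_ h _ _] := hK p Kp; rewrite lE ?pointE//; last exact: Kc.
 by rewrite CinfM_E -expr2 mulrC; apply: ler_wpM2r => //; exact: sqr_ge0.
have grad f : off K f ->
  (\int[Leb]_x (partial o0 (chart_lift c f) x ^+ 2 + partial o1 (chart_lift c f) x ^+ 2) <=
  L * W * \int[omega]_q Gam f f q).
 move=> f0; have [cl lE l0] := lc f f0.
 have G0 p : ~ K p -> Gam f f p = 0 by move=> nK; exact: (Gam_off f (compact_closedM cK) f0 nK).
 have [F cF [FE Fs _ FI]] := chart_pull Ac cK KcZ G0.
 rewrite FI -intZ; last exact: Cc_int.
 apply: int_le.
 - by apply: integD; [exact: (Cc_sq (Cc_partial o0 cl)).2|exact: (Cc_sq (Cc_partial o1 cl)).2].
 - by apply: integZ; exact: Cc_int.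
 move=> x; rewrite FE; have [[p Kp <-]|nx] := pselect ((cmap c @` K) x); last first.
  have pz i : partial i (chart_lift c f) x = 0 := partial_off i cK Kc l0 nx.
  by rewrite pull0// mulr0 !pz expr0n addr0.
 have cv i := @coord_vec_lift c (cdom c) f (chart_lift c f) p i Ac (chart_dom_open c) (@subset_refl _ _) (fun q cq => esym (lE q cq)) (Kc _ Kp).
 rewrite -!cv pointE//; have [_ _ h hf] := hK p Kp.
 have := hf f; rewrite sum_ord2 => {}hf; apply: le_trans hf _.
 rewrite (_ : L * W * _ = L * Gam f f p * (W * weight c (cmap c p))); last by ring.
 rewrite -[leLHS]mulr1; apply: ler_wpM2l => //.
 by rewrite mulr_ge0// ?(ltW L0)// Gam_ge0.
pose D := s * (1 + W * (\int[Leb]_x (zeta x ^+ 2))).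
have z0 : (0 <= \int[Leb]_x (zeta x ^+ 2)) by apply: int_ge0 => x; exact: sqr_ge0.
exists N, (fun j f => s * \int[Leb]_x (chart_lift c f x * g j x)), D; split.
- by apply: mulr_ge0; [exact: ltW|rewrite addr_ge0// mulr_ge0// ltW].
- move=> j f h f0 h0; rewrite -mulrBr -intB; [|exact: li|exact: li].
 congr (_ * _); apply: eq_int => x; rewrite -mulrBl; congr (_ * _).
 by rewrite /chart_lift; case: (pselect _) => [h1|h1] //=; rewrite subr0.
- move=> j f f0 f1; have [cl lE l0] := lc f f0; have [q1 _] := sqs f f0.
 rewrite normrM (gtr0_norm s0) /D; apply: ler_wpM2l; first exact: ltW.
 have sz : sq_integ Leb (fun x : mpt => g j x * zeta x) := sq_integM_bounded (mg j) (g1 j) (Cc_sq czeta).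
 have cs := int_cauchy_schwarz (Cc_sq cl) sz.
 have h1 : (\int[Leb]_x (chart_lift c f x * g j x) = \int[Leb]_x (chart_lift c f x * (g j x * zeta x))).
  apply: eq_int => x; have [h|/ltW h] := leP `|x| B; first by rewrite zeta1// mulr1.
  by rewrite lB// !mul0r.
 have h2 : (\int[Leb]_x ((g j x * zeta x) ^+ 2) <= \int[Leb]_x (zeta x ^+ 2)).
  apply: int_le; [exact: sz.2|exact: (Cc_sq czeta).2|move=> x].
  by rewrite exprMn ler_piMl ?sqr_ge0// -real_normK ?num_real// exprn_ile1.
 rewrite h1; set I := (\int[Leb]_x _).
 have h3 : I ^+ 2 <= W * (\int[Leb]_x (zeta x ^+ 2)).
  apply: le_trans cs _; apply: ler_pM => //; [|by apply: int_ge0 => x; exact: sqr_ge0|].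
   by apply: int_ge0 => x; exact: sqr_ge0.
  by apply: le_trans q1 _; rewrite ler_piMr// ltW.
 apply: le_trans (_ : 1 + I ^+ 2 <= _); last by rewrite lerD2l.
 by rewrite -real_normK ?num_real//; have := normr_ge0 I; move: `|I| => t t0; nra.
move=> f f0 hl; have [cl lE l0] := lc f f0; have [_ q1] := sqs f f0.
apply: le_trans q1 _; have h := hr _ cl (fun x => lB f x f0).
set G := (\int[omega]_q _); have hG := grad f f0.
have hs : C * (\sum_j (\int[Leb]_x (chart_lift c f x * g j x)) ^+ 2) <= e / W.
 apply: (@le_trans _ _ (C * \sum_(j < N) (s ^+ 2)^-1)).
  apply: ler_wpM2l; first exact: ltW.
  apply: ler_sum => j _; have := hl j; rewrite normrM (gtr0_norm s0) => {}hl.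
  rewrite -real_normK ?num_real// -exprVn; apply: sqr_mono => //.
  by rewrite -[leRHS]mul1r ler_pdivlMr// mulrC.
 rewrite sumr_const card_ord -mulr_natr mulrCA mulrC ler_pdivrMr ?exprn_gt0//.
 apply: (@le_trans _ _ (e / W * s)).
  rewrite /s mulrDr mulr1 (_ : e / W * _ = C * N%:R); last by field; rewrite !gt_eqF.
  by rewrite lerDr divr_ge0// ltW.
 by rewrite expr2; apply: ler_wpM2l; [rewrite divr_ge0// ltW|rewrite ler_pMr].
have {}hG : e / (W * (L * W)) * (\int[Leb]_x (partial o0 (chart_lift c f) x ^+ 2 + partial o1 (chart_lift c f) x ^+ 2)) <= e / W * G.
 have -> : e / W * G = e / (W * (L * W)) * (L * W * G) by field; rewrite !gt_eqF.
 by apply: ler_wpM2l => //; exact: ltW.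
have -> : e * (1 + G) = W * (e / W + e / W * G) by field; rewrite gt_eqF.
apply: ler_wpM2l; first exact: ltW.
by apply: le_trans h _; exact: lerD.
Qed.

(** * The Laplacian on classes of square integrable functions *)

Implicit Types (u v w : L2 omega).

Definition represents u phi := L2_repr u = (phi : bM -> R) %[ae omega].

Lemma ae_regular : {ae omega, forall q : borel M, ~ Z q}.
Proof.
have mZ := measurable_singular.
by apply/negligibleP; rewrite setCK//; exact: omegaA.1.
Qed.

Lemma test_sq_integ K phi : compact K -> K `<=` ~` Z -> (off K phi) ->
 sq_integ omega (phi : bM -> R).
Proof.
move=> cK KZ f0; split; first exact: Cinf_borel.
apply: (integ_eq _ (test_integ cK KZ (f := phi * phi) _)) => [q|p nK].
 by rewrite CinfM_E expr2.
by rewrite CinfM_E f0// mul0r.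
Qed.

(** The values of [laplace_beltrami] on the singular set are replaced by those of a smooth g, which
    is harmless because that set is null. *)
Lemma laplace_operatorP u v : Lap (u, v) <->
 exists K phi g, [/\ test_pair K phi g, represents u phi & represents v g].
Proof.
split=> [[phi /test_functionP[K [cK KZ f0]] [/= uE vE]]|[K [phi [g [[cK KZ f0 gE g0] uE vE]]]]].
 have [g [gE g0]] := test_laplace cK KZ f0; exists K, phi, g; split => //.
 by have := ae_and vE ae_regular; apply: filterS => q [h nZ] _; rewrite h// gE.
exists phi; first by apply/test_functionP; exists K.
split=> //=; have := ae_and vE ae_regular.
by apply: filterS => q [h nZ] _; rewrite h// gE.
Qed.

Lemma inner_represents u v phi psi : represents u phi -> represents v psi ->
 ip u v = (\int[omega]_q (phi q * psi q)).
Proof. by move=> h1 h2; apply: (inner_L2 h1 h2); exact: Cinf_borel. Qed.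

Lemma laplace_lin a phi psi q : ~ Z q -> lap (a *: phi + psi) q =
 a * lap phi q + lap psi q.
Proof.
move=> nZ; have [c Ac cq] := atlas_cover S q; have [y [W [cy Wq]]] := coordinates_at Ac cq.
rewrite !(laplaceE _ cy Wq nZ) /lap_coords !sum_ord2 !GamDl !GamZl !CinfE.
have t i := coord_vec_tangent i Ac cq.
by rewrite !(tangentD _ _ (t _)) !(tangentZ _ _ (t _)); ring.
Qed.

Lemma test_pair_lin a K K' phi g phi' g' : test_pair K phi g -> test_pair K' phi' g' ->
 test_pair (K `|` K') (a *: phi + phi') (a *: g + g').
Proof.
move=> [cK KZ f0 gE g0] [cK' KZ' f0' gE' g0']; split.
- exact: compactU.
- by move=> p [/KZ|/KZ'].
- by move=> p nK; rewrite !CinfE f0 ?f0' ?mulr0 ?addr0// => h; apply: nK; [right|left].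
- by move=> q nZ; rewrite laplace_lin// !CinfE gE// gE'.
- by move=> p nK; rewrite !CinfE g0 ?g0' ?mulr0 ?addr0// => h; apply: nK; [right|left].
Qed.

Lemma represents_lin a u v phi psi : represents u phi -> represents v psi ->
 represents (a *: u + v) (a *: phi + psi).
Proof.
move=> h1 h2; have := ae_and (ae_and h1 h2) (L2_reprP_lin a u v).
by apply: filterS => q [[e1 e2] e3] _; rewrite e3// e1// e2// !CinfE.
Qed.

Lemma laplace_dirichlet K phi g psi : test_pair K phi g ->
 (\int[omega]_q (g q * psi q) = - \int[omega]_q Gam psi phi q).
Proof.
move=> [cK KZ f0 gE g0]; have clK := compact_closedM cK.
apply: (green cK KZ (g := g * psi)).
- by move=> p f nK; rewrite (Gam_off f clK f0 nK) mulr0.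
- by move=> p nK; rewrite (Gam_off psi clK f0 nK).
- by move=> q nZ; rewrite CinfM_E gE// mulrC.
- by move=> p nK; rewrite CinfM_E g0// mul0r.
Qed.

Lemma laplace_symmetric : symmetric_operator ip Lap.
Proof.
move=> u v u' v' /laplace_operatorP[K [phi [g [tp uE vE]]]] /laplace_operatorP[K' [phi' [g' [tp' uE' vE']]]].
rewrite (inner_represents vE uE') (inner_represents uE vE') (laplace_dirichlet _ tp) GamC.
by rewrite -(laplace_dirichlet _ tp'); apply: eq_int => q; rewrite mulrC.
Qed.

Lemma laplace_dissipative u v : Lap (u, v) -> ip u v <= 0.
Proof.
move=> /laplace_operatorP[K [phi [g [tp uE vE]]]]; rewrite (inner_represents uE vE).
under eq_Rintegral do rewrite mulrC.
by rewrite (laplace_dirichlet _ tp) oppr_le0; apply: int_ge0 => q; exact: Gam_ge0.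
Qed.

Lemma test_pair_mem K phi g : test_pair K phi g ->
 exists u v, [/\ Lap (u, v), represents u phi & represents v g].
Proof.
move=> tp; have [cK KZ f0 gE g0] := tp.
have s1 := test_sq_integ cK KZ f0; have s2 := test_sq_integ cK KZ g0.
have r1 : represents (L2_class s1) phi by exact: L2_classE.
have r2 : represents (L2_class s2) g by exact: L2_classE.
by exists (L2_class s1), (L2_class s2); split => //; apply/laplace_operatorP; exists K, phi, g.
Qed.

Lemma inner_function w u phi : represents u phi ->
 integ omega (fun q : bM => L2_repr w q * phi q) /\ ip w u = (\int[omega]_q (L2_repr w q * phi q)).
Proof.
move=> uE; split; last first.
 by apply: (inner_L2 _ uE); [exact: ae_eq_refl|exact: (L2_reprP w).1|exact: Cinf_borel].
apply: integ_ae (sq_integM (L2_reprP w) (L2_reprP u)).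
 by apply: measurable_funM; [exact: (L2_reprP w).1|exact: Cinf_borel].
by apply: filterS uE => q h _; rewrite h.
Qed.

(** * Hardy's inequality *)

Section Weighted.
Context (T : Cinf S) (C : R).
Hypothesis C0 : 0 < C.
Hypothesis T0 : forall q, 0 <= T q.
Hypothesis TZ : forall q, T q = 0 <-> Z q.
Hypothesis T1 : forall q, Gam T T q <= C * T q.
Hypothesis T2 : forall q, T q * (C^-1 - C * T q) <= Gam T T q / 4.
Hypothesis lapT : forall q, ~ Z q -> lap T q ^+ 2 <= C * T q.

Lemma T_gt0 q : ~ Z q -> 0 < T q.
Proof. by move=> nZ; rewrite lt0r T0 andbT; apply/eqP => /TZ. Qed.

(** With r = sqrt T the first term is |grad r|^2 / r^2; the second bounds the contribution of Delta
    T, by |Delta T| <= sqrt (C T). *)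
Definition potential q : R := Gam T T q / (4 * T q ^+ 2) - sqrt C / 2 / sqrt (T q).

Lemma sqrtT_smooth : smooth (~` Z) (fun q => (sqrt (T q))^-1).
Proof.
have oZ := open_regular.
apply: (smooth_funV oZ _ (smooth_fun_sqrt oZ T_gt0 (Cinf_smoothW T))) => q nZ.
by rewrite gt_eqF// sqrtr_gt0 T_gt0.
Qed.

Lemma potential_smooth : smooth (~` Z) potential.
Proof.
have oZ := open_regular.
have s1 : smooth (~` Z) (fun q => (4 * T q ^+ 2)^-1).
 apply: (smooth_funV oZ _ (Cinf_smoothW (4 *: (T ^+ 2)))) => q nZ.
 by rewrite CinfZ_E CinfX_E gt_eqF// mulr_gt0// exprn_gt0// T_gt0.
have s2 := smooth_funM oZ (Cinf_smoothW (Gam T T)) s1.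
have s3 := smooth_funM oZ (@smooth_fun_cst _ _ S (~` Z) (sqrt C / 2)) sqrtT_smooth.
exact: smooth_funB oZ s2 s3.
Qed.

(** Expands the gradient of psi = sqrt T w and drops T |grad w|^2 >= 0. Multiplying by 4 w^2 T
    expresses everything through psi^2 = w^2 T, which is polynomial in w and T. *)
Lemma hardy_pointwise (w psi : Cinf S) q : (forall p, psi p * psi p = w p * w p * T p) -> ~ Z q ->
 w q * w q * Gam T T q / (4 * T q) + 2^-1 * Gam (w * w) T q <= Gam psi psi q.
Proof.
move=> e nZ; have Tq := T_gt0 nZ.
have eC : psi * psi = w * w * T by apply: Cinf_eq => p; rewrite !CinfM_E e.
have h1 : 4 * (psi q * psi q) * Gam psi psi q = Gam (w * w * T) (w * w * T) q.
 by rewrite -eC GamMl !GamMr !CinfE; ring.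
have h2 : Gam (w * w * T) (w * w * T) q = (w q * w q) ^+ 2 * Gam T T q +
  2 * (w q * w q * T q) * Gam (w * w) T q + T q ^+ 2 * (4 * (w q * w q) * Gam w w q).
 by rewrite !GamMl !GamMr !(GamC A T w) !CinfE; ring.
have gw := Gam_ge0 A w q; have gp := Gam_ge0 A psi q.
have h3 : Gam (w * w) T q = 2 * (w q * Gam w T q) by rewrite GamMl !CinfE; ring.
have [w0|w0] := eqVneq (w q) 0; first by rewrite h3 w0 !mul0r !mulr0 addr0.
have ww : 0 < w q * w q by rewrite -expr2 exprn_even_gt0.
have x0 : 0 < 4 * (w q * w q * T q) by apply: mulr_gt0 => //; exact: mulr_gt0.
rewrite -(ler_pM2l x0).
rewrite -[X in _ <= 4 * X * _]e h1 h2.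
rewrite (_ : 4 * (w q * w q * T q) * (w q * w q * Gam T T q / (4 * T q) + 2^-1 * Gam (w * w) T q) =
 (w q * w q) ^+ 2 * Gam T T q + 2 * (w q * w q * T q) * Gam (w * w) T q); last by field; rewrite gt_eqF.
by rewrite lerDl; apply: mulr_ge0; [exact: sqr_ge0|apply: mulr_ge0 => //; rewrite mulr_ge0// ltW].
Qed.

Lemma potential_mul K F : compact K -> K `<=` ~` Z -> off K F ->
 exists2 g : Cinf S, off K g & forall q, g q = potential q * F q ^+ 2.
Proof.
move=> cK KZ F0; have FF0 p : ~ K p -> (F * F) p = 0 by move=> nK; rewrite CinfM_E F0// mul0r.
have [g hg] := ext_mul cK KZ potential_smooth FF0.
by exists g => [p nK|q]; [rewrite hg FF0// mulr0|rewrite hg CinfM_E expr2].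
Qed.

Lemma potential_integ K psi : compact K -> K `<=` ~` Z -> off K psi ->
 integ omega (fun q : bM => potential q * psi q ^+ 2).
Proof.
move=> cK KZ f0; have [g g0 hg] := potential_mul cK KZ f0.
by apply: (@integ_eq _ _ _ _ (g : bM -> R)) => //; exact: (test_integ cK KZ g0).
Qed.

(** Ground state substitution w = psi / sqrt T: Green's formula moves the derivative of w^2 in
    [hardy_pointwise] onto T and leaves - w^2 Delta T / 2. *)
Lemma hardy K psi : compact K -> K `<=` ~` Z -> (off K psi) ->
 (\int[omega]_q (potential q * psi q ^+ 2) <= \int[omega]_q Gam psi psi q).
Proof.
move=> cK KZ f0; have clK := compact_closedM cK.
have [w hw] := ext_mul cK KZ sqrtT_smooth f0.
have w0 p : ~ K p -> w p = 0 by move=> nK; rewrite hw f0// mulr0.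
have ww0 p : ~ K p -> (w * w) p = 0 by move=> nK; rewrite CinfM_E w0// mulr0.
have e p : psi p * psi p = w p * w p * T p.
 have [Kp|nK] := pselect (K p); last by rewrite f0// w0// !mul0r.
 have Tp := T_gt0 (KZ p Kp); rewrite hw -{3}(sqr_sqrtr (ltW Tp)).
 have : sqrt (T p) != 0 by rewrite gt_eqF// sqrtr_gt0.
 by move: (sqrt (T p)) (psi p) => s t s0; field.
have [g hg] := ext_mul cK KZ (laplace_smooth T) ww0.
have g0 p : ~ K p -> g p = 0 by move=> nK; rewrite hg ww0// mulr0.
have G0 f p : ~ K p -> Gam psi f p = 0 by exact: Gam_off clK f0.
have Gw p : ~ K p -> Gam (w * w) T p = 0 by exact: Gam_off clK ww0.
have i1 := test_integ cK KZ g0.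
have i2 := test_integ cK KZ (f := Gam (w * w) T) Gw.
have i3 := test_integ cK KZ (f := Gam psi psi) (G0 psi).
have gr : (\int[omega]_q g q = - \int[omega]_q Gam (w * w) T q).
 apply: (green cK KZ) => // [p f nK|p nK|q nZ].
 - by rewrite ww0// mul0r.
 - by rewrite GamC Gw.
 - by rewrite hg mulrC.
pose D q : R := Gam psi psi q - 2^-1 * Gam (w * w) T q - 2^-1 * g q.
have iD : integ omega (D : bM -> R) by apply: integB; [apply: integB|]; try exact: integZ.
have -> : (\int[omega]_q Gam psi psi q = \int[omega]_q D q).
 rewrite intB; [|apply: integB|]; try exact: integZ; try exact: i3.
 rewrite intB; [|exact: i3|exact: integZ]; rewrite !intZ// gr; ring.
apply: int_le => //; first exact: potential_integ cK KZ f0.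
move=> q; rewrite expr2; have [Kq|nK] := pselect (K q); last first.
 by rewrite /D f0// !mulr0 G0// Gw// g0// !mulr0 !subr0.
have nZ := KZ q Kq; have Tq := T_gt0 nZ; have hp := hardy_pointwise e nZ.
have gq : g q <= sqrt C * sqrt (T q) * (w q * w q).
 rewrite hg CinfM_E ler_wpM2r -?expr2 ?sqr_ge0//.
 apply: le_trans (ler_norm _) _; rewrite -sqrtrM ?(ltW C0)// -sqrtr_sqr.
 by rewrite ler_wsqrtr// lapT.
rewrite /D; apply: (@le_trans _ _ (w q * w q * Gam T T q / (4 * T q) - 2^-1 * (sqrt C * sqrt (T q) * (w q * w q)))).
 rewrite /potential e; apply: le_of_eq.
 have key (t s G x k : R) : s != 0 -> t = s ^+ 2 ->
   (G / (4 * t ^+ 2) - k / 2 / s) * (x * x * t) = x * x * G / (4 * t) - 2^-1 * (k * s * (x * x)).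
  by move=> s0 ->; field.
 by apply: key; rewrite ?gt_eqF ?sqrtr_gt0// sqr_sqrtr// ltW.
move: hp gq; set a := w q * w q * Gam T T q / (4 * T q).
set b := Gam (w * w) T q; set c := Gam psi psi q; set k := sqrt C * _ * _.
by clearbody a b c k; lra.
Qed.

(** * Weighted energy inequality for weak solutions of Delta u = E u *)

Section Regularity.

Context (u : bM -> R) (E : R).
Hypothesis su : sq_integ omega u.
Hypothesis ortho : forall K phi g, test_pair K phi g ->
 (\int[omega]_q (u q * (E * phi q - g q)) = 0).

Section InChart.
Context (c : chart R M) (y : 'I_2 -> Cinf S) (O K : set M) (F chi : Cinf S) (K' N : set M).
Hypothesis cy : coords c y O.
Hypothesis cK : compact K.
Hypothesis cK' : compact K'.
Hypothesis K'O : K' `<=` O `&` ~` Z.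
Hypothesis oN : open N.
Hypothesis KN : K `<=` N.
Hypothesis NK' : N `<=` K'.
Hypothesis F0 : off K F.
Hypothesis chi0 : off K' chi.
Hypothesis chi1 : forall p, N p -> chi p = 1.
Hypothesis chi_ge0 : forall p, 0 <= chi p.

Let Ac : atlas S c. Proof. by case: cy. Qed.
Let K'c : K' `<=` cdom c `\` Z. Proof. by move=> p /K'O[Op nZ]; case: cy => _ _ Oc _; split => //; exact: Oc. Qed.
Let Nc : N `<=` cdom c. Proof. by move=> p /NK'/K'c[]. Qed.
Let KZ : K `<=` ~` Z. Proof. by move=> p /KN/NK'/K'c[]. Qed.
Let Kc : K `<=` cdom c. Proof. by move=> p /KN/Nc. Qed.
Let KcZ : K `<=` cdom c `\` Z. Proof. by move=> p /KN/NK'/K'c. Qed.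
Let NO : N `<=` O. Proof. by move=> p /NK'/K'O[]. Qed.
Let NZ : N `<=` ~` Z. Proof. by move=> p /NK'/K'O[]. Qed.

(** The Euclidean data for [caccioppoli]: a is the density times the inverse metric, rho the
    density, W the density times the potential, all multiplied by chi, which is 1 near the support
    of F. The function u is cut off in the same way by [kap]. *)
Context (a : 'I_2 -> 'I_2 -> pt -> R) (rho W Fh kap : pt -> R).
Hypothesis ca : forall i j, Cc (a i j).
Hypothesis aE : forall i j x, a i j x = chi (chart_point c x) * Gam (y i) (y j) (chart_point c x) * weight c x.
Hypothesis crho : Cc rho.
Hypothesis rhoE : forall x, rho x = chi (chart_point c x) * weight c x.
Hypothesis cW : Cc W.
Hypothesis WE : forall x, W x = potential (chart_point c x) * chi (chart_point c x) * weight c x.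
Hypothesis cFh : Cc Fh.
Hypothesis FhE : forall p, cdom c p -> Fh (cmap c p) = F p.
Hypothesis Fh0 : forall x, Fh x != 0 -> (cmap c @` K) x.
Hypothesis ckap : Cc kap.
Hypothesis kapE : forall p, cdom c p -> kap (cmap c p) = chi p.
Hypothesis kap0 : forall x, kap x != 0 -> (cmap c @` K') x.

Let v x := kap x * u (chart_point c x).

Let Fh_off x : ~ (cmap c @` K) x -> Fh x = 0.
Proof. by move=> nK; apply/eqP/negPn/negP => /Fh0. Qed.

Let point_map p : cdom c p -> chart_point c (cmap c p) = p.
Proof. by move=> cp; rewrite chart_pointE ?chart_mapK//; exact: chart_imgP. Qed.

Let v_map p : cdom c p -> v (cmap c p) = chi p * u p.
Proof. by move=> cp; rewrite /v point_map// kapE. Qed.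

Let mv : mfP (v : mpt -> R).
Proof.
apply: measurable_funM; first exact: continuous_measurable2 (Cc_continuous ckap).
exact: (measurableT_comp su.1 (@measurable_chart_point c)).
Qed.

(** The density is bounded below on K', so square integrability for the area passes to Lebesgue
    measure: [iw] is chi^2 divided by the density, a bounded smooth function. *)
Let sv : sq_integ Leb (v : mpt -> R).
Proof.
split => //; have w0 p : (cdom c `&` ~` Z) p -> weight c (cmap c p) != 0.
 by move=> [cp nZ]; rewrite gt_eqF// weight_gt0//; exact: chart_preP.
have oD := open_chart_regular c.
have s1 := smooth_funM oD (smooth_funV oD w0 (smooth_weight_map Ac)) (Cinf_smoothW (chi * chi)).
have z q : ~ K' q -> (weight c (cmap c q))^-1 * (chi * chi) q = 0.
 by move=> nK; rewrite CinfM_E chi0// !mulr0.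
pose iw := mkCinf (smooth_fun_ext oD (compact_closedM cK') K'c s1 z).
have iwE q : iw q = (weight c (cmap c q))^-1 * (chi q * chi q) by [].
have [B _ hB] := Cinf_bounded iw.
have i1 : integ omega (fun q : bM => u q ^+ 2 * iw q) := integM_bounded (Cinf_borel iw) hB su.2.
apply/(@pull_int c K' (fun q => u q ^+ 2 * iw q) (fun x => v x ^+ 2) Ac K'c (integ_meas i1) _ _ _).1 => //.
- by move=> q nK; rewrite iwE chi0// !mulr0.
- move=> q Kq; have [cq nZ] := K'c Kq; rewrite v_map// iwE; have := w0 q (conj cq nZ).
 by move: (weight c _) => w wn; field.
- by move=> x nK; rewrite /v (_ : kap x = 0) ?mul0r ?expr0n//; apply/eqP/negPn/negP => /kap0.
Qed.

Let iv : integ Leb (v : mpt -> R).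
Proof.
have [B B0 hB] := bsupp_pos ckap.2; have [k ck k1] := cutoff (ltW B0).
apply: (@integ_eq _ _ _ _ (fun x : mpt => v x * k x)); last exact: sq_integM sv (Cc_sq ck).
move=> x; have [h|h] := leP `|x| B; first by rewrite k1// mulr1.
by rewrite /v hB ?ltW// !mul0r.
Qed.

Let asym i j x : a i j x = a j i x.
Proof. by rewrite !aE (GamC A (y i)). Qed.

Let quadE p (xi : 'I_2 -> R) : N p -> quad_form a (cmap c p) xi =
 (\sum_i \sum_j Gam (y i) (y j) p * xi i * xi j) * weight c (cmap c p).
Proof.
move=> Np; have cp := Nc Np; rewrite /quad_form mulr_suml; apply: eq_bigr => i _.
rewrite mulr_suml; apply: eq_bigr => j _; rewrite aE point_map// chi1//; ring.
Qed.

Let lin (xi : 'I_2 -> R) : Cinf S := xi o0 *: y o0 + xi o1 *: y o1.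

Let gramE p (xi : 'I_2 -> R) : \sum_i \sum_j Gam (y i) (y j) p * xi i * xi j = Gam (lin xi) (lin xi) p.
Proof. by rewrite !sum_ord2 GamDl !GamDr !GamZl !GamZr !CinfE; ring. Qed.

Let qpos x (xi : 'I_2 -> R) : 0 <= quad_form a x xi.
Proof.
have -> : quad_form a x xi = chi (chart_point c x) * (\sum_i \sum_j Gam (y i) (y j) (chart_point c x) * xi i * xi j) * weight c x.
 rewrite mulr_sumr mulr_suml; apply: eq_bigr => i _; rewrite mulr_sumr mulr_suml; apply: eq_bigr => j _.
 by rewrite aE; ring.
by rewrite gramE mulr_ge0 ?weight_ge0// mulr_ge0 ?Gam_ge0.
Qed.

Let ell : exists2 Lam : R, 0 < Lam & forall x (xi : 'I_2 -> R), Fh x != 0 ->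
 \sum_i xi i ^+ 2 <= Lam * quad_form a x xi.
Proof.
have KOZ : K `<=` O `\` Z by move=> p /KN Np; split; [exact: NO|exact: NZ].
have [B' [w [L [_ w0 L0 hK]]]] := chart_bounds cy cK KOZ; exists (L * w); first exact: mulr_gt0.
move=> x xi /Fh0[p Kp <-]; have Np := KN Kp; have [_ _ h hf] := hK p Kp.
have t i := coord_vec_tangent i Ac (Kc Kp).
have cv i : cvec c i p (lin xi) = xi i.
 rewrite (tangentD _ _ (t i)) !(tangentZ _ _ (t i)) !(coord_vec_coord _ _ cy (NO Np)).
 by have [->|->] := ord2P i; rewrite /= !mulr1 !mulr0 ?addr0 ?add0r.
have := hf (lin xi); under eq_bigr => i _ do rewrite cv.
move=> {}hf; apply: le_trans hf _; rewrite quadE// gramE -mulrA; apply: ler_wpM2l; first exact: ltW.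
by rewrite mulrCA -[leLHS]mulr1; apply: ler_wpM2l; [exact: Gam_ge0|exact: h].
Qed.

Let hardyF (w : pt -> R) : smooth_on setT w ->
 (\int[Leb]_x (W x * (Fh x * w x) ^+ 2) <=
  \int[Leb]_x quad_form a x (fun i => partial i (fun z => Fh z * w z)%R x)).
Proof.
move=> sw; have sh : smooth_on setT (fun x => Fh x * w x) := smoothM openT cFh.1 sw.
have [|psi [psiE psi0]] := lift_ex Ac cK Kc sh; first by move=> p cp nK; rewrite FhE// F0// mul0r.
have h := hardy cK KZ psi0.
have e1 : (\int[omega]_q (potential q * psi q ^+ 2) = \int[Leb]_x (W x * (Fh x * w x) ^+ 2)).
 apply: (proj2 (@pull_int c K (fun q => potential q * psi q ^+ 2) (fun x => W x * (Fh x * w x) ^+ 2) Ac KcZ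
  (integ_meas (potential_integ cK KZ psi0)) _ _ _)).
 - by move=> q nK; rewrite psi0// expr0n mulr0.
 - by move=> q Kq; have cq := Kc Kq; rewrite WE point_map// chi1 ?psiE//; [ring|exact: KN].
 - by move=> x nK; rewrite Fh_off// mul0r expr0n mulr0.
have z0 x : ~ (cmap c @` K) x -> Fh x * w x = 0 by move=> nK; rewrite Fh_off// mul0r.
have e2 : (\int[omega]_q Gam psi psi q = \int[Leb]_x quad_form a x (fun i => partial i (fun z => Fh z * w z) x)).
 apply: (proj2 (@pull_int c K (fun q => Gam psi psi q) (fun x => quad_form a x (fun i => partial i (fun z => Fh z * w z) x)) Ac KcZ
  (Cinf_borel (Gam psi psi)) _ _ _)).
 - by move=> q nK; exact: (Gam_off psi (compact_closedM cK) psi0 nK).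
 - move=> q Kq; have Nq := KN Kq; rewrite quadE// (Gam_coords2 psi psi cy (NO Nq)).
  have cv i := @coord_vec_lift c N psi (fun x => Fh x * w x) q i Ac oN Nc (fun p Np => psiE p (Nc Np)) Nq.
  by congr (_ * _); apply: eq_bigr => i _; apply: eq_bigr => j _; rewrite !cv.
 - move=> x nK; rewrite /quad_form; apply: big1 => i _; apply: big1 => j _.
  by rewrite (partial_off i cK Kc z0 nK) mulr0 mul0r.
by rewrite -e1 -e2.
Qed.

(** The mollifier reflected about x is lifted to a test function on M and inserted in [ortho]. The
    radius r is a margin between the support of F and the complement of N, where chi may differ from
    1; 1 / (n+1) < r keeps the lift inside N. *)
Let weakE : exists n0, forall n x, (n0 <= n)%N -> Fh x != 0 ->
 \sum_i \sum_j (conv (fun z => v z * a i j z) (partial i (partial j (moll n))) x -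
  conv (fun z => v z * partial j (a i j) z) (partial i (moll n)) x) =
 E * conv (fun z => v z * rho z) (moll n) x.
Proof.
have cKK : compact (cmap c @` K).
 apply: continuous_compact cK; apply: continuous_in_subspaceT => q /set_mem /Kc.
 exact: chart_map_continuous.
have sK : cmap c @` K `<=` chart_pre c N by move=> _ [p Kp <-]; apply: chart_preP; [exact: Kc|exact: KN].
have [r r0 hr] := compact_margin cKK (open_pre c oN) sK.
have [n0 hn0] := near_invS r0; exists n0 => n x nn /Fh0 Kx.
have nr := hn0 n nn; set J := moll n; have cJ := Cc_mollifier R n.
pose Bx := [set z : pt | `|z - x| <= n.+1%:R^-1].
have BN z : Bx z -> chart_pre c N z by move=> Bz; apply: (hr x z Kx); apply: le_trans Bz (ltW nr).
have cB : compact Bx by exact: compact_square.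
have Bimg : Bx `<=` chart_img c by move=> z /BN[].
pose Kp := cinv c @` Bx.
have cKp : compact Kp := compact_chart_inv cB Bimg.
have KpN : Kp `<=` N by move=> _ [z /BN[_ Nz] <-].
have nBx z : ~ Bx z -> n.+1%:R^-1 < `|x - z| by move=> nB; rewrite ltNge distrC; apply/negP.
have cxi := Cc_reflect x cJ; set xi := fun z => J (x - z) in cxi.
have Kp_map p : cdom c p -> Bx (cmap c p) -> Kp p.
 by move=> cp Bp; exists (cmap c p) => //; exact: chart_mapK.
have [|phi [phiE phi0]] := lift_ex Ac cKp (fun p Kpp => Nc (KpN p Kpp)) cxi.1.
 by move=> p cp nK; apply: mollifier_eq0; apply: nBx => Bp; apply: nK; exact: Kp_map.
have KpZ : Kp `<=` ~` Z by move=> p /KpN/NZ.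
have KpcZ : Kp `<=` cdom c `\` Z by move=> p Kpp; split; [exact/Nc/KpN|exact: KpZ].
have [g [gE g0]] := test_laplace cKp KpZ phi0.
have o := ortho (And5 cKp KpZ phi0 gE g0).
have dxi i : partial i xi = (fun z => - partial i J (x - z)) by apply/funext => z; exact: partial_reflect.
have ddxi i j z : partial i (partial j xi) z = partial i (partial j J) (x - z).
 have cdJ := Cc_partial j cJ.
 rewrite dxi (_ : (fun z => - _) = (fun z => -1 * partial j J (x - z))); last by apply/funext => t; rewrite mulN1r.
 rewrite partialZ; last exact: (smooth_partials (Cc_reflect x cdJ).1 (x := z) I).2.
 by rewrite partial_reflect// mulN1r opprK.
have af i j : a i j = a j i by apply/funext => z; exact: asym.
have lapg q : Kp q -> g q * weight c (cmap c q) =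
  \sum_i \sum_j (a i j (cmap c q) * partial i (partial j J) (x - cmap c q) -
   partial j (a i j) (cmap c q) * partial i J (x - cmap c q)).
 move=> Kpq; have Nq := KpN q Kpq; have cq := Nc Nq.
 rewrite gE; last exact: NZ.
 rewrite mulrC (weight_laplace phi cy (NO Nq) (NZ Nq)).
 have oP := open_pre c oN; have Pq : chart_pre c N (cmap c q) by exact: chart_preP.
 have e1 i : {in chart_pre c N, (fun z => weight c z * (Gam phi (y i) \o cinv c) z) =1 (fun z => \sum_j a i j z * partial j xi z)}.
  move=> z /set_mem[cz Nz]; rewrite -[(_ \o _) z]/(Gam phi (y i) (cinv c z)).
  rewrite GamC (Gam_coords A (y i) phi cy (NO Nz)) mulr_sumr; apply: eq_bigr => j _.
  rewrite (@coord_vec_lift c N phi xi _ j Ac oN Nc (fun p Np => phiE p (Nc Np)) Nz) chart_invK//.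
  by rewrite aE chart_pointE// chi1//; ring.
 have dj i j z : derivable (partial j xi) z (bv i).
  exact: (smooth_partials (smooth_on_partial j cxi.1) (x := z) I).2.
 have da i j k z : derivable (a j k) z (bv i) by exact: (smooth_partials (ca j k).1 (x := z) I).2.
 rewrite (eq_bigr (fun i => \sum_j (partial i (a i j) (cmap c q) * partial j xi (cmap c q) +
   a i j (cmap c q) * partial i (partial j xi) (cmap c q)))); last first.
  move=> i _; rewrite (@partial_eq R _ _ _ i oP (e1 i) _ (mem_set Pq)).
  rewrite (@partial_sum2 _ i (fun j z => a i j z * partial j xi z)) => [|j]; last exact: derivableM (da i i j _) (dj i j _).
  by apply: eq_bigr => j _; rewrite (partialM (da i i j _) (dj i j _)).
 have X1 i : partial i xi (cmap c q) = - partial i J (x - cmap c q) by rewrite dxi.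
 have D1 k i j : partial k (a i j) (cmap c q) = partial k (a j i) (cmap c q) by rewrite af.
 rewrite (@divergence_sum _ (fun i j => a i j (cmap c q)) (fun i j => partial i (partial j xi) (cmap c q))
  (fun k i j => partial k (a i j) (cmap c q)) (fun j => partial j xi (cmap c q))
  (fun j => partial j J (x - cmap c q)) D1 X1).
 by apply: eq_bigr => i _; apply: eq_bigr => j _; rewrite ddxi.
pose H z := E * (v z * rho z * J (x - z)) - \sum_i \sum_j (v z * a i j z * partial i (partial j J) (x - z) -
  v z * partial j (a i j) z * partial i J (x - z)).
have mf : mfM (fun q : bM => u q * (E * phi q - g q)).
 by apply: measurable_funM; [exact: su.1|exact: (Cinf_borel (E *: phi - g))].
have zero z : ~ Bx z -> J (x - z) = 0 /\ forall i, partial i J (x - z) = 0 /\ forall j, partial i (partial j J) (x - z) = 0.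
 move=> /nBx nz; split; first exact: mollifier_eq0.
 move=> i; split; first exact: partial_mollifier_eq0.
 move=> j; rewrite (@partial_eq R _ _ (fun=> 0) i (@open_norm_gt R n.+1%:R^-1) _ _ (mem_set (nz : [set t | n.+1%:R^-1 < `|t|] (x - z)))) ?partial_cst//.
 by move=> t /set_mem nt; exact: partial_mollifier_eq0.
have e : (\int[omega]_q (u q * (E * phi q - g q)) = \int[Leb]_z H z).
 apply: (proj2 (@pull_int c Kp (fun q => u q * (E * phi q - g q)) H Ac KpcZ mf _ _ _)).
 - by move=> q nK; rewrite phi0// g0// mulr0 subrr mulr0.
 - move=> q Kq; have Nq := KpN q Kq; have cq := Nc Nq.
  rewrite /H v_map// chi1// mul1r rhoE point_map// chi1// mul1r.
  rewrite -[J (x - _)]/(xi (cmap c q)) -phiE// mulrBr mulrBl -[u q * g q * _]mulrA lapg// mulr_sumr.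
  congr (_ - _); first by ring.
  by apply: eq_bigr => i _; rewrite mulr_sumr; apply: eq_bigr => j _; ring.
 - move=> z nK; have nB : ~ Bx z.
   by move=> Bz; apply: nK; exists (cinv c z); [exists z|exact: chart_invK (Bimg z Bz)].
  have [z1 z2] := zero z nB; rewrite /H z1 !mulr0 sub0r big1 ?oppr0// => i _; rewrite big1// => j _.
  by have [z3 z4] := z2 i; rewrite z3 z4 !mulr0 subrr.
have ia i j : integ Leb (fun z => v z * a i j z) := integM_Cc iv (ca i j).
have ida i j k : integ Leb (fun z => v z * partial k (a i j) z) := integM_Cc iv (Cc_partial k (ca i j)).
have ir := integM_Cc iv crho.
have k1 := conv_integ x ir cJ.
have k2 i j := conv_integ x (ia i j) (Cc_partial i (Cc_partial j cJ)).
have k3 i j := conv_integ x (ida i j j) (Cc_partial i cJ).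
move: e; rewrite o /H intB; [|exact: integZ k1|apply: integ_sum => i; apply: integ_sum => j; exact: integB (k2 i j) (k3 i j)].
rewrite intZ// int_sum => [|i]; last by apply: integ_sum => j; exact: integB (k2 i j) (k3 i j).
move=> /esym/eqP; rewrite subr_eq0 => /eqP ->; apply: eq_bigr => i _.
rewrite int_sum => [|j]; last exact: integB (k2 i j) (k3 i j).
by apply: eq_bigr => j _; rewrite intB.
Qed.

Lemma reg_in_chart :
 (\int[omega]_q (potential q * F q ^+ 2 * u q ^+ 2) + E * \int[omega]_q (F q ^+ 2 * u q ^+ 2) <=
  \int[omega]_q (Gam F F q * u q ^+ 2)).
Proof.
have [Lam L0 hL] := ell; have [n0 hw] := weakE.
have main := @caccioppoli R a rho W Fh v E Lam n0 ca asym crho cW cFh iv sv L0 qpos hL hw hardyF.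
have mu2 : mfM (fun q : bM => u q ^+ 2) := integ_meas su.2.
have [g _ gE] := potential_mul cK KZ F0.
have m1 : mfM (fun q : bM => potential q * F q ^+ 2 * u q ^+ 2).
 by under eq_fun do rewrite -gE; apply: measurable_funM => //; exact: Cinf_borel.
have m2 : mfM (fun q : bM => F q ^+ 2 * u q ^+ 2).
 by apply: measurable_funM => //; apply: measurable_funX; exact: Cinf_borel.
have m3 : mfM (fun q : bM => Gam F F q * u q ^+ 2).
 by apply: measurable_funM => //; exact: Cinf_borel.
have e1 : (\int[omega]_q (potential q * F q ^+ 2 * u q ^+ 2) = \int[Leb]_x (W x * Fh x ^+ 2 * v x * v x)).
 apply: (proj2 (@pull_int c K _ (fun x => W x * Fh x ^+ 2 * v x * v x) Ac KcZ m1 _ _ _)).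
 - by move=> q nK; rewrite F0// expr0n mulr0 mul0r.
 - move=> q Kq; have Nq := KN Kq; have cq := Kc Kq.
  by rewrite WE point_map// chi1// v_map// chi1// FhE//; ring.
 - by move=> x nK; rewrite Fh_off// expr0n mulr0 !mul0r.
have e2 : (\int[omega]_q (F q ^+ 2 * u q ^+ 2) = \int[Leb]_x (Fh x ^+ 2 * v x * (v x * rho x))).
 apply: (proj2 (@pull_int c K _ (fun x => Fh x ^+ 2 * v x * (v x * rho x)) Ac KcZ m2 _ _ _)).
 - by move=> q nK; rewrite F0// expr0n mul0r.
 - move=> q Kq; have Nq := KN Kq; have cq := Kc Kq.
  by rewrite rhoE point_map// chi1// v_map// chi1// FhE//; ring.
 - by move=> x nK; rewrite Fh_off// expr0n !mul0r.
have e3 : (\int[omega]_q (Gam F F q * u q ^+ 2) = \int[Leb]_x (quad_form a x (fun i => partial i Fh x) * v x * v x)).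
 apply: (proj2 (@pull_int c K _ (fun x => quad_form a x (fun i => partial i Fh x) * v x * v x) Ac KcZ m3 _ _ _)).
 - by move=> q nK; rewrite (Gam_off F (compact_closedM cK) F0 nK) mul0r.
 - move=> q Kq; have Nq := KN Kq; have cq := Kc Kq.
  have cv i := coord_vec_lift i Ac oN Nc (fun p Np => esym (FhE (Nc Np))) Nq.
  rewrite quadE// v_map// chi1// (Gam_coords2 F F cy (NO Nq)).
  rewrite (eq_bigr (fun i => \sum_j Gam (y i) (y j) q * cvec c i q F * cvec c j q F)); first by ring.
  by move=> i _; apply: eq_bigr => j _; rewrite !cv.
 - move=> x nK; rewrite (_ : quad_form a x _ = 0) ?mul0r//; apply: big1 => i _; apply: big1 => j _.
  by rewrite (partial_off i cK Kc Fh_off nK) mulr0 mul0r.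
by rewrite e1 e2 e3.
Qed.

End InChart.

Lemma reg_chart c y O K F : coords c y O -> compact K -> K `<=` O `\` Z -> (off K F) ->
 (\int[omega]_q (potential q * F q ^+ 2 * u q ^+ 2) + E * \int[omega]_q (F q ^+ 2 * u q ^+ 2) <=
  \int[omega]_q (Gam F F q * u q ^+ 2)).
Proof.
move=> cy cK KO F0; have [Ac oO Oc _] := cy; have oZ := openI oO (open_regular).
have [chi' [K' [N [[cK' K'O] oN KN h1 h0]]]] := smooth_cutoff cK oZ KO.
(* Squared to be nonnegative, which the positivity of the quadratic form a relies on. *)
pose chi := chi' * chi'.
have chi1 p : N p -> chi p = 1 by move=> Np; rewrite CinfM_E h1// mulr1.
have chi0 p : ~ K' p -> chi p = 0 by move=> nK; rewrite CinfM_E h0// mulr0.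
have chig p : 0 <= chi p by rewrite CinfM_E -expr2 sqr_ge0.
have NK' : N `<=` K'.
 by move=> p Np; apply: contrapT => nK; have := chi1 p Np; rewrite chi0// => /esym/eqP; rewrite oner_eq0.
have K'c : K' `<=` cdom c `\` Z by move=> p /K'O[Op nZ]; split => //; exact: Oc.
have K'd : K' `<=` cdom c by move=> p /K'c[].
have KZ' : K' `<=` ~` Z by move=> p /K'c[].
have cG0 i j q : ~ K' q -> (chi * Gam (y i) (y j)) q = 0 by move=> nK; rewrite CinfM_E chi0// mul0r.
have ha i j := cid2 (chart_pull Ac cK' K'c (cG0 i j)).
have [rho crho [rhoE _ _ _]] := chart_pull Ac cK' K'c chi0.
have [g hg] := ext_mul cK' KZ' (potential_smooth) chi0.
have g0 q : ~ K' q -> g q = 0 by move=> nK; rewrite hg chi0// mulr0.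
have [W cW [WE _ _ _]] := chart_pull Ac cK' K'c g0.
have Kd : K `<=` cdom c by move=> p /KO[/Oc].
have [Fh cFh [FhE Fh0]] := chart_ext Ac cK Kd (Cinf_smoothW F) F0.
have [kap ckap [kapE kap0]] := chart_ext Ac cK' K'd (Cinf_smoothW chi) chi0.
apply: (@reg_in_chart c y O K F chi K' N cy cK cK' K'O oN KN NK' F0 chi0 chi1 chig
 (fun i j => s2val (ha i j)) rho W Fh kap) => //.
- by move=> i j; exact: (s2valP (ha i j)).
- by move=> i j x; have [h _ _ _] := s2valP' (ha i j); rewrite h.
- by move=> x; rewrite WE hg.
Qed.

End Regularity.

(** The weight is F = r j sg, with r = sqrt T, j = 1 / (1 + b r) and a gate sg closed near the
    singular set. Where the gate is open, [agmon_arith] gives a gain kappa sqrt T. In the layer eps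
    <= T <= 2 eps the loss is at most D whatever eps is, because |grad sg|^2 is of order 1 / eps
    while r^2 <= 2 eps. *)
Lemma agmon_function : exists L kappa D : R, [/\ 0 < L, 0 < kappa, 0 <= D & forall eps : R, 0 < eps ->
 exists F K, [/\ compact K, K `<=` ~` Z, off K F &
  forall q, (if 2 * eps < T q then kappa * sqrt (T q) else - D) <=
   (potential q + L) * F q ^+ 2 - Gam F F q]].
Proof.
have [Tm Tm0 hT] := Cinf_bounded T; pose Rm := 1 + Tm.
have sT q : sqrt (T q) <= Rm.
 have h : T q <= Tm by apply: le_trans (ler_norm _) (hT q).
 rewrite -(ler_pXn2r (_ : 0 < 2)%N) ?nnegrE ?sqrtr_ge0//; last by rewrite /Rm; lra.
 by rewrite sqr_sqrtr//; apply: le_trans h _; rewrite /Rm; nra.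
pose c := sqrt C / 2; have c0 : 0 <= c by rewrite divr_ge0// sqrtr_ge0.
pose b := C * (c + 1); have b0 : 0 < b by rewrite mulr_gt0// ltr_wpDl.
pose L := 2 * c * b + c * b ^+ 2 * Rm + (c + 1) * (2 * C).
have L0 : 0 < L.
 rewrite /L ltr_wpDl//; last by rewrite !mulr_gt0// ltr_wpDl.
 have k1 : 0 <= 2 * c * b.
  by apply: mulr_ge0; [exact: mulr_ge0|exact: ltW].
 have k2 : 0 <= c * b ^+ 2 by rewrite mulr_ge0// sqr_ge0.
 by rewrite addr_ge0// mulr_ge0// /Rm; lra.
have [Ds Ds0 hDs] := compact_bound (@compact_box R 1) (fun x _ => (smooth_partials
 (smooth_on_partial o0 (@smooth_smooth_step R)) (x := x) I).1).
have oZ := open_regular.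
(* The first term bounds the negative part of the potential, the other two the halves of [Gam F F]
   given by [Gam_mul_le]. *)
pose D := c * Rm + 2 * (C / 4) + 2 * (4 * Ds ^+ 2 * C).
have D0 : 0 <= D.
 by rewrite !addr_ge0// ?mulr_ge0// ?divr_ge0 ?sqr_ge0 ?(ltW C0)//; rewrite /Rm; lra.
exists L, ((1 + b * Rm) ^+ 4)^-1, D; split => //.
 by rewrite invr_gt0 exprn_gt0// ltr_pwDl// mulr_ge0 ?(ltW b0)// /Rm; lra.
move=> eps e0.
pose K := [set q | eps / 4 <= T q].
have clK : closed K by exact: closed_Cinf_ge.
have cK := closed_compactM clK.
have KZ : K `<=` ~` Z by move=> q Kq /TZ Tq; have := Kq; rewrite /K /mkset Tq; lra.
pose st (a : R) q := smooth_step (a * T q - 1).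
have sst a : smooth setT (st a) := smooth_fun_step openT (Cinf_smooth (a *: T - 1)).
have e4 : 4 / eps * eps = 4 by rewrite divfK// gt_eqF.
have s1 := smooth_funM oZ (smooth_fun_sqrt oZ (T_gt0) (Cinf_smoothW T)) (smooth_fun_sub (@subsetT _ (~` Z)) (sst (4 / eps))).
have rz q : ~ K q -> sqrt (T q) * st (4 / eps) q = 0.
 move=> nK; rewrite /st smooth_step_eq0 ?mulr0//.
 have h : T q <= eps / 4 by rewrite leNgt; apply/negP => h; apply: nK; exact: ltW.
 rewrite subr_le0; apply: le_trans (ler_wpM2l _ h) _; first by rewrite divr_ge0// ltW.
 by rewrite mulrA e4; lra.
(* Cutting sqrt T off below eps / 4 makes r smooth on M; it is exact for T > eps / 2, which contains
   the support of the gate. *)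
pose r := mkCinf (smooth_fun_ext oZ clK KZ s1 rz).
have rE q : eps / 2 < T q -> r q = sqrt (T q).
 move=> h; change (sqrt (T q) * st (4 / eps) q = sqrt (T q)); rewrite /st smooth_step_eq1 ?mulr1//.
 have : 4 / eps * (eps / 2) <= 4 / eps * T q by rewrite ler_wpM2l ?divr_ge0 ?ltW.
 by rewrite mulrA e4; lra.
have r0 q : 0 <= r q by exact: mulr_ge0 (sqrtr_ge0 _) (smooth_step_ge0 _).
have br q : setT q -> 1 + b * r q != 0 by move=> _; rewrite gt_eqF// ltr_pwDl// mulr_ge0// ltW.
pose j := mkCinf (smooth_funV openT br (Cinf_smooth (1 + b *: r))).
have jE q : j q * (1 + b * r q) = 1 by exact: mulVf (br q I).
have j01 q : 0 < j q /\ j q <= 1.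
 have h : 0 < 1 + b * r q by rewrite ltr_pwDl// mulr_ge0// ltW.
 have -> : j q = (1 + b * r q)^-1 by [].
 by split; [rewrite invr_gt0|rewrite invf_le1// lerDl mulr_ge0// ltW].
have jC : j * (1 + b *: r) = 1 by apply: Cinf_eq => q; exact: jE.
(* The derivative of r / (1 + b r) with respect to r is 1 / (1 + b r)^2. *)
have Gj phi q : Gam phi (r * j) q = j q ^+ 2 * Gam phi r q.
 have h1 : Gam phi (j * (1 + b *: r)) q = 0 by rewrite jC Gam1r.
 have h2 : j q * (b * Gam phi r q) + (1 + b * r q) * Gam phi j q = 0.
  by rewrite -h1 GamMr GamDr Gam1r add0r GamZr !CinfE.
 have h3 : Gam phi j q = - (b * j q ^+ 2 * Gam phi r q).
  have h4 : j q * (j q * (b * Gam phi r q) + (1 + b * r q) * Gam phi j q) = 0 by rewrite h2 mulr0.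
  have h5 : j q * (1 + b * r q) * Gam phi j q = - (b * j q ^+ 2 * Gam phi r q).
   by apply/eqP; rewrite -addr_eq0 -h4; apply/eqP; ring.
  by rewrite -h5 jE mul1r.
 rewrite GamMr CinfD_E !CinfM_E h3.
 rewrite (_ : j q * Gam phi r q = j q * (j q * (1 + b * r q)) * Gam phi r q); last by rewrite jE mulr1.
 ring.
have Grr q : eps / 2 < T q -> Gam r r q = Gam T T q / (4 * T q).
 move=> h; have Tq : 0 < T q by apply: lt_trans h; rewrite divr_gt0.
 have oV := open_Cinf_gt T (eps / 2).
 have h1 : Gam T T q = Gam (r * r) (r * r) q.
  apply: (Gam_local2 A oV h) => p hp; rewrite CinfM_E rE// -expr2 sqr_sqrtr//.
 have h2 : Gam (r * r) (r * r) q = 4 * (r q * r q) * Gam r r q by rewrite GamMl !GamMr !CinfE; ring.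
 have rr : r q * r q = T q by rewrite rE// -expr2 sqr_sqrtr.
 by rewrite h1 h2 rr; field; rewrite gt_eqF.
pose sg := mkCinf (sst eps^-1).
have sg0 q : T q <= eps -> sg q = 0.
 by move=> h; apply: smooth_step_eq0; rewrite subr_le0 mulrC ler_pdivrMr// mul1r.
have sg1 q : 2 * eps <= T q -> sg q = 1.
 by move=> h; apply: smooth_step_eq1; rewrite lerBrDr mulrC ler_pdivlMr// mulrDl mul1r -mulr2n -mulr_natl.
have sg01 q : 0 <= sg q /\ sg q <= 1 by split; [exact: smooth_step_ge0|exact: smooth_step_le1].
pose p := r * j; pose F := p * sg.
have F0 q : T q <= eps -> F q = 0 by move=> /sg0 h; rewrite CinfM_E h mulr0.
exists F, K; split => //.
 move=> q nK; apply: F0; rewrite leNgt; apply/negP => h; apply: nK; rewrite /K /mkset; lra.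
move=> q.
have Gpp : Gam p p q = j q ^+ 4 * Gam r r q by rewrite {1}/p Gj GamC Gj; ring.
have [Tq|Tq] := ltP (T q) eps.
 have -> : (2 * eps < T q) = false by apply/negbTE; rewrite -leNgt; lra.
 rewrite [X in X <= _](_ : _ = - D)// (F0 q (ltW Tq)) expr0n mulr0 sub0r lerN2.
 rewrite (@Gam_local2 _ _ _ A F 0 _ q (open_Cinf_lt T eps) Tq) ?(tangent0 (Gam_tangent A 0 q))//.
 by move=> z hz; rewrite F0// ltW.
have Th : eps / 2 < T q by lra.
have Tp : 0 < T q by lra.
have sp : 0 < sqrt (T q) by rewrite sqrtr_gt0.
have s2 : sqrt (T q) ^+ 2 = T q by rewrite sqr_sqrtr.
have m0 : 0 <= Gam r r q := Gam_ge0 A r q.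
have pE : potential q = Gam r r q / sqrt (T q) ^+ 2 - c / sqrt (T q).
 by rewrite /potential Grr// s2; congr (_ - _); field; rewrite gt_eqF.
have FE : F q = sqrt (T q) * j q * sg q by rewrite !CinfM_E rE.
have [T2e|T2e] := ltP (2 * eps) (T q).
 rewrite FE sg1 ?(ltW T2e)// mulr1 pE.
 rewrite (@Gam_local2 _ _ _ A F p _ q (open_Cinf_gt T (2 * eps)) T2e); last first.
  by move=> z hz; rewrite CinfM_E sg1 ?mulr1// ltW.
 rewrite Gpp; apply: (agmon_arith (C := C)) => //; last by rewrite -(rE q Th).
 rewrite s2 Grr//; have := T2 q; move: (Gam T T q) => G h.
 have -> : G / (4 * T q) = G / 4 / T q by field; rewrite gt_eqF.
 by rewrite ler_pdivlMr// mulrC.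
have [j0 j1] := j01 q; have [g0 g1] := sg01 q.
have Grr4 : Gam r r q <= C / 4.
 rewrite Grr// ler_pdivrMr ?mulr_gt0//; apply: le_trans (T1 q) _.
 by apply: le_of_eq; field.
have p2 : p q ^+ 2 <= T q.
 by rewrite CinfM_E rE// exprMn s2 ler_piMr// exprn_ile1 ?(ltW j0).
have Gsg : Gam sg sg q <= 2 * Ds ^+ 2 * C / eps.
 have sE z : sg z = smooth_step ((eps^-1 *: T - 1 : Cinf S) z) by [].
 have h1 phi : Gam phi sg q = partial o0 (fun x : pt => smooth_step x.1) (eps^-1 * T q - 1, 0) * (eps^-1 * Gam phi T q).
  rewrite (Gam_comp phi q (@smooth_smooth_step R) sE); congr (_ * _).
  by rewrite GamBr Gam1r subr0 GamZr CinfZ_E.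
 have tq : `|(eps^-1 * T q - 1, 0) : pt| <= 1.
  rewrite prod_norm_le /= normr0 ler01 andbT ler_norml; apply/andP; split.
   have : 1 <= eps^-1 * T q by rewrite mulrC ler_pdivlMr// mul1r.
   lra.
  rewrite lerBlDr mulrC ler_pdivrMr//; lra.
 have := hDs _ tq; move: h1; set d := partial _ _ _ => h1 hd.
 have -> : Gam sg sg q = d ^+ 2 * (eps^-1 ^+ 2 * Gam T T q) by rewrite h1 GamC h1; ring.
 have d2 : d ^+ 2 <= Ds ^+ 2 by rewrite -real_normK ?num_real//; exact: sqr_mono.
 have h2 : eps^-1 ^+ 2 * Gam T T q <= 2 * C / eps.
  have -> : 2 * C / eps = eps^-1 ^+ 2 * (C * (2 * eps)) by field; rewrite gt_eqF.
  apply: ler_wpM2l; first exact: sqr_ge0.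
  by apply: le_trans (T1 q) _; apply: ler_wpM2l T2e; exact: ltW.
 rewrite (_ : 2 * Ds ^+ 2 * C / eps = Ds ^+ 2 * (2 * C / eps)); last by ring.
 by apply: ler_pM => //; rewrite ?sqr_ge0// mulr_ge0 ?sqr_ge0// Gam_ge0.
have GF := Gam_mul_le p sg q.
have k1 : sg q ^+ 2 * Gam p p q <= C / 4.
 rewrite Gpp; apply: le_trans Grr4; rewrite mulrA ler_piMl// -[leRHS]mulr1.
 by apply: ler_pM; rewrite ?exprn_ge0 ?exprn_ile1// ltW.
have k2 : p q ^+ 2 * Gam sg sg q <= 4 * Ds ^+ 2 * C.
 apply: (@le_trans _ _ (2 * eps * (2 * Ds ^+ 2 * C / eps))).
  by apply: ler_pM => //; rewrite ?sqr_ge0 ?Gam_ge0//; exact: le_trans p2 T2e.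
 by apply: le_of_eq; field; rewrite gt_eqF.
have k3 : - (c * Rm) <= (potential q + L) * F q ^+ 2.
 have F2 : F q ^+ 2 <= T q.
  apply: le_trans p2; rewrite CinfM_E exprMn ler_piMr ?sqr_ge0// exprn_ile1//.
 apply: (@le_trans _ _ (- (c / sqrt (T q)) * F q ^+ 2)); last first.
  rewrite ler_wpM2r ?sqr_ge0// pE -addrA addrCA lerDl addr_ge0 ?(ltW L0)// divr_ge0// sqr_ge0.
 rewrite mulNr lerN2; apply: (@le_trans _ _ (c / sqrt (T q) * T q)).
  by rewrite ler_wpM2l// divr_ge0// ltW.
 rewrite -{2}s2 (_ : c / _ * _ = c * sqrt (T q)); last by field; rewrite gt_eqF.
 by rewrite ler_wpM2l.
have := GF; rewrite -/F => {}GF.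
by move: k1 k2 k3 GF; rewrite -[Gam (p * sg) (p * sg) q]/(Gam F F q) /D; lra.
Qed.

(** * Vanishing of square integrable weak solutions *)

Section Uniqueness.
Context (u : bM -> R).
Hypothesis su : sq_integ omega u.

Lemma integ_Cinf_sq f : integ omega (fun q : bM => f q * u q ^+ 2).
Proof.
have [B _ hB] := Cinf_bounded f.
apply: (@integ_eq _ _ _ _ (fun q : bM => u q ^+ 2 * f q)) => [q|]; first exact: mulrC.
exact: (integM_bounded (Cinf_borel f) hB su.2).
Qed.

(* The localisation errors of a partition sum eta_k^2 = 1 (the IMS formula). *)
Lemma reg_global N (cc : 'I_N -> chart R M) (yy : 'I_N -> 'I_2 -> Cinf S) (OO KK : 'I_N -> set M)
  (eta : 'I_N -> Cinf S) (B E : R) K F :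
 (forall k, coords (cc k) (yy k) (OO k)) -> (forall k, compact (KK k) /\ KK k `<=` OO k) ->
 (forall k p, ~ KK k p -> eta k p = 0) -> (forall p, \sum_k eta k p ^+ 2 = 1) ->
 (forall p, \sum_k Gam (eta k) (eta k) p <= B) ->
 (forall K phi g, test_pair K phi g ->
  (\int[omega]_q (u q * (E * phi q - g q)) = 0)) ->
 compact K -> K `<=` ~` Z -> (off K F) ->
 (\int[omega]_q (((potential q + (E - B)) * F q ^+ 2 - Gam F F q) * u q ^+ 2) <= 0).
Proof.
move=> cyy hK e0 e1 hB ortho cK KZ F0; have clK := compact_closedM cK.
have [g _ hg] := potential_mul cK KZ F0.
pose G k := (g + E *: (F * F)) * (eta k * eta k) - Gam (F * eta k) (F * eta k).
have hk k : (\int[omega]_q (G k q * u q ^+ 2) <= 0).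
 have [cKk KO] := hK k.
 have cI : compact (KK k `&` K) by apply: (closed_compactM); exact: closedI (compact_closedM cKk) clK.
 have sI : KK k `&` K `<=` OO k `\` Z by move=> p [/KO Op /KZ].
 have z p : ~ (KK k `&` K) p -> (F * eta k) p = 0.
  move=> nI; rewrite CinfM_E; have [Kp|nK] := pselect (K p); last by rewrite F0// mul0r.
  by rewrite e0 ?mulr0// => Kp'; apply: nI.
 have h := reg_chart su ortho (cyy k) cI sI z.
 have i1 := integ_Cinf_sq (g * (eta k * eta k)); have i2 := integ_Cinf_sq (F * F * (eta k * eta k)).
 have i3 := integ_Cinf_sq (Gam (F * eta k) (F * eta k)).
 have -> : (\int[omega]_q (G k q * u q ^+ 2) = \int[omega]_q ((g * (eta k * eta k)) q * u q ^+ 2 +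
   E * ((F * F * (eta k * eta k)) q * u q ^+ 2) - Gam (F * eta k) (F * eta k) q * u q ^+ 2)).
  by apply: eq_int => q; rewrite /G !CinfE; ring.
 rewrite intB//; last by apply: integD => //; exact: integZ.
 rewrite intD ?intZ//; last exact: integZ.
 rewrite subr_le0; apply: le_trans h; apply: le_of_eq.
 have ea q : (g * (eta k * eta k)) q = potential q * (F * eta k) q ^+ 2.
  by rewrite [LHS]CinfM_E hg !CinfM_E; ring.
 have eb q : (F * F * (eta k * eta k)) q = (F * eta k) q ^+ 2 by rewrite !CinfM_E; ring.
 have E1 : (\int[omega]_q ((g * (eta k * eta k)) q * u q ^+ 2) = \int[omega]_q (potential q * (F * eta k) q ^+ 2 * u q ^+ 2)).
  by apply: eq_int => q; rewrite ea.
 have E2 : (\int[omega]_q ((F * F * (eta k * eta k)) q * u q ^+ 2) = \int[omega]_q ((F * eta k) q ^+ 2 * u q ^+ 2)).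
  by apply: eq_int => q; rewrite eb.
 by rewrite E1 E2.
have sE q : \sum_k G k q = (potential q + E) * F q ^+ 2 - Gam F F q - F q ^+ 2 * \sum_k Gam (eta k) (eta k) q.
 have t k : G k q = ((potential q + E) * F q ^+ 2 - Gam F F q) * eta k q ^+ 2 - F q * (2 * (eta k q * Gam F (eta k) q))
   - F q ^+ 2 * Gam (eta k) (eta k) q.
  have e : Gam (F * eta k) (F * eta k) q = eta k q ^+ 2 * Gam F F q + 2 * (F q * eta k q * Gam F (eta k) q) + F q ^+ 2 * Gam (eta k) (eta k) q.
   by rewrite GamMl !GamMr (GamC A (eta k) F) !CinfE; ring.
  by rewrite /G CinfB_E e !(CinfM_E, CinfD_E, CinfZ_E) hg; ring.
 rewrite (eq_bigr _ (fun k _ => t k)) !sumrB -mulr_sumr e1 mulr1 -!mulr_sumr.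
 (* Half the derivative of the constant sum of the squares of the eta_k. *)
 have -> : \sum_k eta k q * Gam F (eta k) q = 0.
  have h : Gam F (\sum_k eta k * eta k) q = 0.
   rewrite (_ : \sum_k eta k * eta k = 1) ?Gam1r//; apply: Cinf_eq => p.
   by rewrite Cinf_sum_E -[RHS](e1 p); apply: eq_bigr => k _; rewrite CinfM_E expr2.
  have h2 : 2 * (\sum_k eta k q * Gam F (eta k) q) = 0.
   apply: etrans h; rewrite (tangent_sum _ _ (Gam_tangent A F q)) mulr_sumr; apply: eq_bigr => k _.
   by rewrite GamMr CinfD_E CinfM_E; ring.
  by move/eqP: h2; rewrite mulf_eq0 pnatr_eq0 => /eqP.
 by rewrite !mulr0 subr0.
have iG : integ omega (fun q : bM => \sum_k G k q * u q ^+ 2) by apply: integ_sum => k; exact: integ_Cinf_sq.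
pose H := g + (E - B) *: (F * F) - Gam F F.
apply: (@le_trans _ _ (\int[omega]_q (\sum_k G k q * u q ^+ 2))); last first.
 by rewrite int_sum => [|k]; [exact: sumr_le0|exact: integ_Cinf_sq].
apply: (@int_le _ _ _ omega) => //.
 apply: (integ_eq _ (integ_Cinf_sq H)) => q; congr (_ * _).
 by rewrite /H CinfB_E CinfD_E CinfZ_E hg CinfM_E; ring.
move=> q; rewrite -mulr_suml; apply: ler_wpM2r; first exact: sqr_ge0.
rewrite sE; have := hB q; set b := \sum_k _ => hb.
have h : F q ^+ 2 * b <= F q ^+ 2 * B by rewrite ler_wpM2l// sqr_ge0.
have -> : (potential q + (E - B)) * F q ^+ 2 = (potential q + E) * F q ^+ 2 - F q ^+ 2 * B by ring.
by move: h; move: (F q ^+ 2 * b) (F q ^+ 2 * B) (_ * F q ^+ 2) => x1 x2 x3 h; lra.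
Qed.

End Uniqueness.

(** E = B + L pays for the localisation errors B and for the constant L of the Agmon weight. As eps
    tends to 0 the loss D is confined to sets shrinking to the singular set, so in the limit the
    integral of u^2 sqrt T is at most 0. *)
Lemma distributional_uniqueness : exists2 E : R, 0 < E & forall u : borel M -> R, sq_integ omega u ->
 (forall K phi g, test_pair K phi g ->
  (\int[omega]_q (u q * (E * phi q - g q)) = 0)) ->
 u = cst 0 %[ae omega].
Proof.
have [N [cc [yy [OO [KK [eta [cyy hK e0 e1]]]]]]] := partition_unity cM.
have [L [kappa [D [L0 k0 D0 hF]]]] := agmon_function.
have [B B0 hB] := Cinf_bounded (\sum_k Gam (eta k) (eta k)).
exists (B + L) => [|u su ortho]; first exact: addr_gt0.
have hB' p : \sum_k Gam (eta k) (eta k) p <= B by rewrite -Cinf_sum_E; apply: le_trans (ler_norm _) (hB p).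
pose s q : R := kappa * sqrt (T q).
pose w n q : R := if 2 * n.+1%:R^-1 < T q then s q else - D.
have ms : mfM (s : bM -> R).
 apply: measurable_funM => //; apply: continuous_borel => q.
 by apply: continuous_comp; [exact: Cinf_continuous|exact: sqrt_continuous].
have mw n : mfM (w n : bM -> R).
 by apply: measurable_fun_ifT => //; apply: measurable_fun_ltr => //; exact: Cinf_borel.
have [Tm Tm0 hT] := Cinf_bounded T.
have ks q : 0 <= s q by apply: mulr_ge0; [exact: ltW|exact: sqrtr_ge0].
have wb n q : `|w n q| <= kappa * sqrt Tm + D.
 have k1 : 0 <= kappa * sqrt Tm by apply: mulr_ge0; [exact: ltW|exact: sqrtr_ge0].
 rewrite /w; case: ifP => _; last by rewrite normrN ger0_norm// lerDr.
 rewrite ger0_norm// -[leLHS]addr0; apply: lerD => //; apply: ler_wpM2l; first exact: ltW.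
 by rewrite ler_wsqrtr//; apply: le_trans (ler_norm _) (hT q).
have iw n : integ omega (fun q : bM => u q ^+ 2 * w n q) := integM_bounded (mw n) (wb n) su.2.
have neg n : (\int[omega]_q (u q ^+ 2 * w n q) <= 0).
 have n0 : 0 < n.+1%:R^-1 :> R by rewrite invr_gt0.
 have [F [K [cK KZ F0 hFq]]] := hF _ n0.
 have := reg_global su cyy hK e0 e1 hB' ortho cK KZ F0.
 rewrite addrAC subrr add0r; apply: le_trans; apply: int_le => //.
  have [g _ hg] := potential_mul cK KZ F0.
  apply: (integ_eq _ (integ_Cinf_sq su (g + L *: (F * F) - Gam F F))) => q; congr (_ * _).
  by rewrite CinfB_E CinfD_E CinfZ_E hg CinfM_E; ring.
 by move=> q; rewrite mulrC; apply: ler_wpM2r; [exact: sqr_ge0|exact: hFq].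
have ibd := integZ (kappa * sqrt Tm + D) su.2.
have wB n q : `|u q ^+ 2 * w n q| <= (kappa * sqrt Tm + D) * u q ^+ 2.
 by rewrite normrM (ger0_norm (sqr_ge0 _)) mulrC; apply: ler_wpM2r => //; exact: sqr_ge0.
have cw : {ae omega, forall q : bM, u q ^+ 2 * w n q @[n --> \oo] --> u q ^+ 2 * s q}.
 apply: filterS ae_regular => q nZ; apply: cvgM; [exact: cvg_cst|apply: cvg_near_cst].
 have [n0 hn] := @near_invS R (T q / 2) (divr_gt0 (T_gt0 nZ) (ltr0Sn _ 1)).
 exists n0 => // n /= nn; rewrite /w ifT//.
 by have := hn n nn; rewrite ltr_pdivlMr// mulrC.
have [iS cP] := int_dominated (fun n => integ_meas (iw n)) (measurable_funM (integ_meas su.2) ms) ibd wB cw.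
have lim : (\int[omega]_q (u q ^+ 2 * s q) <= 0).
 by rewrite -(cvg_lim _ cP)//; apply: limr_le; [apply/cvg_ex; eexists; exact: cP|exact: nearW].
have pos (q : borel M) : 0 <= u q ^+ 2 * s q by apply: mulr_ge0 => //; exact: sqr_ge0.
have ae0 := int_eq0_ae iS pos (le_anti (introT andP (conj lim (int_ge0 _ pos)))).
have := ae_and ae_regular ae0; apply: filterS => q [nZ h] _.
have /eqP := h I; rewrite mulf_eq0 /s (mulf_eq0 kappa) (gt_eqF k0) sqrtr_eq0 leNgt (T_gt0 nZ).
by rewrite orbF sqrf_eq0 => /eqP.
Qed.

(** * Control of the mass near the singular set by the energy *)

Local Notation L := (C + C ^+ 2 / 8).

(** The lower bound on [Gam T T] gives 1 / (C T) - C for the first term of the potential. Half of 1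
    / (C T) absorbs the term in 1 / sqrt T by completing a square, at the price C^2 / 8. *)
Lemma potential_lower q : ~ Z q -> (2 * C * T q)^-1 <= potential q + L.
Proof.
move=> nZ; have t0 := T_gt0 nZ; have s0 : 0 < sqrt (T q) by rewrite sqrtr_gt0.
have h : C^-1 / T q - C <= Gam T T q / (4 * T q ^+ 2).
 rewrite (_ : Gam T T q / _ = Gam T T q / 4 / T q / T q); last by field; rewrite gt_eqF.
 rewrite ler_pdivlMr// mulrBl divfK ?gt_eqF// ler_pdivlMr// mulrC.
 by apply: le_trans (T2 q); apply: le_of_eq; ring.
rewrite /potential; move: h; set a := Gam T T q / _ => h.
have cc : sqrt C ^+ 2 = C by rewrite sqr_sqrtr// ltW.
have tt : sqrt (T q) ^+ 2 = T q by rewrite sqr_sqrtr.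
move: h; rewrite -{1 2}tt; move: (sqrt (T q)) s0 (sqrt C) cc => s s0 r cc h.
have k : 0 <= (s^-1 - C * r / 2) ^+ 2 / (2 * C) by rewrite divr_ge0 ?sqr_ge0// mulr_ge0// ltW.
have e : (s^-1 - C * r / 2) ^+ 2 / (2 * C) = (2 * C * s ^+ 2)^-1 - r / 2 / s + C * r ^+ 2 / 8.
 by field; rewrite !gt_eqF.
rewrite e cc in k.
have e2 : C^-1 / s ^+ 2 = 2 * (2 * C * s ^+ 2)^-1 by field; rewrite !gt_eqF.
have e3 : C * C / 8 = C ^+ 2 / 8 by rewrite expr2.
rewrite e2 in h; rewrite e3 in k; move: h k; set x := (2 * C * s ^+ 2)^-1; set z := r / 2 / s; set b := C ^+ 2 / 8.
by clear; move=> h k; lra.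
Qed.

Lemma gate (eps : R) : 0 < eps -> exists sg : Cinf S, [/\ forall q, 0 <= sg q <= 1,
 forall q, T q < eps -> sg q = 0 & forall q, 2 * eps <= T q -> sg q = 1].
Proof.
move=> e0; exists (mkCinf (smooth_fun_step openT (Cinf_smooth (eps^-1 *: T - 1)))); split=> q.
- by apply/andP; split; [exact: smooth_step_ge0|exact: smooth_step_le1].
- move=> h; apply: smooth_step_eq0; rewrite CinfB_E CinfZ_E Cinf1_E.
 by rewrite subr_le0 mulrC ler_pdivrMr// mul1r ltW.
move=> h; apply: smooth_step_eq1; rewrite CinfB_E CinfZ_E Cinf1_E.
by rewrite lerBrDr mulrC ler_pdivlMr// mulrDl mul1r -mulr2n -mulr_natl.
Qed.

(** Where T < 2 eps, potential + L is at least 1 / (4 C eps), so Hardy's inequality makes the mass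
    there small; elsewhere sg is 1 and the last integral accounts for it. *)
Lemma mass_near_singular K f sg (eps : R) : 0 < eps -> compact K -> K `<=` ~` Z -> off K f ->
 (forall q, 2 * eps <= T q -> sg q = 1) ->
 (\int[omega]_q (f q ^+ 2) <= 4 * C * eps * (\int[omega]_q Gam f f q + L * \int[omega]_q (f q ^+ 2)) +
  \int[omega]_q ((sg * f)%R q ^+ 2)).
Proof.
move=> e0 cK KZ f0 sg1.
have i1 := potential_integ cK KZ f0.
have i2 := (test_sq_integ cK KZ f0).2.
have i3 : integ omega (fun q : bM => (sg * f)%R q ^+ 2).
 apply: (test_sq_integ cK KZ (phi := sg * f) _).2 => p nK.
 by rewrite CinfM_E f0// mulr0.
have h : (\int[omega]_q (f q ^+ 2) <= \int[omega]_q (4 * C * eps * (potential q * f q ^+ 2 + L * f q ^+ 2) + (sg * f)%R q ^+ 2)).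
 apply: int_le => //.
  by apply: integD => //; apply: integZ; apply: integD => //; exact: integZ.
 move=> q; rewrite CinfM_E; have [Kq|nK] := pselect (K q); last first.
  by rewrite f0// mulr0 expr0n !mulr0 !addr0 mulr0.
 have nZ := KZ q Kq; have t0 := T_gt0 nZ; have hp := potential_lower nZ.
 have f2 := sqr_ge0 (f q); rewrite -mulrDl.
 have p0 : 0 <= potential q + L by apply: le_trans hp; rewrite invr_ge0 !mulr_ge0// ltW.
 have [Tq|Tq] := leP (2 * eps) (T q).
  rewrite sg1// mul1r lerDr; apply: mulr_ge0; first by rewrite !mulr_ge0// ltW.
  exact: mulr_ge0.
 apply: (@le_trans _ _ (4 * C * eps * ((potential q + L) * f q ^+ 2))); last by rewrite lerDl sqr_ge0.
 rewrite mulrA -[leLHS]mul1r; apply: ler_wpM2r => //.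
 apply: (@le_trans _ _ (4 * C * eps * (2 * C * T q)^-1)); last first.
  by apply: ler_wpM2l => //; rewrite !mulr_ge0// ltW.
 rewrite ler_pdivlMr ?mulr_gt0// mul1r.
 have -> : 4 * C * eps = 2 * C * (2 * eps) by ring.
 by apply: ler_wpM2l; [rewrite mulr_ge0// ltW|exact: ltW].
apply: le_trans h _.
have iD : integ omega (fun q : bM => potential q * f q ^+ 2 + L * f q ^+ 2).
 by apply: integD => //; exact: integZ.
rewrite intD//; last exact: integZ.
rewrite intZ// intD//; last exact: integZ.
rewrite intZ// lerD2r; apply: ler_wpM2l; first by rewrite !mulr_ge0// ltW.
by rewrite lerD2r; exact: (hardy cK KZ f0).
Qed.

End Weighted.

(** * Density, uniqueness and compactness for the Laplace operator *)

Hypothesis HB : forall q : M,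
  HBat q.

Lemma laplace_uniqueness :
 exists2 E : R, 0 < E & forall w, (forall u v, Lap (u, v) -> ip w (E *: u - v) = 0) -> w = 0.
Proof.
have [T [C [C0 T0 TZ [T1 T2 lapT]]]] := singular_function HB.
have [E E0 hE] := distributional_uniqueness C0 T0 TZ T1 T2 lapT.
exists E => // w hw; apply: L2_eq.
have w0 : L2_repr w = cst 0 %[ae omega].
 apply: hE; first exact: L2_reprP.
 move=> K phi g tp; have [u [v [uv uE vE]]] := test_pair_mem tp.
 have [i1 e1] := inner_function w uE; have [i2 e2] := inner_function w vE.
 have := hw u v uv; rewrite (ipBr (hilbert_L2 omega)) (ipZr (hilbert_L2 omega)) e1 e2 => <-.
 rewrite -intZ// -intB//; last exact: integZ.
 by apply: eq_int => q; ring.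
by have := ae_and w0 (L2_repr0 omega); apply: filterS => q [h1 h2] _; rewrite h1// h2.
Qed.

Lemma laplace_operator0 : Lap (0, 0).
Proof.
apply/laplace_operatorP; exists set0, 0, 0; split; [split => //|exact: L2_repr0|exact: L2_repr0].
 exact: compact0.
move=> q nZ; have := laplace_lin (-1) 0 0 nZ.
by rewrite scaleN1r addNr mulN1r addNr => ->.
Qed.

Lemma laplace_operator_lin a (p r : L2 omega * L2 omega) : Lap p -> Lap r -> Lap (a *: p + r).
Proof.
case: p r => [u u'] [v v'] /laplace_operatorP[K [phi [g [tp uE vE]]]] /laplace_operatorP[K' [phi' [g' [tp' uE' vE']]]].
apply/laplace_operatorP; exists (K `|` K'), (a *: phi + phi'), (a *: g + g').
by split; [exact: test_pair_lin|exact: represents_lin|exact: represents_lin].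
Qed.

Lemma laplace_subspace : subspace (op_domain Lap).
Proof.
split=> [|a u u' [v uv] [v' uv']]; first by exists 0; exact: laplace_operator0.
by exists (a *: v + v'); exact: (laplace_operator_lin a uv uv').
Qed.

(** The Laplacian v of a test function u is again a test function, so a class orthogonal to the
    domain is orthogonal to every E u - v and vanishes by [laplace_uniqueness]. *)
Lemma laplace_dense : dense (op_domain Lap).
Proof.
have [E E0 hE] := laplace_uniqueness.
have h w : (forall u, op_domain Lap u -> ip w u = 0) -> w = 0.
 move=> hw; apply: hE => u v uv; apply: hw.
 have /laplace_operatorP[K [phi [g [[cK KZ f0 gE g0] uE vE]]]] := uv.
 have [g' [gE' g0']] := test_laplace cK KZ g0.
 have [v0 [v1 [v01 rv0 _]]] := test_pair_mem (And5 cK KZ g0 gE' g0').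
 have dv : op_domain Lap v by rewrite (L2_eq (ae_eq_trans vE (ae_eq_sym rv0))); exists v1.
 have := laplace_subspace.2 (-1) _ _ dv (laplace_subspace.2 E _ _ (ex_intro _ v uv) laplace_subspace.1).
 by rewrite addr0 scaleN1r addrC.
have hd := orth_dense (hilbert_L2 omega) laplace_subspace h.
move=> O [f Of] oO.
have [e e0 he] : exists2 e : R, 0 < e & forall v, `|f - v| < e -> O v.
 have /nbhs_ballP[e /= e0 he] := open_nbhs_nbhs (conj oO Of).
 by exists e => // v fv; apply: he; rewrite -ball_normE.
by have [v dv fv] := hd f e e0; exists v; split => //; exact: he.
Qed.

(** Single-valuedness follows from symmetry and the density of the domain. *)
Lemma laplace_linear : linear_operator Lap.
Proof.
split.
- exact: laplace_operator0.
- exact: laplace_operator_lin.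
move=> u v w uv uw; apply/eqP; rewrite -subr_eq0; apply/eqP.
apply: (dense_orth (hilbert_L2 omega) laplace_dense) => x y xy.
by rewrite (ipBl (hilbert_L2 omega)) (laplace_symmetric uv xy) (laplace_symmetric uw xy) subrr.
Qed.

Definition energy_bound K u phi := [/\ compact K, K `<=` ~` Z, off K phi,
 represents u phi & (\int[omega]_q (phi q ^+ 2) + \int[omega]_q Gam phi phi q <= 1)].

(** By Green's formula the energy |u|^2 - (u, Delta u) is the integral of phi^2 + [Gam phi phi]. *)
Lemma energy_boundP u v : Lap (u, v) -> `|u| ^+ 2 - ip u v <= 1 -> exists K phi, energy_bound K u phi.
Proof.
move=> /laplace_operatorP[K [phi [g [tp uE vE]]]] h; have [cK KZ f0 gE g0] := tp.
exists K, phi; split => //; move: h; rewrite L2_norm_sq (inner_represents uE uE) (inner_represents uE vE).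
rewrite [X in _ - X](_ : _ = - (\int[omega]_q Gam phi phi q)); last first.
 rewrite -(laplace_dirichlet phi tp).
 by apply: eq_int => q; rewrite mulrC.
by rewrite opprK (_ : (\int[omega]_q (phi q * phi q) = \int[omega]_q (phi q ^+ 2)))//; apply: eq_int => q.
Qed.

Lemma energy_difference K K' u w phi psi (f := phi - psi) : energy_bound K u phi -> energy_bound K' w psi ->
 [/\ [/\ compact (K `|` K'), K `|` K' `<=` ~` Z & off (K `|` K') f],
  (\int[omega]_q (f q ^+ 2) <= 4), (\int[omega]_q Gam f f q <= 4) &
  `|u - w| ^+ 2 = (\int[omega]_q (f q ^+ 2))].
Proof.
move=> [cK KZ f0 uE h] [cK' KZ' f0' wE h'].
have G K1 g : compact K1 -> K1 `<=` ~` Z -> (off K1 g) -> integ omega (fun q : bM => Gam g g q).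
 move=> cK1 KZ1 g0; apply: (test_integ cK1 KZ1) => p nK.
 exact: (Gam_off g (compact_closedM cK1) g0 nK).
have i1 := (test_sq_integ cK KZ f0).2; have i1' := (test_sq_integ cK' KZ' f0').2.
have i2 := G _ _ cK KZ f0; have i2' := G _ _ cK' KZ' f0'.
have cU := compactU cK cK'.
have UZ : K `|` K' `<=` ~` Z by move=> p [/KZ|/KZ'].
have U0 p : ~ (K `|` K') p -> f p = 0.
 by move=> nK; rewrite CinfB_E f0 ?f0' ?subrr// => hp; apply: nK; [right|left].
have ge1 g : (0 <= \int[omega]_q (g q ^+ 2)) by apply: int_ge0 => q; exact: sqr_ge0.
have ge2 g : (0 <= \int[omega]_q Gam g g q) by apply: int_ge0 => q; exact: Gam_ge0.
have a1 := ge1 phi; have a2 := ge1 psi; have a3 := ge2 phi; have a4 := ge2 psi.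
split => //.
- apply: (@le_trans _ _ (\int[omega]_q (2 * phi q ^+ 2 + 2 * psi q ^+ 2))).
  apply: int_le; [exact: (test_sq_integ cU UZ U0).2|by apply: integD; exact: integZ|].
  move=> q; rewrite CinfB_E -subr_ge0 (_ : _ - _ = (phi q + psi q) ^+ 2) ?sqr_ge0//; ring.
 rewrite intD ?intZ//; try exact: integZ.
 by move: a1 a2 a3 a4 h h'; clear; lra.
- apply: (@le_trans _ _ (\int[omega]_q (2 * Gam phi phi q + 2 * Gam psi psi q))).
  apply: int_le; [exact: (G _ _ cU UZ U0)|by apply: integD; exact: integZ|].
  move=> q; rewrite -subr_ge0 (_ : _ - _ = Gam (phi + psi) (phi + psi) q) ?Gam_ge0//.
  by rewrite /f GamBl !GamBr GamDl !GamDr !(CinfB_E, CinfD_E) (GamC A psi phi); ring.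
 rewrite intD ?intZ//; try exact: integZ.
 by move: a1 a2 a3 a4 h h'; clear; lra.
have r : represents (u - w) f.
 have := represents_lin (-1) wE uE; rewrite !scaleN1r addrC.
 by rewrite (addrC (- psi)).
by rewrite L2_norm_sq (inner_represents r r); apply: eq_int => q.
Qed.

(** For a difference f of two elements, the mass near the singular set is small by
    [mass_near_singular]. Away from it f is cut into the pieces eta_k sg f supported in charts, each
    controlled by the functionals of [chart_rellich]. *)
Lemma laplace_compact : totally_bounded [set u | exists2 v, Lap (u, v) & `|u| ^+ 2 - ip u v <= 1].
Proof.
have [T [C [C0 T0 TZ [T1 T2 lapT]]]] := singular_function HB.
have [N [cc [yy [OO [KK [eta [cyy hK e0 e1]]]]]]] := partition_unity cM.
apply: totally_bounded_finite => e e_gt0.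
pose L := C + C ^+ 2 / 8; have L0 : 0 < L by rewrite ltr_wpDr// divr_ge0// sqr_ge0.
(* The mass and the energy of a difference are at most 4, and 4 C eps (4 + 4 L) = e^2 / 4. *)
pose eps := e ^+ 2 / (64 * C * (1 + L)).
have eps0 : 0 < eps by rewrite divr_gt0 ?exprn_gt0// !mulr_gt0// addr_gt0.
have [sg [sg01 sgz sg1]] := gate T eps0.
pose KT := [set q | eps <= T q].
have clT : closed KT by exact: closed_Cinf_ge.
pose KL k := KK k `&` KT.
have cKL k : compact (KL k).
 by apply: (closed_compactM); apply: closedI clT; exact: (compact_closedM (hK k).1).
have KLZ k : KL k `<=` OO k `\` Z.
 move=> q [Kq Tq]; split; first exact: (hK k).2.
 by move=> /TZ h; move: Tq; rewrite /KT /mkset h leNgt eps0.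
have [D D0 hD] := Cinf_bounded (\sum_k Gam (eta k * sg) (eta k * sg)).
have hDk k q : Gam (eta k * sg) (eta k * sg) q <= D.
 apply: le_trans (le_trans (ler_norm _) (hD q)); rewrite Cinf_sum_E (bigD1 k)//= lerDl.
 by apply: sumr_ge0 => i _; exact: Gam_ge0.
(* Each of the N pieces has energy at most 8 + 8 D, so together they cost at most N d (9 + 8 D) <=
   e^2 / 4. The index N + 1 avoids a division by zero. *)
pose d := e ^+ 2 / (4 * (N.+1)%:R * (9 + 8 * D)).
have d0 : 0 < d by rewrite divr_gt0 ?exprn_gt0// !mulr_gt0// addr_gt0// mulr_gt0.
have /choice[F hF] k : exists F : {n : nat & 'I_n -> Cinf S -> R} * R, [/\ 0 <= F.2,
  forall j f g, (forall p, ~ KL k p -> f p = 0) -> (forall p, ~ KL k p -> g p = 0) ->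
   projT2 F.1 j (f - g) = projT2 F.1 j f - projT2 F.1 j g,
  forall j f, (forall p, ~ KL k p -> f p = 0) -> (\int[omega]_q (f q ^+ 2) <= 1) -> `|projT2 F.1 j f| <= F.2 &
  forall f, (forall p, ~ KL k p -> f p = 0) -> (forall j, `|projT2 F.1 j f| <= 1) ->
   (\int[omega]_q (f q ^+ 2) <= d * (1 + \int[omega]_q Gam f f q))].
 have [n [l [B h]]] := chart_rellich (cyy k) (cKL k) (KLZ k) d0.
 by exists (existT _ n l, B).
pose rep u := xget 0 [set phi | exists K, energy_bound K u phi].
pose loc k phi := eta k * sg * phi.
have repP u : (exists2 v, Lap (u, v) & `|u| ^+ 2 - ip u v <= 1) -> exists K, energy_bound K u (rep u).
 move=> [v uv h]; have [K [phi hphi]] := energy_boundP uv h.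
 exact: (@xgetPex _ 0 [set phi | exists K, energy_bound K u phi] (ex_intro _ phi (ex_intro _ K hphi))).
have loc0 k phi p : ~ KL k p -> loc k phi p = 0.
 move=> nK; rewrite !CinfM_E; have [Kp|nKp] := pselect (KK k p); last by rewrite e0// !mul0r.
 by rewrite sgz ?mulr0 ?mul0r// ltNge; apply/negP => h; apply: nK.
have eta1 k p : eta k p ^+ 2 <= 1.
 by rewrite -(e1 p) (bigD1 k)//= lerDl; apply: sumr_ge0 => i _; exact: sqr_ge0.
have w1 k p : (eta k * sg) p ^+ 2 <= 1.
 have /andP[s0 s1] := sg01 p; rewrite CinfM_E exprMn -[leRHS]mulr1; apply: ler_pM; rewrite ?sqr_ge0//.
 by rewrite exprn_ile1.
exists {k : 'I_N & 'I_(projT1 (F k).1)}, (fun i u => projT2 (F (tag i)).1 (tagged i) (loc (tag i) (rep u))),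
 (\sum_k (F k).2), 1; split => //.
 move=> [k j] u /repP[K [cK KZ f0 uE hE]] /=; have [B0 _ hB _] := hF k.
 apply: (@le_trans _ _ (F k).2); last first.
  by rewrite (bigD1 k)//= lerDl; apply: sumr_ge0 => i _; have [] := hF i.
 apply: hB => [p|]; first exact: loc0.
 apply: (@le_trans _ _ (\int[omega]_q (rep u q ^+ 2))); last first.
  by apply: le_trans hE; rewrite lerDl; apply: int_ge0 => q; exact: Gam_ge0.
 apply: int_le; [|exact: (test_sq_integ cK KZ f0).2|].
  apply: (test_sq_integ cK KZ _).2 => p nK.
  by rewrite CinfM_E f0// mulr0.
 by move=> q; rewrite CinfM_E exprMn ler_piMl ?sqr_ge0.
move=> u w /repP[K hu] /repP[K' hw] hl.
have [[cU UZ U0] n1 n2 nE] := energy_difference hu hw.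
move: U0 n1 n2 nE hl; set f := rep u - rep w => U0 n1 n2 nE hl.
have iL k : integ omega (fun q : bM => loc k f q ^+ 2).
 apply: (test_sq_integ cU UZ _).2 => p nK.
 by rewrite CinfM_E U0// mulr0.
have i2 := (test_sq_integ cU UZ U0).2.
have iG : integ omega (fun q : bM => Gam f f q).
 by apply: (test_integ cU UZ) => p nK; exact: (Gam_off f (compact_closedM cU) U0 nK).
have hk k : (\int[omega]_q (loc k f q ^+ 2) <= d * (9 + 8 * D)).
 have [_ hadd _ hr] := hF k.
 have lB j : `|projT2 (F k).1 j (loc k f)| <= 1.
  by rewrite /loc mulrBr hadd; [exact: (hl (existT _ k j))|exact: loc0|exact: loc0].
 apply: le_trans (hr _ (loc0 k f) lB) _; apply: ler_wpM2l; first exact: ltW.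
 have iGl : integ omega (fun q : bM => Gam (loc k f) (loc k f) q).
  apply: (test_integ cU UZ) => p nK; apply: (Gam_off _ (compact_closedM cU) _ nK) => z nKz.
  by rewrite CinfM_E U0// mulr0.
 have h : (\int[omega]_q Gam (loc k f) (loc k f) q <= \int[omega]_q (2 * Gam f f q + 2 * D * f q ^+ 2)).
  apply: int_le => //; first by apply: integD; exact: integZ.
  move=> q; rewrite /loc (mulrC _ f); apply: le_trans (Gam_mul_le _ _ q) _.
  have t1 : (eta k * sg) q ^+ 2 * Gam f f q <= Gam f f q by rewrite ler_piMl// Gam_ge0.
  have t2 : f q ^+ 2 * Gam (eta k * sg) (eta k * sg) q <= D * f q ^+ 2.
   by rewrite mulrC; apply: ler_wpM2r; [exact: sqr_ge0|exact: hDk].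
  by rewrite -mulrA; apply: lerD; apply: ler_wpM2l.
 rewrite intD ?intZ// in h; try exact: integZ.
 have h4 : 2 * D * (\int[omega]_q (f q ^+ 2)) <= 2 * D * 4.
  by apply: ler_wpM2l => //; rewrite mulr_ge0// ltW.
 by move: h h4 n2; clear; lra.
have hs : (\int[omega]_q ((sg * f)%R q ^+ 2) <= N%:R * (d * (9 + 8 * D))).
 have -> : (\int[omega]_q ((sg * f)%R q ^+ 2) = \sum_k \int[omega]_q (loc k f q ^+ 2)).
  rewrite -int_sum//; apply: eq_int => q.
  under [RHS]eq_bigr => k _ do rewrite /loc -mulrA CinfM_E exprMn.
  by rewrite -mulr_suml e1 mul1r.
 apply: le_trans (ler_sum _ (fun k _ => hk k)) _.
 by rewrite sumr_const card_ord -[leLHS]mulr_natl.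
have hm := mass_near_singular C0 T0 TZ T2 lapT eps0 cU UZ U0 sg1.
have b1 : 4 * C * eps * (\int[omega]_q Gam f f q + L * \int[omega]_q (f q ^+ 2)) <= e ^+ 2 / 4.
 have -> : e ^+ 2 / 4 = 4 * C * eps * (4 + L * 4).
  by rewrite /eps; field; rewrite !gt_eqF// addr_gt0.
 apply: ler_wpM2l; first by apply: mulr_ge0; [rewrite mulr_ge0// ltW|exact: ltW].
 by apply: lerD => //; apply: ler_wpM2l => //; exact: ltW.
have b2 : N%:R * (d * (9 + 8 * D)) <= e ^+ 2 / 4.
 have D8 : 0 < 9 + 8 * D by rewrite addr_gt0// mulr_gt0.
 rewrite (_ : N%:R * _ = e ^+ 2 / 4 * (N%:R / N.+1%:R)); last first.
  by rewrite /d; move: (N.+1%:R) (ltr0Sn R N) => m m0; field; rewrite !gt_eqF.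
 rewrite ler_piMr ?divr_ge0 ?sqr_ge0// ler_pdivrMr// mul1r ler_nat; exact: leqnSn.
have h2 : `|u - w| ^+ 2 < e ^+ 2.
 rewrite nE; apply: le_lt_trans hm _; rewrite -/L.
 have e20 : 0 < e ^+ 2 by rewrite exprn_gt0.
 by move: b1 (le_trans hs b2) e20; clear; lra.
by move: h2; rewrite ltr_pXn2r ?nnegrE// ltW.
Qed.

(** Test functions with their Laplacians make up the graph, and the singular set is null, so testing
    off that set is the same as pairing in L2. *)
Lemma distributional_laplacianP u (f : L2 omega) : distributional_laplacian A u f <-> adjoint ip Lap (u, f).
Proof.
have mZ := measurable_singular.
have intZ (h : bM -> R) : integ omega h -> (\int[omega]_(q in ~` Z) h q = \int[omega]_q h q).
 by move=> ih; rewrite -setTD /Rintegral [in RHS](negligible_integral mZ measurableT ih omegaA.1).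
have key phi K g a b : test_pair K phi g -> represents a phi -> represents b g ->
 (\int[omega]_(q in ~` Z) (L2_repr u q * lap phi q) = ip b u) /\
 (\int[omega]_(q in ~` Z) (L2_repr f q * (phi : M -> R) q) = ip a f).
 move=> tp aE bE; have [cK KZ f0 gE g0] := tp.
 have [i1 e1] := inner_function u bE; have [i2 e2] := inner_function f aE.
 rewrite !(ipC (hilbert_L2 omega) _ u) !(ipC (hilbert_L2 omega) _ f) e1 e2; split; last exact: intZ.
 rewrite -intZ//; apply: eq_Rintegral => q; rewrite inE => nZ.
 by rewrite gE.
split=> [h a b /laplace_operatorP[K [phi [g [tp aE bE]]]]|h phi /test_functionP[K [cK KZ f0]]] /=.
 have [e1 e2] := key _ _ _ _ _ tp aE bE; rewrite -e1 -e2; apply: h.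
 by apply/test_functionP; exists K; have [] := tp.
have [g [gE g0]] := test_laplace cK KZ f0; have tp := And5 cK KZ f0 gE g0.
have [a [b [ab aE bE]]] := test_pair_mem tp.
by have [-> ->] := key _ _ _ _ _ tp aE bE; exact: h.
Qed.

End LaplaceBeltrami.

Theorem theorem1 (R : realType) (M : ptopologicalType)
    (S : smooth_surface R M) (A : almost_riemannian S)
    (omega : {measure set (borel M) -> \bar R}) :
  compact [set: M] ->
  orientable S ->
  riemannian_area A omega ->
  (* HA *)
  embedded_curve S (singular_set A) ->
  (* HB *)
  (forall q : M,
    [set v + w | v in distribution_at A q & w in bracket_at A q] =
    tangent S q) ->
  essentially_self_adjoint (inner omega) (laplace_operator A omega) /\
  forall Delta : set (L2 omega * L2 omega),
    self_adjoint (inner omega) Delta ->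
    laplace_operator A omega `<=` Delta ->
    [/\ op_domain Delta =
          [set u | exists f, distributional_laplacian A u f],
        exists K, inverse_operator (affine_operator (-1) 1 Delta) K /\
                  compact_operator K,
        forall lambda : R, ~ limit_point (spectrum Delta) lambda &
        forall lambda : R, spectrum Delta lambda ->
          op_eigenvalue Delta lambda /\
          exists n : nat, lin_dim (op_eigenspace Delta lambda) n].
Proof.
move=> cM _ omegaA _ HB.
have hip := hilbert_L2 omega.
have lA := laplace_linear omegaA cM HB; have dA := laplace_dense omegaA cM HB.
have sA := laplace_symmetric omegaA cM; have nA := laplace_dissipative omegaA cM.
have [E E0 uA] := laplace_uniqueness omegaA cM HB; have cA := laplace_compact omegaA cM HB.
split=> [|Delta sD AD]; first exact: (essentially_self_adjoint_closure hip lA dA sA nA E0 uA).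
rewrite (self_adjoint_extension_unique hip lA sA nA E0 uA sD AD); split.
(* A self-adjoint extension is the closure, hence the adjoint, and the adjoint is the distributional
   Laplacian. *)
- rewrite -(adjoint_eq_closure hip lA sA nA E0 uA).
 by apply/seteqP; split=> u [f /(distributional_laplacianP omegaA cM) h]; exists f.
- exact: (compact_resolvent hip lA sA nA E0 uA cA).
- exact: (spectrum_discrete hip lA sA nA E0 uA cA).
move=> lambda h; split; first exact: (spectrum_eigenvalue hip lA sA nA E0 uA cA).
exact: (eigenspace_dim hip lA cA).
Qed.
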